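(* Let $G=(V,E)$ be a directed graph with non-negative integer edge weights, $|V|=n$, $|E|=m$. The All Pairs Second Simple Shortest Paths problem on $G$ can be solved in the PRAM model (A) in $\tilde{O}(mn)$ work and $\tilde{O}(n)$ parallel time, and (B) (randomized, correct with high probability in $n$) in $\tilde{O}(n^3)$ work and $\tilde{O}(1)$ parallel time.
   Context: PRAM model (CREW): costs measured by work (total operations) and parallel time (span). $\tilde{O}$ hides factors polylogarithmic in $n$. For $x,y\in V$ with a shortest $x$-$y$ path $P_{xy}$, the second simple shortest path distance $d_2(x,y)$ is the weight of a shortest simple $x$-$y$ path that differs from $P_{xy}$ in at least one edge. All Pairs Second Simple Shortest Paths: compute $d_2(x,y)$ for all pairs $x,y\in V$. *)

(* Defs.v *)
From mathcomp Require Import all_boot all_order all_algebra.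
From mathcomp Require Import boolp.

Set Implicit Arguments.
Unset Strict Implicit.
Unset Printing Implicit Defensive.

(** * Second simple shortest paths *)

(* Vertices are 0, ..., n-1; [weight] is only meaningful on [edges]. *)
Record wdigraph (n : nat) := WDigraph {
  edges : {set 'I_n * 'I_n};
  weight : 'I_n -> 'I_n -> nat
}.

Section SecondSimpleShortestPaths.
Variables (n : nat) (G : wdigraph n).

(* An x-y path x, v1, ..., vk = y is represented by p = [:: v1; ...; vk]. *)
Definition simple_path (x y : 'I_n) (p : seq 'I_n) : bool :=
  [&& path (fun u v => (u, v) \in edges G) x p, last x p == y & uniq (x :: p)].

Definition path_edges (x : 'I_n) (p : seq 'I_n) : {set 'I_n * 'I_n} :=
  [set:: pairmap pair x p].

Definition path_weight (x : 'I_n) (p : seq 'I_n) : nat :=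
  sumn (pairmap (weight G) x p).

Definition shortest_path (x y : 'I_n) (p : seq 'I_n) : Prop :=
  simple_path x y p /\
  forall q, simple_path x y q -> path_weight x p <= path_weight x q.

(* [d] is the least weight of a simple x-y path other than [P]; [None] stands
   for an infinite distance. *)
Definition second_distance_wrt (x y : 'I_n) (P : seq 'I_n) (d : option nat) :
    Prop :=
  let alternative q := simple_path x y q /\ path_edges x q <> path_edges x P in
  if d is Some v then
    (exists2 q, alternative q & path_weight x q = v) /\
    (forall q, alternative q -> v <= path_weight x q)
  else forall q, ~ alternative q.

(* d_2(x, y) = d. The value does not depend on the choice of the shortest path
   [P], and it is infinite when y is not reachable from x. *)
Definition second_distance (x y : 'I_n) (d : option nat) : Prop :=
  (forall P, shortest_path x y P -> second_distance_wrt x y P d) /\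
  ((forall p, ~~ simple_path x y p) -> d = None).

End SecondSimpleShortestPaths.

(** * The CREW PRAM *)

(* The machine follows the synchronous P-RAM of Fortune and Wyllie (1978), with
   multiplication, division and coins added: all the
   active processors run the same program in lock step on a shared memory, and
   new processors are activated by [Fork]. Registers are private to a processor;
   in the arguments below they are given by their number. *)
Inductive instr :=
| Const (r k : nat)     (* r <- k *)
| Add (r s t : nat)     (* r <- s + t *)
| Sub (r s t : nat)     (* r <- max(s - t, 0) *)
| Mul (r s t : nat)     (* r <- s * t *)
| Div (r s t : nat)     (* r <- floor(s / t), and 0 if t = 0 *)
| Read (r s : nat)      (* r <- memory[s] *)
| Write (r s : nat)     (* memory[r] <- s *)
| Jz (r l : nat)        (* if r = 0 then goto l *)
| Fork (l : nat)        (* activate a copy of this processor at l *)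
| Coin (r : nat)        (* r <- fresh uniform random bit *)
| Halt.

Definition program := seq instr.

Definition is_coin (i : instr) : bool := if i is Coin _ then true else false.

Definition coin_free (P : program) : bool := ~~ has is_coin P.

Record proc := Proc { pc : nat; regs : nat -> nat }.

(* [procs] lists the active processors only. *)
Record config := Config { memory : nat -> nat; procs : seq proc }.

Definition update (f : nat -> nat) (a v : nat) : nat -> nat :=
  fun b => if b == a then v else f b.

(* One instruction of one processor, where [b] is the outcome of its coin: the
   resulting active processors (none after [Halt], two after [Fork]), and the
   pair (address, value) if it writes to the shared memory. *)
Definition exec (P : program) (M : nat -> nat) (b : bool) (q : proc) :
    seq proc * option (nat * nat) :=
  let R := regs q in
  let next := (pc q).+1 in
  let set_reg r v := ([:: Proc next (update R r v)], None) in
  match nth Halt P (pc q) with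
  | Const r k => set_reg r k
  | Add r s t => set_reg r (R s + R t)
  | Sub r s t => set_reg r (R s - R t)
  | Mul r s t => set_reg r (R s * R t)
  | Div r s t => set_reg r (R s %/ R t)
  | Read r s => set_reg r (M (R s))
  | Write r s => ([:: Proc next R], Some (R r, R s))
  | Jz r l => ([:: Proc (if R r == 0 then l else next) R], None)
  | Fork l => ([:: Proc next R; Proc l R], None)
  | Coin r => set_reg r (nat_of_bool b)
  | Halt => ([::], None)
  end.

(* One synchronous step; [coins i] is the coin of the i-th active processor.
   All reads see the memory as it was before the step; two writes to the same
   cell (exclusive write) crash the machine. *)
Definition step (P : program) (coins : nat -> bool) (c : config) :
    option config :=
  let k := size (procs c) in
  let outs := [seq exec P (memory c) bq.1 bq.2 | bq <- zip (mkseq coins k) (procs c)] in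
  let writes := pmap snd outs in
  if uniq (map fst writes) then
    Some (Config (foldr (fun av M => update M av.1 av.2) (memory c) writes)
                 (flatten (map fst outs)))
  else None.

Fixpoint run (P : program) (coins : nat -> nat -> bool) (c : config) (t : nat) :
    option config :=
  if t is s.+1 then obind (step P (coins s)) (run P coins c s) else Some c.

(* The number of operations performed in step [t]. *)
Definition active (P : program) (coins : nat -> nat -> bool) (c : config)
    (t : nat) : nat :=
  if run P coins c t is Some c' then size (procs c') else 0.

Definition words_below (B : nat) (c : config) : Prop :=
  (forall a, memory c a < B) /\
  (forall i q r, onth (procs c) i = Some q -> regs q r < B).

(* The execution from [c] does not crash, halts within parallel time [T], performs
   at most [W] operations in total, and only manipulates words smaller than [B]. *)
Definition within_budget (P : program) (coins : nat -> nat -> bool) (c : config)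
    (T W B : nat) : Prop :=
  [/\ (exists2 cT, run P coins c T = Some cT & procs cT = [::]),
      \sum_(t < T) active P coins c t <= W
    & forall t ct, t <= T -> run P coins c t = Some ct -> words_below B ct].

(** * Randomness *)

(* In an execution with at most [T] steps and [W] operations, every coin has
   coordinates (step, processor) in [0, T) x [0, W). *)
Definition coin_table (T W : nat) : finType := {ffun 'I_T * 'I_W -> bool}.

Definition coins_of (T W : nat) (om : coin_table T W) (t i : nat) : bool :=
  if (insub t : option 'I_T, insub i : option 'I_W) is (Some t', Some i')
  then om (t', i') else false.

Definition uniform_prob (Om : finType) (A : {set Om}) : rat :=
  (#|A|%:R / #|Om|%:R)%R.

(** * Computing all pairs second simple shortest paths *)

Section Problem.
Variables (n : nat) (G : wdigraph n).

Definition lists_edges (es : seq ('I_n * 'I_n)) : Prop :=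
  perm_eq es (enum (edges G)).

(* The input occupies the cells 0, 1, ..., 3m + 1: n, m, and for each edge its
   tail, its head and its weight. All the other cells are 0. *)
Definition input (es : seq ('I_n * 'I_n)) : seq nat :=
  n :: size es ::
  flatten [seq [:: val e.1; val e.2; weight G e.1 e.2] | e <- es].

(* Initially a single processor is active. *)
Definition initial (es : seq ('I_n * 'I_n)) : config :=
  Config (nth 0 (input es)) [:: Proc 0 (fun _ => 0)].

(* Distances are represented in one word: 0 is infinity, v + 1 is v. *)
Definition decode (w : nat) : option nat := if w is v.+1 then Some v else None.

(* The output is an n x n row-major array that starts right after the input. *)
Definition correct_output (es : seq ('I_n * 'I_n)) (c : config) : Prop :=
  forall x y : 'I_n,
    second_distance G x y (decode (memory c (size (input es) + (x * n + y)))).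

Definition computes_APSSSP (P : program) (coins : nat -> nat -> bool)
    (es : seq ('I_n * 'I_n)) (T : nat) : Prop :=
  exists2 c, run P coins (initial es) T = Some c & correct_output es c.

Definition max_weight : nat := \max_(e in edges G) weight G e.1 e.2.

(* Words of O(log (n + max_weight)) bits. *)
Definition word_bound (K : nat) : nat := (n + max_weight + 2) ^ K.

End Problem.

(* Bound C * f * log(n)^k for a quantity in O~(f). The successors only prevent the
   bound from vanishing for degenerate graphs (n <= 1 or f = 0). *)
Definition soft_bound (C k n f : nat) : nat :=
  C * f.+1 * (trunc_log 2 n).+1 ^ k.

(* Main.v *)
Require Import Defs.
From mathcomp Require Import all_boot all_order all_algebra.
From mathcomp Require Import boolp.
From mathcomp Require Import zify.

(* Every edge weight w becomes N * w + 1, so that lengths are positive, and lengths are stored as BIG minus the length,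
   so that infinity is 0 and minima are maxima. Let a = lab(x, y) be the first vertex of a shortest x-y path P. A second
   path either leaves x through another vertex, and then it is no shorter than the least detour E(x, y), i.e. the least
   length of a walk to y that leaves x through another vertex and does not return to x, or it continues from a by a
   second path for (a, y). Hence d_2(x, y) is the best E(u, y) over the vertices u of P, each prefixed by the part of P
   up to u, and pointer jumping computes it from the tables of labels and detours.

   (A) For a fixed source z, labels and distances come from one run of Dijkstra's algorithm, and detours from a second
   run: a detour to y crosses once from the branch of another label into the branch of y, and then stays there. All
   sources run in lock step; a queue is a tournament tree, and the d edges out of an extracted vertex are relaxed by d
   processors that climb the tree together, so a phase takes logarithmic time and the total work is O~(mn).

   (B) Detours at z only need the distances from b to y in G - z. They are computed by doubling the number r of hops. For
   each pair (u, v) the tables hold a walk that is optimal for r hops, and for each of its at most r vertices f the length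
   of a walk from u to v that avoids f; any other vertex is avoided by the optimal walk itself. An optimal walk avoiding f
   with at most 3r/2 hops has r/2 vertices that split it into two walks of at most r hops, so among O~(n / r) random
   vertices there is such a centre with high probability; a second round reaches 2r hops. Since there are n^2 r entries,
   a round costs O~(n^3) operations.

   The programs are written in a structured language in which all active processors execute the same statement. Its
   weakest preconditions record time and work, its compiler is verified, and words are bounded by inferring for each
   register a degree in n + max_weight + 2. *)

Set Implicit Arguments.
Unset Strict Implicit.
Unset Printing Implicit Defensive.

(** Lock step and exclusive writes shape the algorithms. All processors share one control flow, so a
    source whose queue is empty cannot stop early: it extracts the isolated vertex 0, which serves
    as a null vertex throughout (no label, no successor, absorbing for pointer jumping). Word sizes
    are inferred from the code alone, and the inference sees no invariants. Hence values that a loop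
    assigns or stores are capped by an explicit minimum, and the correctness proofs show that the
    cap does no harm. Sampling needs two rounds per level: cutting a walk of 2r hops into two pieces
    of at most r hops leaves only its middle vertex as a centre, while 3r/2 hops leave about r/2
    centres, and 2r hops leave about r once 3r/2 are available. The centres are determined by the
    graph alone, so one batch of samples serves all levels and the union bound is over fixed sets.
    The factor N in the edge lengths exceeds the number of edges of any simple path, so division by
    N recovers the weight; the added 1 makes ties go to fewer edges and excludes closed walks of
    length 0. *)

Section AllProp.
Variable T : Type.

(** A list predicate in [Prop], because the simulation relation below quantifies over registers and
    is not boolean. *)
Fixpoint allp (Q : T -> Prop) (s : seq T) : Prop :=
  if s is x :: s' then Q x /\ allp Q s' else True.

Lemma allp_sub (Q Q' : T -> Prop) s : (forall x, Q x -> Q' x) -> allp Q s -> allp Q' s.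
Proof. by move=> h; elim: s => //= x s ih [/h ? /ih ?]. Qed.

Lemma allp_cat (Q : T -> Prop) s1 s2 : allp Q (s1 ++ s2) <-> allp Q s1 /\ allp Q s2.
Proof. by elim: s1 => [|x s ih] /=; [split=> // -[] | rewrite ih; tauto]. Qed.

Lemma allp_filter (Q : T -> Prop) a s : allp Q s -> allp Q [seq x <- s | a x].
Proof. by elim: s => //= x s ih [? /ih ?]; case: ifP. Qed.

Lemma eq_map_allp (U : Type) (Q : T -> Prop) (f f' : T -> U) s :
  (forall x, Q x -> f x = f' x) -> allp Q s -> map f s = map f' s.
Proof. by move=> h; elim: s => //= x s ih [/h -> /ih ->]. Qed.

End AllProp.

Lemma allp_map (T U : Type) (f : T -> U) (Q : U -> Prop) s :
  allp Q (map f s) <-> allp (fun x => Q (f x)) s.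
Proof. by elim: s => //= x s ->. Qed.

Lemma allp_flatten (T U : Type) (f : T -> seq U) (Q : U -> Prop) s :
  allp (fun x => allp Q (f x)) s -> allp Q (flatten (map f s)).
Proof. by elim: s => //= x s ih [? /ih ?]; apply/allp_cat. Qed.

(** * A lock-step language *)

(** [EOff] is the first cell after the input and the output. The memory from there on is divided
    into 64 unbounded regions, and [ERd k a] reads cell [a] of region [k]. *)
Inductive expr :=
| ECst of nat | EVar of nat | EOff
| EAdd of expr & expr | ESub of expr & expr | EMul of expr & expr | EDiv of expr & expr
| ERd of nat & expr.

(** There is no conditional statement, since processors on different branches would lose the lock
    step. A choice is made arithmetically, by a guarded write (the guard is the first expression of
    [Wr] and [WrOut]), or by [Kill], which stops the processors where its argument is 0. [Dup r]
    forks every processor, and [r] tells the two copies apart. *)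
Inductive stmt :=
| Asg of nat & expr
| RdIn of nat & expr
| Wr of nat & expr & expr & expr
| WrOut of expr & expr & expr
| Dup of nat
| Kill of expr
| Flip of nat
| Seq of stmt & stmt
| While of expr & stmt.

Definition upd (M : nat -> nat -> nat) (k a v : nat) : nat -> nat -> nat :=
  fun k' a' => if (k' == k) && (a' == a) then v else M k' a'.

(* Region [raw] is the part of the memory that holds the input and the output. *)
Notation raw := 64.
Notation tmp0 := 42.

(** [env] lists the variables of each active processor in the order of the machine's processor list;
    the order decides which coin a processor gets. *)
Record state := St { smem : nat -> nat -> nat; env : seq (seq nat); tm : nat; wk : nat }.

Fixpoint cost (e : expr) : nat :=
  match e with
  | ECst _ => 1 | EVar _ | EOff => 0
  | EAdd a b | ESub a b | EMul a b | EDiv a b => (cost a + cost b).+1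
  | ERd _ a => cost a + 6
  end.

(** Interleaving the regions modulo 64 lets each of them grow without bound, so no layout depending
    on sizes has to be computed. *)
Definition addr (k : nat) (a : expr) := EAdd (EAdd (EMul a (ECst 64)) EOff) (ECst k).

Definition wr_cost (c a v : expr) := cost c + cost a + cost v + 3.

Section Semantics.
Variables (OFF : nat) (coins : nat -> nat -> bool).

Fixpoint eval (M : nat -> nat -> nat) (v : seq nat) (e : expr) : nat :=
  match e with
  | ECst k => k
  | EVar r => nth 0 v r
  | EOff => OFF
  | EAdd a b => eval M v a + eval M v b
  | ESub a b => eval M v a - eval M v b
  | EMul a b => eval M v a * eval M v b
  | EDiv a b => eval M v a %/ eval M v b
  | ERd k a => M k (eval M v a)
  end.

Definition upds (k : nat) (ws : seq (nat * nat)) (M : nat -> nat -> nat) :=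
  foldr (fun av M => upd M k av.1 av.2) M ws.

Definition writes (M : nat -> nat -> nat) (E : seq (seq nat)) (c a v : expr) :=
  [seq (eval M x a, eval M x v) | x <- E & eval M x c != 0].

Definition tick (d : nat) (st : state) :=
  St (smem st) (env st) (tm st + d) (wk st + d * size (env st)).

(** [F] is the transformer of the loop body and [k] the number of iterations. The test must have the
    same truth value in all processors. The extra [tick 1] is the jump back. *)
Fixpoint wpw (F : (state -> Prop) -> state -> Prop) (e : expr) (Q : state -> Prop)
    (k : nat) (st : state) : Prop :=
  if k is k'.+1 then
    all (fun v => eval (smem st) v e != 0) (env st) /\
    F (fun st1 => wpw F e Q k' (tick 1 st1)) (tick (cost e).+1 st)
  else all (fun v => eval (smem st) v e == 0) (env st) /\ Q (tick (cost e).+1 st).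

(** Simultaneous writes must have distinct addresses, so a provable precondition excludes a crash.
    [Dup] takes 3 steps but 5 instructions per original processor, as both copies are active in the
    last two steps. Coins are indexed by absolute time. *)
Fixpoint wp (s : stmt) (Q : state -> Prop) (st : state) : Prop :=
  let: St M E t w := st in
  match s with
  | Asg r e =>
      Q (St M [seq set_nth 0 v r (eval M v e) | v <- E]
            (t + (cost e).+1) (w + (cost e).+1 * size E))
  | RdIn r e =>
      all (fun v => eval M v e < OFF) E /\
      Q (St M [seq set_nth 0 v r (M raw (eval M v e)) | v <- E]
            (t + (cost e).+1) (w + (cost e).+1 * size E))
  | Wr k c a v =>
      uniq (unzip1 (writes M E c a v)) /\
      Q (St (upds k (writes M E c a v) M) E (t + wr_cost c (addr k a) v)
            (w + wr_cost c (addr k a) v * size E))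
  | WrOut c a v =>
      [/\ uniq (unzip1 (writes M E c a v)),
          all (fun x => eval M x a < OFF) E &
          Q (St (upds raw (writes M E c a v) M) E (t + wr_cost c a v)
                (w + wr_cost c a v * size E))]
  | Dup r =>
      Q (St M (flatten [seq [:: set_nth 0 v r 0; set_nth 0 v r 1] | v <- E])
            (t + 3) (w + 5 * size E))
  | Kill e =>
      Q (St M [seq v <- E | eval M v e != 0] (t + (cost e + 2)) (w + (cost e + 2) * size E))
  | Flip r =>
      Q (St M [seq set_nth 0 bv.2 r (nat_of_bool bv.1) | bv <- zip (mkseq (coins t) (size E)) E]
            (t + 1) (w + size E))
  | Seq a b => wp a (wp b Q) st
  | While e s => exists k, wpw (wp s) e Q k st
  end.

Lemma wpw_mono F e (Q Q' : state -> Prop) k st :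
  (forall R R' : state -> Prop, (forall s, R s -> R' s) -> forall s, F R s -> F R' s) ->
  (forall s, Q s -> Q' s) -> wpw F e Q k st -> wpw F e Q' k st.
Proof.
move=> hF h; elim: k st => [|k ih] st /= [? H]; split=> //; first exact: h.
by apply: hF H => s; apply: ih.
Qed.

Lemma wp_mono s (Q Q' : state -> Prop) st :
  (forall x, Q x -> Q' x) -> wp s Q st -> wp s Q' st.
Proof.
elim: s Q Q' st => [r e|r e|k c a v|c a v|r|e|r|a iha b ihb|e s ih] Q Q' [M E t w] h /=.
- exact: h.
- by case=> ? /h.
- by case=> ? /h.
- by case=> ? ? /h.
- exact: h.
- exact: h.
- exact: h.
- by apply: iha => s; apply: ihb.
- by case=> k H; exists k; apply: wpw_mono H => // R R' hR s'; apply: ih.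
Qed.

End Semantics.

(** * Compilation *)

(** Yields the code, the register that holds the result, and the first register still free. *)
Fixpoint ce (e : expr) (c : nat) : seq instr * nat * nat :=
  match e with
  | ECst k => ([:: Const c k], c, c.+1)
  | EVar r => ([::], r.+2, c)
  | EOff => ([::], 0, c)
  | EAdd a b => let: (p, ra, c1) := ce a c in let: (q, rb, c2) := ce b c1 in
      (p ++ q ++ [:: Add c2 ra rb], c2, c2.+1)
  | ESub a b => let: (p, ra, c1) := ce a c in let: (q, rb, c2) := ce b c1 in
      (p ++ q ++ [:: Defs.Sub c2 ra rb], c2, c2.+1)
  | EMul a b => let: (p, ra, c1) := ce a c in let: (q, rb, c2) := ce b c1 in
      (p ++ q ++ [:: Mul c2 ra rb], c2, c2.+1)
  | EDiv a b => let: (p, ra, c1) := ce a c in let: (q, rb, c2) := ce b c1 in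
      (p ++ q ++ [:: Div c2 ra rb], c2, c2.+1)
  | ERd k a => let: (p, ra, c1) := ce a c in
      (p ++ [:: Const c1 64; Mul c1.+1 ra c1; Add c1.+2 c1.+1 0; Const c1.+3 k;
                Add c1.+4 c1.+2 c1.+3; Read c1.+4.+1 c1.+4], c1.+4.+1, c1.+4.+2)
  end.

(** The five final instructions take three steps whether or not the guard holds: processors that do
    not write make two more jumps as padding. This keeps the lock step and explains the constant 3
    in [wr_cost]. *)
Definition cstore (c a v : expr) (l n : nat) : seq instr * nat :=
  let: (p, rc, n1) := ce c n in
  let: (q, ra, n2) := ce a n1 in
  let: (r, rv, n3) := ce v n2 in
  let z := l + size (p ++ q ++ r) in
  ((p ++ q ++ r) ++ [:: Jz rc (z + 3); Write ra rv; Jz 1 (z + 5); Jz 1 (z + 4); Jz 1 (z + 5)], n3).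

(* Register 0 holds [OFF], register 1 holds 0, and variable [r] lives in register
   [r.+2]; every intermediate result gets a register of its own, so that a single
   degree per register bounds its contents. *)
Fixpoint cs (s : stmt) (l n : nat) : seq instr * nat :=
  match s with
  | Asg r e => let: (p, re, n1) := ce e n in (p ++ [:: Defs.Sub r.+2 re 1], n1)
  | RdIn r e => let: (p, re, n1) := ce e n in (p ++ [:: Read r.+2 re], n1)
  | Wr k c a v => cstore c (addr k a) v l n
  | WrOut c a v => cstore c a v l n
  | Dup r => ([:: Fork (l + 3); Const r.+2 0; Jz 1 (l + 5); Const r.+2 1; Jz 1 (l + 5)], n)
  | Kill e => let: (p, re, n1) := ce e n in
      let z := l + size p in (p ++ [:: Jz re (z + 2); Jz 1 (z + 3); Halt], n1)
  | Flip r => ([:: Coin r.+2], n)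
  | Seq a b => let: (p, n1) := cs a l n in let: (q, n2) := cs b (l + size p) n1 in (p ++ q, n2)
  | While e s => let: (p, re, n1) := ce e n in
      let: (q, n2) := cs s (l + (size p).+1) n1 in
      (p ++ Jz re (l + ((size p).+1 + (size q).+1)) :: q ++ [:: Jz 1 l], n2)
  end.

Fixpoint wfe (e : expr) : bool :=
  match e with
  | ECst _ | EOff => true | EVar r => r.+2 < tmp0
  | EAdd a b | ESub a b | EMul a b | EDiv a b => wfe a && wfe b
  | ERd k a => (k < 64) && wfe a
  end.

Fixpoint wfs (s : stmt) : bool :=
  match s with
  | Asg r e | RdIn r e => (r.+2 < tmp0) && wfe e
  | Wr k c a v => [&& k < 64, wfe c, wfe a & wfe v]
  | WrOut c a v => [&& wfe c, wfe a & wfe v]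
  | Dup r | Flip r => r.+2 < tmp0
  | Kill e => wfe e
  | Seq a b => wfs a && wfs b
  | While e s => wfe e && wfs s
  end.

Definition is_sl (i : instr) : bool :=
  match i with Const _ _ | Add _ _ _ | Defs.Sub _ _ _ | Mul _ _ _ | Div _ _ _ | Read _ _ => true
  | _ => false end.

Definition upd1 (M R : nat -> nat) (i : instr) : nat -> nat :=
  match i with
  | Const r k => update R r k
  | Add r s t => update R r (R s + R t)
  | Defs.Sub r s t => update R r (R s - R t)
  | Mul r s t => update R r (R s * R t)
  | Div r s t => update R r (R s %/ R t)
  | Read r s => update R r (M (R s))
  | _ => R
  end.

Lemma ce_mono e c : c <= (ce e c).2.
Proof.
elim: e c => [k|r||a iha b ihb|a iha b ihb|a iha b ihb|a iha b ihb|k a iha] c //=.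
1-4: by have := iha c; case: (ce a c) => [[p r] c1] /= h; have := ihb c1; case: (ce b c1) => [[q r'] c2] /=; lia.
by have := iha c; case: (ce a c) => [[p r] c1] /=; lia.
Qed.

Lemma cs_mono s l n : n <= (cs s l n).2.
Proof.
have hst c a v l' n' : n' <= (cstore c a v l' n').2.
  rewrite /cstore; have := ce_mono c n'; case: (ce c n') => [[p r] c1] /= h.
  have := ce_mono a c1; case: (ce a c1) => [[p2 r2] c2] /= h2.
  by have := ce_mono v c2; case: (ce v c2) => [[p3 r3] c3] /=; lia.
elim: s l n => [r e|r e|k c a v|c a v|r|e|r|a iha b ihb|e s ih] l n //=; try exact: hst.
1-3: by have := ce_mono e n; case: (ce e n) => [[p re] n1].
- have := iha l n; case: (cs a l n) => [p n1] /= h; have := ihb (l + size p) n1.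
  by case: (cs b _ n1) => [q n2] /=; lia.
- have := ce_mono e n; case: (ce e n) => [[p re] n1] /= h; have := ih (l + (size p).+1) n1.
  by case: (cs s _ n1) => [q n2] /=; lia.
Qed.

(** * Simulation of the lock-step language by the machine *)

Section Correctness.
Variables (P : program) (coins : nat -> nat -> bool) (OFF : nat).

(** The program counters stay in the interval from [lo] to [hi]. This allows word sizes to be
    checked on just the code that runs, with different degrees for the two halves of a program. *)
Inductive reach (lo hi : nat) : nat -> config -> nat -> config -> nat -> Prop :=
| reach0 t c : reach lo hi t c t c 0
| reachS t c c1 t' c' w : all (fun q => lo <= pc q < hi) (procs c) ->
    step P (coins t) c = Some c1 -> reach lo hi t.+1 c1 t' c' w ->
    reach lo hi t c t' c' (size (procs c) + w).

Lemma reach_trans lo hi t c t1 c1 w1 t2 c2 w2 :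
  reach lo hi t c t1 c1 w1 -> reach lo hi t1 c1 t2 c2 w2 -> reach lo hi t c t2 c2 (w1 + w2).
Proof.
by elim=> // {t c t1 c1 w1} t c c1 t' c' w hp hs _ ih /ih h; rewrite -addnA; apply: reachS h.
Qed.

Lemma reach_widen lo hi lo' hi' t c t1 c1 w :
  lo' <= lo -> hi <= hi' -> reach lo hi t c t1 c1 w -> reach lo' hi' t c t1 c1 w.
Proof.
move=> hl hh; elim=> [*|{c1 w}t0 c0 c1 t' c' w hp hs _ ih]; first exact: reach0.
by apply: reachS ih => //; apply: sub_all hp => q /andP[a b]; rewrite (leq_trans hl a) (leq_trans b).
Qed.

Lemma reach_app lo hi lo1 hi1 lo2 hi2 t c t1 c1 w1 t2 c2 w2 w :
  reach lo1 hi1 t c t1 c1 w1 -> reach lo2 hi2 t1 c1 t2 c2 w2 ->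
  [&& lo <= lo1, hi1 <= hi, lo <= lo2 & hi2 <= hi] -> w = w1 + w2 -> reach lo hi t c t2 c2 w.
Proof.
by move=> h1 h2 /and4P[a b d e] ->; apply: reach_trans (reach_widen a b h1) (reach_widen d e h2).
Qed.

Lemma reach1 lo hi t c c1 : all (fun q => lo <= pc q < hi) (procs c) ->
  step P (coins t) c = Some c1 -> reach lo hi t c t.+1 c1 (size (procs c)).
Proof. by move=> h hs; rewrite -[size _]addn0; apply: reachS h hs (reach0 _ _ _ _). Qed.

Definition applyw (ws : seq (nat * nat)) (M : nat -> nat) :=
  foldr (fun av M => update M av.1 av.2) M ws.

(** The outcome [G] may not depend on the coin, which covers every instruction except [Coin].
    Indexing the processors by an arbitrary list keeps the abstract data attached to them. *)
Lemma stepE (T : Type) (co : nat -> bool) M (X : seq T) (F : T -> proc)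
    (G : T -> seq proc * option (nat * nat)) :
  (forall x b, exec P M b (F x) = G x) ->
  uniq (unzip1 (pmap (fun x => (G x).2) X)) ->
  step P co (Config M (map F X)) =
  Some (Config (applyw (pmap (fun x => (G x).2) X) M) (flatten (map (fun x => (G x).1) X))).
Proof.
move=> hG hu; rewrite /step /= size_map.
have -> : [seq exec P M bq.1 bq.2 | bq <- zip (mkseq co (size X)) (map F X)] = map G X.
  elim: X co {hu} => //= x X ih co.
  rewrite /mkseq /= hG; congr cons.
  by rewrite (iotaDl 1 0) -map_comp; exact: (ih (fun i => co i.+1)).
have -> : pmap snd (map G X) = pmap (fun x => (G x).2) X by elim: (X) => //= x s ->.
by rewrite hu -map_comp.
Qed.

Lemma stepE0 (T : Type) (co : nat -> bool) M (X : seq T) (F : T -> proc) (G : T -> seq proc) :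
  (forall x b, exec P M b (F x) = (G x, None)) ->
  step P co (Config M (map F X)) = Some (Config M (flatten (map G X))).
Proof.
move=> hG; rewrite (stepE (G := fun x => (G x, None)) co) //=;
  have -> // : pmap (fun _ : T => None : option (nat * nat)) X = [::] by elim: X.
Qed.

Lemma flatten1 (T U : Type) (f : T -> U) X : flatten [seq [:: f x] | x <- X] = map f X.
Proof. by elim: X => //= x X ->. Qed.

Lemma stepE1 (T : Type) (co : nat -> bool) M (X : seq T) (F G : T -> proc) :
  (forall x b, exec P M b (F x) = ([:: G x], None)) ->
  step P co (Config M (map F X)) = Some (Config M (map G X)).
Proof. by move=> h; rewrite (stepE0 (G := fun x => [:: G x]) co X h) flatten1. Qed.

Definition code_at (l : nat) (code : seq instr) :=
  forall i, i < size code -> nth Halt P (l + i) = nth Halt code i.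

Lemma code_at_cat l p q : code_at l (p ++ q) -> code_at l p /\ code_at (l + size p) q.
Proof.
move=> h; split=> i hi.
  by rewrite h ?size_cat ?(ltn_addr _ hi) // nth_cat hi.
by rewrite -addnA h ?size_cat ?ltn_add2l // nth_cat ltnNge leq_addr /= addKn.
Qed.

Lemma code_at_cons l i q : code_at l (i :: q) -> nth Halt P l = i /\ code_at l.+1 q.
Proof.
by move=> h; split; [have := h 0 isT; rewrite addn0 | move=> j hj; rewrite addSnnS (h j.+1)].
Qed.

Lemma reach_sl code l t M (Rs : seq (nat -> nat)) :
  code_at l code -> all is_sl code ->
  reach l (l + size code) t (Config M [seq Proc l R | R <- Rs]) (t + size code)
    (Config M [seq Proc (l + size code) (foldl (upd1 M) R code) | R <- Rs]) (size code * size Rs).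
Proof.
elim: code l t Rs => [|i code ih] l t Rs /=; first by rewrite !addn0 mul0n => *; apply: reach0.
move=> /code_at_cons[hi hc] /andP[sli slc].
rewrite mulSn -[X in reach _ _ _ _ _ _ (X + _)](size_map (fun R => Proc l R)).
have {ih} := ih l.+1 t.+1 [seq upd1 M R i | R <- Rs] hc slc.
rewrite size_map -!map_comp /= !addSnnS => H.
apply: reachS (reach_widen (leqnSn _) (leqnn _) H).
  by rewrite /= all_map; apply/allP => R _ /=; lia.
apply: stepE1 => R b /=; rewrite /exec /= hi.
by case: (i) sli.
Qed.

(** A variable beyond the end of [v] must have register value 0, in agreement with the zeroed
    initial registers. *)
Definition sim (v : seq nat) (R : nat -> nat) :=
  [/\ R 0 = OFF, R 1 = 0 & forall r, r.+2 < tmp0 -> R r.+2 = nth 0 v r].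

Lemma sim_agree v R R' : (forall q, q < tmp0 -> R' q = R q) -> sim v R -> sim v R'.
Proof. by move=> h [a b c]; split=> [||r hr]; rewrite h // c. Qed.

(** The machine memory that an abstract memory stands for. Cells of region [raw] from [OFF] on have
    no counterpart, which is why [RdIn] and [WrOut] carry address bounds. *)
Definition conc (M : nat -> nat -> nat) (a : nat) : nat :=
  if a < OFF then M raw a else M ((a - OFF) %% 64) ((a - OFF) %/ 64).

Lemma conc_addr M k a : k < 64 -> conc M (a * 64 + OFF + k) = M k a.
Proof.
move=> hk; rewrite /conc ltnNge; have -> /= : OFF <= a * 64 + OFF + k by lia.
have -> : a * 64 + OFF + k - OFF = a * 64 + k by lia.
by rewrite modnMDl divnMDl // modn_small // divn_small // addn0.
Qed.

Lemma conc_upd M k a v : k < 64 -> conc (upd M k a v) = update (conc M) (a * 64 + OFF + k) v.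
Proof.
move=> hk; apply: funext => b; rewrite /conc /update /upd.
have h1 : (64 == k) = false by lia.
case: ltnP => hb.
  have h2 : (b == a * 64 + OFF + k) = false by lia.
  by rewrite h1 h2.
case: (b =P _) => [->|hne].
  have -> : a * 64 + OFF + k - OFF = a * 64 + k by lia.
  by rewrite modnMDl divnMDl // modn_small // divn_small // addn0 !eqxx.
case: andP => // -[/eqP h3 /eqP h2]; case: hne.
by have := divn_eq (b - OFF) 64; rewrite h3 h2; lia.
Qed.

Lemma conc_upd_raw M a v : a < OFF -> conc (upd M raw a v) = update (conc M) a v.
Proof.
move=> ha; apply: funext => b; rewrite /conc /update /upd.
case: ltnP => hb; first by rewrite eqxx.
have h2 : (b == a) = false by lia.
have h1 : ((b - OFF) %% 64 == 64) = false by apply/negP => /eqP h; have := ltn_pmod (b - OFF) (isT : 0 < 64); rewrite h.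
by rewrite h1 h2.
Qed.

Lemma conc_upds M k ws : k < 64 ->
  applyw [seq (av.1 * 64 + OFF + k, av.2) | av <- ws] (conc M) = conc (upds k ws M).
Proof. by move=> hk; elim: ws => //= av ws ->; rewrite conc_upd. Qed.

Lemma conc_upds_raw M ws : all (fun a => a < OFF) (unzip1 ws) ->
  applyw ws (conc M) = conc (upds raw ws M).
Proof. by elim: ws => //= av ws ih /andP[h /ih ->]; rewrite conc_upd_raw. Qed.

Lemma ce_correct e c R v M : tmp0 <= c -> sim v R -> wfe e ->
  let: (p, r, c') := ce e c in
  [/\ foldl (upd1 (conc M)) R p r = eval OFF M v e,
      forall q, q < c -> foldl (upd1 (conc M)) R p q = R q,
      c <= c' /\ r < c', all is_sl p & size p = cost e].
Proof.
elim: e c R => [k|r||a iha b ihb|a iha b ihb|a iha b ihb|a iha b ihb|k a iha] c R hc hs /=.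
- by move=> _; split=> //=; rewrite /update ?eqxx // => q hq; case: eqP => // ?; lia.
- by move=> hr; case: hs => _ _ h; split=> //; [rewrite h|lia].
- by move=> _; case: hs => h _ _; split=> //; lia.
1-4: move=> /andP[wa wb]; have := iha c R hc hs wa; case: (ce a c) => [[p ra] c1] [e1 k1 [l1 r1] s1 z1];
  (have hs1 : sim v (foldl (upd1 (conc M)) R p) by (apply: sim_agree hs => q hq; apply: k1; lia));
  have := ihb c1 _ (leq_trans hc l1) hs1 wb; case: (ce b c1) => [[q rb] c2] [e2 k2 [l2 r2] s2 z2];
  rewrite !foldl_cat !all_cat s1 s2 !size_cat /= /update eqxx; split=> //;
  [ by rewrite e2 k2 // e1 | move=> j hj; case: eqP => [?|_]; [lia | by rewrite k2 ?k1 //; lia]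
  | lia | by rewrite z1 z2; lia ].
move=> /andP[hk wa]; have := iha c R hc hs wa; case: (ce a c) => [[p ra] c1] [e1 k1 [l1 r1] s1 z1].
have hs1 : sim v (foldl (upd1 (conc M)) R p) by (apply: sim_agree hs => q hq; apply: k1; lia).
rewrite foldl_cat all_cat s1 size_cat z1 /=; split=> //; try lia.
  case: hs1 => h0 _ _; rewrite /update !(eqn_add2l, eqxx) /=.
  have E : forall i j, (c1.+1 + i == c1 + j) = (i.+1 == j) by move=> i j; rewrite addSnnS eqn_add2l.
  do ! (case: eqP => [?|_]; try lia).
  by rewrite h0 e1 conc_addr.
move=> j hj; rewrite /update; do ! (case: eqP => [?|_]; try lia).
by rewrite k1 //; lia.
Qed.

Definition sims (X : seq (seq nat * (nat -> nat))) := allp (fun x => sim x.1 x.2) X.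

Definition at_pc (M : nat -> nat -> nat) l (X : seq (seq nat * (nat -> nat))) :=
  Config (conc M) [seq Proc l x.2 | x <- X].

(** Earlier results sit in registers below [n]. A stable predicate about them survives the
    evaluation of the next expression, which writes only to registers from [n] on. *)
Definition stable n (A : seq nat * (nat -> nat) -> Prop) :=
  forall v R R', (forall q, q < n -> R' q = R q) -> A (v, R) -> A (v, R').

Lemma eval_reach e n l t M X (A : seq nat * (nat -> nat) -> Prop) :
  tmp0 <= n -> wfe e -> code_at l (ce e n).1.1 -> sims X -> stable n A -> allp A X ->
  let: (p, r, n1) := ce e n in
  exists2 Y, [/\ map fst Y = map fst X,
    allp (fun y => [/\ sim y.1 y.2, A y & y.2 r = eval OFF M y.1 e]) Y &
    reach l (l + size p) t (at_pc M l X) (t + cost e) (at_pc M (l + size p) Y)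
      (cost e * size X)] & [/\ size p = cost e, n <= n1 & r < n1].
Proof.
move=> hn hw hc hs hA hAX.
have hcor v R : sim v R -> _ := fun h => @ce_correct e n R v M hn h hw.
move: hc hcor; case: (ce e n) => [[p r] n1] /= hc hcor.
have [hz hl [hl1 hl2]] : [/\ size p = cost e, all is_sl p & n <= n1 /\ r < n1].
  have hs0 : sim [::] (update (fun _ => 0) 0 OFF).
    by split=> // j _; rewrite /update nth_nil.
  by case: (hcor _ _ hs0) => _ _ ? ? ?; split.
exists [seq (x.1, foldl (upd1 (conc M)) x.2 p) | x <- X]; last by split.
split.
- by rewrite -map_comp.
- apply/allp_map; move: hs hAX; elim: (X) => //= x s ih [sx ss] [ax as_]; split; last exact: ih.
  case: (hcor _ _ sx) => h1 h2 _ _ _; split=> //; first by apply: sim_agree sx => q hq; apply: h2; lia.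
  by case: x ax {sx h1} h2 => v R /= ax h2; apply: hA ax.
- have := @reach_sl p l t (conc M) [seq x.2 | x <- X] hc hl.
  by rewrite size_map -!map_comp hz /at_pc -map_comp.
Qed.

Definition rep l st c := exists X, [/\ c = at_pc (smem st) l X, env st = map fst X & sims X].

Lemma stableT n : stable n (fun _ => True). Proof. by []. Qed.

Lemma allpT (T : Type) (X : seq T) : allp (fun _ => True) X.
Proof. by elim: X. Qed.

Lemma store_reach c a v n l t M X : tmp0 <= n -> [&& wfe c, wfe a & wfe v] ->
  code_at l (cstore c a v l n).1 -> sims X ->
  let ws := writes OFF M (map fst X) c a v in
  uniq (unzip1 ws) ->
  let p := (cstore c a v l n).1 in
  n <= (cstore c a v l n).2 /\
  exists2 Y, map fst Y = map fst X /\ sims Y &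
    reach l (l + size p) t (at_pc M l X) (t + wr_cost c a v)
     (Config (applyw ws (conc M)) [seq Proc (l + size p) y.2 | y <- Y]) (wr_cost c a v * size X).
Proof.
move=> hn /and3P[wc wa wv]; rewrite /cstore.
have := fun h1 h2 => @eval_reach c n l t M X _ hn wc h1 h2 (@stableT n) (allpT _).
case: (ce c n) => [[p rc] n1] /= H1.
have := fun h => @eval_reach a n1 (l + size p) (t + cost c) M _ (fun y => y.2 rc = eval OFF M y.1 c) h wa.
case: (ce a n1) => [[q ra] n2] /= H2.
have := fun h => @eval_reach v n2 (l + size p + size q) (t + cost c + cost a) M _
   (fun y => y.2 rc = eval OFF M y.1 c /\ y.2 ra = eval OFF M y.1 a) h wv.
case: (ce v n2) => [[r rv] n3] /= H3.
move=> /code_at_cat[/code_at_cat[hp /code_at_cat[hq hr]] hj] hs hu.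
have [X1 [f1 s1 g1] [z1 l1 m1]] := H1 hp hs.
have st1 : stable n1 (fun y => y.2 rc = eval OFF M y.1 c) by move=> u R R' h /=; rewrite h.
have [X2 [f2 s2 g2] [z2 l2 m2]] := H2 X1 (leq_trans hn l1) hq (allp_sub (fun x h => let: And3 h1 _ _ := h in h1) s1)
  st1 (allp_sub (fun x h => let: And3 _ _ h1 := h in h1) s1).
have st2 : stable n2 (fun y => y.2 rc = eval OFF M y.1 c /\ y.2 ra = eval OFF M y.1 a).
  by move=> u R R' h /=; rewrite !h //; lia.
have [X3 [f3 s3 g3] [z3 l3 m3]] := H3 X2 (leq_trans hn (leq_trans l1 l2)) hr
  (allp_sub (fun x h => let: And3 h1 _ _ := h in h1) s2) st2
  (allp_sub (fun x h => let: And3 _ h1 h2 := h in conj h1 h2) s2).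
split; first lia.
have s4 : sims X3 by apply: allp_sub s3 => x [].
exists X3; first by rewrite f3 f2 f1.
set z := l + size (p ++ q ++ r) in hj *.
have ez : l + size p + size q + size r = z by rewrite /z !size_cat; lia.
rewrite size_cat -/z /= addnA -/z.
have zs : size X1 = size X /\ size X2 = size X /\ size X3 = size X.
  by rewrite -!(size_map fst) f3 f2 f1.
have G : reach l (z + 5) t (at_pc M l X) (t + cost c + cost a + cost v) (at_pc M z X3)
   ((cost c + cost a + cost v) * size X).
  rewrite -ez in g3 *; case: zs => zs1 [zs2 _].
  apply: reach_app (reach_app g1 g2 (lo := l) (hi := z) _ erefl) g3 _ _; rewrite ?zs1 ?zs2; lia.
rewrite /wr_cost !addnA mulnDl; apply: reach_trans G _.
have [j0 /code_at_cons[j1 /code_at_cons[j2 /code_at_cons[j3 /code_at_cons[j4 _]]]]] := code_at_cons hj.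
case: zs => _ [_ zs].
(* [F1] and [F2] are the processors after one and two of the three final steps; those with a false
   guard are on the padding jumps. *)
pose F1 (x : seq nat * (nat -> nat)) := Proc (if x.2 rc == 0 then z + 3 else z.+1) x.2.
pose F2 (x : seq nat * (nat -> nat)) := Proc (if x.2 rc == 0 then z + 4 else z.+2) x.2.
set t0 := t + _ + _ + _.
rewrite -zs (_ : 3 * size X3 = size X3 + (size X3 + (size X3 + 0))); last by lia.
rewrite (_ : t0 + 3 = t0.+3); last by lia.
have S1 : step P (coins t0) (at_pc M z X3) = Some (Config (conc M) (map F1 X3)).
  by apply: stepE1 => x b; rewrite /exec /= j0.
rewrite -{1}(size_map (fun x => Proc z x.2) X3).
apply: reachS S1 _; first by rewrite /= all_map; apply/allP=> x _ /=; lia.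
pose G2 (x : seq nat * (nat -> nat)) : seq proc * option (nat * nat) :=
  if x.2 rc == 0 then ([:: F2 x], None) else ([:: F2 x], Some (x.2 ra, x.2 rv)).
have ew : pmap (fun x => (G2 x).2) X3 = writes OFF M (map fst X) c a v.
  rewrite -f1 -f2 -f3 /writes; elim: (X3) s3 => //= x s ih [[sx [e1 e2] e3] hs'].
  by rewrite /G2 e1; case: eqP => _ /=; rewrite ?e2 ?e3 ih.
have S2 : step P (coins t0.+1) (Config (conc M) (map F1 X3)) =
   Some (Config (applyw (writes OFF M (map fst X) c a v) (conc M)) (map F2 X3)).
  have e2 x b : exec P (conc M) b (F1 x) = G2 x.
    rewrite /G2 /F1 /F2 /exec /=; case: ifP => h.
      by rewrite (_ : z + 3 = z.+3) ?j3 ?if_same; [case: ifP => _; congr (_, _); congr [:: _]; congr Proc; lia|lia].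
    by rewrite j1.
  rewrite (stepE _ e2) ew // /G2; congr (Some (Config _ _)).
  by elim: (X3) => //= x s ->; case: ifP.
rewrite -{1}(size_map F1 X3).
apply: reachS S2 _.
  by rewrite /= all_map; apply/allP=> x _ /=; case: ifP; lia.
have S3 : step P (coins t0.+2) (Config (applyw (writes OFF M (map fst X) c a v) (conc M)) (map F2 X3)) =
   Some (Config (applyw (writes OFF M (map fst X) c a v) (conc M)) [seq Proc (z + 5) y.2 | y <- X3]).
  rewrite (@stepE1 _ _ _ X3 F2 (fun x => Proc (if (x.2 rc == 0) || (x.2 1 == 0) then z + 5 else z.+3) x.2)).
    congr (Some (Config _ _)); apply: eq_map_allp s4 => x [_ e _].
    by rewrite e eqxx orbT.
  move=> x b; rewrite /exec /F2 /=; case: ifP => h /=.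
    by rewrite (_ : z + 4 = z.+4) ?j4; [case: ifP => _; congr (_, _); congr [:: _]; congr Proc; lia|lia].
  by rewrite j2.
rewrite -{1}(size_map F2 X3).
apply: reachS S3 (reach0 _ _ _ _).
by rewrite /= all_map; apply/allP=> x _ /=; case: ifP; lia.
Qed.

(** Induction on the statement and, for a loop, on the number of iterations that [wp] provides. Time
    and work are components of the abstract state, so the postcondition speaks about the exact costs
    of the machine. *)
Theorem cs_correct s l n Q st c : tmp0 <= n -> wfs s -> code_at l (cs s l n).1 ->
  rep l st c -> wp OFF coins s Q st ->
  exists st' c' w, [/\ Q st', rep (l + size (cs s l n).1) st' c', wk st' = wk st + w &
    reach l (l + size (cs s l n).1) (tm st) c (tm st') c' w].
Proof.
elim: s l n Q st c => [r e|r e|k b a v|b a v|r|e|r|s1 ih1 s2 ih2|e s ih] l n Q [M E t w] c hn /= hw;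
  rewrite /rep /= => hc [X [-> -> hs]] {c E}.
- move: hw => /andP[hr hw]; have := fun h1 => @eval_reach e n l t M X _ hn hw h1 hs (@stableT n) (allpT _).
  case: (ce e n) hc => [[p re] n1] /= /code_at_cat[hp /code_at_cons[hi _]] /(_ hp).
  case=> Y [fY sY gY] [z1 l1 m1] hQ.
  exists (St M [seq set_nth 0 v r (eval OFF M v e) | v <- map fst X] (t + (cost e).+1)
    (w + (cost e).+1 * size (map fst X))), (at_pc M (l + size p).+1
      [seq (set_nth 0 y.1 r (eval OFF M y.1 e), update y.2 r.+2 (y.2 re - y.2 1)) | y <- Y]),
    ((cost e).+1 * size X).
  have eS : size Y = size X by rewrite -(size_map fst) fY size_map.
  split=> //=; last 2 first.
  + by rewrite size_map.
  + rewrite size_cat addnA addn1 addnS.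
    apply: reach_app gY (reach1 (lo := l) (hi := (l + size p).+1) _ _) _ _; try (by rewrite /= size_map eS; lia); try lia.
      by rewrite /= all_map; apply/allP=> x _ /=; lia.
    by rewrite /at_pc -map_comp; apply: stepE1 => x b0; rewrite /exec /= hi.
  + exists [seq (set_nth 0 y.1 r (eval OFF M y.1 e), update y.2 r.+2 (y.2 re - y.2 1)) | y <- Y].
    rewrite size_cat addnA addn1 -fY -!map_comp; split=> //.
    apply/allp_map; apply: allp_sub sY => y [[a1 a2 a3] _ a4] /=; split; rewrite ?/update //= => q hq.
    by rewrite nth_set_nth /= eqSS eqSS a4 a2 subn0 a3.
- move: hw => /andP[hr hw]; have := fun h1 => @eval_reach e n l t M X _ hn hw h1 hs (@stableT n) (allpT _).
  case: (ce e n) hc => [[p re] n1] /= /code_at_cat[hp /code_at_cons[hi _]] /(_ hp).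
  case=> Y [fY sY gY] [z1 l1 m1] [hO hQ].
  exists (St M [seq set_nth 0 v r (M raw (eval OFF M v e)) | v <- map fst X] (t + (cost e).+1)
    (w + (cost e).+1 * size (map fst X))), (at_pc M (l + size p).+1
      [seq (set_nth 0 y.1 r (M raw (eval OFF M y.1 e)), update y.2 r.+2 (conc M (y.2 re))) | y <- Y]),
    ((cost e).+1 * size X).
  have eS : size Y = size X by rewrite -(size_map fst) fY size_map.
  split=> //=; last 2 first.
  + by rewrite size_map.
  + rewrite size_cat addnA addn1 addnS.
    apply: reach_app gY (reach1 (lo := l) (hi := (l + size p).+1) _ _) _ _; try (by rewrite /= size_map eS; lia); try lia.
      by rewrite /= all_map; apply/allP=> x _ /=; lia.
    by rewrite /at_pc -map_comp; apply: stepE1 => x b0; rewrite /exec /= hi.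
  + exists [seq (set_nth 0 y.1 r (M raw (eval OFF M y.1 e)), update y.2 r.+2 (conc M (y.2 re))) | y <- Y].
    rewrite size_cat addnA addn1 -fY -!map_comp; split=> //.
    move: hO; rewrite -fY; elim: (Y) sY => //= y s ih [[[a1 a2 a3] _ a4] hs'] /andP[hO /ih]; split; last tauto.
    split; rewrite ?/update //= => q hq.
    by rewrite nth_set_nth /= eqSS eqSS a4 /conc hO a3.
- move: hw => /andP[hk hw] [hu hQ].
  have hw' : [&& wfe b, wfe (addr k a) & wfe v] by move: hw => /and3P[? ? ?] /=; apply/and3P; rewrite /= !andbT.
  have ew : writes OFF M (map fst X) b (addr k a) v =
     [seq (av.1 * 64 + OFF + k, av.2) | av <- writes OFF M (map fst X) b a v].
    by rewrite /writes -map_comp.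
  have [|hl [Y [fY sY] gY]] := @store_reach b (addr k a) v n l t M X hn hw' hc hs.
    rewrite ew /unzip1 -map_comp (map_comp (fun a => a * 64 + OFF + k)) map_inj_uniq //.
    by move=> i j; lia.
  rewrite ew conc_upds // in gY.
  do 3 eexists; split; [exact: hQ| |by []|rewrite /= size_map; exact: gY].
  by exists Y; split; rewrite //= fY.
- move=> [hu hO hQ].
  have [|hl [Y [fY sY] gY]] := @store_reach b a v n l t M X hn hw hc hs => //.
  rewrite conc_upds_raw in gY; last first.
    by apply/allP=> x /mapP[[a0 v0]]; rewrite /writes => /mapP[y]; rewrite mem_filter => /andP[_ hy] [-> _] -> /=;
       exact: (allP hO).
  do 3 eexists; split; [exact: hQ| |by []|rewrite /= size_map; exact: gY].
  by exists Y; split; rewrite //= fY.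
- move=> hQ.
  have [j0 /code_at_cons[j1 /code_at_cons[j2 /code_at_cons[j3 /code_at_cons[j4 _]]]]] := code_at_cons hc.
  pose Y := flatten [seq [:: (set_nth 0 x.1 r 0, update x.2 r.+2 0); (set_nth 0 x.1 r 1, update x.2 r.+2 1)] | x <- X].
  exists (St M (flatten [seq [:: set_nth 0 v r 0; set_nth 0 v r 1] | v <- map fst X]) (t + 3) (w + 5 * size (map fst X))).
  exists (at_pc M (l + 5) Y), (5 * size X); split=> //=; last 2 first.
  + by rewrite size_map.
  + rewrite (_ : 5 * size X = size X + (2 * size X + (2 * size X + 0))); last by lia.
    rewrite (_ : t + 3 = t.+3); last by lia.
    rewrite -{1}(size_map (fun x => Proc l x.2) X).
    pose Z1 := flatten [seq [:: (l.+1, x.2); (l + 3, x.2)] | x <- X].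
    have S1 : step P (coins t) (at_pc M l X) = Some (Config (conc M) [seq Proc z.1 z.2 | z <- Z1]).
      rewrite /at_pc (@stepE0 _ _ _ X _ (fun x => [:: Proc l.+1 x.2; Proc (l + 3) x.2])).
        by congr (Some (Config _ _)); rewrite /Z1; elim: (X) => //= x s ->.
      by move=> x b; rewrite /exec /= j0.
    apply: reachS S1 _; first by rewrite /= all_map; apply/allP=> x _ /=; lia.
    pose Z2 := flatten [seq [:: (l.+2, update x.2 r.+2 0); (l.+4, update x.2 r.+2 1)] | x <- X].
    have S2 : step P (coins t.+1) (Config (conc M) [seq Proc z.1 z.2 | z <- Z1]) =
       Some (Config (conc M) [seq Proc z.1 z.2 | z <- Z2]).
      rewrite (_ : [seq Proc z.1 z.2 | z <- Z1] =
        [seq Proc (if z.1 then l.+1 else l + 3) z.2 |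
           z <- flatten [seq [:: (true, x.2); (false, x.2)] | x <- X]]); last first.
        by rewrite /Z1; elim: (X) => //= x s ->.
      rewrite (@stepE1 _ _ _ _ _ (fun z => if z.1 then Proc l.+2 (update z.2 r.+2 0)
        else Proc l.+4 (update z.2 r.+2 1))).
        by congr (Some (Config _ _)); rewrite /Z2; elim: (X) => //= x s ->.
      by move=> [[] R] b; rewrite /exec /= ?j1 // addn3 j3.
    have sz1 : size [seq Proc z.1 z.2 | z <- Z1] = 2 * size X.
      by rewrite /Z1 size_map; elim: (X) => //= x s ->; lia.
    have sz2 : size [seq Proc z.1 z.2 | z <- Z2] = 2 * size X.
      by rewrite /Z2 size_map; elim: (X) => //= x s ->; lia.
    rewrite -{1}sz1; apply: reachS S2 _.
      by rewrite /= /Z1; elim: (X) => //= x s ->; lia.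
    rewrite -sz2; apply: reachS (reach0 _ _ _ _).
      by rewrite /= /Z2; elim: (X) => //= x s ->; lia.
    rewrite (_ : [seq Proc z.1 z.2 | z <- Z2] =
        [seq Proc (if z.1 then l.+2 else l.+4) (update z.2.2 r.+2 (~~ z.1)) |
           z <- flatten [seq [:: (true, x); (false, x)] | x <- X]]); last first.
      by rewrite /Z2; elim: (X) => //= x s ->.
    rewrite (@stepE1 _ _ _ _ _ (fun z => Proc (if z.1 ==> (update z.2.2 r.+2 (~~ z.1) 1 == 0) then l + 5 else l.+3)
       (update z.2.2 r.+2 (~~ z.1)))).
      congr (Some (Config _ _)); rewrite /Y; elim: (X) hs => //= x s ih [[_ e _] hs'].
      by rewrite ih // /update /= e.
    move=> [[] [u R]] b; rewrite /exec /= ?j2 // j4 /=.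
    by rewrite (_ : l.+1.+4 = l + 5) ?if_same //; lia.
  + exists Y; split=> //; first by rewrite /Y; elim: (X) => //= x s ->.
    apply: allp_flatten; apply: allp_sub hs => x [a1 a2 a3] /=.
    by do ! split=> //; move=> q hq; rewrite /update /= nth_set_nth /= eqSS eqSS a3.
- have := fun h1 => @eval_reach e n l t M X _ hn hw h1 hs (@stableT n) (allpT _).
  case: (ce e n) hc => [[p re] n1] /= /code_at_cat[hp /code_at_cons[j0 /code_at_cons[j1 /code_at_cons[j2 _]]]] /(_ hp).
  case=> Y [fY sY gY] [z1 l1 m1] hQ.
  set z := l + size p in gY j0 j1 j2 *.
  have sY' : sims Y by apply: allp_sub sY => x [].
  have eS : size Y = size X by rewrite -(size_map fst) fY size_map.
  pose Y' := [seq y <- Y | eval OFF M y.1 e != 0].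
  do 3 eexists; split; [exact: hQ| |by []|].
    exists Y'; split; [reflexivity| |exact: allp_filter].
    by rewrite -fY filter_map.
  rewrite size_cat !addnA addnS -/z /= size_map.
  rewrite (_ : (_ + 2) * _ = cost e * size X + (size Y + (size Y + 0))); last by rewrite eS; lia.
  apply: reach_trans (reach_widen (leqnn _) (leq_addr _ _) gY) _.
  pose F1 (y : seq nat * (nat -> nat)) := Proc (if y.2 re == 0 then z + 2 else z.+1) y.2.
  rewrite -{1}(size_map (fun y => Proc z y.2) Y).
  apply: (reachS (c1 := Config (conc M) (map F1 Y))).
    by rewrite /= all_map; apply/allP=> x _ /=; lia.
    by apply: stepE1 => x b; rewrite /exec /= j0.
  rewrite -{1}(size_map F1 Y) addn2.
  apply: reachS (reach0 _ _ _ _).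
    by rewrite /= all_map; apply/allP=> x _ /=; case: ifP; lia.
  rewrite (@stepE0 _ _ _ Y F1 (fun y => if y.2 re == 0 then [::] else [:: Proc (if y.2 1 == 0 then z + 3 else z.+2) y.2])).
    congr (Some (Config _ _)); rewrite /Y'.
    elim: (Y) sY => //= y s ih [[[_ e1 _] _ e2] hs'].
    by rewrite ih // e1 e2 eqxx; case: eqP.
  move=> x b; rewrite /exec /F1 /=; case: ifP => h; last by rewrite j1.
  by rewrite addn2 j2.
- move=> hQ.
  have [j0 _] := code_at_cons hc.
  pose Y := [seq (set_nth 0 bx.2.1 r (nat_of_bool bx.1), update bx.2.2 r.+2 (nat_of_bool bx.1)) |
    bx <- zip (mkseq (coins t) (size X)) X].
  exists (St M [seq set_nth 0 bv.2 r (nat_of_bool bv.1) | bv <- zip (mkseq (coins t) (size (map fst X))) (map fst X)]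
     (t + 1) (w + size (map fst X))), (at_pc M (l + 1) Y), (size X).
  split=> //; last 2 first.
  + by rewrite /= size_map.
  + rewrite /= !addn1 -(size_map (fun x => Proc l x.2) X).
    apply: reach1; first by rewrite /= all_map; apply/allP=> x _ /=; lia.
    rewrite /step /= size_map.
    set outs := [seq exec _ _ _ _ | _ <- _].
    have -> : outs = [seq ([:: Proc (l + 1) (update bx.2.2 r.+2 (nat_of_bool bx.1))], None) |
       bx <- zip (mkseq (coins t) (size X)) X].
      rewrite /outs; elim: (X) (mkseq _ _) => [|x s ih] [|b bs] //=.
      by rewrite ih /exec /= j0 addn1.
    set zz := zip _ _.
    have -> : pmap snd [seq ([:: Proc (l + 1) (update bx.2.2 r.+2 (nat_of_bool bx.1))], None : option (nat * nat)) | bx <- zz] = [::].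
      by elim: zz => //= ? ? ->.
    congr (Some (Config _ _)).
    by rewrite /Y -/zz; elim: (zz) => //= x s0 ->; rewrite addn1.
  + exists Y; split=> //.
      rewrite /Y /= size_map; elim: (X) (mkseq _ _) => [|x s ih] [|b bs] //=.
      by rewrite ih.
    rewrite /Y; elim: (X) (mkseq _ _) hs => [|x s ih] [|b bs] //= [[a1 a2 a3] hs']; split; last exact: ih.
    by split=> // q hq; rewrite /update /= nth_set_nth /= eqSS eqSS a3.
- move: hw => /andP[w1 w2].
  have := ih1 l n (wp OFF coins s2 Q) (St M (map fst X) t w) (at_pc M l X) hn w1.
  have := cs_mono s1 l n; case: (cs s1 l n) hc => [p n1] /= hc hl H1.
  have := fun st c => ih2 (l + size p) n1 Q st c.
  case: (cs s2 (l + size p) n1) hc => [q n2] /= /code_at_cat[hp hq] H2 h.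
  have [|st1 [c1 [v1 [q1 r1 k1 g1]]]] := H1 hp _ h; first by exists X.
  have [st2 [c2 [v2 [q2 r2 k2 g2]]]] := H2 st1 c1 (leq_trans hn hl) w2 hq r1 q1.
  exists st2, c2, (v1 + v2); split=> //.
  + by rewrite size_cat addnA.
  + by rewrite k2 k1 addnA.
  + rewrite size_cat addnA; apply: reach_trans (reach_widen _ _ g1) (reach_widen _ _ g2) => //; lia.
- move: hw => /andP[we ws] [k hk].
  have := fun M t X hp hs => @eval_reach e n l t M X _ hn we hp hs (@stableT n) (allpT _).
  case: (ce e n) hc => [[p re] n1] /=.
  have := fun Q st c h => ih (l + (size p).+1) n1 Q st c h ws.
  case: (cs s (l + (size p).+1) n1) => [q n2] /= IH /code_at_cat[hp /code_at_cons[j0 /code_at_cat[hq /code_at_cons[j1 _]]]] H.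
  set hi := l + _; rewrite -addnS in hq.
  have ehi : hi = l + ((size p).+1 + (size q).+1) by rewrite /hi size_cat /= size_cat /=; lia.
  rewrite -ehi in j0; move: hi ehi j0 => hi ehi j0.
  have {}j1 : nth Halt P (l + (size p).+1 + size q) = Jz 1 l by rewrite -j1; congr nth; lia.
  have h1 : tmp0 <= n1 by have [X' _ [_ ? _]] := H M t X hp hs; lia.
  suff [st' [c' [w' [a1 a2 a3 a4]]]] : exists st' c' w0, [/\ Q st', rep hi st' c', wk st' = w + w0 &
     reach l hi t (at_pc M l X) (tm st') c' w0] by exists st', c', w'.
  elim: k M X t w hs hk => [|k IHk] M X t w hs /= [hall hF].
  + have [Y [fY sY gY] [z1 _ _]] := H M t X hp hs.
    have eS : size Y = size X by rewrite -(size_map fst) fY size_map.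
    do 3 eexists; split; [exact: hF| |rewrite /tick /=; reflexivity|].
      by exists Y; split; [reflexivity|rewrite /tick /= fY|apply: allp_sub sY => x []].
    rewrite /tick /= size_map addnS.
    apply: reach_app gY (reach1 (lo := l) (hi := hi) _ _) _ _; try (by rewrite /= size_map eS; lia); try lia.
      by rewrite /= all_map; apply/allP=> x _ /=; lia.
    rewrite /at_pc (@stepE1 _ _ _ Y _ (fun y => Proc (if y.2 re == 0 then hi else (l + size p).+1) y.2)).
      congr (Some (Config _ _)); move: hall; rewrite -fY.
      elim: (Y) sY => //= y s0 ih0 [[_ _ e1] hs'] /andP[/eqP e0 /(ih0 hs') ->].
      by rewrite e1 e0.
    by move=> x b; rewrite /exec /= j0.
  + have [Y [fY sY gY] [z1 _ _]] := H M t X hp hs.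
    have eS : size Y = size X by rewrite -(size_map fst) fY size_map.
    have [|st1 [c1 [w1 [b1 [X1 [-> e1 s1]] b3 b4]]]] := IH _ _ (at_pc M (l + (size p).+1) Y) h1 hq _ hF.
      by exists Y; split; [by []|rewrite /= fY|apply: allp_sub sY => x []].
    case: st1 b1 e1 b3 b4 => M1 E1 t1 wk1 /= b1 e1 b3 b4.
    rewrite /tick /= e1 in b1.
    have [st2 [c2 [w2 [d1 d2 d3 d4]]]] := IHk M1 X1 _ _ s1 b1.
    exists st2, c2, (cost e * size X + (size X + (w1 + (size X1 + w2)))); split=> //.
      by rewrite d3 b3 /tick /= !size_map; lia.
    apply: reach_trans (reach_widen _ _ gY) _ => //; first lia.
    rewrite -{1}eS -{1}[size Y](size_map (fun y => Proc (l + size p) y.2)).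
    apply: (reachS (c1 := at_pc M (l + (size p).+1) Y)).
    * by rewrite /= all_map; apply/allP=> x _ /=; lia.
    * rewrite /at_pc (@stepE1 _ _ _ Y _ (fun y => Proc (if y.2 re == 0 then hi else (l + size p).+1) y.2)).
        congr (Some (Config _ _)); move: hall; rewrite -fY addnS.
        elim: (Y) sY => //= y s0 ih0 [[_ _ e0] hs'] /andP[/negbTE e2 /(ih0 hs') ->].
        by rewrite e0 e2.
      by move=> x b; rewrite /exec /= j0.
    rewrite -addnS.
    apply: reach_trans (reach_widen _ _ b4) _; [by lia|by lia|].
    rewrite -{1}[size X1](size_map (fun y => Proc (l + (size p).+1 + size q) y.2)).
    apply: (reachS (c1 := at_pc M1 l X1)); last by rewrite -addn1.
    * by rewrite /= all_map; apply/allP=> x _ /=; lia.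
    * rewrite /at_pc (@stepE1 _ _ _ X1 _ (fun y => Proc (if y.2 1 == 0 then l else (l + (size p).+1 + size q).+1) y.2)).
        congr (Some (Config _ _)); apply: eq_map_allp s1 => x [_ e0 _].
        by rewrite e0.
      by move=> x b; rewrite /exec /= j1.
Qed.

End Correctness.

(** * Word sizes *)

Section Degrees.
Variables (P : program) (coins : nat -> nat -> bool) (b lim : nat).
Hypothesis b_gt1 : 1 < b.
Hypothesis lim_lt : lim < b.

(* Constants up to [lim] have degree 1. Register [r] always holds a value below [b ^ nth 0 d r], and memory cells hold
   values below [b ^ dM]. *)
Definition okd (d : seq nat) (dM : nat) (i : instr) : bool :=
  let D r := nth 0 d r in
  match i with
  | Const r k => [|| k == 0, trunc_log 2 k < D r | (k <= lim) && (0 < D r)]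
  | Add r s t => maxn (D s) (D t) < D r
  | Defs.Sub r s t => D s <= D r
  | Mul r s t => D s + D t <= D r
  | Div r s t => D s <= D r
  | Read r s => dM <= D r
  | Write r s => D s <= dM
  | Coin r => 0 < D r
  | Jz _ _ | Fork _ | Halt => true
  end.

Definition typed d dM (c : config) :=
  (forall a, memory c a < b ^ dM) /\
  allp (fun q => forall r, regs q r < b ^ nth 0 d r) (procs c).

Lemma typed_weaken d dM d' dM' c : dM <= dM' -> (forall r, nth 0 d r <= nth 0 d' r) ->
  typed d dM c -> typed d' dM' c.
Proof.
move=> hM hd [h1 h2]; split=> [a|]; first by apply: leq_trans (h1 a) _; rewrite leq_exp2l.
by apply: allp_sub h2 => q h r; apply: leq_trans (h r) _; rewrite leq_exp2l.
Qed.

Lemma exec_typed d dM M q co : (forall a, M a < b ^ dM) -> (forall r, regs q r < b ^ nth 0 d r) ->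
  okd d dM (nth Halt P (pc q)) ->
  allp (fun q => forall r, regs q r < b ^ nth 0 d r) (exec P M co q).1 /\
  (forall av, (exec P M co q).2 = Some av -> av.2 < b ^ dM).
Proof.
move=> hM hq; rewrite /exec.
have hup r v : v < b ^ nth 0 d r -> forall r', update (regs q) r v r' < b ^ nth 0 d r'.
  by move=> hv r'; rewrite /update; case: eqP => [->|].
have hle v r r' : v <= regs q r -> nth 0 d r <= nth 0 d r' -> v < b ^ nth 0 d r'.
  by move=> hv hd; apply: leq_ltn_trans hv _; apply: leq_trans (hq r) _; rewrite leq_exp2l.
case: (nth Halt P (pc q)) => [r k|r s t|r s t|r s t|r s t|r s|r s|r l|l|r|] //= h; split=> //; try by split=> // r'.
- split=> //; apply: hup; case/or3P: h => [/eqP->|h|/andP[h hd]]; first by rewrite expn_gt0 ltnW.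
    apply: leq_trans (trunc_log_ltn k (isT : 1 < 2)) _.
    by apply: leq_trans (_ : 2 ^ nth 0 d r <= _); rewrite ?leq_pexp2l // leq_exp2r // (leq_ltn_trans _ h).
  by apply: leq_ltn_trans h _; apply: leq_trans lim_lt _; rewrite -{1}(expn1 b) leq_exp2l.
- split=> //; apply: hup; apply: leq_trans (_ : b ^ (maxn (nth 0 d s) (nth 0 d t)).+1 <= _); last by rewrite leq_exp2l.
  have h1 := hle _ s (maxn 0 0) (leqnn _); have := hq s; have := hq t.
  have e1 : b ^ nth 0 d s <= b ^ maxn (nth 0 d s) (nth 0 d t) by rewrite leq_exp2l // leq_maxl.
  have e2 : b ^ nth 0 d t <= b ^ maxn (nth 0 d s) (nth 0 d t) by rewrite leq_exp2l // leq_maxr.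
  rewrite expnS => x y.
  have : 2 * b ^ maxn (nth 0 d s) (nth 0 d t) <= b * b ^ maxn (nth 0 d s) (nth 0 d t) by rewrite leq_mul2r b_gt1 orbT.
  lia.
- by split=> //; apply: hup; apply: hle h; rewrite leq_subr.
- split=> //; apply: hup; apply: leq_trans (_ : b ^ (nth 0 d s + nth 0 d t) <= _); last by rewrite leq_exp2l.
  rewrite expnD; apply: leq_ltn_trans (_ : regs q s * b ^ nth 0 d t < _); first by rewrite leq_mul2l ltnW ?orbT.
  by rewrite ltn_mul2r hq expn_gt0 (ltnW b_gt1).
- by split=> //; apply: hup; apply: hle h; rewrite leq_div.
- by split=> //; apply: hup; apply: leq_trans (hM _) _; rewrite leq_exp2l.
- by move=> av [<-] /=; apply: leq_trans (hq s) _; rewrite leq_exp2l.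
- by split=> //; apply: hup; apply: leq_ltn_trans (leq_b1 _) _; rewrite -{1}(expn0 b) ltn_exp2l.
Qed.

Lemma step_typed d dM c c1 co : typed d dM c -> all (fun q => okd d dM (nth Halt P (pc q))) (procs c) ->
  step P co c = Some c1 -> typed d dM c1.
Proof.
case: c => M qs [/= hM hqs] hok; rewrite /step /=; case: ifP => // _ [<-]; split=> /=.
  move=> a; elim: qs (mkseq _ _) hqs hok => [|q qs ih] [|x xs] //= [hq hqs] /andP[h1 h2].
  have [_ hw] := exec_typed x hM hq h1.
  by case: (exec P M x q).2 hw => [av|] /= hw; last exact: ih; rewrite /update; case: eqP => [_|_]; [exact: hw|exact: ih].
elim: qs (mkseq _ _) hqs hok => [|q qs ih] [|x xs] //= [hq hqs] /andP[h1 h2].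
by apply/allp_cat; split; [exact: (exec_typed x hM hq h1).1|exact: ih].
Qed.

(** Turns an abstract execution into the ingredients of [within_budget]: the run itself, the sum of
    active processors, and a degree bound for every configuration on the way. *)
Lemma reach_run lo hi c0 t c t' c' w d dM : reach P coins lo hi t c t' c' w ->
  run P coins c0 t = Some c -> typed d dM c -> (forall i, lo <= i < hi -> okd d dM (nth Halt P i)) ->
  [/\ t <= t', run P coins c0 t' = Some c', \sum_(t <= i < t') active P coins c0 i = w &
      forall i ci, t <= i <= t' -> run P coins c0 i = Some ci -> typed d dM ci].
Proof.
move=> h hr hty hok; elim: h hr hty => {t c t' c' w} [t c|t c c1 t' c' w hp hs _ ih] hr hty.
  split=> //; first by rewrite big_geq.
  by move=> i ci hi0; have -> : i = t by [lia]; rewrite hr => -[<-].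
have hr1 : run P coins c0 t.+1 = Some c1 by rewrite /= hr.
have hty1 : typed d dM c1.
  by apply: step_typed hty _ hs; apply: sub_all hp => q; apply: hok.
have [h1 h2 h3 h4] := ih hr1 hty1; split=> //; first lia.
  by rewrite big_ltn // h3 /active hr.
move=> i ci /andP[hi1 hi2]; case: (ltngtP t i) hi1 => // [hlt|<-] _; first by apply: h4; rewrite hlt.
by rewrite hr => -[<-].
Qed.

End Degrees.

(** The degree that the operands force on the target of an instruction. A constant is judged by its
    binary logarithm, which is sound because the base is at least 2. *)
Definition target_degree (d : seq nat) (dM : nat) (i : instr) : option (nat * nat) :=
  let D r := nth 0 d r in
  match i with
  | Const r k => Some (r, if k == 0 then 0 else (trunc_log 2 k).+1)
  | Add r s t => Some (r, (maxn (D s) (D t)).+1)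
  | Defs.Sub r s t => Some (r, D s)
  | Mul r s t => Some (r, D s + D t)
  | Div r s t => Some (r, D s)
  | Read r s => Some (r, dM)
  | Coin r => Some (r, 1)
  | _ => None
  end.

(** One pass of an iteration towards a fixed point. Convergence is not proved; the result is checked
    afterwards with [okd]. *)
Fixpoint infer (d : seq nat) (dM : nat) (p : seq instr) : seq nat :=
  if p is i :: p' then
    infer (if target_degree d dM i is Some (r, k) then set_nth 0 d r (maxn (nth 0 d r) k) else d) dM p'
  else d.

Fixpoint leqs (d d' : seq nat) : bool :=
  match d, d' with
  | [::], _ => true
  | x :: d, [::] => (x == 0) && leqs d [::]
  | x :: d, y :: d' => (x <= y) && leqs d d'
  end.

Lemma leqsP d d' : leqs d d' -> forall r, nth 0 d r <= nth 0 d' r.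
Proof.
elim: d d' => [|x d ih] d' /=; first by move=> _ r; rewrite nth_nil.
case: d' => [|y d'] /andP[hx h] [|r] //=; first by rewrite (eqP hx).
  by have := ih _ h r; rewrite nth_nil.
exact: ih.
Qed.

(** * Complete programs *)

(** Register 0 receives 3m + n^2 + 2, the number of cells of input and output together; registers 2
    and 3 are the variables for n and m. *)
Definition prelude : seq instr :=
  [:: Read 2 1; Const 42 1; Read 3 42; Const 43 3; Mul 44 3 43; Mul 45 2 2; Add 46 44 45;
      Const 47 2; Add 0 46 47].

Definition code1 (s1 : stmt) := cs s1 9 48.
Definition code2 (s1 s2 : stmt) := cs s2 (9 + size (code1 s1).1) (code1 s1).2.
Definition compile (s1 s2 : stmt) : program :=
  prelude ++ (code1 s1).1 ++ (code2 s1 s2).1 ++ [:: Halt].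

(** Two stages are used because [BIG] is computed from a weight read from memory, so its degree
    exceeds that of the memory, while the main program stores numbers up to [BIG]: a single memory
    degree would be inconsistent. Memory has degree 2 in the first statement and a larger degree
    [dM] in the second. *)
Definition degrees1 s1 := iter 3 (fun d => infer d 2 (prelude ++ (code1 s1).1)) [::].
Definition degrees2 s1 s2 dM := iter 3 (fun d => infer d dM (code2 s1 s2).1) (degrees1 s1).

Definition well_sized s1 s2 dM K :=
  let d1 := degrees1 s1 in let d2 := degrees2 s1 s2 dM in
  [&& wfs s1, wfs s2, all (okd 0 d1 2) (prelude ++ (code1 s1).1), 2 <= dM, leqs d1 d2,
      all (okd 0 d2 dM) (code2 s1 s2).1, all (leq^~ K) d1, all (leq^~ K) d2 & dM <= K].

(* A program that depends on a parameter is checked with the constant 61 in its place. *)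
Definition subst_const (kap : nat) (i : instr) : instr :=
  if i is Const r k then Const r (if k == 61 then kap else k) else i.

Lemma subst_const61 i : subst_const 61 i = i.
Proof. by case: i => //= r k; case: eqP => [->|]. Qed.

Lemma okd_weak kap d dM i : okd 0 d dM i -> okd kap d dM i.
Proof. by case: i => //= r k; case: (k =P 0) => //= hk; case: (_ < _) => //=; rewrite leqn0 (negbTE (introN eqP hk)). Qed.

Lemma okd_subst kap d dM i : okd 0 d dM i -> okd kap d dM (subst_const kap i).
Proof.
have h0 r k : [|| k == 0, trunc_log 2 k < nth 0 d r | (k <= 0) && (0 < nth 0 d r)] -> (k == 0) || (trunc_log 2 k < nth 0 d r).
  by rewrite leqn0; case: eqP => //= _; rewrite orbF.
case: i => //= r k; case: (k =P 61) => [-> /h0 h|_ /h0]; last by rewrite orbA => ->.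
by rewrite leqnn (leq_ltn_trans (leq0n _) h) !orbT.
Qed.

Definition mem0 (inp : seq nat) (k a : nat) : nat := if k == raw then nth 0 inp a else 0.

Lemma conc_mem0 OFF inp : size inp <= OFF -> conc OFF (mem0 inp) = nth 0 inp.
Proof.
move=> h; apply: funext => a; rewrite /conc /mem0 eqxx.
case: (ltnP a OFF) => ha; first reflexivity.
have -> : ((a - OFF) %% 64 == 64) = false.
  by apply/negP => /eqP e; have := ltn_pmod (a - OFF) (isT : 0 < 64); rewrite e.
by rewrite nth_default //; apply: leq_trans h ha.
Qed.

Lemma prelude_sim M n m : M 0 = n -> M 1 = m ->
  sim (3 * m + n * n + 2) [:: n; m] (foldl (upd1 M) (fun=> 0) prelude).
Proof.
move=> <- <-; split; [by rewrite /= /update /= mulnC | by [] |].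
case=> [|[|r]] hr; [by []|by []|].
rewrite /= /update /= nth_nil !eqSS.
by do ! (case: eqP => [?|_]; first lia).
Qed.

(** The final [Halt] costs one more step of every remaining processor, hence the strict inequality
    on the time and the summand [size (env st)]. *)
Lemma halt_budget P coins c0 OFF st l c T W B : rep OFF l st c -> nth Halt P l = Halt ->
  run P coins c0 (tm st) = Some c -> \sum_(0 <= i < tm st) active P coins c0 i = wk st ->
  (forall t ct, t <= tm st -> run P coins c0 t = Some ct -> words_below B ct) ->
  tm st < T -> wk st + size (env st) <= W ->
  within_budget P coins c0 T W B /\
  exists2 c', run P coins c0 T = Some c' & memory c' = conc OFF (smem st).
Proof.
case=> X [ec2 eE _] hH A3 hsum hw qT qW.
have S3 : step P (coins (tm st)) c = Some (Config (memory c) [::]).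
  rewrite ec2 /at_pc (@stepE0 P _ (coins (tm st)) _ X _ (fun _ => [::])) //=.
    by congr (Some (Config _ _)); elim: (X).
  by move=> x bb; rewrite /exec /= hH.
have A4 : run P coins c0 (tm st).+1 = Some (Config (memory c) [::]) by rewrite /= A3.
have A5 j : run P coins c0 ((tm st).+1 + j) = Some (Config (memory c) [::]).
  elim: j => [|j ih]; first by rewrite addn0.
  by rewrite addnS -[LHS]/(obind (step P (coins ((tm st).+1 + j))) (run P coins c0 ((tm st).+1 + j))) ih.
have sz : size (procs c) = size (env st) by rewrite ec2 eE /at_pc /= !size_map.
split; last first.
  exists (Config (memory c) [::]); first by rewrite -(A5 (T - (tm st).+1)); congr run; lia.
  by rewrite ec2.
split.
- exists (Config (memory c) [::]) => //; rewrite -(A5 (T - (tm st).+1)); congr run; lia.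
- rewrite -(big_mkord xpredT (active P coins c0)).
  rewrite (big_cat_nat (n := (tm st).+1)) //= big_nat_recr //= hsum.
  rewrite [X in _ + X]big_nat_cond big1 ?addn0.
    by rewrite /active A3 sz.
  by move=> i /andP[/andP[hi1 hi2] _]; rewrite /active -(subnKC hi1) A5.
- move=> t ct ht hct; case: (leqP t (tm st)) => ht2; first exact: hw hct.
  move: hct; rewrite -(subnKC ht2) A5 => -[<-].
  have [u1 u2] := hw _ _ (leqnn _) A3.
  by split=> // i q r; case: i.
Qed.

Lemma size_input n (G : wdigraph n) (es : seq ('I_n * 'I_n)) : size (input G es) = 3 * size es + 2.
Proof. by rewrite /input /=; elim: es => //= e s ih; lia. Qed.

Section RunProgram.
Variables (n : nat) (G : wdigraph n) (es : seq ('I_n * 'I_n)) (coins : nat -> nat -> bool).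
Variables (s1 s2 s2' : stmt) (dM K kap r : nat).
Hypothesis hes : lists_edges G es.
Hypothesis hws : well_sized s1 s2' dM K.
Hypothesis hwf : wfs s2.
Hypothesis hsub : (code2 s1 s2).1 = map (subst_const kap) (code2 s1 s2').1.
Hypothesis hkap : kap < 2 ^ r.
Let P := compile s1 s2.
Let m := size es.
Let OFF := 3 * m + n * n + 2.
Let b := n + max_weight G + 2.

Lemma m_le : m <= n * n.
Proof.
rewrite /m (perm_size hes) -cardE; apply: leq_trans (max_card _) _.
by rewrite card_prod card_ord.
Qed.

Lemma input_small a : nth 0 (input G es) a < b ^ 2.
Proof.
have h1 : 1 < b by rewrite /b; lia.
have hb : forall x, x < b -> x < b ^ 2 by move=> x hx; apply: leq_trans hx _; rewrite -{1}(expn1 b) leq_exp2l.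
have h0 : 0 < b ^ 2 by rewrite expn_gt0 (ltnW h1).
suff h : all (fun x => x < b ^ 2) (input G es).
  by case: (ltnP a (size (input G es))) => ha; [exact: (allP h _ (mem_nth 0 ha)) | rewrite nth_default].
rewrite /= hb ?/b //=; last by lia.
apply/andP; split.
  by have := m_le; rewrite -/m expnS expn1 /b; nia.
apply/allP=> x /flattenP[s /mapP[e he ->]].
have hE : e \in edges G by move: he; rewrite (perm_mem hes) mem_enum.
rewrite !inE => /or3P[]/eqP->; apply: hb; rewrite /b.
- by apply: ltn_addr; apply: ltn_addr; exact: ltn_ord.
- by apply: ltn_addr; apply: ltn_addr; exact: ltn_ord.
- have h : weight G e.1 e.2 <= max_weight G by rewrite /max_weight (bigD1 e) //= leq_maxl.
  by move: (weight _ _ _) h => y h; lia.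
Qed.

Lemma base_gt1 : 1 < b ^ r.+1.
Proof. by rewrite -(expn0 b) ltn_exp2l // /b addn2. Qed.

(** The base of the degrees is raised to the power [r.+1] so that the constant [kap] has degree
    1. *)
Lemma kap_lt : kap < b ^ r.+1.
Proof.
apply: leq_trans hkap _; apply: leq_trans (_ : b ^ r <= _); last by rewrite leq_exp2l // /b addn2.
by case: (r) => // k; rewrite leq_exp2r // /b addn2.
Qed.

Lemma typed_words D DM c : all (leq^~ K) D -> DM <= K -> typed (b ^ r.+1) D DM c ->
  words_below (word_bound G (r.+1 * K)) c.
Proof.
have h1 : 1 < b by rewrite /b addn2.
have hh x : x <= K -> (b ^ r.+1) ^ x <= b ^ (r.+1 * K) by rewrite -expnM leq_exp2l // leq_mul2l.
move=> hd hM [t1' t2']; split=> [a|i q z].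
  by apply: leq_trans (t1' a) _; rewrite /word_bound -/b hh.
elim: (procs c) i t2' => [|q0 qs ih] [|i] //= [h3 h4]; last exact: ih.
case=> <-; apply: leq_trans (h3 z) _; rewrite /word_bound -/b hh //.
by case: (ltnP z (size D)) => hr; [exact: (allP hd _ (mem_nth 0 hr)) | rewrite nth_default].
Qed.

(** The abstract execution starts with time and work 9, spent by the single initial processor on the
    nine instructions of the prelude. *)
Theorem program_correct (R : state -> Prop) T W :
  wp OFF coins s1 (wp OFF coins s2 (fun st =>
     [/\ tm st < T, wk st + size (env st) <= W & R st])) (St (mem0 (input G es)) [:: [:: n; m]] 9 9) ->
  within_budget P coins (initial G es) T W (word_bound G (r.+1 * K)) /\
  exists2 c, run P coins (initial G es) T = Some c &
    exists2 st, R st & memory c = conc OFF (smem st).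
Proof.
move: hws => /and5P[w1 _ ok1 hdM /and5P[le12 ok2 k1 k2 kM]] hwp.
have {}w2 := hwf; move: (degrees1 s1) (degrees2 s1 s2' dM) ok1 le12 ok2 k1 k2 => D1 D2 ok1 le12 ok2 k1 k2.
have h1 := base_gt1; have hk := kap_lt.
set c0 := initial G es.
have hP0 : code_at P 0 prelude.
  by move=> i hi; rewrite /P /compile nth_cat /= hi.
have hP1 : code_at P 9 (code1 s1).1.
  move=> i hi; rewrite /P /compile nth_cat ltnNge leq_addr /= (addKn 9) nth_cat hi //.
have hP2 : code_at P (9 + size (code1 s1).1) (code2 s1 s2).1.
  move=> i hi; rewrite /P /compile nth_cat -addnA ltnNge leq_addr /= (addKn 9) nth_cat ltnNge leq_addr /= addKn nth_cat hi //.
set l2 := 9 + size (code1 s1).1 in hP2 *.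
set l3 := l2 + size (code2 s1 s2).1.
have ndx x : nth Halt P x = nth Halt (prelude ++ (code1 s1).1) x \/ l2 <= x.
  case: (ltnP x l2) => h; [left|by right].
  by rewrite /P /compile catA nth_cat size_cat -/l2 h.
have R0 : reach P coins 0 9 0 c0 9 (Config (nth 0 (input G es))
   [seq Proc 9 (foldl (upd1 (nth 0 (input G es))) R prelude) | R <- [:: fun=> 0]]) 9.
  by apply: (@reach_sl P coins prelude 0 0 (nth 0 (input G es)) [:: fun=> 0]).
have T0 : typed (b ^ r.+1) D1 2 c0.
  split=> /= [a|]; last by split=> // z; rewrite expn_gt0 ltnW.
  by apply: leq_trans (input_small a) _; rewrite leq_exp2r // -{1}(expn1 b) leq_exp2l // /b addn2.
have ok1' i : 0 <= i < l2 -> okd kap D1 2 (nth Halt P i).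
  move=> hi; case: (ndx i) => [->|h]; last by move: hi; rewrite ltnNge h andbF.
  have := all_nthP Halt ok1 i; rewrite size_cat -/l2 => /(_ _)/okd_weak; apply; lia.
have [_ A1 B1 C1] := reach_run h1 hk (reach_widen (leqnn 0) (leq_addr _ _ : 9 <= l2) R0)
  (erefl : run P coins c0 0 = Some c0) T0 ok1'.
pose R1 := foldl (upd1 (nth 0 (input G es))) (fun=> 0) prelude.
pose ca := Config (nth 0 (input G es)) [:: Proc 9 R1].
have {}A1 : run P coins c0 9 = Some ca by exact: A1.
have eM : conc OFF (mem0 (input G es)) = nth 0 (input G es).
  by apply: conc_mem0; rewrite size_input /OFF -addnA leq_add2l leq_addl.
have rep1 : rep OFF 9 (St (mem0 (input G es)) [:: [:: n; m]] 9 9) ca.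
  exists [:: ([:: n; m], R1)]; split; [|reflexivity|split; last exact: I].
    by rewrite /at_pc [smem _]/= eM.
  exact: prelude_sim.
have [st1 [c1 [w' [q1 r1 k1' g1]]]] := cs_correct (isT : tmp0 <= 48) w1 hP1 rep1 hwp.
have {}hn2 : tmp0 <= (code1 s1).2 by apply: leq_trans (cs_mono s1 9 48).
rewrite -/(code1 s1) -/l2 /= in g1 r1.
have T1 : typed (b ^ r.+1) D1 2 ca by apply: (C1 9).
have [t9 A2 B2 C2] := reach_run h1 hk (reach_widen (leq0n 9) (leqnn l2) g1) A1 T1 ok1'.
have T2 : typed (b ^ r.+1) D1 2 c1 by apply: (C2 (tm st1)); rewrite ?t9 ?leqnn.
have [st2 [c2 [w'' [q2 r2 k2' g2]]]] := cs_correct hn2 w2 hP2 r1 q1.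
rewrite -/(code2 s1 s2) -/l3 in g2 r2.
have ok2' i : l2 <= i < l3 -> okd kap D2 dM (nth Halt P i).
  move=> /andP[hi1 hi2]; have hi3 : i - l2 < size (code2 s1 s2).1 by rewrite ltn_subLR.
  rewrite -(subnKC hi1) (hP2 _ hi3); move: (i - l2) hi3 => j; rewrite hsub size_map => hj.
  by rewrite (nth_map Halt _ _ hj); apply: okd_subst; apply: (all_nthP Halt ok2).
have T2' : typed (b ^ r.+1) D2 dM c1 by exact: (typed_weaken h1 hdM (leqsP le12) T2).
have [t2 A3 B3 C3] := reach_run h1 hk g2 A2 T2' ok2'.
have T3 : typed (b ^ r.+1) D2 dM c2 by apply: (C3 (tm st2)); rewrite ?t2 ?leqnn.
case: q2 => qT qW qR.
have hH : nth Halt P l3 = Halt.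
  by rewrite /P /compile !catA nth_cat !size_cat -addnA -/l2 -/l3 /= ltnn subnn.
have hsum : \sum_(0 <= i < tm st2) active P coins c0 i = wk st2.
  clear -k2' k1' B1 B2 B3 t9 t2; move: (active P coins c0) B1 B2 B3 => f B1 B2 B3.
  rewrite (big_cat_nat (n := tm st1)) // B3 (big_cat_nat (n := 9)) // B1 B2 k2' k1'.
  by [].
have hwords t ct : t <= tm st2 -> run P coins c0 t = Some ct -> words_below (word_bound G (r.+1 * K)) ct.
  clear -k1 k2 hdM kM C1 C2 C3; move=> ht hct.
  case: (leqP t 9) => h9; first by apply: typed_words k1 (leq_trans hdM kM) (C1 _ _ _ hct).
  case: (leqP t (tm st1)) => ht1.
    by apply: typed_words k1 (leq_trans hdM kM) (C2 _ _ _ hct); rewrite (ltnW h9).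
  by apply: typed_words k2 kM (C3 _ _ _ hct); rewrite (ltnW ht1).
have [X1 [c' X2 X3]] := halt_budget r2 hH A3 hsum hwords qT qW.
by split; [exact: X1 | exists c'; [exact: X2 | exists st2]].
Qed.

End RunProgram.

(** * Program construction *)

Declare Scope expr_scope.
Delimit Scope expr_scope with X.
Bind Scope expr_scope with expr.
Notation "a + b" := (EAdd a b) : expr_scope.
Notation "a - b" := (ESub a b) : expr_scope.
Notation "a * b" := (EMul a b) : expr_scope.
Notation "a / b" := (EDiv a b) : expr_scope.
Coercion ECst : nat >-> expr.
Notation V := EVar.
Notation "s ;; s'" := (Seq s s') (at level 60, right associativity).

(** The cap [b] is the minuend, so the inferred degree of the result is that of [b], whatever the
    degree of [a]. This form is what keeps degrees from growing around loops. *)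
Definition EMin (a b : expr) : expr := (b - (b - a))%X.
Definition EEq (a b : expr) : expr := (1 - ((a - b) + (b - a)))%X.
Definition EMod (a b : expr) : expr := (a - (a / b) * b)%X.

Definition For (i l : nat) (s : stmt) : stmt :=
  Asg i 0 ;; While (V l - V i) (s ;; Asg i (EMin (V i + 1) (V l))).

Definition assertion := (nat -> nat -> nat) -> seq (seq nat) -> nat -> Prop.

(** * Weakest preconditions with a bounded number of processors *)

Section Capped.
Variables (OFF : nat) (coins : nat -> nat -> bool) (cap : nat).

Fixpoint wpcw (F : assertion -> assertion) (e : expr) (Q : assertion) (k : nat) : assertion :=
  fun M E t =>
  if k is k'.+1 then
    all (fun v => eval OFF M v e != 0) E /\
    F (fun M1 E1 t1 => wpcw F e Q k' M1 E1 (t1 + 1)) M E (t + (cost e).+1)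
  else all (fun v => eval OFF M v e == 0) E /\ Q M E (t + (cost e).+1).

(* As [wp], but at most [cap] processors may be active at any time, and the work is
   not recorded: it is at most [cap] times the elapsed time. *)
Fixpoint wpc (s : stmt) (Q : assertion) (M : nat -> nat -> nat) (E : seq (seq nat)) (t : nat) : Prop :=
  match s with
  | Asg r e => Q M [seq set_nth 0 v r (eval OFF M v e) | v <- E] (t + (cost e).+1)
  | RdIn r e =>
      all (fun v => eval OFF M v e < OFF) E /\
      Q M [seq set_nth 0 v r (M raw (eval OFF M v e)) | v <- E] (t + (cost e).+1)
  | Wr k c a v =>
      uniq (unzip1 (writes OFF M E c a v)) /\
      Q (upds k (writes OFF M E c a v) M) E (t + wr_cost c (addr k a) v)
  | WrOut c a v =>
      [/\ uniq (unzip1 (writes OFF M E c a v)),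
          all (fun x => eval OFF M x a < OFF) E &
          Q (upds raw (writes OFF M E c a v) M) E (t + wr_cost c a v)]
  | Dup r =>
      2 * size E <= cap /\
      Q M (flatten [seq [:: set_nth 0 v r 0; set_nth 0 v r 1] | v <- E]) (t + 3)
  | Kill e => Q M [seq v <- E | eval OFF M v e != 0] (t + (cost e + 2))
  | Flip r =>
      Q M [seq set_nth 0 bv.2 r (nat_of_bool bv.1) | bv <- zip (mkseq (coins t) (size E)) E] (t + 1)
  | Seq a b => wpc a (wpc b Q) M E t
  | While e s => exists k, wpcw (wpc s) e Q k M E t
  end.

(** The crude product of processors and time suffices for stages whose number of processors is
    bounded in advance; stages with amortized work are chained with [wp] instead. *)
Lemma wpc_wp s (Q : assertion) M E t w : wpc s Q M E t -> size E <= cap ->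
  wp OFF coins s (fun st => [/\ Q (smem st) (env st) (tm st), t <= tm st, size (env st) <= cap &
     wk st <= w + cap * (tm st - t)]) (St M E t w).
Proof.
have bnd a b c : b <= cap -> a <= c -> a * b <= cap * c by move=> *; rewrite mulnC; apply: leq_mul.
elim: s Q M E t w => [r e|r e|k c a v|c a v|r|e|r|a iha b ihb|e s ih] Q M E t w /=.
- by move=> hQ hE; split; rewrite ?size_map ?leq_addr // leq_add2l addKn bnd.
- by move=> [h hQ] hE; split=> //; split; rewrite ?size_map ?leq_addr // leq_add2l addKn bnd.
- by move=> [h hQ] hE; split=> //; split; rewrite ?size_map ?leq_addr // leq_add2l addKn bnd.
- by move=> [h h' hQ] hE; split=> //; split; rewrite ?size_map ?leq_addr // leq_add2l addKn bnd.
- move=> [h hQ] hE; have e1 : size (flatten [seq [:: set_nth 0 v r 0; set_nth 0 v r 1] | v <- E]) = 2 * size E.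
    by elim: (E) => //= v s ->; lia.
  by split; rewrite ?e1 ?leq_addr // leq_add2l addKn; lia.
- move=> hQ hE; split; rewrite ?leq_addr // ?leq_add2l ?addKn ?bnd //.
  by rewrite size_filter; apply: leq_trans (count_size _ _) hE.
- move=> hQ hE; split; rewrite ?leq_addr // ?leq_add2l ?addKn ?muln1 //.
  by rewrite size_map size_zip size_mkseq minnn.
- move=> h hE; apply: wp_mono (iha _ _ _ _ w h hE) => -[M1 E1 t1 w1] /= [h1 l1 c1 k1].
  apply: wp_mono (ihb _ _ _ _ w1 h1 c1) => -[M2 E2 t2 w2] /= [h2 l2 c2 k2].
  by split=> //; [lia | nia].
- case=> k h hE; exists k; elim: k M E t w h hE => [|k ihk] M E t w /= [h1 h2] hE; split=> //.
    by rewrite /tick /=; split; rewrite ?leq_addr // leq_add2l addKn bnd.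
  apply: wp_mono (ih _ _ _ _ (w + (cost e).+1 * size E) h2 hE) => -[M1 E1 t1 w1] /= [h3 l3 c3 k3].
  rewrite /tick /=; apply: wpw_mono (ihk _ _ _ (w1 + 1 * size E1) h3 c3) => [R R' hR s'|-[M2 E2 t2 w2] /= [h4 l4 c4 k4]].
    exact: wp_mono.
  split=> //; first lia.
  have b1 := bnd (cost e).+1 (size E) (cost e).+1 hE (leqnn _).
  by nia.
Qed.

Lemma wpc_mono s (Q Q' : assertion) M E t :
  (forall M E t, Q M E t -> Q' M E t) -> wpc s Q M E t -> wpc s Q' M E t.
Proof.
elim: s Q Q' M E t => [r e|r e|k c a v|c a v|r|e|r|a iha b ihb|e s ih] Q Q' M E t h /=; try exact: h.
- by case=> ? /h.
- by case=> ? /h.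
- by case=> ? ? /h.
- by case=> ? /h.
- by apply: iha => *; apply: ihb h _.
- case=> k H; exists k; elim: k M E t H => [|k ihk] M E t /= [? H]; split=> //; first exact: h.
  by apply: ih H => *; apply: ihk.
Qed.

Lemma evalMin M v a b : eval OFF M v (EMin a b) = minn (eval OFF M v a) (eval OFF M v b).
Proof. by rewrite /=; lia. Qed.

Lemma evalMod M v a b : eval OFF M v (EMod a b) = eval OFF M v a %% eval OFF M v b.
Proof. by rewrite /= {1}(divn_eq (eval OFF M v a) (eval OFF M v b)) addKn. Qed.

(** A round pays 2 for the test and 6 for the increment together with the jump back; the last test
    costs 2 more. *)
Lemma wpc_for (I : nat -> assertion) k i l s (Q : assertion) M E t :
  I 0 M [seq set_nth 0 v i 0 | v <- E] (t + 2) ->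
  (forall j M E t, j <= k -> I j M E t -> all (fun v => (nth 0 v i == j) && (nth 0 v l == k)) E) ->
  (forall j M E t, j < k -> I j M E t ->
     wpc s (fun M' E' t' => all (fun v => (nth 0 v i == j) && (nth 0 v l == k)) E' /\
       I j.+1 M' [seq set_nth 0 v i j.+1 | v <- E'] (t' + 6)) M E (t + 2)) ->
  (forall M E t, I k M E t -> Q M E (t + 2)) ->
  wpc (For i l s) Q M E t.
Proof.
move=> h0 hall hs hQ.
rewrite -[wpc _ _ _ _ _]/(exists d, wpcw (wpc (s ;; Asg i (EMin (V i + 1) (V l)))) (V l - V i)%X Q d M
  [seq set_nth 0 v i 0 | v <- E] (t + 2)).
move: [seq set_nth 0 v i 0 | v <- E] (t + 2) h0 => {}E {}t h0.
exists k; have : forall d j M E t, d + j = k -> I j M E t ->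
  wpcw (wpc (s ;; Asg i (EMin (V i + 1) (V l)))) (V l - V i)%X Q d M E t; last first.
  by move/(_ k 0 M E t); rewrite addn0; apply.
clear h0 M E t; elim=> [|d ih] j M E t hd hI.
  have hj : j = k by []. 
  subst j; have ha := hall _ _ _ _ (leqnn _) hI.
  split; last exact: hQ.
  by apply: sub_all ha => v /andP[/eqP e1 /eqP e2]; rewrite /= e1 e2 subnn.
have hjk : j < k by lia.
have ha := hall _ _ _ _ (ltnW hjk) hI.
split; first by apply: sub_all ha => v /andP[/eqP e1 /eqP e2]; rewrite /= e1 e2; lia.
apply: wpc_mono (hs _ _ _ _ hjk hI) => M1 E1 t1 [ha1 hI1] /=.
have -> : [seq set_nth 0 v i (nth 0 v l - (nth 0 v l - (nth 0 v i + 1))) | v <- E1] = [seq set_nth 0 v i j.+1 | v <- E1].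
  by apply/eq_in_map => v /(allP ha1)/andP[/eqP-> /eqP->]; congr set_nth; lia.
rewrite -addnA; apply: (ih j.+1) => //; lia.
Qed.

Lemma wpc_while (I : nat -> assertion) k e s (Q : assertion) M E t :
  I 0 M E t ->
  (forall j M E t, j < k -> I j M E t -> all (fun v => eval OFF M v e != 0) E /\
     wpc s (fun M' E' t' => I j.+1 M' E' (t' + 1)) M E (t + (cost e).+1)) ->
  (forall M E t, I k M E t -> all (fun v => eval OFF M v e == 0) E /\ Q M E (t + (cost e).+1)) ->
  wpc (While e s) Q M E t.
Proof.
move=> h0 hs hQ; exists k; have : forall d j M E t, d + j = k -> I j M E t -> wpcw (wpc s) e Q d M E t; last first.
  by move/(_ k 0 M E t); rewrite addn0; apply.
clear h0 M E t; elim=> [|d ih] j M E t hd hI /=; first by rewrite -hd in hQ; exact: hQ.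
have [|h1 h2] := hs j M E t _ hI; first by lia.
split=> //; apply: wpc_mono h2 => M1 E1 t1 h; apply: ih h; lia.
Qed.

Lemma wpc_asg1 v r e (Q : assertion) M t :
  Q M [:: set_nth 0 v r (eval OFF M v e)] (t + (cost e).+1) -> wpc (Asg r e) Q M [:: v] t.
Proof. by []. Qed.

Lemma wpc_seq a b Q M E t : wpc a (wpc b Q) M E t -> wpc (a ;; b) Q M E t.
Proof. by []. Qed.

Lemma wpc_asg (T : Type) (I : seq T) (f : T -> seq nat) r e (Q : assertion) M t :
  Q M [seq set_nth 0 (f x) r (eval OFF M (f x) e) | x <- I] (t + (cost e).+1) ->
  wpc (Asg r e) Q M (map f I) t.
Proof. by rewrite /= -map_comp. Qed.

Lemma wpc_asg_in (T : eqType) (I : seq T) (f g : T -> seq nat) r e (Q : assertion) M t :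
  (forall x, x \in I -> set_nth 0 (f x) r (eval OFF M (f x) e) = g x) ->
  Q M [seq g x | x <- I] (t + (cost e).+1) -> wpc (Asg r e) Q M (map f I) t.
Proof. by move=> h hQ; apply: wpc_asg; rewrite (eq_in_map _ g I).1. Qed.

Lemma wpc_rdin (T : eqType) (I : seq T) (f : T -> seq nat) r e (Q : assertion) M t :
  (forall x, x \in I -> eval OFF M (f x) e < OFF) ->
  Q M [seq set_nth 0 (f x) r (M raw (eval OFF M (f x) e)) | x <- I] (t + (cost e).+1) ->
  wpc (RdIn r e) Q M (map f I) t.
Proof. by move=> h; rewrite /= -map_comp; split=> //; rewrite all_map; apply/allP=> x /h. Qed.

Lemma wpc_kill (T : Type) (I : seq T) (f : T -> seq nat) e (Q : assertion) M t :
  Q M [seq f x | x <- I & eval OFF M (f x) e != 0] (t + (cost e + 2)) ->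
  wpc (Kill e) Q M (map f I) t.
Proof. by rewrite /= filter_map. Qed.

End Capped.

Lemma upds_notin k ws M k' a : (k' == k) && (a \in unzip1 ws) = false -> upds k ws M k' a = M k' a.
Proof.
elim: ws => //= av ws ih; rewrite inE => h; rewrite /upd.
move: h ih; case: (k' =P k) => [->|_] /= => [|_ ->] //.
by case: eqP => //= _ h ->.
Qed.

Lemma upds_in k ws M a v : uniq (unzip1 ws) -> (a, v) \in ws -> upds k ws M k a = v.
Proof.
elim: ws => //= av ws ih /andP[hn hu]; rewrite inE /upd eqxx /= => /orP[/eqP <-|h]; first by rewrite eqxx.
case: eqP => [e|_]; last exact: ih.
by case/negP: hn; rewrite -e; apply/mapP; exists (a, v).
Qed.

(** * Simultaneous writes by a family of processors *)

Section Families.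
Variables (T : eqType) (I : seq T) (c : T -> bool) (ad va : T -> nat) (k : nat) (M : nat -> nat -> nat).

Definition wfam := upds k [seq (ad x, va x) | x <- I & c x] M.

Definition inj_fam := forall x y, x \in I -> y \in I -> c x -> c y -> ad x = ad y -> x = y.

Lemma wfam_uniq : uniq I -> inj_fam -> uniq (unzip1 [seq (ad x, va x) | x <- I & c x]).
Proof.
move=> hu hi; rewrite /unzip1 -map_comp map_inj_in_uniq ?filter_uniq // => x y.
by rewrite !mem_filter => /andP[cx ix] /andP[cy iy]; apply: hi.
Qed.

Lemma wfam_in x : uniq I -> inj_fam -> x \in I -> c x -> wfam k (ad x) = va x.
Proof.
move=> hu hi hx hc; apply: upds_in; first exact: wfam_uniq.
by apply: map_f; rewrite mem_filter hc.
Qed.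

Lemma wfam_out k' a : (k' = k -> forall x, x \in I -> c x -> ad x <> a) -> wfam k' a = M k' a.
Proof.
move=> h; apply: upds_notin; apply/negbTE/negP => /andP[/eqP ek].
case/mapP=> -[a' v'] /mapP[x]; rewrite mem_filter => /andP[cx ix] [-> _] /= e.
exact: (h ek x ix cx).
Qed.

Lemma wfam_other k' : k' <> k -> wfam k' = M k'.
Proof. by move=> h; apply: funext => a; apply: wfam_out. Qed.

End Families.

Lemma wfam_id (I : seq nat) (c : nat -> bool) va k M p : uniq I ->
  wfam I c id va k M k p = if (p \in I) && c p then va p else M k p.
Proof.
move=> hu; case: ifP => [/andP[hp hc]|h]; first by apply: (@wfam_in _ I c id va k M p).
by apply: wfam_out => _ x hx hc e; rewrite -e hx hc in h.
Qed.

Lemma writes_map OFF (T : Type) M (f : T -> seq nat) (I : seq T) c a v :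
  writes OFF M (map f I) c a v =
  [seq (eval OFF M (f x) a, eval OFF M (f x) v) | x <- I & eval OFF M (f x) c != 0].
Proof. by rewrite /writes filter_map -map_comp. Qed.

Lemma wpc_wr OFF coins cap (T : eqType) (I : seq T) (f : T -> seq nat) (c : T -> bool) (ad va : T -> nat)
    k ce ae ve (Q : assertion) M t :
  uniq I -> inj_fam I c ad ->
  (forall x, x \in I -> (eval OFF M (f x) ce != 0) = c x) ->
  (forall x, x \in I -> c x -> eval OFF M (f x) ae = ad x) ->
  (forall x, x \in I -> c x -> eval OFF M (f x) ve = va x) ->
  Q (wfam I c ad va k M) (map f I) (t + wr_cost ce (addr k ae) ve) ->
  wpc OFF coins cap (Wr k ce ae ve) Q M (map f I) t.
Proof.
move=> hu hi hc ha hv hQ /=.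
have -> : writes OFF M (map f I) ce ae ve = [seq (ad x, va x) | x <- I & c x].
  rewrite writes_map (eq_in_filter hc); apply/eq_in_map => x; rewrite mem_filter => /andP[cx ix].
  by rewrite ha ?hv.
by split; first exact: wfam_uniq.
Qed.

Lemma wpc_wrout OFF coins cap (T : eqType) (I : seq T) (f : T -> seq nat) (c : T -> bool) (ad va : T -> nat)
    ce ae ve (Q : assertion) M t :
  uniq I -> inj_fam I c ad ->
  (forall x, x \in I -> (eval OFF M (f x) ce != 0) = c x) ->
  (forall x, x \in I -> eval OFF M (f x) ae < OFF) ->
  (forall x, x \in I -> c x -> eval OFF M (f x) ae = ad x) ->
  (forall x, x \in I -> c x -> eval OFF M (f x) ve = va x) ->
  Q (wfam I c ad va raw M) (map f I) (t + wr_cost ce ae ve) ->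
  wpc OFF coins cap (WrOut ce ae ve) Q M (map f I) t.
Proof.
move=> hu hi hc hb ha hv hQ /=.
have -> : writes OFF M (map f I) ce ae ve = [seq (ad x, va x) | x <- I & c x].
  rewrite writes_map (eq_in_filter hc); apply/eq_in_map => x; rewrite mem_filter => /andP[cx ix].
  by rewrite ha ?hv.
by split; [exact: wfam_uniq|rewrite all_map; apply/allP=> x hx /=; exact: hb|].
Qed.

Arguments wpc : simpl never.

Lemma flatten_iota (T : Type) (f : nat -> T) s :
  flatten [seq [:: f (2 * p); f (2 * p + 1)] | p <- iota 0 s] = map f (iota 0 (2 * s)).
Proof.
elim: s => [|s ih] //; rewrite -[s.+1]addn1 iotaD map_cat flatten_cat ih mulnDr iotaD map_cat /=.
by rewrite !add0n addn1.
Qed.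

(** * Processor numbers *)

(* Variables: 0 = n, 1 = m, 2 = N, 3 = L, 4 = log2 of the number of edge processors, 5 = bound on
   processor numbers, 6 = BIG, 7 = bound on keys, 8 = level, 9 = 2 ^ level; the others are scratch,
   and 13 is the processor number. *)
Notation vn := (V 0). Notation vm := (V 1). Notation vN := (V 2). Notation vL := (V 3).
Notation vLM := (V 4). Notation vCP := (V 5). Notation vBIG := (V 6). Notation vKB := (V 7).
Notation vlev := (V 8). Notation vrep := (V 9). Notation vpid := (V 13).

(** Processor numbers gain one bit per doubling, and the processors end up listed in increasing
    order of their numbers. *)
Definition FORK (q : expr) : stmt :=
  Asg 10 q ;; Asg 13 0 ;;
  For 11 10 (Dup 12 ;; Asg 13 (EMin (2 * vpid + V 12) vCP)) ;;
  Asg 10 0 ;; Asg 11 0 ;; Asg 12 0.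

(** Clearing the scratch variables restores the environment [en0], so that stages compose without
    knowledge of each other's leftovers. *)
Definition RESET : stmt :=
  Asg 10 0 ;; Asg 11 0 ;; Asg 12 0 ;; Asg 13 0 ;; Asg 14 0 ;; Asg 15 0 ;; Asg 16 0 ;; Asg 17 0 ;; Asg 18 0 ;;
  Asg 19 0 ;; Asg 20 0 ;; Asg 21 0 ;; Asg 22 0 ;; Asg 23 0 ;; Asg 24 0 ;; Asg 25 0.

Definition JOIN : stmt := Kill (1 - vpid) ;; RESET.

(* Window maxima: after [r] rounds cell [p] holds the maximum of cells [p], ..., [p + 2 ^ r - 1]. *)
Definition WINMAX (k : nat) (q r : expr) : stmt :=
  FORK q ;; Asg 14 1 ;; Asg 10 r ;;
  For 11 10 (Asg 15 (ERd k (vpid + V 14)) ;; Wr k (V 15 - ERd k vpid) vpid (V 15) ;;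
             Asg 14 (EMin (V 14 + V 14) vCP)) ;; JOIN.

Record ctl := Ctl { cn : nat; cm : nat; cN : nat; cL : nat; cLM : nat; cCP : nat; cBIG : nat; cKB : nat;
  clev : nat; crep : nat }.

Definition en (c : ctl) (a10 a11 a12 a13 a14 a15 a16 a17 a18 a19 a20 a21 a22 a23 a24 a25 : nat) : seq nat :=
  [:: cn c; cm c; cN c; cL c; cLM c; cCP c; cBIG c; cKB c; clev c; crep c;
      a10; a11; a12; a13; a14; a15; a16; a17; a18; a19; a20; a21; a22; a23; a24; a25].

Definition en0 c := en c 0 0 0 0 0 0 0 0 0 0 0 0 0 0 0 0.
Definition enp c p := en c 0 0 0 p 0 0 0 0 0 0 0 0 0 0 0 0.

(** * Correctness of forking, joining and window maxima *)

Section Kernels.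
Variables (OFF : nat) (coins : nat -> nat -> bool) (cap : nat).
Notation wpk := (wpc OFF coins cap).

Definition tfork q k := (cost q).+1 + 2 + 4 + 6 + k * 17.

Lemma wpc_fork c qe q (Q : assertion) M t :
  eval OFF M (en0 c) qe = q -> 2 ^ q <= cap -> 2 ^ q <= cCP c ->
  Q M (map (enp c) (iota 0 (2 ^ q))) (t + tfork qe q) ->
  wpk (FORK qe) Q M [:: en0 c] t.
Proof.
move=> hq hcap hcp hQ; rewrite /FORK -[[:: en0 c]]/(map (fun _ => en0 c) [:: tt]).
apply: wpc_seq; apply: wpc_asg; rewrite hq.
apply: wpc_seq; apply: wpc_asg.
apply: wpc_seq; apply: (wpc_for (I := fun j M' E t' => [/\ M' = M, t' = t + (cost qe).+1 + 2 + 2 + j * 17 &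
   E = [seq en c q j (odd p) p 0 0 0 0 0 0 0 0 0 0 0 0 | p <- iota 0 (2 ^ j)]]) (k := q)).
- by split=> //; rewrite addn0.
- by move=> j M' E t' _ [_ _ ->]; rewrite all_map; apply/allP=> p _ /=; rewrite !eqxx.
- move=> j M' E t' hj [-> -> ->]; split.
    by rewrite size_map size_iota -expnS; apply: leq_trans hcap; rewrite leq_exp2l.
  rewrite /wpc -/wpc.
  have -> : [seq set_nth 0 v 13 (eval OFF M v (EMin (2 * vpid + V 12) vCP))
     | v <- flatten [seq [:: set_nth 0 v 12 0; set_nth 0 v 12 1]
        | v <- [seq en c q j (odd p) p 0 0 0 0 0 0 0 0 0 0 0 0 | p <- iota 0 (2 ^ j)]]] =
     [seq en c q j (odd p) p 0 0 0 0 0 0 0 0 0 0 0 0 | p <- iota 0 (2 ^ j.+1)].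
    rewrite expnS -flatten_iota -map_comp map_flatten -map_comp; congr flatten.
    apply/eq_in_map => p; rewrite mem_iota => /andP[_ hp] /=.
    have hb : 2 * p + 1 < 2 ^ q.
      by apply: (@leq_trans (2 ^ j.+1)); rewrite ?leq_exp2l // expnS; lia.
    have e1 : odd (2 * p) = false by rewrite mul2n odd_double.
    have e2 : odd (2 * p + 1) = true by rewrite addn1 /= mul2n odd_double.
    have e3 : cCP c - (cCP c - (2 * p + 0)) = 2 * p by lia.
    have e4 : cCP c - (cCP c - (2 * p + 1)) = 2 * p + 1 by lia.
    by rewrite /en e1 e2 e3 e4.
  split; first by rewrite all_map; apply/allP=> p _ /=; rewrite !eqxx.
  by split=> //; [rewrite /=; lia | rewrite -map_comp].
- move=> M' E t' [-> -> ->].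
  do 2 (apply: wpc_seq; apply: wpc_asg); apply: wpc_asg => /=.
  rewrite (_ : _ + _ + _ + _ = t + tfork qe q); first exact: hQ.
  by rewrite /tfork /=; lia.
Qed.

Lemma wpc_join (I : seq nat) f (Q : assertion) M t :
  uniq I -> 0 \in I -> (forall p, nth 0 (f p) 13 = p) ->
  wpk RESET Q M [:: f 0] (t + 4) -> wpk JOIN Q M (map f I) t.
Proof.
move=> hu h0 hf hQ; rewrite /JOIN; apply: wpc_seq; rewrite /wpc -/wpc.
have -> : [seq v <- map f I | eval OFF M v (1 - vpid)%X != 0] = [:: f 0].
  rewrite filter_map; have -> : [seq p <- I | preim f (fun v => eval OFF M v (1 - vpid)%X != 0) p] = [:: 0].
    rewrite -(filter_pred1_uniq hu h0).
    by apply: eq_filter => p /=; rewrite hf; lia.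
  by [].
exact: hQ.
Qed.

Definition treset := 32.

Lemma wpc_reset c (a10 a11 a12 a13 a14 a15 a16 a17 a18 a19 a20 a21 a22 a23 a24 a25 : nat) (Q : assertion) M t :
  Q M [:: en0 c] (t + treset) ->
  wpk RESET Q M [:: en c a10 a11 a12 a13 a14 a15 a16 a17 a18 a19 a20 a21 a22 a23 a24 a25] t.
Proof.
move=> hQ; have : forall I : seq unit, Q M [seq en0 c | _ <- I] (t + treset) ->
   wpk RESET Q M [seq en c a10 a11 a12 a13 a14 a15 a16 a17 a18 a19 a20 a21 a22 a23 a24 a25 | _ <- I] t.
  move=> I {}hQ; rewrite /RESET; do 15 (apply: wpc_seq; apply: wpc_asg => /=); apply: wpc_asg => /=.
  by rewrite -!addnA; exact: hQ.
by move/(_ [:: tt]); apply.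
Qed.

Definition winmax (f : nat -> nat) r p := \max_(d < 2 ^ r) f (p + d).

Lemma winmax0 f p : winmax f 0 p = f p.
Proof. by rewrite /winmax expn0 big_ord1 addn0. Qed.

Lemma winmaxS f r p : winmax f r.+1 p = maxn (winmax f r p) (winmax f r (p + 2 ^ r)).
Proof.
rewrite /winmax expnS mul2n -addnn.
rewrite -(big_mkord xpredT (fun d => f (p + d))) (big_cat_nat (n := 2 ^ r)) ?leq_addr //=.
rewrite big_mkord; congr maxn.
rewrite -{1}[2 ^ r]add0n big_addn addnK big_mkord.
by apply: eq_bigr => d _; congr f; lia.
Qed.

Definition twin qe re q r := tfork qe q + 2 + (cost re).+1 + 4 + r * 35 + 4 + treset.

(** Two adjacent windows of length 2^j give one of length 2^(j+1). Windows that reach past cell 2^q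
    may hold garbage, but a window that fits is composed of windows that fit. *)
Lemma wpc_winmax c k qe re q r (Q : assertion) M t :
  eval OFF M (en0 c) qe = q -> (forall v, (forall i, i < 10 -> nth 0 v i = nth 0 (en0 c) i) -> eval OFF M v re = r) ->
  2 ^ q <= cap -> 2 ^ q <= cCP c -> r <= q ->
  (forall M', (forall k', k' <> k -> M' k' = M k') ->
     (forall p, p + 2 ^ r <= 2 ^ q -> M' k p = winmax (M k) r p) ->
     Q M' [:: en0 c] (t + twin qe re q r)) ->
  wpk (WINMAX k qe re) Q M [:: en0 c] t.
Proof.
move=> hq hr hcap hcp hrq hQ; rewrite /WINMAX.
apply: wpc_seq; apply: (wpc_fork hq hcap hcp).
do 2 (apply: wpc_seq; apply: wpc_asg) => /=.
rewrite (eq_map (g := fun p => en c r 0 0 p 1 0 0 0 0 0 0 0 0 0 0 0)); last first.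
  by move=> p; rewrite /= hr // => -[|[|[|[|[|[|[|[|[|[|i]]]]]]]]]].
apply: wpc_seq; apply: (wpc_for (I := fun j M' E t' => [/\ forall k', k' <> k -> M' k' = M k',
   forall p, 2 ^ q <= p -> M' k p = M k p,
   forall p, p + 2 ^ j <= 2 ^ q -> M' k p = winmax (M k) j p,
   t' = t + tfork qe q + 2 + (cost re).+1 + 2 + j * 35 &
   exists x, E = [seq en c r j 0 p (2 ^ j) (x p) 0 0 0 0 0 0 0 0 0 0 | p <- iota 0 (2 ^ q)]]) (k := r)).
- split=> //; [by move=> p _; rewrite winmax0|by rewrite /=; lia|exists (fun=> 0)].
  by rewrite -map_comp.
- by move=> j M' E t' _ [_ _ _ _ [x ->]]; rewrite all_map; apply/allP=> p _ /=; rewrite !eqxx.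
- move=> j M1 E t1 hj [hk ho hw ht [x ->]].
  have hs : 2 ^ j + 2 ^ j <= 2 ^ q by rewrite addnn -mul2n -expnS leq_exp2l //; lia.
  apply: wpc_seq; apply: wpc_asg => /=; apply: wpc_seq.
  apply: (@wpc_wr OFF coins cap _ _ _ (fun p => M1 k p < M1 k (p + 2 ^ j)) id (fun p => M1 k (p + 2 ^ j))) => //.
  + exact: iota_uniq.
  + by move=> p _ /=; lia.
  apply: wpc_asg => /=.
  set M2 := wfam _ _ _ _ _ _.
  have hM2 p : p < 2 ^ q -> M2 k p = maxn (M1 k p) (M1 k (p + 2 ^ j)).
    by move=> hp; rewrite /M2 wfam_id ?iota_uniq // mem_iota hp.
  split; first by rewrite all_map; apply/allP=> p _ /=; rewrite !eqxx.
  split.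
  + by move=> k' hk'; rewrite /M2 wfam_other // hk.
  + move=> p hp; rewrite /M2 wfam_out ?ho // => _ y; rewrite mem_iota => hy _ e; lia.
  + move=> p hp; have h2 : 2 ^ j.+1 = 2 ^ j + 2 ^ j by rewrite expnS; lia.
    rewrite winmaxS hM2; last by lia.
    by rewrite !hw //; lia.
  + by rewrite /wr_cost /=; lia.
  + exists (fun p => M1 k (p + 2 ^ j)); rewrite -map_comp; apply: eq_map => p /=.
    have e : cCP c - (cCP c - (2 ^ j + 2 ^ j)) = 2 ^ j.+1 by rewrite expnS; lia.
    by rewrite /en e.
- move=> M1 E t1 [hk ho hw ht [x ->]].
  apply: wpc_join => //.
  + exact: iota_uniq.
  + by rewrite mem_iota expn_gt0.
  apply: wpc_reset; rewrite (_ : _ + _ = t + twin qe re q r); first exact: hQ.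
  by rewrite ht /twin; lia.
Qed.

End Kernels.

(** * Reading the input *)

(** N = 2^(logN n) is above n, and at most 2n if n is positive. So the vertices 1, ..., n and the
    null vertex 0 fit below N, at the cost of a constant factor. *)
Definition logN (n : nat) : nat := if n is 0 then 0 else (trunc_log 2 n).+1.

Lemma ltn_logN n : n < 2 ^ logN n.
Proof. by case: n => // n; apply: trunc_log_ltn. Qed.

Lemma logN_leq n : 0 < n -> 2 ^ logN n <= 2 * n.
Proof. by case: n => // n _; rewrite /logN expnS leq_mul2l /= trunc_logP. Qed.

Lemma logN_lt n j : j < logN n -> 2 ^ j <= n.
Proof.
case: n => // n; rewrite /logN ltnS => h.
by apply: leq_trans (trunc_logP (isT : 1 < 2) (ltn0Sn n)); rewrite leq_exp2l.
Qed.

Lemma logN_small n : logN n <= n.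
Proof. case: n => // n; rewrite /logN; have := trunc_logP (isT : 1 < 2) (ltn0Sn n).
by have := ltn_expl (trunc_log 2 n.+1) (isT : 1 < 2); lia. Qed.

Definition logM (m : nat) := logN m.-1.

Lemma leq_logM m : m <= 2 ^ logM m.
Proof. by rewrite /logM; have := ltn_logN m.-1; lia. Qed.

Lemma logM_leq m : 0 < m -> 2 ^ logM m <= 2 * m.
Proof.
rewrite /logM; case: m => // -[|m] _ //=.
by apply: leq_trans (logN_leq (ltn0Sn m)) _; lia.
Qed.

Lemma logM_lt m j : j < logM m -> 2 ^ j < m.
Proof. by rewrite /logM => h; have := logN_lt h; case: m h => [|m] //=; lia. Qed.

(** There may be more processors than edges; the cap at the last input cell keeps their reads inside
    the input. *)
Definition idx (i : nat) : expr := EMin (3 * vpid + i) (3 * vm + 1).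

(** [BIG] exceeds N times any edge length, hence the length of any simple path, and [KB] bounds the
    keys of the form score * N + vertex. The bound 4 N^3 leaves room for every fork, the largest one
    having 2 N^3 processors. *)
Definition PHASE1 : stmt :=
  Asg 25 0 ;; Asg 2 1 ;; Asg 3 0 ;;
  While (vn + 1 - vN) (Asg 2 (EMin (vN + vN) (vn + vn + 2)) ;; Asg 3 (EMin (vL + 1) (vn + 1))) ;;
  Asg 12 1 ;; Asg 4 0 ;;
  While (vm - V 12) (Asg 12 (EMin (V 12 + V 12) (vm + vm)) ;; Asg 4 (EMin (vLM + 1) vm)) ;;
  Asg 12 0 ;; Asg 5 (4 * vN * vN * vN) ;;
  FORK vLM ;; RdIn 17 (idx 4) ;; Wr 1 (vm - vpid) vpid (V 17) ;; JOIN ;;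
  WINMAX 1 vLM vLM ;;
  Asg 6 (vN * (vN * ERd 1 0 + 1) + 1) ;; Asg 7 (vBIG * vN + vN).

(* Vertex [x] of the graph becomes [x + 1]; vertex 0 is isolated. *)
Definition ADJ : stmt :=
  FORK vLM ;; RdIn 14 (idx 2) ;; RdIn 15 (idx 3) ;; RdIn 16 (idx 4) ;;
  Asg 14 (EMin (V 14 + 1) vN) ;; Asg 15 (EMin (V 15 + 1) vN) ;;
  Wr 2 ((vm - vpid) * (1 - EEq (V 14) (V 15))) (V 14 * vN + V 15) (EMin (vN * V 16 + 1) vBIG) ;; JOIN.

Section Input.
Variables (n : nat) (G : wdigraph n) (es : seq ('I_n * 'I_n)).
Hypothesis hes : lists_edges G es.

Notation m := (size es).
Notation inp := (input G es).
Notation OFF := (3 * m + n * n + 2).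
Notation L := (logN n).
Notation N := (2 ^ L).
Notation LM := (logM m).

Lemma nth_input i j : i < m -> j < 3 -> forall e0,
  nth 0 inp (3 * i + j + 2) =
  nth 0 [:: val (nth e0 es i).1; val (nth e0 es i).2; weight G (nth e0 es i).1 (nth e0 es i).2] j.
Proof.
move=> hi hj e0; rewrite /input addn2 /=.
elim: es i hi => //= e s ih [|i] hi.
  by rewrite muln0 add0n; case: j hj {ih} => [|[|[|j]]].
rewrite -(ih i) // mulnS.
by rewrite (_ : 3 + 3 * i + j = (3 * i + j).+3) //; lia.
Qed.

Lemma input_tail i e0 : i < m -> nth 0 inp (3 * i + 2) = (nth e0 es i).1.
Proof. by move=> hi; rewrite -[3 * i]addn0 (@nth_input i 0 hi isT e0). Qed.

Lemma input_head i e0 : i < m -> nth 0 inp (3 * i + 3) = (nth e0 es i).2.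
Proof. by move=> hi; rewrite (_ : 3 * i + 3 = 3 * i + 1 + 2) ?(@nth_input i 1 hi isT e0) //; lia. Qed.

Lemma input_weight i e0 : i < m -> nth 0 inp (3 * i + 4) = weight G (nth e0 es i).1 (nth e0 es i).2.
Proof. by move=> hi; rewrite (_ : 3 * i + 4 = 3 * i + 2 + 2) ?(@nth_input i 2 hi isT e0) //; lia. Qed.

Definition ctlW (W lev rep : nat) : ctl :=
  let BIG := N * (N * W + 1) + 1 in
  Ctl n m N L LM (4 * N * N * N) BIG (BIG * N + N) lev rep.

Variables (coins : nat -> nat -> bool) (cap : nat).
Hypothesis hcap : 2 ^ LM <= cap.

Lemma LM_CP : 2 ^ LM <= 4 * N * N * N.
Proof.
have hm := m_le hes; have hN := ltn_logN n.
case: (posnP m) => [->|h]; first by rewrite /logM /=; nia.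
by apply: leq_trans (logM_leq h) _; nia.
Qed.

Definition time1 := 109 + L * 24 + LM * 14 + tfork vLM LM + twin vLM vLM LM LM.

Lemma wpc_phase1 (Q : assertion) :
  (forall M W t, (forall k, k <> 1 -> M k = mem0 inp k) -> (forall i, i < m -> nth 0 inp (3 * i + 4) <= W) ->
     t = time1 -> Q M [:: en0 (ctlW W 0 0)] t) ->
  wpc OFF coins cap PHASE1 Q (mem0 inp) [:: [:: n; m]] 9.
Proof.
move=> hQ; rewrite /PHASE1; do 3 (apply: wpc_seq; apply: wpc_asg1 => /=).
apply: wpc_seq; apply: (wpc_while (I := fun j M E t => [/\ M = mem0 inp,
  E = [:: en0 (Ctl n m (2 ^ j) j 0 0 0 0 0 0)] & t = 15 + j * 24]) (k := L)).
- by [].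
- move=> j M E t hj [-> -> ->]; have h := logN_lt hj; have hL := logN_small n; split; first by rewrite /= andbT; lia.
  apply: wpc_seq; apply: wpc_asg1 => /=; apply: wpc_asg1 => /=.
  split=> //; last lia.
  have e1 : n + n + 2 - (n + n + 2 - (2 ^ j + 2 ^ j)) = 2 ^ j.+1 by rewrite expnS; lia.
  have e2 : n + 1 - (n + 1 - (j + 1)) = j.+1 by lia.
  by rewrite e1 e2.
move=> _ _ _ [-> -> ->]; have h := ltn_logN n; split; first by rewrite /= andbT; lia.
do 2 (apply: wpc_seq; apply: wpc_asg1 => /=).
apply: wpc_seq; apply: (wpc_while (I := fun j M E t => [/\ M = mem0 inp,
  E = [:: en (Ctl n m N L j 0 0 0 0 0) 0 0 (2 ^ j) 0 0 0 0 0 0 0 0 0 0 0 0 0] & t = 23 + L * 24 + j * 14]) (k := LM)).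
- by split=> //; lia.
- move=> j M E t hj [-> -> ->]; have hh := logM_lt hj; have hL := ltn_expl j (isT : 1 < 2).
  split; first by rewrite /= andbT; lia.
  apply: wpc_seq; apply: wpc_asg1 => /=; apply: wpc_asg1 => /=.
  split=> //; last lia.
  have e1 : m + m - (m + m - (2 ^ j + 2 ^ j)) = 2 ^ j.+1 by rewrite expnS; lia.
  have e2 : m - (m - (j + 1)) = j.+1 by lia.
  by rewrite e1 e2.
move=> M E t [-> -> ->]; have h' := leq_logM m; split; first by rewrite /= andbT; lia.
do 2 (apply: wpc_seq; apply: wpc_asg1 => /=).
pose c := Ctl n m N L LM (4 * N * N * N) 0 0 0 0.
apply: wpc_seq; apply: (@wpc_fork _ _ _ c _ LM) => //; first exact: LM_CP.
apply: wpc_seq; apply: wpc_rdin => [p _|]; first by rewrite /idx evalMin /=; nia.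
have hidx i p : p < m -> i <= 4 -> eval OFF (mem0 inp) (enp c p) (idx i) = 3 * p + i.
  by move=> hp hi; rewrite /idx evalMin /=; lia.
apply: wpc_seq; apply: (@wpc_wr _ _ _ _ _ _ (fun p => p < m) id (fun p => nth 0 inp (3 * p + 4))) => //.
- exact: iota_uniq.
- by move=> p _ /=; lia.
- by move=> p _ hp; rewrite [LHS]/= -/(enp c p) -/(idx 4) /= ; congr nth; lia.
set M1 := wfam _ _ _ _ _ _.
apply: wpc_seq; apply: wpc_join; [exact: iota_uniq|by rewrite mem_iota expn_gt0|by []|].
apply: wpc_reset.
apply: wpc_seq; apply: (@wpc_winmax _ _ _ c _ _ _ LM LM) => //; [by move=> v /(_ 4 isT)|exact: LM_CP|].
move=> M2 hM2 hw; apply: wpc_seq; apply: wpc_asg1 => /=; apply: wpc_asg1 => /=.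
apply: (hQ M2 (M2 1 0)).
- by move=> k hk; rewrite hM2 // /M1 wfam_other.
- move=> i hi; rewrite hw // /winmax.
  have hi2 : i < 2 ^ LM by apply: leq_trans hi h'.
  rewrite (bigD1 (Ordinal hi2)) //= add0n.
  by rewrite /M1 wfam_id ?iota_uniq // mem_iota hi2 hi leq_maxl.
- by rewrite /time1 /wr_cost /treset /=; lia.
Qed.

(** The value 0 encodes a missing edge, which is unambiguous because actual lengths are positive.
    Loops are dropped, as no simple path uses them. *)
Definition gG (u v : nat) : nat :=
  if (0 < u) && (0 < v) then
    if (insub u.-1 : option 'I_n, insub v.-1 : option 'I_n) is (Some x, Some y) then
      if ((x, y) \in edges G) && (x != y) then N * weight G x y + 1 else 0
    else 0
  else 0.

Lemma gGE (x y : 'I_n) : gG x.+1 y.+1 = if ((x, y) \in edges G) && (x != y) then N * weight G x y + 1 else 0.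
Proof. by rewrite /gG /= !valK. Qed.

Lemma gG_inv u v : gG u v != 0 -> exists x y : 'I_n, [/\ u = x.+1, v = y.+1, (x, y) \in edges G & x != y].
Proof.
rewrite /gG; case: andP => // -[hu hv].
case: insubP => // x _ ex; case: insubP => // y _ ey; case: andP => // -[h1 h2] _.
by exists x, y; split=> //; rewrite (ex, ey) prednK.
Qed.

Lemma wpc_adj W lev rep (Q : assertion) M t :
  M raw = nth 0 inp -> (forall a, M 2 a = 0) -> (forall i, i < m -> nth 0 inp (3 * i + 4) <= W) ->
  (forall M' t', t' <= t + tfork vLM LM + 200 -> (forall k, k <> 2 -> M' k = M k) -> (forall u v, u < N -> v < N -> M' 2 (u * N + v) = gG u v) ->
     Q M' [:: en0 (ctlW W lev rep)] t') ->
  wpc OFF coins cap ADJ Q M [:: en0 (ctlW W lev rep)] t.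
Proof.
move=> hraw h2 hW hQ; rewrite /ADJ; set c := ctlW W lev rep.
apply: wpc_seq; apply: (@wpc_fork _ _ _ c _ LM) => //; first exact: LM_CP.
have hN := ltn_logN n.
have e0 : 0 < m -> 'I_n * 'I_n by case: (es) => // e.
do 3 (apply: wpc_seq; apply: wpc_rdin => [p _|/=]; first by rewrite /idx /=; nia).
do 2 (apply: wpc_seq; apply: wpc_asg => /=).
pose X i p := M raw (3 * m + 1 - (3 * m + 1 - (3 * p + i))).
have hX i p : p < m -> i <= 4 -> X i p = nth 0 inp (3 * p + i).
  by move=> hp hi; rewrite /X hraw; congr nth; lia.
have hX2 p : p < m -> X 2 p < n.
  move=> hp; have d := e0 (leq_ltn_trans (leq0n _) hp).
  by rewrite hX // (input_tail d hp) ltn_ord.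
have hX3 p : p < m -> X 3 p < n.
  move=> hp; have d := e0 (leq_ltn_trans (leq0n _) hp).
  by rewrite hX // (input_head d hp) ltn_ord.
have hX4 p : p < m -> X 4 p <= W by move=> hp; rewrite hX // hW.
have hN0 : 0 < N by rewrite expn_gt0.
have hinj : inj_fam (iota 0 (2 ^ LM)) (fun p => (p < m) && (X 2 p != X 3 p)) (fun p => (X 2 p).+1 * N + (X 3 p).+1).
  move=> p p' _ _ /andP[hp _] /andP[hp' _] e.
  have h1 := hX2 _ hp; have h5 := hX3 _ hp; have h3 := hX2 _ hp'; have h4 := hX3 _ hp'.
  have e1 : X 2 p = X 2 p'.
    have := congr1 (fun x => x %/ N) e; rewrite /= !divnMDl // !(divn_small (m := _.+1)) //; lia.
  have e2 : X 3 p = X 3 p' by move: e; rewrite e1 => /addnI [].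
  have d := e0 (leq_ltn_trans (leq0n _) hp).
  have hu : uniq es by rewrite (perm_uniq hes) enum_uniq.
  apply/eqP; rewrite -(nth_uniq d hp hp' hu); apply/eqP.
  move: e1 e2; rewrite !hX // !(input_tail d) // !(input_head d) //.
  by case: (nth d es p) (nth d es p') => a b [a' b'] /= /val_inj -> /val_inj ->.
apply: wpc_seq; apply: (@wpc_wr _ _ _ _ _ _ (fun p => (p < m) && (X 2 p != X 3 p))
  (fun p => (X 2 p).+1 * N + (X 3 p).+1) (fun p => N * X 4 p + 1)).
- exact: iota_uniq.
- exact: hinj.
- move=> p _ /=; rewrite -/(X 2 p) -/(X 3 p) muln_eq0 negb_or; case: (ltnP p m) => hp; last by rewrite (eqP hp).
  have h1 := hX2 _ hp; have h5 := hX3 _ hp.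
  by rewrite (_ : m - p != 0) /=; lia.
- by move=> p _ /andP[hp _] /=; rewrite -/(X 2 p) -/(X 3 p); have := hX2 _ hp; have := hX3 _ hp; lia.
- move=> p _ /andP[hp _] /=; rewrite -/(X 4 p); have h4 := hX4 _ hp.
  suff : N * X 4 p + 1 <= N * (N * W + 1) + 1 by lia.
  by rewrite leq_add2r leq_mul2l; nia.
set M1 := wfam _ _ _ _ _ _.
apply: wpc_join; [exact: iota_uniq|by rewrite mem_iota expn_gt0|by []|].
apply: (@wpc_reset _ _ _ c); apply: hQ => [|k hk|u v hu hv]; first by rewrite /treset /wr_cost /=; lia.
  by rewrite /M1 wfam_other.
case: (boolP (gG u v != 0)) => [hg|/negPn/eqP hg].
  have [x [y [eu ev hE hxy]]] := gG_inv hg.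
  have /(nthP (x, y)) [i hi ei] : (x, y) \in es by rewrite (perm_mem hes) mem_enum.
  have e2 : X 2 i = x by rewrite hX // (input_tail (x, y) hi) ei.
  have e3 : X 3 i = y by rewrite hX // (input_head (x, y) hi) ei.
  have e4 : X 4 i = weight G x y by rewrite hX // (input_weight (x, y) hi) ei.
  have hne : X 2 i != X 3 i by rewrite e2 e3.
  have := @wfam_in _ _ _ _ (fun p => N * X 4 p + 1) 2 M i (iota_uniq _ _) hinj.
  rewrite mem_iota /= (leq_trans hi (leq_logM m)) hi hne => /(_ isT isT).
  by rewrite -/M1 e2 e3 e4 eu ev gGE hE hxy.
rewrite hg /M1 wfam_out ?h2 // => _ i _ /andP[hi hne] e.
have h1 := hX2 _ hi; have h3 := hX3 _ hi.
have d := e0 (leq_ltn_trans (leq0n _) hi).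
have hE : nth d es i \in edges G by rewrite -(mem_enum (edges G)) -(perm_mem hes) mem_nth.
have e2 : X 2 i = (nth d es i).1 by rewrite hX // (input_tail d hi).
have e3 : X 3 i = (nth d es i).2 by rewrite hX // (input_head d hi).
have eu : (X 2 i).+1 = u.
  by have := congr1 (fun x => x %/ N) e; rewrite /= !divnMDl // !divn_small ?addn0 //; lia.
have ev : (X 3 i).+1 = v by move: e; rewrite eu => /addnI.
have hne' : (nth d es i).1 != (nth d es i).2 by rewrite -(inj_eq val_inj) /= -e2 -e3.
by move: hg; rewrite -eu -ev e2 e3 gGE -surjective_pairing hE hne' addn1.
Qed.

End Input.

(** * Second simple shortest paths *)

Lemma pairmap_pair_tail (T : eqType) (x : T) p u v : (u, v) \in pairmap pair x p -> u \in x :: p.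
Proof.
elim: p x => //= a p ih x; rewrite inE => /orP[/eqP[-> _]|/ih h]; first by rewrite inE eqxx.
by rewrite in_cons; apply/orP; right.
Qed.

(** A simple path has only one edge out of each of its vertices, so its edge set determines it.
    Hence differing in an edge can be replaced by being a different sequence. *)
Lemma simple_edges_sub (T : eqType) (x : T) p q : uniq (x :: p) -> uniq (x :: q) -> last x p = last x q ->
  {subset pairmap pair x p <= pairmap pair x q} -> p = q.
Proof.
elim: p x q => [|a p ih] x [|b q] //=.
- by move=> _ /andP[hx _] e _; case/negP: hx; rewrite e mem_last.
- by move=> _ _ _ /(_ _ (mem_head _ _)).
move=> /andP[hx hp] /andP[hx' hq] e hs.
have eab : a = b.
  have := hs _ (mem_head _ _); rewrite inE => /orP[/eqP[]//|/pairmap_pair_tail h].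
  by rewrite h in hx'.
subst b; congr cons; apply: (ih a) => // -[u v] huv.
have := hs (u, v); rewrite !inE huv orbT => /(_ isT) /orP[/eqP[eu _]|//].
by case/negP: hx; rewrite -eu; apply: pairmap_pair_tail huv.
Qed.

Definition glen (g : nat -> nat -> nat) x p := sumn (pairmap g x p).

Lemma glen_cat g x p q : glen g x (p ++ q) = glen g x p + glen g (last x p) q.
Proof. by rewrite /glen pairmap_cat sumn_cat. Qed.

Lemma glen_cons g x a p : glen g x (a :: p) = g x a + glen g a p.
Proof. by []. Qed.

Lemma walk_simple (g : nat -> nat -> nat) (e : rel nat) x p : path e x p ->
  exists q, [/\ path e x q, last x q = last x p, uniq (x :: q), glen g x q <= glen g x p & {subset q <= p}].
Proof.
elim: p x => [|a p ih] x /=; first by exists [::].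
move=> /andP[hxa /ih[q [h1 h2 h3 h4 h5]]].
case: (boolP (x \in a :: q)) => hx; last first.
  exists (a :: q); split=> //=; rewrite ?hxa ?h1 //.
  - by rewrite hx.
  - by rewrite !glen_cons leq_add2l.
  - by move=> z; rewrite !inE => /orP[->//|/h5 ->]; rewrite orbT.
move: hx; rewrite inE => /orP[/eqP ex|hx].
  subst a; exists q; split=> //; first by rewrite glen_cons; lia.
  by move=> z /h5 h; rewrite inE h orbT.
case/splitPr: hx h1 h2 h3 h4 h5 => q1 q2; rewrite cat_path last_cat /= => /and3P[_ _ h1] h2 h3 h4 h5.
exists q2; split=> //.
- by move: h3 => /= /andP[_]; rewrite cat_uniq => /and3P[_ _].
- by move: h4; rewrite glen_cat !glen_cons; lia.
- by move=> z hz; rewrite inE h5 ?orbT // mem_cat inE hz !orbT.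
Qed.

(** * Second simple paths from labels and detours *)

Section Weighted.
Variables (N BIG : nat) (g : nat -> nat -> nat).
Hypothesis hg : forall u v, g u v != 0 -> [&& 0 < u, 0 < v, u < N, v < N & u != v].
Hypothesis hB : forall u v, N * g u v < BIG.

Definition ge u v := g u v != 0.

Definition gsimple x y p := [&& path ge x p, last x p == y & uniq (x :: p)].

Lemma path_lt x p : path ge x p -> all (fun v => 0 < v < N) p.
Proof. by elim: p x => //= a p ih x /andP[/hg/and5P[_ h1 _ h2 _] /ih ->]; rewrite h1 h2. Qed.

Lemma path_start x p : path ge x p -> p <> [::] -> 0 < x < N.
Proof. by case: p => //= a p /andP[/hg/and5P[h1 _ h2 _ _] _] _; rewrite h1. Qed.

Lemma simple_size x p : path ge x p -> uniq (x :: p) -> p <> [::] -> size p < N.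
Proof.
move=> h1 hu hp; have hx := path_start h1 hp; have ha := path_lt h1.
rewrite -[(size p).+1]/(size (x :: p)) -(size_iota 0 N); apply: uniq_leq_size => // v.
by rewrite inE mem_iota add0n => /orP[/eqP->|/(allP ha)] /andP[_ ->] || by rewrite inE mem_iota => /orP[/eqP->|/(allP ha)]; [case/andP: hx|case/andP].
Qed.

Lemma glen_le x p K : (forall u v, g u v <= K) -> glen g x p <= size p * K.
Proof.
by move=> hK; elim: p x => //= a p ih x; rewrite glen_cons mulSn leq_add.
Qed.

(** There are fewer than N edges, each of length at most some K with N K below [BIG]. *)
Lemma glen_small x p : path ge x p -> uniq (x :: p) -> 0 < BIG -> glen g x p < BIG.
Proof.
move=> h1 hu h0; case: (eqVneq p [::]) => [->|/eqP hp] //; have hs := simple_size h1 hu hp.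
have [K hK1 hK2] : exists2 K, N * K < BIG & forall u v, g u v <= K.
  exists ((BIG.-1) %/ N) => [|u v]; first by have := leq_trunc_div BIG.-1 N; rewrite mulnC; lia.
  by rewrite leq_divRL ?(leq_ltn_trans _ hs) // mulnC; have := hB u v; lia.
apply: leq_ltn_trans (glen_le x p hK2) _; apply: leq_ltn_trans hK1.
by rewrite leq_mul2r (ltnW hs) orbT.
Qed.

(** Here [o] is a score, [BIG] minus a length, so 0 says that there is no second path. The last
    clause asks for a path at most as long as claimed; together with the clause before it, the
    length is exact. *)
Definition second_wrt x y P o :=
  [/\ gsimple x y P, forall q, gsimple x y q -> glen g x P <= glen g x q,
      forall q, gsimple x y q -> q <> P -> BIG - glen g x q <= o &
      0 < o -> exists q, [/\ gsimple x y q, q <> P & glen g x q <= BIG - o]].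

Definition is_second x y o :=
  (exists P, second_wrt x y P o) \/ ((forall p, ~~ gsimple x y p) /\ o = 0).

Section LabelledDistances.
(* [D z y] is BIG minus the distance from z to y, [lab z y] the first vertex of a shortest path, and
   [E z y] is BIG minus the least weight of a path that leaves z through another vertex. *)
Variables D lab E : nat -> nat -> nat.
Hypothesis BIG_gt0 : 0 < BIG.
Hypothesis N_gt0 : 0 < N.
Hypothesis Dle : forall z y, D z y <= BIG.
Hypothesis D1 : forall z, z < N -> D z z = BIG.
Hypothesis D2 : forall z u v, z < N -> ge u v -> D z u - g u v <= D z v.
Hypothesis D3 : forall z y, z < N -> y <> z -> 0 < D z y ->
  exists p, [/\ path ge z (lab z y :: p), last (lab z y) p = y & glen g z (lab z y :: p) <= BIG - D z y].
Hypothesis labz : forall z, lab z z = 0.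
Hypothesis Ele : forall z y, E z y <= BIG.
Hypothesis labD : forall z y, D z y = 0 -> lab z y = 0.
Hypothesis lab0 : forall y, lab 0 y = 0.
Hypothesis E1 : forall z u y, z < N -> y <> z -> ge u y -> (if u == z then y else lab z u) <> lab z y ->
  D z u - g u y <= E z y.
Hypothesis E2 : forall z u y, z < N -> y <> z -> u <> z -> ge u y -> lab z u = lab z y -> E z u - g u y <= E z y.
Hypothesis E3 : forall z y, z < N -> 0 < E z y -> y <> z /\ exists b p,
  [/\ path ge z (b :: p), last b p = y, b <> lab z y, z \notin b :: p & glen g z (b :: p) <= BIG - E z y].

Lemma D_complete z p : z < N -> path ge z p -> BIG - glen g z p <= D z (last z p).
Proof.
move=> hz; elim/last_ind: p => [|p v ih]; first by rewrite /glen /= subn0 D1.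
rewrite rcons_path last_rcons => /andP[/ih h1 h2].
have := D2 hz h2; rewrite -cats1 glen_cat /= /glen /= -/(glen g z p); lia.
Qed.

(** Induction from the end of the walk. If the tail of the last edge has the same label as the head,
    the rest of the walk is itself a detour and [E2] applies. Otherwise the edge crosses between
    branches, and [E1] applies with the distance to its tail, however the walk got there. *)
Lemma E_complete z b q y : z < N -> path ge z (b :: q) -> z \notin b :: q -> last b q = y -> b <> lab z y ->
  BIG - glen g z (b :: q) <= E z y.
Proof.
move=> hz; move ea : (lab z y) => a.
elim/last_ind: q y ea => [|q v ih] y ea.
  rewrite /= inE andbT => hb hzb eb hba; rewrite -eb in ea *.
  have := @E1 z z b hz _ hb; rewrite eqxx ea D1 // /glen /= addn0; apply => //.
  by move=> e; rewrite e eqxx in hzb.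
rewrite -rcons_cons rcons_path mem_rcons inE negb_or last_rcons => /andP[hp hv] /andP[hzv hzq] ev hba.
rewrite -ev in ea *.
rewrite -cats1 glen_cat {2}/glen /= addn0; set u := last b q in hv *.
have hu : u <> z by move=> e; move: hzq; rewrite -e mem_last.
have hvz : v <> z by move=> e; rewrite e eqxx in hzv.
case: (lab z u =P a) => hl.
  have := ih u hl hp hzq erefl hba; have := @E2 z u v hz hvz hu hv (etrans hl (esym ea)); lia.
have := D_complete hz hp; have := @E1 z u v hz hvz hv.
by rewrite (introF eqP hu) ea => /(_ hl); rewrite /= -/u; lia.
Qed.

(** [D3] gives one inequality; prefixing the edge to a shortest path from the label gives the other.
    The strict increase of the score makes chains of labels finite. *)
Lemma D_next x y : x < N -> x <> y -> 0 < D x y ->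
  [/\ ge x (lab x y), lab x y < N, D (lab x y) y = D x y + g x (lab x y) & D x y < D (lab x y) y].
Proof.
move=> hx hxy h0; have [|p [/= /andP[h1 h2] h3 h4]] := D3 hx _ h0; first by move/esym.
set a := lab x y in h1 h2 h3 h4 *.
have ha : a < N by case/hg/and5P: h1.
have k1 := D_complete ha h2; rewrite h3 in k1.
have hle := Dle x y; have hle' := Dle a y.
have k2 : D a y - g x a <= D x y.
  case: (a =P y) => [e|/eqP hay].
    by have := @D_complete x [:: a] hx; rewrite /= h1 /glen /= addn0 => /(_ isT); rewrite {2}e; lia.
  case: (posnP (D a y)) => [->|h5] //.
  have [|p' [h6 h7 h8]] := D3 ha _ h5; first by move=> e; rewrite e eqxx in hay.
  have := @D_complete x (a :: lab a y :: p') hx; rewrite [path _ _ _]/= h1 -[_ && path _ _ _]/(path ge a (lab a y :: p')) h6 => /(_ isT).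
  by move: h8; rewrite /= h7 !glen_cons; lia.
rewrite glen_cons in h4.
by move: (h1); rewrite {1}/ge => h1'; split=> //; lia.
Qed.

(** Since the label of [y] for itself is 0, the recursion passes from [y] to the null vertex, where
    all values are 0; too many steps are therefore harmless. *)
Fixpoint Vn k x y := if k is k'.+1 then maxn (E x y) (Vn k' (lab x y) y - g x (lab x y)) else 0.

Fixpoint chain y x P := if P is a :: P' then [/\ x <> y, a = lab x y, ge x a & chain y a P'] else x = y.

Lemma E0 y : E 0 y = 0.
Proof.
case: (posnP (E 0 y)) => // h; have [_ [b [p [/= /andP[h1 _] _ _ _ _]]]] := E3 N_gt0 h.
by have := hg h1.
Qed.

Lemma Vn0 k y : Vn k 0 y = 0.
Proof. by elim: k => //= k ih; rewrite lab0 ih E0. Qed.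

(** The walk does not return to [x], so removing its cycles keeps the first edge and thus leaves it
    a detour. *)
Lemma E_simple x y b p : path ge x (b :: p) -> last b p = y -> x \notin b :: p ->
  exists q, gsimple x y (b :: q) /\ glen g x (b :: q) <= glen g x (b :: p).
Proof.
move=> /= /andP[h1 h2] h3 h4; have [q [k1 k2 k3 k4 k5]] := walk_simple g h2.
exists q; split; last by rewrite !glen_cons leq_add2l.
rewrite /gsimple /= h1 k1 k2 h3 eqxx /=; apply/andP; split; last by move: k3.
apply: contra h4; rewrite !inE => /orP[->//|/k5 ->]; by rewrite orbT.
Qed.

Lemma gsimple_nil y q : gsimple y y q -> q = [::].
Proof.
case: q => // c q /and3P[_ /eqP h]; rewrite cons_uniq => /andP[h' _].
by case/negP: h'; rewrite -{1}h /= mem_last.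
Qed.

Lemma Vn_le k x y : Vn k x y <= BIG.
Proof. by elim: k x => //= k ih x; rewrite geq_max Ele (leq_trans (leq_subr _ _) (ih _)). Qed.

Lemma chain_len y x P : chain y x P -> x < N -> 0 < D x y ->
  [/\ path ge x P, last x P = y & glen g x P = BIG - D x y].
Proof.
elim: P x => [|a P ih] x /=; first by move=> -> hx _; rewrite D1 // subnn.
move=> [hxy ea hxa hc] hx h0; have [k1 k2 k3 k4] := D_next hx hxy h0; rewrite -ea in k1 k2 k3 k4.
have [h1 h2 h3] := ih a hc k2 (leq_trans h0 (ltnW k4)).
by rewrite hxa h1; split=> //; rewrite glen_cons h3; have := Dle a y; lia.
Qed.

Lemma chain_second y P : forall x k, x < N -> 0 < D x y -> chain y x P -> uniq (x :: P) -> size P < k ->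
  second_wrt x y P (Vn k x y).
Proof.
elim: P => [|a P ih] x [|k] // hx h0.
  rewrite /= => e _ _; rewrite e labz Vn0 sub0n maxn0 in hx h0 *.
  split=> [|q /gsimple_nil-> //|q /gsimple_nil-> //|]; first by rewrite /gsimple /= eqxx.
  by move=> h; case: (E3 hx h).
move=> [hxy ea hxa hc] hu hk.
have [k1 k2 k3 k4] := D_next hx hxy h0; rewrite -ea in k1 k2 k3 k4.
have hup : uniq (a :: P) by move: hu; rewrite cons_uniq => /andP[].
have [s1 s2 s3 s4] := ih a k k2 (leq_trans h0 (ltnW k4)) hc hup hk.
have hnil q : gsimple x y q -> q <> [::] by move=> /and3P[_ /eqP h _] e; case: hxy; rewrite -h e.
split.
- rewrite /gsimple /= hxa; move: s1 => /and3P[-> /eqP -> _] /=; rewrite eqxx /=; exact: hu.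
- move=> [/hnil//|b q] /and3P[h1 /eqP h2 h3].
  have [_ _ ->] : [/\ path ge x (a :: P), last x (a :: P) = y & glen g x (a :: P) = BIG - D x y].
    by apply: chain_len.
  by have := D_complete hx h1; rewrite h2; lia.
- move=> [/hnil//|b q] hq hne /=; rewrite -ea leq_max.
  move: (hq) => /and3P[h1 /eqP h2 h3].
  case: (b =P a) => [eb|hb].
    rewrite eb in hq hne h1 h2 h3 *; apply/orP; right.
    have := s3 q; rewrite /gsimple; move: h1 h2 h3 => /= /andP[_ ->] -> /andP[_ ->]; rewrite eqxx => /(_ isT).
    by rewrite glen_cons => h; apply: leq_trans (leq_sub2r _ (h _)); [lia | move=> e; case: hne; rewrite e].
  apply/orP; left; apply: E_complete => //; first by move: h3; rewrite cons_uniq => /andP[].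
  by rewrite -ea.
- rewrite /= -ea => ho.
  case: (leqP (Vn k a y - g x a) (E x y)) => hcmp.
    have hE0 : 0 < E x y by lia.
    have [hyx [b [p [p1 p2 p3 p4 p5]]]] := E3 hx hE0.
    have [q [q1 q2]] := E_simple p1 p2 p4; exists (b :: q); split=> //; last by lia.
    by case=> e; case: p3; rewrite e ea.
  have [|q [q1 q2 q3]] := s4; first by lia.
  move: (q1) => /and3P[r1 /eqP r2 r3].
  (* If the second path from [a] passes through [x], prefixing the edge would not give a simple
     path. But its part after [x] is then a simple path from [x] that does not visit [a]; so it
     differs from [a :: P] and is no longer than required. *)
  case: (boolP (x \in q)) => hxq; last first.
    exists (a :: q); split; last by rewrite glen_cons; have := Vn_le k a y; lia.
      rewrite /gsimple /= hxa r1 r2 eqxx /=; apply/andP; split; last by move: r3.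
      by rewrite inE negb_or hxq andbT; apply/eqP => e; move: k4; rewrite -e ltnn.
    by case=> e; case: q2.
  case/splitPr: hxq q1 q2 q3 r1 r2 r3 => t1 t2 q1 q2 q3.
  rewrite cat_path last_cat /= => /and3P[_ _ r1] r2 /andP[r3]; rewrite cat_uniq => /and3P[_ _ r4].
  exists t2; split.
  + by rewrite /gsimple r1 r2 eqxx.
  + by move=> e; move: r3; rewrite e mem_cat !inE eqxx !orbT.
  + by move: q3; rewrite glen_cat /= glen_cons; lia.
Qed.

(** Induction on [BIG - D x y]. The scores increase strictly along the chain, which also makes it
    simple. *)
Lemma chain_ex x y : x < N -> 0 < D x y -> exists P, [/\ chain y x P, uniq (x :: P) & size P < N].
Proof.
have [k hk] := ubnP (BIG - D x y); elim: k x hk => // k ih x hk hx h0.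
suff [P [h1 h2]] : exists P, chain y x P /\ path (fun u v => D u y < D v y) x P.
  have hu : uniq (x :: P).
    have tr : transitive (fun u v => D u y < D v y) by move=> u v w; apply: ltn_trans.
    have ir : irreflexive (fun u v => D u y < D v y) by move=> u; rewrite ltnn.
    exact: (sorted_uniq tr ir (h2 : sorted _ (x :: P))).
  exists P; split=> //; have [hp _ _] := chain_len h1 hx h0.
  by case: (eqVneq P [::]) => [->//|/eqP hP]; apply: simple_size hp hu hP.
case: (x =P y) => hxy; first by exists [::].
have [k1 k2 k3 k4] := D_next hx hxy h0.
have [||P [h1 _ _]] := ih (lab x y) _ k2; [by have := Dle (lab x y) y; lia|by lia|].
have [|hp _ _] := chain_len h1 k2; first by lia.
exists (lab x y :: P); split=> //=; rewrite k4 /=.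
have h5' := leq_trans h0 (ltnW k4).
elim: P (lab x y) h1 k2 h5' {k1 k3 k4 hp} => [|b P ihP] a //= [c1 c2 c3 c4] ha h5.
have [d1 d2 d3 d4] := D_next ha c1 h5; rewrite -c2 in d1 d2 d3 d4.
by rewrite d4 ihP //; lia.
Qed.

(** N steps cover the whole chain because it is simple. If [y] is unreachable, any detour would
    contain a path, so the value is 0. *)
Theorem labels_second x y : x < N -> is_second x y (Vn N x y).
Proof.
move=> hx; case: (posnP (D x y)) => h0; last first.
  have [P [h1 h2 h3]] := chain_ex hx h0.
  by left; exists P; apply: chain_second.
have hno p : path ge x p -> uniq (x :: p) -> last x p = y -> False.
  by move=> h1 h2 h3; have := D_complete hx h1; have := glen_small h1 h2 BIG_gt0; rewrite h3 h0; lia.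
right; split=> [p|]; first by apply/negP => /and3P[h1 /eqP h2 h3]; apply: (hno p).
case: (N) => // k /=; rewrite labD // Vn0 sub0n maxn0.
case: (posnP (E x y)) => // hE; have [_ [b [p [p1 p2 p3 p4 p5]]]] := E3 hx hE.
have [q [/and3P[q1 /eqP q2 q3] _]] := E_simple p1 p2 p4.
by case: (hno (b :: q)).
Qed.

End LabelledDistances.

End Weighted.

(** * From perturbed lengths back to the weighted digraph *)

Section Link.
Variables (n : nat) (G : wdigraph n) (W : nat).
Hypothesis hW : forall x y, (x, y) \in edges G -> weight G x y <= W.
Notation N := (2 ^ logN n).
Notation g := (gG G).
Notation BIG := (N * (N * W + 1) + 1).

Lemma gG_ge u v : g u v != 0 -> [&& 0 < u, 0 < v, u < N, v < N & u != v].
Proof.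
move=> /gG_inv[x [y [-> -> _ hxy]]]; have := ltn_logN n; have := ltn_ord x; have := ltn_ord y => h1 h2 h3.
by rewrite !(leq_trans _ h3) // eqSS hxy.
Qed.

Lemma gG_small u v : N * g u v < BIG.
Proof.
rewrite addn1 ltnS; case: (boolP (g u v != 0)) => [h|/negPn/eqP ->]; last by rewrite muln0.
have [x [y [-> -> hE hxy]]] := gG_inv h; rewrite gGE hE hxy leq_mul2l leq_add2r leq_mul2l hW //.
by rewrite !orbT.
Qed.

Definition lift (p : seq 'I_n) : seq nat := [seq (val i).+1 | i <- p].

Lemma lift_simple (x y : 'I_n) p : simple_path G x y p ->
  gsimple g x.+1 y.+1 (lift p) /\ glen g x.+1 (lift p) = N * path_weight G x p + size p.
Proof.
rewrite /gsimple => /and3P[h1 h2 h3].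
have -> : uniq (x.+1 :: lift p) by rewrite -[_ :: _]/(lift (x :: p)) map_inj_uniq // => i j [] /val_inj.
have -> : last x.+1 (lift p) = (last x p).+1 by rewrite (last_map (fun i : 'I_n => (val i).+1)).
rewrite (eqP h2) eqxx andbT.
elim: p x h1 h3 {h2} => [|a p ih] x /=; first by rewrite muln0.
move=> /andP[hE h1] /andP[hx h3]; have hxa : x != a by apply: contra hx => /eqP->; rewrite inE eqxx.
have [k1 k2] := ih a h1 h3; rewrite /ge gGE hE hxa addn1 k1; split=> //.
rewrite glen_cons k2 gGE hE hxa /path_weight /= ; lia.
Qed.

Lemma gsimple_lift (x y : 'I_n) q : gsimple g x.+1 y.+1 q -> exists2 p, q = lift p & simple_path G x y p.
Proof.
move=> /and3P[h1 /eqP h2 h3].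
have [p eq hp] : exists2 p, q = lift p & path (fun u v => (u, v) \in edges G) x p.
  elim: q x h1 {h2 h3} => [|a q ih] x /=; first by exists [::].
  move=> /andP[/gG_inv[x' [a' [ex ea hE _]]]]; rewrite ea => /ih[p -> hp].
  exists (a' :: p) => //=; rewrite hp andbT.
  by have -> : x = x' by apply: val_inj; case: ex.
exists p => //; rewrite /simple_path hp /=; subst q.
have e : last x.+1 (lift p) = (last x p).+1 by rewrite (last_map (fun i : 'I_n => (val i).+1)).
apply/andP; split; first by apply/eqP/val_inj; move: h2; rewrite e => -[].
by move: h3; rewrite -[x.+1 :: _]/(lift (x :: p)) map_inj_uniq // => i j [] /val_inj.
Qed.

Lemma path_edges_inj (x y : 'I_n) p q : simple_path G x y p -> simple_path G x y q ->
  path_edges x p = path_edges x q -> p = q.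
Proof.
move=> /and3P[_ /eqP h2 h3] /and3P[_ /eqP k2 k3] /setP he.
apply: simple_edges_sub h3 k3 _ _; first by rewrite h2.
by move=> z hz; have := he z; rewrite !inE hz.
Qed.

Lemma second_link (x y : 'I_n) o : is_second BIG g x.+1 y.+1 o ->
  second_distance G x y (decode (if o == 0 then 0 else ((BIG - o) %/ N).+1)).
Proof.
have hN0 : 0 < N by rewrite expn_gt0.
have hB0 : 0 < BIG by rewrite addn1.
have hs p : simple_path G x y p -> size p < N.
  move=> /lift_simple[/and3P[h1 _ h3] _]; case: p h1 h3 => // a p h1 h3.
  by have := simple_size gG_ge h1 h3; rewrite size_map; apply.
have pw p : simple_path G x y p -> path_weight G x p = glen g x.+1 (lift p) %/ N.
  move=> h; have [_ ->] := lift_simple h.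
  by rewrite mulnC divnMDl // divn_small ?addn0 // hs.
have lift_inj : injective lift by apply: inj_map => i j [] /val_inj.
case=> [[P0 [s1 s2 s3 s4]]|[hno ->]]; last first.
  split=> [P [hP _]|//]; have [h _] := lift_simple hP; by rewrite (negbTE (hno _)) in h.
have [p0 e0 hp0] := gsimple_lift s1; subst P0.
split=> [P [hP hmin]|hno]; last by have := hno p0; rewrite hp0.
have alt q : simple_path G x y q -> q <> p0 -> BIG - o <= glen g x.+1 (lift q).
  move=> hq hne; have [h1 _] := lift_simple hq.
  by have := s3 _ h1 (fun e => hne (lift_inj _ _ e)); lia.
case: (posnP o) => ho.
  have all_eq q : simple_path G x y q -> q = p0.
    move=> hq; apply: contrapT => hne; have := alt _ hq hne; rewrite ho subn0.
    have [/and3P[h1 _ h3] _] := lift_simple hq.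
    by have := glen_small gG_ge gG_small h1 h3 hB0; lia.
  by move=> q [hq]; rewrite (all_eq _ hq) (all_eq _ hP).
have [q1 [q2 q3 q4]] := s4 ho; have [p1 e1 hp1] := gsimple_lift q2; subst q1.
have ne1 : p1 <> p0 by move=> e; case: q3; rewrite e.
have len1 : glen g x.+1 (lift p1) = BIG - o by have := alt _ hp1 ne1; lia.
rewrite /second_distance_wrt /=; case: (P =P p0) => [eP|hne].
  subst P; split; first exists p1; first split=> //.
  - by move=> e; case: ne1; exact: (path_edges_inj hp1 hp0 e).
  - by rewrite pw // len1.
  - move=> q [hq hne]; rewrite pw // leq_div2r // alt // => e.
    by case: hne; rewrite e.
(* Here [P] is a shortest path by weight, but not the path [p0] that is minimal in the perturbed
   lengths. Then [p0] is an alternative to [P], and the second distance is their common weight; the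
   inequalities squeeze the weight of [p1] to the same value. *)
have a1 := hmin _ hp1; have a2 : (BIG - o) %/ N <= path_weight G x P by rewrite (pw P) // leq_div2r // alt.
have [gP _] := lift_simple hP.
have a3 : path_weight G x p0 <= path_weight G x P by rewrite !pw // leq_div2r // s2.
have a4 := hmin _ hp0; rewrite (pw p1) // len1 in a1.
split; first exists p0; first split=> //.
- by move=> e; case: hne; symmetry; exact: (path_edges_inj hp0 hP e).
- by lia.
- by move=> q [hq _]; have := hmin _ hq; lia.
Qed.

End Link.

(** * Parallel relaxation of the edges out of a vertex *)

Lemma flatten_iota2 a b : flatten [seq [:: 2 * x; 2 * x + 1] | x <- iota a b] = iota (2 * a) (2 * b).
Proof.
elim: b a => // b ih a; rewrite (_ : 2 * b.+1 = (2 * b).+2); last by lia.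
by rewrite /= ih addn1 (_ : 2 * a.+1 = (2 * a).+2) //; lia.
Qed.

Lemma row_inj B z z' v v' : v < B -> v' < B -> z * B + v = z' * B + v' -> z = z' /\ v = v'.
Proof.
move=> hv hv' e; have h0 : 0 < B by lia.
have e1 : z = z' by have := congr1 (divn^~ B) e; rewrite /= !divnMDl // !divn_small // !addn0.
by move: e; rewrite e1 => /addnI.
Qed.

(** Nodes are numbered as in a binary heap: the root is 1, the children of x are 2x and 2x + 1, and
    the leaf of vertex v is N + v. *)
Definition nodes (tr : nat -> bool) h := [seq nd <- iota (2 ^ h) (2 ^ h) | tr nd].

Section Nodes.
Variables (tr : nat -> bool) (h : nat).
Hypothesis htr : forall nd, 2 ^ h <= nd < 2 ^ h.+1 -> tr nd = tr (2 * nd) || tr (2 * nd + 1).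

Lemma nodes_down : [seq nd <- flatten [seq [:: 2 * nd; 2 * nd + 1] | nd <- nodes tr h] | tr nd] = nodes tr h.+1.
Proof.
rewrite /nodes expnS -flatten_iota2.
have : all (fun nd => 2 ^ h <= nd < 2 ^ h.+1) (iota (2 ^ h) (2 ^ h)).
  by apply/allP=> x; rewrite mem_iota expnS mul2n addnn.
elim: (iota _ _) => //= x s ih /andP[hx /ih <-].
have := htr hx; case: (tr x) => /=; first by [].
by case: (tr (2 * x)) => //=; case: (tr (2 * x + 1)).
Qed.

(** On the way up a right child dies if its left sibling is marked too, so exactly one processor
    reaches each marked parent. *)
Lemma nodes_up : [seq nd %/ 2 | nd <- nodes tr h.+1 & ~~ (odd nd && tr nd.-1)] = nodes tr h.
Proof.
rewrite /nodes expnS -flatten_iota2.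
have : all (fun nd => 2 ^ h <= nd < 2 ^ h.+1) (iota (2 ^ h) (2 ^ h)).
  by apply/allP=> x; rewrite mem_iota expnS mul2n addnn.
elim: (iota _ _) => //= x s ih /andP[hx /ih {ih} <-].
have e1 : odd (2 * x) = false by rewrite mul2n odd_double.
have e2 : odd (2 * x + 1) by rewrite addn1 /= mul2n odd_double.
have e3 : (2 * x + 1).-1 = 2 * x by lia.
have e4 : (2 * x) %/ 2 = x by rewrite mulKn.
have e5 : (2 * x + 1) %/ 2 = x by rewrite mulnC divnMDl // addn0.
rewrite (htr hx); case h1: (tr (2 * x)) => /=; rewrite ?e1 /=.
  by case h2: (tr (2 * x + 1)) => /=; rewrite ?e2 ?e3 ?h1 /= ?e4.
by case h2: (tr (2 * x + 1)) => //=; rewrite e2 e3 h1 /= e5.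
Qed.

(** Marked levels never shrink downwards, so the number of marked leaves bounds the number of
    processors on every level. *)
Lemma size_nodes : size (nodes tr h) <= size (nodes tr h.+1).
Proof. by rewrite -nodes_up size_map size_filter count_size. Qed.

End Nodes.

(** The edges out of u are found without scanning a row of the matrix: processors descend a
    precomputed tree of the out-neighbours, doubling at each node and dying on unmarked ones. There
    are never more than twice as many as leaves. *)
Definition FORKOUT : stmt :=
  Asg 16 1 ;; Asg 10 vL ;;
  For 11 10 (Dup 12 ;; Asg 16 (EMin (2 * V 16 + V 12) (vN + vN)) ;; Asg 12 0 ;;
             Kill (ERd 3 (V 14 * (vN + vN) + V 16))).

(* Variables: 13 = source z, 14 = vertex u, 15 = score of u, 16 = tree node, 17 = vertex v, 18 = old key,
   19 = condition, 20 = new key, 21 = new score. *)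
Definition LEAF (kH : nat) (cnd : expr) (zs wl : nat) : stmt :=
  Asg 17 (V 16 - vN) ;; Asg 18 (ERd kH (V 13 * (vN + vN) + V 16)) ;; Asg 19 cnd ;;
  Asg 21 (V 15 - ERd 2 (V 14 * vN + V 17)) ;;
  Asg 20 (EMin (V 19 * (1 - (1 - V 21)) * (V 21 * vN + V 17)) vKB) ;;
  Wr 7 (wl * (V 20 - V 18)) (V 13 * vN + V 17)
    (EMin (EEq (V 14) (V 13) * V 17 + (1 - EEq (V 14) (V 13)) * ERd 7 (V 13 * vN + V 14)) vN) ;;
  Wr kH 1 (V 13 * (vN + vN) + V 16) (EMin ((1 - zs * EEq (V 14) (V 17)) * (V 18 + (V 20 - V 18))) vKB) ;;
  Asg 17 0 ;; Asg 18 0 ;; Asg 19 0 ;; Asg 20 0 ;; Asg 21 0.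

Definition UP (kH : nat) : stmt :=
  For 11 10 (Kill (1 - EMod (V 16) 2 * ERd 3 (V 14 * (vN + vN) + V 16 - 1)) ;; Asg 16 (V 16 / 2) ;;
    Wr kH 1 (V 13 * (vN + vN) + V 16)
      (EMin (ERd kH (V 13 * (vN + vN) + 2 * V 16) +
             (ERd kH (V 13 * (vN + vN) + (2 * V 16 + 1)) - ERd kH (V 13 * (vN + vN) + 2 * V 16))) vKB)).

(** [kH] is the region of the queue and [cnd] the condition on an edge; [zs] asks for the key of u
    to be deleted, [wl] for labels to be recorded. *)
Definition RELAX (kH : nat) (cnd : expr) (zs wl : nat) : stmt :=
  FORKOUT ;; LEAF kH cnd zs wl ;; UP kH ;; Asg 10 0 ;; Asg 11 0 ;; Asg 16 0.

Lemma upds_le k ws M B : (forall x, x \in ws -> x.2 <= B) -> (forall a, M k a <= B) -> forall a, upds k ws M k a <= B.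
Proof.
move=> h hM a; elim: ws h => //= w ws ih h; rewrite /upd eqxx /=; case: eqP => _; first by apply: h; rewrite mem_head.
by apply: ih => x hx; apply: h; rewrite inE hx orbT.
Qed.

Lemma wfam_le (T : eqType) (I : seq T) (c : T -> bool) (ad va : T -> nat) k M B : (forall x, x \in I -> c x -> va x <= B) ->
  (forall a, M k a <= B) -> forall a, wfam I c ad va k M k a <= B.
Proof.
move=> h hM; apply: upds_le => // _ /mapP[x hx ->] /=.
by move: hx; rewrite mem_filter => /andP[hc hx]; apply: h.
Qed.

Section Relax.
Variables (OFF : nat) (coins : nat -> nat -> bool) (cap : nat) (c : ctl).
Notation N := (cN c).
Notation L := (cL c).
Notation BIG := (cBIG c).
Notation KB := (cKB c).
Hypothesis hN : N = 2 ^ L.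
Hypothesis hKB : KB = BIG * N + N.
Variables (g : nat -> nat -> nat) (tr : nat -> nat -> bool).
Hypothesis htr : forall u nd, u < N -> 0 < nd < N -> tr u nd = tr u (2 * nd) || tr u (2 * nd + 1).
Hypothesis htr1 : forall u, u < N -> tr u 1.
Hypothesis htrg : forall u v, u < N -> v < N -> g u v != 0 -> tr u (N + v).
Hypothesis hgu : forall u, g u u = 0.

(** A vertex with score 0 has key 0. So an empty queue has root 0, which decodes to the null vertex
    with score 0. *)
Definition enc (s v : nat) := if s == 0 then 0 else s * N + v.

Lemma enc_max a b v : maxn (enc a v) (enc b v) = enc (maxn a b) v.
Proof.
have h0 : 0 < N by rewrite hN expn_gt0.
rewrite /enc; case: a b => [|a] [|b] //=; rewrite ?max0n ?maxn0 //.
by rewrite maxnSS /= -addn_maxl -maxnMl maxnSS.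
Qed.

Variables (Z : seq nat) (u s : nat -> nat).
Hypothesis Zu : uniq Z.
Hypothesis Zlt : forall z, z \in Z -> z < N.
Hypothesis ult : forall z, z \in Z -> u z < N.

Definition IL h := [seq (z, nd) | z <- Z, nd <- nodes (tr (u z)) h].

Lemma mem_IL h z nd : ((z, nd) \in IL h) = [&& z \in Z, 2 ^ h <= nd < 2 ^ h.+1 & tr (u z) nd].
Proof.
apply/allpairsPdep/and3P => [[z' [nd' [hz]]]|[hz hnd ht]].
  by rewrite mem_filter mem_iota expnS mul2n addnn => /andP[h1 h2] [-> ->].
by exists z, nd; rewrite mem_filter ht mem_iota addnn -mul2n -expnS; split.
Qed.

Lemma uniq_IL h : uniq (IL h).
Proof.
apply: allpairs_uniq_dep => // [z _|]; first by rewrite filter_uniq ?iota_uniq.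
by move=> [z nd] [z' nd'] _ _ /= [-> ->].
Qed.

Lemma htr_level h z : h < L -> z \in Z -> forall nd, 2 ^ h <= nd < 2 ^ h.+1 ->
  tr (u z) nd = tr (u z) (2 * nd) || tr (u z) (2 * nd + 1).
Proof.
move=> hh hz nd /andP[h1 h2]; apply: htr; first exact: ult.
by rewrite (leq_trans _ h1) ?expn_gt0 // hN (leq_trans h2) // leq_exp2l.
Qed.

Lemma size_IL h : h <= L -> size (IL h) <= size (IL L).
Proof.
have step i : i < L -> size (IL i) <= size (IL i.+1).
  move=> hi; rewrite !size_allpairs_dep; have := fun z => @htr_level _ z hi; elim: (Z) => //= z Z' ih hz.
  by apply: leq_add; [apply: size_nodes; apply: hz; rewrite mem_head | apply: ih => z' hz'; apply: hz; rewrite inE hz' orbT].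
move=> hh; rewrite -(subnKC hh); move: (L - h) (subnKC hh) => d hd.
have : h + d <= L by lia.
elim: d {hd} => [|d ih] hd; first by rewrite addn0.
by apply: leq_trans (ih _) _; [lia | rewrite addnS; apply: step; lia].
Qed.

Lemma IL_down h : h < L ->
  [seq x <- flatten [seq [:: (x.1, 2 * x.2); (x.1, 2 * x.2 + 1)] | x <- IL h] | tr (u x.1) x.2] = IL h.+1.
Proof.
move=> hh; rewrite /IL; have := fun z => @htr_level _ z hh; elim: (Z) => //= z Z' ih hz.
rewrite map_cat flatten_cat filter_cat ih; last by move=> z' hz'; apply: hz; rewrite inE hz' orbT.
congr cat; rewrite -(nodes_down (hz z (mem_head _ _))).
by elim: (nodes _ h) => //= nd s' ->; case: (tr (u z) (2 * nd)); case: (tr (u z) (2 * nd + 1)).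
Qed.

Lemma IL_up h : h < L ->
  [seq (x.1, x.2 %/ 2) | x <- IL h.+1 & ~~ (odd x.2 && tr (u x.1) x.2.-1)] = IL h.
Proof.
move=> hh; rewrite /IL; have := fun z => @htr_level _ z hh; elim: (Z) => //= z Z' ih hz.
rewrite filter_cat map_cat ih; last by move=> z' hz'; apply: hz; rewrite inE hz' orbT.
congr cat; rewrite -(nodes_up (hz z (mem_head _ _))).
by elim: (nodes _ h.+1) => //= nd s' ih'; case: (~~ _) => //=; rewrite ih'.
Qed.

Lemma IL0 : IL 0 = [seq (z, 1) | z <- Z].
Proof.
rewrite /IL /nodes /= ; elim: (Z) ult => //= z Z' ih hz.
by rewrite htr1 ?hz ?mem_head //= ih // => z' hz'; apply: hz; rewrite inE hz' orbT.
Qed.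

Hypothesis hcap : 2 * size (IL L) <= cap.

Definition lenv (k t x : nat -> nat) (z : nat) :=
  en c 0 0 0 z (u z) (s z) 0 0 0 0 0 0 (k z) (t z) (x z) 0.

Section ForkOut.
Variables (k0 t0 x0 : nat -> nat).

Definition wenv l j nd v old cc nk sg z :=
  en c l j 0 z (u z) (s z) nd v old cc nk sg (k0 z) (t0 z) (x0 z) 0.

Definition tforkout := 6 + 2 + L * 60.

Lemma wpc_forkout (Q : assertion) (M : nat -> nat -> nat) t :
  (forall z nd, z \in Z -> nd < N + N -> M 3 (u z * (N + N) + nd) = tr (u z) nd) ->
  (forall t', t' <= t + tforkout ->
     Q M [seq wenv L L x.2 0 0 0 0 0 x.1 | x <- IL L] t') ->
  wpc OFF coins cap FORKOUT Q M (map (lenv k0 t0 x0) Z) t.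
Proof.
move=> h3 hQ; rewrite /FORKOUT; do 2 (apply: wpc_seq; apply: wpc_asg => /=).
apply: (wpc_for (I := fun j M' E t' => [/\ M' = M, t' <= t + 6 + j * 60 &
   E = [seq wenv L j x.2 0 0 0 0 0 x.1 | x <- IL j]]) (k := L)).
- by split=> //; [lia | rewrite IL0 -!map_comp].
- by move=> j M' E t' _ [_ _ ->]; rewrite all_map; apply/allP=> x _ /=; rewrite !eqxx.
- move=> j M' E t' hj [-> ht ->]; apply: wpc_seq; split.
    by rewrite size_map; apply: leq_trans hcap; rewrite leq_mul2l size_IL // ltnW.
  have -> : flatten [seq [:: set_nth 0 v 12 0; set_nth 0 v 12 1] | v <- [seq wenv L j x.2 0 0 0 0 0 x.1 | x <- IL j]]
    = [seq en c L j (odd x.2) x.1 (u x.1) (s x.1) (x.2 %/ 2) 0 0 0 0 0 (k0 x.1) (t0 x.1) (x0 x.1) 0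
        | x <- flatten [seq [:: (x.1, 2 * x.2); (x.1, 2 * x.2 + 1)] | x <- IL j]].
    elim: (IL j) => //= x I' ->.
    have e1 : odd (2 * x.2) = false by rewrite mul2n odd_double.
    have e2 : odd (2 * x.2 + 1) by rewrite addn1 /= mul2n odd_double.
    have e4 : (2 * x.2) %/ 2 = x.2 by rewrite mulKn.
    have e5 : (2 * x.2 + 1) %/ 2 = x.2 by rewrite mulnC divnMDl // addn0.
    by rewrite e1 e2 e4 e5.
  apply: wpc_seq; apply: (@wpc_asg_in _ _ _ _ _ _ (fun x => en c L j (odd x.2) x.1 (u x.1) (s x.1) x.2
    0 0 0 0 0 (k0 x.1) (t0 x.1) (x0 x.1) 0)).
    move=> x /flattenP[l /mapP[[z nd]]]; rewrite mem_IL => /and3P[hz hnd _] -> hx /=.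
    have hx2 : x.2 < N + N.
      have : 2 ^ j.+1 <= N by rewrite hN leq_exp2l.
      by move: hx; rewrite !inE => /orP[]/eqP-> /=; lia.
    have e : 2 * (x.2 %/ 2) + odd x.2 = x.2 by rewrite [RHS](divn_eq _ 2) modn2 mulnC.
    by rewrite e (_ : N + N - (N + N - x.2) = x.2) //; lia.
  apply: wpc_seq; apply: wpc_asg => /=; apply: wpc_kill => /=.
  rewrite (eq_in_filter (a2 := fun x => tr (u x.1) x.2)); last first.
    move=> x /flattenP[l /mapP[[z nd]]]; rewrite mem_IL => /and3P[hz hnd _] -> hx /=.
    have hx1 : x.1 = z by move: hx; rewrite !inE => /orP[]/eqP->.
    have hx2 : x.2 < N + N.
      have : 2 ^ j.+1 <= N by rewrite hN leq_exp2l.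
      by move: hx; rewrite !inE => /orP[]/eqP-> /=; lia.
    by rewrite hx1 h3 //; case: (tr _ _).
  rewrite IL_down //; split; first by rewrite all_map; apply/allP=> x _ /=; rewrite !eqxx.
  by split=> //; [lia | rewrite -map_comp].
- by move=> M' E t' [-> ht ->]; apply: hQ; rewrite /tforkout; lia.
Qed.

End ForkOut.

Definition heap (H : nat -> nat) (K : nat -> nat -> nat) := forall z, z \in Z ->
  (forall v, v < N -> H (z * (N + N) + (N + v)) = enc (K z v) v) /\
  (forall nd, 0 < nd < N -> H (z * (N + N) + nd) = maxn (H (z * (N + N) + 2 * nd)) (H (z * (N + N) + (2 * nd + 1)))).

Section Step.
Variables (k0 t0 x0 : nat -> nat) (kH : nat) (cnd : expr) (zs wl : bool) (cc : nat -> nat -> bool)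
  (K : nat -> nat -> nat) (M : nat -> nat -> nat).
Notation wenv := (wenv k0 t0 x0).
Hypothesis h7 : kH <> 7.
Hypothesis hs : forall z, z \in Z -> s z <= BIG.
Hypothesis hK : forall z v, z \in Z -> v < N -> K z v <= BIG.
Hypothesis M2 : forall u v, u < N -> v < N -> M 2 (u * N + v) = g u v.
Hypothesis M3 : forall u nd, u < N -> nd < N + N -> M 3 (u * (N + N) + nd) = tr u nd.
Hypothesis M7 : forall a, M 7 a <= N.
Hypothesis MH : forall a, M kH a <= KB.
Hypothesis hH : heap (M kH) K.
Hypothesis hcnd : forall z v old, z \in Z -> v < N ->
  eval OFF M (wenv L L (N + v) v old 0 0 0 z) cnd = cc z v.
Hypothesis hcc : forall z v, z \in Z -> cc z v -> g (u z) v != 0.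

Definition newK z v :=
  if zs && (v == u z) then 0 else if cc z v then maxn (K z v) (s z - g (u z) v) else K z v.

Definition newL z v := if u z == z then v else M 7 (z * N + u z).

Lemma leaf_node z nd : (z, nd) \in IL L -> [/\ z \in Z, nd - N < N, nd = N + (nd - N) & tr (u z) nd].
Proof. by rewrite mem_IL -hN expnS => /and3P[hz hnd ht]; rewrite -hN in hnd; split=> //; lia. Qed.

Definition tleaf := 150 + cost cnd.

Lemma wpc_leaf (Q : assertion) t :
  (forall M' t', t' <= t + tleaf -> (forall k, k <> kH -> k <> 7 -> M' k = M k) ->
     (forall a, a %/ N \notin Z -> M' 7 a = M 7 a) ->
     (forall a, M' 7 a <= N) -> (forall a, M' kH a <= KB) ->
     (forall z v, z \in Z -> v < N -> M' 7 (z * N + v) =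
        if [&& wl, cc z v & K z v < s z - g (u z) v] then newL z v else M 7 (z * N + v)) ->
     (forall z v, z \in Z -> v < N -> tr (u z) (N + v) ->
        M' kH (z * (N + N) + (N + v)) = enc (newK z v) v) ->
     (forall z nd, z \in Z -> nd < N + N -> ~~ ((N <= nd) && tr (u z) nd) ->
        M' kH (z * (N + N) + nd) = M kH (z * (N + N) + nd)) ->
     Q M' [seq wenv L L x.2 0 0 0 0 0 x.1 | x <- IL L] t') ->
  wpc OFF coins cap (LEAF kH cnd zs wl) Q M [seq wenv L L x.2 0 0 0 0 0 x.1 | x <- IL L] t.
Proof.
move=> hQ; have N0 : 0 < N by rewrite hN expn_gt0.
rewrite /LEAF; do 2 (apply: wpc_seq; apply: wpc_asg).
pose old x := M kH (x.1 * (N + N) + x.2).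
apply: wpc_seq; apply: (@wpc_asg_in _ _ _ _ _ _ (fun x => wenv L L x.2 (x.2 - N) (old x) (cc x.1 (x.2 - N)) 0 0 x.1)).
  move=> [z nd] /leaf_node[hz hv e ht]; rewrite /= -/(old (z, nd)).
  rewrite -[X in eval OFF M X cnd]/(wenv L L nd (nd - N) (old (z, nd)) 0 0 0 z).
  have hc := hcnd (old (z, nd)) hz hv; rewrite -e in hc.
  by rewrite hc.
pose sg (x : nat * nat) := s x.1 - g (u x.1) (x.2 - N).
apply: wpc_seq; apply: (@wpc_asg_in _ _ _ _ _ _ (fun x => wenv L L x.2 (x.2 - N) (old x) (cc x.1 (x.2 - N)) 0 (sg x) x.1)).
  by move=> [z nd] /leaf_node[hz hv e ht] /=; rewrite M2 ?ult.
pose nk (x : nat * nat) := if cc x.1 (x.2 - N) then enc (sg x) (x.2 - N) else 0.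
have encle a v : a <= BIG -> v < N -> enc a v <= KB by rewrite /enc hKB; case: eqP => // _; nia.
have sgle x : x \in IL L -> sg x <= BIG.
  by case: x => z nd /leaf_node[hz _ _ _]; rewrite /sg /=; have := hs hz; lia.
apply: wpc_seq; apply: (@wpc_asg_in _ _ _ _ _ _ (fun x => wenv L L x.2 (x.2 - N) (old x) (cc x.1 (x.2 - N)) (nk x) (sg x) x.1)).
  move=> [z nd] hx; have [hz hv e ht] := leaf_node hx; have hsg := sgle _ hx.
  have hen := encle _ _ hsg hv.
  rewrite /= /wenv /en; congr [:: _, _, _, _, _, _, _, _, _, _, _, _, _, _, _, _, _, _, _, _, _ & _].
  rewrite /nk /=; case: (cc z (nd - N)); rewrite ?mul0n ?subn0 ?subnn // mul1n.
  move: hen; rewrite /enc; case: (sg (z, nd) =P 0) => [->|/eqP h0] hen; first by rewrite subn0 subnn mul0n subn0 subnn.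
  have -> : 1 - (1 - sg (z, nd)) = 1 by case: (sg (z, nd)) h0.
  by rewrite mul1n subKn.
have oldE z v : z \in Z -> v < N -> old (z, N + v) = enc (K z v) v.
  by move=> hz hv; rewrite /old /=; have [-> //] := hH hz.
have nkold z v : z \in Z -> v < N -> (old (z, N + v) < nk (z, N + v)) = cc z v && (K z v < s z - g (u z) v).
  move=> hz hv; rewrite oldE // /nk /sg /= addKn; case: (cc z v) => //=; rewrite /enc.
  case: (s z - g (u z) v =P 0) => [->|/eqP h1]; first by rewrite !ltn0.
  case: (K z v =P 0) => [->|/eqP h2]; first by lia.
  by rewrite ltn_add2r ltn_pmul2r.
pose c7 (x : nat * nat) := wl && (old x < nk x).
pose a7 (x : nat * nat) := x.1 * N + (x.2 - N).
pose v7 (x : nat * nat) := newL x.1 (x.2 - N).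
have inj7 : inj_fam (IL L) c7 a7.
  move=> [z nd] [z' nd'] /leaf_node[hz hv e ht] /leaf_node[hz' hv' e' ht'] _ _ /(row_inj hv hv') /= [ez h].
  by rewrite ez e e' h.
apply: wpc_seq; apply: (@wpc_wr _ _ _ _ _ _ c7 a7 v7).
- exact: uniq_IL.
- exact: inj7.
- by move=> [z nd] _ /=; rewrite /c7; case: (wl); rewrite ?mul1n ?mul0n //= subn_eq0 -ltnNge.
- by [].
- move=> [z nd] /leaf_node[hz hv e ht] _ /=; rewrite /v7 /newL /=.
  rewrite (_ : 1 - (u z - z + (z - u z)) = (u z == z)); last by lia.
  by have := M7 (z * N + u z); case: (u z == z); lia.
set M1 := wfam _ _ _ _ _ _.
have M1k k : k <> 7 -> M1 k = M k by move=> h; rewrite /M1 wfam_other.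
pose vH (x : nat * nat) := enc (newK x.1 (x.2 - N)) (x.2 - N).
have injH : inj_fam (IL L) xpredT (fun x => x.1 * (N + N) + x.2).
  move=> [z nd] [z' nd'] /leaf_node[hz hv e ht] /leaf_node[hz' hv' e' ht'] _ _ /= h.
  by have [-> ->] := @row_inj (N + N) z z' nd nd' (ltac:(lia)) (ltac:(lia)) h.
apply: wpc_seq; apply: (@wpc_wr _ _ _ _ _ _ xpredT (fun x => x.1 * (N + N) + x.2) vH).
- exact: uniq_IL.
- exact: injH.
- by [].
- by [].
- move=> [z nd] hx _; have [hz hv e ht] := leaf_node hx.
  have hmax : maxn (old (z, nd)) (nk (z, nd)) = enc (if cc z (nd - N) then maxn (K z (nd - N)) (s z - g (u z) (nd - N)) else K z (nd - N)) (nd - N).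
    rewrite {1}e oldE // /nk /sg /=; case: (cc z _); last by rewrite maxn0.
    by rewrite enc_max.
  have hb : maxn (old (z, nd)) (nk (z, nd)) <= KB.
    rewrite hmax; apply: encle => //; case: (cc z _); last exact: hK.
    by rewrite geq_max hK //=; have := hs hz; lia.
  rewrite /= /vH /newK /= -/(old (z, nd)) -/(nk (z, nd)).
  rewrite (_ : old (z, nd) + _ = maxn (old (z, nd)) (nk (z, nd))); last by move: (old _) (nk _); clear => a b; lia.
  move: (maxn _ _) hmax hb => mx hmax hb.
  rewrite (_ : 1 - (u z - _ + _) = (nd - N == u z)); last by lia.
  by case: zs; case: eqP => /= _; rewrite ?muln1 ?mul0n ?subn0 ?subnn ?mul0n ?subnn ?mul1n // ?subKn.
set M' := wfam _ _ _ _ _ _.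
do 4 (apply: wpc_seq; apply: wpc_asg); apply: wpc_asg; rewrite [X in Q M' X _](_ : _ = [seq wenv L L x.2 0 0 0 0 0 x.1 | x <- IL L]) //.
apply: hQ.
- by rewrite /wr_cost /tleaf /=; lia.
- by move=> k hk hk7; rewrite /M' wfam_other // M1k.
- move=> a ha; rewrite /M' wfam_other; last by move/esym.
  rewrite /M1 wfam_out // => _ [z nd] /leaf_node[hz hv e ht] _ h.
  by move: ha; rewrite -h /a7 /= divnMDl // divn_small // addn0 hz.
- move=> a; rewrite /M' wfam_other; last by move/esym.
  by apply: wfam_le M7 _ => -[z nd] /leaf_node[hz hv e ht] _; rewrite /v7 /newL /=; case: ifP => _; [lia | exact: M7].
- apply: wfam_le; last by move=> a; rewrite M1k.
  move=> [z nd] /leaf_node[hz hv e ht] _; rewrite /vH /=; apply: encle => //.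
  rewrite /newK; case: ifP => // _; case: ifP => _; last exact: hK.
  by rewrite geq_max hK //=; have := hs hz; lia.
- move=> z v hz hv; rewrite /M' wfam_other; last by move/esym.
  have hcase : (z, N + v) \in IL L \/ cc z v = false.
    case h: (cc z v); [left|by right]; have := hcc hz h => hg.
    by rewrite mem_IL hz -hN expnS -hN htrg ?ult // andbT; lia.
  case: ifP => [/and3P[h1 h2 h3]|h1].
    case: hcase => [hx|]; last by rewrite h2.
    have := @wfam_in _ _ _ _ v7 7 M _ (uniq_IL L) inj7 hx.
    by rewrite /M1 /c7 nkold // h1 h2 h3 /a7 /v7 /= addKn => ->.
  rewrite /M1 wfam_out // => _ [z' nd'] hx hc; have [hz' hv' e' ht'] := leaf_node hx.
  rewrite /a7 /= => /(row_inj hv' hv) [ez ev].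
  by move: hc; rewrite /c7 ez e' ev nkold // h1.
- move=> z v hz hv ht.
  have hx : (z, N + v) \in IL L by rewrite mem_IL hz -hN expnS -hN ht; lia.
  by have := @wfam_in _ _ _ _ vH kH M1 _ (uniq_IL L) injH hx isT; rewrite /M' /vH /= addKn => ->.
- move=> z nd hz hnd hn; rewrite /M' wfam_out ?M1k // => _ [z' nd'] hx _ /= e.
  have [hz' hv' e' ht'] := leaf_node hx.
  have [e1 e2] := @row_inj (N + N) z' z nd' nd (ltac:(lia)) hnd e.
  by move: hn; rewrite -e1 -e2 ht' andbT; lia.
Qed.

Definition tup := 2 + L * 150.

(** After j rounds every inner node from 2^(L-j) on is the maximum of its children. Unmarked nodes
    need no update, since no leaf below them has changed. *)
Lemma wpc_up (Q : assertion) (M1 : nat -> nat -> nat) t :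
  (forall u nd, u < N -> nd < N + N -> M1 3 (u * (N + N) + nd) = tr u nd) -> (forall a, M1 kH a <= KB) -> kH <> 3 ->
  (forall z nd, z \in Z -> 0 < nd < N -> ~~ tr (u z) nd ->
     M1 kH (z * (N + N) + nd) = maxn (M1 kH (z * (N + N) + 2 * nd)) (M1 kH (z * (N + N) + (2 * nd + 1)))) ->
  (forall (M' : nat -> nat -> nat) t', t' <= t + tup + 2 -> (forall k, k <> kH -> M' k = M1 k) -> (forall a, M' kH a <= KB) ->
     (forall z nd, z \in Z -> N <= nd < N + N -> M' kH (z * (N + N) + nd) = M1 kH (z * (N + N) + nd)) ->
     (forall z nd, z \in Z -> 0 < nd < N ->
        M' kH (z * (N + N) + nd) = maxn (M' kH (z * (N + N) + 2 * nd)) (M' kH (z * (N + N) + (2 * nd + 1)))) ->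
     Q M' [seq wenv L L x.2 0 0 0 0 0 x.1 | x <- IL 0] t') ->
  wpc OFF coins cap (UP kH) Q M1 [seq wenv L L x.2 0 0 0 0 0 x.1 | x <- IL L] t.
Proof.
move=> h3 hM1 hk3 hn hQ; have N0 : 0 < N by rewrite hN expn_gt0.
apply: (wpc_for (I := fun j M' E t' => [/\ t' <= t + 2 + j * 150, forall k, k <> kH -> M' k = M1 k, forall a, M' kH a <= KB,
   (forall z nd, z \in Z -> nd < N + N -> (nd < 2 ^ (L - j)) || (N <= nd) || ~~ tr (u z) nd ->
      M' kH (z * (N + N) + nd) = M1 kH (z * (N + N) + nd)) /\
   (forall z nd, z \in Z -> 2 ^ (L - j) <= nd < N ->
      M' kH (z * (N + N) + nd) = maxn (M' kH (z * (N + N) + 2 * nd)) (M' kH (z * (N + N) + (2 * nd + 1)))) &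
   E = [seq wenv L j x.2 0 0 0 0 0 x.1 | x <- IL (L - j)]]) (k := L)).
- split=> //; [lia| |by rewrite subn0 -map_comp].
  by split=> // z nd hz; rewrite subn0 -hN; lia.
- by move=> j M' E t' _ [_ _ _ _ ->]; rewrite all_map; apply/allP=> x _ /=; rewrite !eqxx.
- move=> j M2' E t' hj [ht hk hle [hun hhp] ->].
  have hh : L - j.+1 < L by lia.
  have hLj : L - j = (L - j.+1).+1 by lia.
  have e2 : 2 ^ (L - j) = 2 * 2 ^ (L - j.+1) by rewrite hLj expnS.
  have hle2 : 2 ^ (L - j) <= N by rewrite hN leq_exp2l //; lia.
  apply: wpc_seq; apply: wpc_kill; apply: wpc_seq.
  rewrite (eq_in_filter (a2 := fun x => ~~ (odd x.2 && tr (u x.1) x.2.-1))); last first.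
    move=> [z nd]; rewrite mem_IL => /and3P[hz /andP[hnd1 hnd2] ht']; rewrite /= hk; last by move/esym.
    have hnd0 : 0 < nd by apply: leq_trans hnd1; rewrite expn_gt0.
    have hnd3 : nd.-1 < N + N by move: hnd2; rewrite expnS; lia.
    rewrite (_ : _ + nd - 1 = u z * (N + N) + nd.-1); last by lia.
    rewrite h3 ?ult // (_ : nd - nd %/ 2 * 2 = odd nd); last by rewrite -modn2; lia.
    by case: (odd nd); case: (tr _ _).
  apply: wpc_asg.
  rewrite [X in wpc _ _ _ _ _ _ X _](_ : _ = [seq wenv L j x.2 0 0 0 0 0 x.1 | x <- IL (L - j.+1)]); last first.
    by rewrite -(IL_up hh) -hLj -[in RHS]map_comp.
  have hnode x : x \in IL (L - j.+1) -> [/\ x.1 \in Z, 2 ^ (L - j.+1) <= x.2, x.2 < 2 ^ (L - j), tr (u x.1) x.2 & x.2 < N].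
    by case: x => z nd; rewrite mem_IL -hLj => /and3P[hz /andP[h1 h2] ht']; split=> //=; apply: leq_trans h2 hle2.
  pose H z nd := M2' kH (z * (N + N) + nd).
  have inj : inj_fam (IL (L - j.+1)) xpredT (fun x => x.1 * (N + N) + x.2).
    move=> [z nd] [z' nd'] /hnode[_ _ _ _ h1] /hnode[_ _ _ _ h2] _ _ /= h.
    by have [-> ->] := @row_inj (N + N) z z' nd nd' (ltac:(simpl in *; lia)) (ltac:(simpl in *; lia)) h.
  apply: (@wpc_wr _ _ _ _ _ _ xpredT (fun x => x.1 * (N + N) + x.2)
     (fun x => maxn (H x.1 (2 * x.2)) (H x.1 (2 * x.2 + 1)))).
  + exact: uniq_IL.
  + exact: inj.
  + by [].
  + by [].
  + move=> [z nd] hx _ /=; rewrite -/(H z (2 * nd)) -/(H z (2 * nd + 1)).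
    have h1 := hle (z * (N + N) + 2 * nd); have h2 := hle (z * (N + N) + (2 * nd + 1)).
    by rewrite -/(H z _) in h1; rewrite -/(H z _) in h2; move: (H z _) (H z _) h1 h2; clear => a b; lia.
  set M3' := wfam _ _ _ _ _ _.
  have hin z nd : (z, nd) \in IL (L - j.+1) -> M3' kH (z * (N + N) + nd) = maxn (H z (2 * nd)) (H z (2 * nd + 1)).
    by move=> hx; have := @wfam_in _ _ _ _ (fun x => maxn (H x.1 (2 * x.2)) (H x.1 (2 * x.2 + 1))) kH M2' _ (uniq_IL _) inj hx isT.
  have hout z nd : nd < N + N -> (z, nd) \notin IL (L - j.+1) -> M3' kH (z * (N + N) + nd) = H z nd.
    move=> hnd hx; rewrite /M3' wfam_out // => _ [z' nd'] hx' _ /= h; have [_ _ _ _ h1] := hnode _ hx'.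
    have [ez en'] := @row_inj (N + N) z' z nd' nd (ltac:(simpl in *; lia)) hnd h.
    by rewrite -ez -en' hx' in hx.
  have hlow z nd : 2 ^ (L - j) <= nd -> (z, nd) \notin IL (L - j.+1).
    by move=> h; apply/negP => /hnode[_ _ h1 _ _]; move: h1 => /=; lia.
  split; first by rewrite all_map; apply/allP=> x _ /=; rewrite !eqxx.
  split.
  + by rewrite /wr_cost /=; lia.
  + by move=> k hk'; rewrite /M3' wfam_other // hk.
  + by apply: wfam_le => [x hx _|//]; rewrite geq_max !hle.
  + split=> z nd hz hnd.
      move=> hc; rewrite hout // ?/H ?hun //; last first.
        apply/negP => /hnode[_ h1 h2 h3' h4]; simpl in *; move: hc; rewrite h3' orbF; lia.
      by move: hc => /orP[/orP[h|->]|->]; rewrite ?orbT // (leq_trans h) // leq_exp2l //; lia.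
    have hc1 : 2 * nd < N + N by lia.
    have hc2 : 2 * nd + 1 < N + N by lia.
    rewrite [in RHS]hout //; last by apply: hlow; lia.
    rewrite [in RHS](@hout z (2 * nd + 1)) //; last by apply: hlow; lia.
    case: (ltnP nd (2 ^ (L - j))) => hlt; last by rewrite hout ?hlow //; [apply: hhp => //; lia | lia].
    case: (boolP (tr (u z) nd)) => ht'.
      by rewrite hin // mem_IL hz -hLj ht' hlt; lia.
    have hnd0 : 0 < nd < N by have := expn_gt0 2 (L - j.+1); lia.
    have := htr (ult hz) hnd0; rewrite (negbTE ht') => /esym/norP[t1 t2].
    rewrite hout; [|lia|by apply/negP => /hnode[_ _ _ h1 _]; move: h1 => /=; rewrite (negbTE ht')].
    by rewrite /H !hun ?hlt ?t1 ?t2 ?orbT //; [apply: hn | lia].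
  + by rewrite -map_comp.
- move=> M' E t' [ht hk hle [hun hhp] ->]; rewrite subnn in hhp *; apply: hQ => //.
  + by rewrite /tup; lia.
  + by move=> z nd hz hnd; apply: hun => //; [lia | apply/orP; left; apply/orP; right; lia].
Qed.

Definition trelax := tforkout + 2 + tleaf + tup + 20.

(** The tree of u has to contain the leaf of u itself, for otherwise no processor would be there to
    delete its key. *)
Lemma wpc_relax (Q : assertion) t : kH <> 3 -> (forall u, u < N -> tr u (N + u)) ->
  (forall M' t', t' <= t + trelax -> (forall k, k <> kH -> k <> 7 -> M' k = M k) ->
     (forall a, a %/ N \notin Z -> M' 7 a = M 7 a) ->
     (forall a, M' 7 a <= N) -> (forall a, M' kH a <= KB) ->
     (forall z v, z \in Z -> v < N -> M' 7 (z * N + v) =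
        if [&& wl, cc z v & K z v < s z - g (u z) v] then newL z v else M 7 (z * N + v)) ->
     heap (M' kH) newK -> Q M' (map (lenv k0 t0 x0) Z) t') ->
  wpc OFF coins cap (RELAX kH cnd zs wl) Q M (map (lenv k0 t0 x0) Z) t.
Proof.
move=> hk3 hself hQ; have N0 : 0 < N by rewrite hN expn_gt0.
rewrite /RELAX; apply: wpc_seq; apply: (@wpc_forkout k0 t0 x0); first by move=> z nd hz hnd; rewrite M3 ?ult.
move=> t1 ht1.
apply: wpc_seq; apply: wpc_leaf => M1 t2 ht2 hk h7o h7le hHle h7in hleaf hunch.
apply: wpc_seq; apply: wpc_up => //.
- by move=> w nd hw hnd; rewrite hk ?M3 //; move/esym.
- move=> z nd hz hnd ht; have := htr (ult hz) hnd; rewrite (negbTE ht) => /esym/norP[t1' t2'].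
  rewrite !hunch ?negb_and ?t1' ?t2' ?ht ?orbT //; try lia.
  by have [_ ->] := hH hz.
move=> M' t' ht' hk' hHle' hlv hhp; rewrite IL0 -map_comp.
do 2 (apply: wpc_seq; apply: wpc_asg); apply: wpc_asg.
rewrite [X in Q M' X _](_ : _ = map (lenv k0 t0 x0) Z) //; apply: hQ => //.
- by rewrite /trelax /=; lia.
- by move=> k h1 h2; rewrite hk' ?hk.
- by move=> a ha; rewrite hk' ?h7o // => /esym.
- by move=> a; rewrite hk' ?h7le // => /esym.
- by move=> z v hz hv; rewrite hk' ?h7in // => /esym.
- move=> z hz; split=> [v hv|nd hnd]; last exact: hhp.
  rewrite hlv //; last by lia.
  case: (boolP (tr (u z) (N + v))) => ht; first exact: hleaf.
  rewrite hunch ?negb_and ?ht ?orbT //; last by lia.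
  have [-> // _] := hH hz; rewrite /newK.
  have hne : (v == u z) = false by apply/negP => /eqP e; case/negP: ht; rewrite e hself // ult.
  rewrite hne andbF; case: ifP => // hc; case/negP: ht; apply: htrg => //; [exact: ult|exact: hcc].
Qed.

End Step.

End Relax.

(** * Dijkstra's algorithm *)

Section Dijkstra.
Variables (N BIG : nat) (g : nat -> nat -> nat).
Hypothesis hg : forall u v, g u v != 0 -> [&& 0 < u, 0 < v, u < N, v < N & u != v].

(* [D] holds the scores of the settled vertices, [K] those of the vertices in the queue. *)
Definition dinv (A : rel nat) (D K : nat -> nat) :=
  [/\ forall v, v < N -> D v <= BIG, forall v, v < N -> K v <= BIG,
      forall v, v < N -> 0 < D v -> K v = 0,
      forall u v, u < N -> v < N -> 0 < D u -> K v <= D u &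
      forall u v, u < N -> v < N -> 0 < D u -> A u v -> D u - g u v <= maxn (D v) (K v)].

Definition settle (u s : nat) (D : nat -> nat) v := if (s != 0) && (v == u) then s else D v.

Definition requeue (A : rel nat) (u s : nat) (D K : nat -> nat) v :=
  if v == u then 0 else if A u v && (D v == 0) then maxn (K v) (s - g u v) else K v.

Definition extracted (K : nat -> nat) (u s : nat) :=
  [/\ u < N, s = K u, s != 0 \/ u = 0 & forall v, v < N -> K v <= s].

(* [lab] is the first vertex after [z] on the path that gives a vertex its score. *)
Definition dwit z (D K lab : nat -> nat) :=
  [/\ maxn (D z) (K z) = BIG, lab z = 0, forall v, v < N -> maxn (D v) (K v) = 0 -> lab v = 0 &
   forall v, v < N -> v <> z -> 0 < maxn (D v) (K v) -> exists p,
    [/\ path (ge g) z (lab v :: p), last (lab v) p = v, z \notin lab v :: p &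
        glen g z (lab v :: p) <= BIG - maxn (D v) (K v)]].

Lemma extend_path z b p v w : path (ge g) z (b :: p) -> last b p = v -> z \notin b :: p -> ge g v w -> w <> z ->
  [/\ path (ge g) z (b :: rcons p w), last b (rcons p w) = w, z \notin b :: rcons p w &
      glen g z (b :: rcons p w) = glen g z (b :: p) + g v w].
Proof.
move=> h1 h2 h3 h4 h5; split.
- by rewrite -rcons_cons rcons_path h1 [last _ _]h2 h4.
- by rewrite last_rcons.
- by rewrite -rcons_cons mem_rcons inE (negbTE h3) orbF; apply/eqP => e; case: h5.
- by rewrite -cats1 -cat_cons glen_cat [last _ _]h2 /glen /= addn0.
Qed.

(** The labels are those of the first run and stay fixed. A detour starts with a vertex other than
    the label of its end. *)
Definition ewit z (lab D K : nat -> nat) := forall v, v < N -> 0 < maxn (D v) (K v) -> v <> z /\ exists b p,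
    [/\ path (ge g) z (b :: p), last b p = v, b <> lab v, z \notin b :: p &
        glen g z (b :: p) <= BIG - maxn (D v) (K v)].

Section Step.
Variables (A : rel nat) (D K : nat -> nat) (u s : nat).
Hypothesis hA : forall u v, A u v -> g u v != 0.
Hypothesis hinv : dinv A D K.
Hypothesis hext : extracted K u s.
Let D' := settle u s D.
Let K' := requeue A u s D' K.

Lemma hA0 v : A 0 v = false.
Proof. by apply/negP => /hA/hg. Qed.

Lemma unsettled : s != 0 -> D u = 0.
Proof.
move=> hs; have [hu es _ _] := hext; have [_ _ hex _ _] := hinv.
by apply/eqP; rewrite -leqn0 leqNgt; apply/negP => /(hex _ hu); rewrite -es => e; rewrite e in hs.
Qed.

(** An empty queue yields the isolated vertex 0, and processing it changes nothing. So every source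
    can run exactly N phases, as lock step demands. *)
Lemma dijkstra_idle : s = 0 -> (forall v, v < N -> D' v = D v) /\ (forall v, v < N -> K' v = K v).
Proof.
move=> es; have [hu eK hs0 hmax] := hext; have eu : u = 0 by case: hs0 => //; rewrite es.
split=> v hv; rewrite /K' /D' /requeue /settle es //=.
have := hmax v hv; rewrite eu hA0 es leqn0 => /eqP ->; by case: ifP.
Qed.

Lemma dijkstra_ge v : v < N -> maxn (D v) (K v) <= maxn (D' v) (K' v).
Proof.
move=> hv; case: (posnP s) => hs; first by have [h1 h2] := dijkstra_idle hs; rewrite h1 // h2.
rewrite /K' /D' /requeue /settle; have [hu eK _ hmax] := hext; rewrite -lt0n hs /=.
by case: eqP => [->|_]; [rewrite unsettled ?lt0n // -?lt0n // -eK; lia | case: ifP => _; lia].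
Qed.

Lemma dijkstra_inv : dinv A D' K'.
Proof.
case: (posnP s) => hs.
  have [h1 h2] := dijkstra_idle hs; have [i1 i2 i3 i4 i5] := hinv.
  by split; move=> *; rewrite ?h1 ?h2 //; [apply: i1|apply: i2|apply: i3; rewrite -?h1 |apply: i4; rewrite -?h1|apply: i5; rewrite -?h1].
have hge := dijkstra_ge; have hu0 := unsettled (lt0n_neq0 hs).
have [hu eK _ hmax] := hext; have [i1 i2 i3 i4 i5] := hinv.
have eD v : D' v = if v == u then s else D v by rewrite /D' /settle -lt0n hs.
have hK'le v : v < N -> K' v <= s.
  move=> hv; rewrite /K' /requeue; case: eqP => // _; have := hmax v hv; case: ifP => _; lia.
have sB : s <= BIG by rewrite eK i2.
split.
- by move=> v hv; rewrite eD; case: ifP => // _; apply: i1.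
- by move=> v hv; apply: leq_trans (hK'le v hv) sB.
- move=> v hv; rewrite /K' /requeue eD; case: (v =P u) => // h1 h.
  by rewrite (gtn_eqF h) andbF i3.
- move=> w v hw hv; rewrite eD; case: eqP => [_ _|_ h]; first exact: hK'le.
  by apply: leq_trans (hK'le v hv) _; rewrite eK; apply: i4.
- move=> w v hw hv; rewrite eD; case: (w =P u) => [->|_] h hwv; last exact: leq_trans (i5 _ _ hw hv h hwv) (hge v hv).
  rewrite eD /K' /requeue; case: (v =P u) => [e|hvu].
    by move: (hg (hA hwv)); rewrite e eqxx !andbF.
  rewrite hwv eD (introF eqP hvu) /=.
  case: (posnP (D v)) => [->|h0] /=; first by lia.
  by have := i4 v u hv hu h0; rewrite -eK; lia.
Qed.

(** A vertex is settled at most once. With [o] the out-degree, the sum is a budget that pays for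
    relaxing its edges. *)
Lemma settle_count (o : nat -> nat) :
  \sum_(v < N) (D' v != 0) * o v = \sum_(v < N) (D v != 0) * o v + (s != 0) * o u.
Proof.
have [hu _ _ _] := hext; case: (posnP s) => hs.
  have [h1 _] := dijkstra_idle hs; rewrite addn0; apply: eq_bigr => v _; by rewrite h1.
rewrite (bigD1 (Ordinal hu)) //= [X in _ = X + _](bigD1 (Ordinal hu)) //= unsettled -?lt0n // mul0n add0n.
have eDu : D' u = s by rewrite /D' /settle eqxx -lt0n hs.
rewrite eDu hs !mul1n addnC; congr addn.
by apply: eq_bigr => v hv; rewrite /D' /settle (introF eqP (_ : v <> u :> nat)) ?andbF // => e; case/eqP: hv; apply: val_inj.
Qed.

Lemma dijkstra_wit z lab (lab' : nat -> nat) : z < N -> s <= BIG ->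
  (forall v, A u v = (g u v != 0)) ->
  (forall v, v < N -> lab' v = if A u v && (D' v == 0) && (K v < s - g u v) then (if u == z then v else lab u) else lab v) ->
  dwit z D K lab -> dwit z D' K' lab'.
Proof.
move=> hz sB hAu hlab [w1 w2 w3 w4]; have hge := dijkstra_ge; have [i1 i2 i3 i4 i5] := hinv.
have [j1 j2 j3 j4 j5] := dijkstra_inv.
have [hu eK hs0 hmax] := hext.
have eD v : D' v = if (s != 0) && (v == u) then s else D v by [].
(* The source has the maximal score [BIG], so no edge can improve it. *)
have impz : A u z && (D' z == 0) && (K z < s - g u z) = false.
  apply/negP => /andP[/andP[_ /eqP h1] h2]; have := j1 z hz; have := i2 z hz.
  move: h1; rewrite eD; case: ifP => [/andP[/negP h3 _] /eqP //|_ h1]; rewrite h1 max0n in w1; lia.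
have same v : v < N -> A u v && (D' v == 0) && (K v < s - g u v) = false -> maxn (D' v) (K' v) = maxn (D v) (K v).
  move=> hv himp; case: (posnP s) => hs; first by have [h1 h2] := dijkstra_idle hs; rewrite h1 // h2.
  rewrite /K' /requeue eD -lt0n hs /=; move: himp; case: (v =P u) => [->|_] himp.
    by rewrite unsettled -?lt0n // -eK; lia.
  case: ifP => // h; move: himp; rewrite eD (introF eqP (_ : v <> u)) ?andbF; last by move=> e; move: h; rewrite e => /andP[/hA/hg]; rewrite eqxx !andbF.
  by rewrite h /=; lia.
split.
- by rewrite same // impz.
- by rewrite hlab // impz.
- move=> v hv h; have h1 : maxn (D v) (K v) = 0 by have := hge v hv; lia.
  rewrite hlab //; case: ifP => [/andP[/andP[h2 h3] h4]|_]; last exact: w3.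
  move: h; rewrite /K' /requeue h2 h3 /=; case: eqP => [e|_]; last by lia.
  by move: (hA h2) => /hg; rewrite e eqxx !andbF.
- move=> v hv hvz; rewrite hlab //; case: ifP => [/andP[/andP[h2 h3] h4] _|himp]; last by rewrite same //; apply: w4.
  have hg2 := hA h2; have hvu : v <> u by move=> e; move: (hg hg2); rewrite e eqxx !andbF.
  have -> : maxn (D' v) (K' v) = s - g u v.
    by rewrite (eqP h3) max0n /K' /requeue (introF eqP hvu) h2 h3 /=; lia.
  have hs : s != 0 by lia.
  case: (u =P z) => [eu|hne].
    exists [::]; rewrite /= -eu /ge hg2 inE; split=> //; first by apply/eqP => e; case: hvu.
    have es : s = BIG by move: w1; rewrite -eu unsettled // max0n -eK.
    by rewrite /glen /= addn0 es; lia.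
  have [|p [p1 p2 p3 p4]] := w4 u hu hne; first by rewrite -eK; lia.
  have [q1 q2 q3 q4] := extend_path p1 p2 p3 hg2 hvz.
  exists (rcons p v); split=> //; rewrite q4; move: p4; rewrite unsettled // max0n -eK; lia.
Qed.

Lemma dijkstra_ewit z lab : s <= BIG -> (forall v, A u v -> v <> z /\ lab u = lab v) ->
  ewit z lab D K -> ewit z lab D' K'.
Proof.
move=> sB hAu hw v hv h0; have [i1 i2 i3 i4 i5] := hinv; have [hu eK hs0 hmax] := hext.
case: (posnP s) => hs; first by have [h1 h2] := dijkstra_idle hs; move: h0; rewrite h1 // h2 //; apply: hw.
have eD w : D' w = if w == u then s else D w by rewrite /D' /settle -lt0n hs.
case imp : (A u v && (D' v == 0) && (K v < s - g u v)); last first.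
  have e : maxn (D' v) (K' v) = maxn (D v) (K v).
    rewrite /K' /requeue eD; move: imp; case: (v =P u) => [->|hne] himp.
      by rewrite unsettled -?lt0n // -eK; lia.
    case: ifP => // h; move: himp; rewrite eD (introF eqP hne) h /=; lia.
  by move: h0; rewrite e; apply: hw.
move: imp => /andP[/andP[h2 h3] h4]; have [hvz hl] := hAu _ h2.
have hg2 := hA h2; have hvu : v <> u by move=> e; move: (hg hg2); rewrite e eqxx !andbF.
have -> : maxn (D' v) (K' v) = s - g u v.
  by rewrite (eqP h3) max0n /K' /requeue (introF eqP hvu) h2 h3 /=; lia.
have [|huz [b [p [p1 p2 p3 p4 p5]]]] := hw u hu; first by rewrite -eK; lia.
have [q1 q2 q3 q4] := extend_path p1 p2 p4 hg2 hvz.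
split=> //; exists b, (rcons p v); split=> //; first by rewrite -hl.
by rewrite q4; move: p5; rewrite unsettled -?lt0n // max0n -eK; lia.
Qed.

End Step.

(** Either every phase so far has settled a vertex, and N phases settle them all, or the queue has
    already run empty. *)
Lemma queue_empty (D K : nat -> nat) A j : dinv A D K -> N <= j ->
  (j <= \sum_(v < N) (D v != 0) \/ forall v, v < N -> K v = 0) -> forall v, v < N -> K v = 0.
Proof.
move=> [_ _ hex _ _] hj [hc|//] v hv; apply: hex => //; rewrite lt0n; apply/negP => /eqP h0.
have : \sum_(v < N) (D v != 0) < N.
  rewrite (bigD1 (Ordinal hv)) //= h0 add0n.
  apply: (@leq_ltn_trans (\sum_(i < N | i != Ordinal hv) 1)); first by apply: leq_sum => i _; case: (_ != _).
  by rewrite sum1_card cardC1 card_ord; lia.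
lia.
Qed.

(** A crossing edge turns the shortest path to its tail into a detour to its head: that path starts
    with the label of the tail, which is not the label of the head. *)
Lemma seed_ewit z lab D (K K' : nat -> nat) u : z < N -> u < N -> D z = BIG -> (forall v, v < N -> D v <= BIG) ->
  dwit z D (fun=> 0) lab ->
  (forall v, v < N -> K' v = if [&& g u v != 0, v != z & (if u == z then v else lab u) != lab v]
      then maxn (K v) (D u - g u v) else K v) ->
  ewit z lab (fun=> 0) K -> ewit z lab (fun=> 0) K'.
Proof.
move=> hz hu hDz hD [_ _ _ w4] hK' hw v hv; rewrite max0n hK' //; case: ifP => [/and3P[h1 /eqP h2 /eqP h3]|_ h]; last first.
  by have := hw v hv; rewrite max0n; apply.
case: (leqP (D u - g u v) (K v)) => hc; first by have := hw v hv; rewrite max0n; apply.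
move=> _; split=> //; case: (u =P z) => [eu|hne].
  rewrite eu eqxx in h3; exists v, [::]; rewrite /= /ge -eu h1 inE; split=> //.
    by rewrite eu; apply/eqP => e; case: h2.
  have e : D u = BIG by rewrite eu.
  by rewrite /glen /= addn0 e; lia.
rewrite (introF eqP hne) in h3.
have [|p [p1 p2 p3 p4]] := w4 u hu hne; first by rewrite maxn0; lia.
have [q1 q2 q3 q4] := extend_path p1 p2 p3 h1 h2.
by exists (lab u), (rcons p v); split=> //; rewrite q4; move: p4; rewrite maxn0; have := hD u hu; lia.
Qed.

End Dijkstra.

(** * Shortest paths from many sources *)

Arguments wp : simpl never.

(** The analogue of [wpc_for] with work recorded, for loops whose rounds use varying numbers of
    processors. *)
Lemma wp_for OFF coins (I : nat -> state -> Prop) k i l s (Q : state -> Prop) M E t w :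
  I 0 (St M [seq set_nth 0 v i 0 | v <- E] (t + 2) (w + 2 * size E)) ->
  (forall j st, j <= k -> I j st -> all (fun v => (nth 0 v i == j) && (nth 0 v l == k)) (env st)) ->
  (forall j M E t w, j < k -> I j (St M E t w) ->
     wp OFF coins s (fun st => all (fun v => (nth 0 v i == j) && (nth 0 v l == k)) (env st) /\
       I j.+1 (St (smem st) [seq set_nth 0 v i j.+1 | v <- env st] (tm st + 6) (wk st + 6 * size (env st))))
       (St M E (t + 2) (w + 2 * size E))) ->
  (forall M E t w, I k (St M E t w) -> Q (St M E (t + 2) (w + 2 * size E))) ->
  wp OFF coins (For i l s) Q (St M E t w).
Proof.
move=> h0 hall hs hQ.
rewrite -[wp _ _ _ _ _]/(exists d, wpw OFF (wp OFF coins (s ;; Asg i (EMin (V i + 1) (V l)))) (V l - V i)%X Q d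
  (St M [seq set_nth 0 v i 0 | v <- E] (t + 2) (w + 2 * size E))).
move: [seq set_nth 0 v i 0 | v <- E] (t + 2) (w + 2 * size E) h0 => {}E {}t {}w h0.
exists k; have : forall d j M E t w, d + j = k -> I j (St M E t w) ->
  wpw OFF (wp OFF coins (s ;; Asg i (EMin (V i + 1) (V l)))) (V l - V i)%X Q d (St M E t w); last first.
  by move/(_ k 0 M E t w); rewrite addn0; apply.
clear h0 M E t w; elim=> [|d ih] j M E t w hd hI.
  have hj : j = k by [].
  subst j; have ha := hall _ _ (leqnn _) hI.
  split; last exact: hQ.
  by apply: sub_all ha => v /andP[/eqP e1 /eqP e2]; rewrite /= e1 e2 subnn.
have hjk : j < k by lia.
have ha := hall _ _ (ltnW hjk) hI.
split; first by apply: sub_all ha => v /andP[/eqP e1 /eqP e2]; rewrite /= e1 e2; lia.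
apply: wp_mono (hs _ _ _ _ _ hjk hI) => -[M1 E1 t1 w1] /= [ha1 hI1].
have -> : [seq set_nth 0 v i (nth 0 v l - (nth 0 v l - (nth 0 v i + 1))) | v <- E1] = [seq set_nth 0 v i j.+1 | v <- E1].
  by apply/eq_in_map => v /(allP ha1)/andP[/eqP-> /eqP->]; congr set_nth; lia.
rewrite /tick /= size_map; move: hI1; rewrite -(addnA t1) -(addnA w1) -mulnDl => hI1.
by apply: (ih j.+1) => //; lia.
Qed.

(** The root encodes the vertex to settle as score * N + vertex. The value of [add] is added to the
    root: in phase 0 of the first run it simulates a queue that holds the source with score [BIG],
    while the tree is still empty. *)
Definition PHASE (kH kD : nat) (cnd : expr) (wl : nat) (add : expr) : stmt :=
  Asg 22 (EMin (ERd kH (V 13 * (vN + vN) + 1) + add) vKB) ;; Asg 14 (EMod (V 22) vN) ;; Asg 15 (V 22 / vN) ;;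
  Wr kD (V 22) (V 13 * vN + V 14) (EMin (V 15) vBIG) ;; RELAX kH cnd 1 wl.

(** * Lock-step phases for all sources with amortized work *)

Section Phases.
Variables (OFF : nat) (coins : nat -> nat -> bool) (c : ctl).
Notation N := (cN c).
Notation L := (cL c).
Notation BIG := (cBIG c).
Notation KB := (cKB c).
Hypothesis hN : N = 2 ^ L.
Hypothesis hKB : KB = BIG * N + N.
Variables (g : nat -> nat -> nat) (tr : nat -> nat -> bool).
Hypothesis hg : forall u v, g u v != 0 -> [&& 0 < u, 0 < v, u < N, v < N & u != v].
Hypothesis htr : forall u nd, u < N -> 0 < nd < N -> tr u nd = tr u (2 * nd) || tr u (2 * nd + 1).
Hypothesis htr1 : forall u, u < N -> tr u 1.
Hypothesis hleaf : forall u v, u < N -> v < N -> tr u (N + v) = (g u v != 0) || (v == u).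
Variable (Z : seq nat).
Hypothesis Zu : uniq Z.
Hypothesis Zlt : forall z, z \in Z -> z < N.

Let N0 : 0 < N. Proof. by rewrite hN expn_gt0. Qed.

Definition outdeg u := size (nodes (tr u) L).

(** Only the leaf of vertex 0 itself is marked. An idle phase therefore needs a single leaf per
    source. *)
Lemma outdeg0 : outdeg 0 = 1.
Proof.
have e : nodes (tr 0) L = [:: N]; last by rewrite /outdeg e.
rewrite /nodes -hN (@eq_in_filter _ _ (pred1 N)); first by rewrite filter_pred1_uniq ?iota_uniq // mem_iota; lia.
move=> nd; rewrite mem_iota => hnd; rewrite (_ : nd = N + (nd - N)); last by lia.
rewrite hleaf //; last by lia.
by case: (boolP (g 0 _ != 0)) => [/hg //|_] /=; lia.
Qed.

Lemma size_ILE (u : nat -> nat) : size (IL tr Z u L) = \sum_(z <- Z) outdeg (u z).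
Proof. by rewrite size_allpairs_dep sumnE big_map. Qed.

(** By induction from the leaves to the root, each node dominates all leaves below it and is 0 or
    equal to the key of some leaf. *)
Lemma heap_extract H K z : heap c Z H K -> (forall v, v < N -> K z v <= BIG) -> z \in Z ->
  extracted N (K z) (H (z * (N + N) + 1) %% N) (H (z * (N + N) + 1) %/ N) /\ H (z * (N + N) + 1) <= BIG * N + N.
Proof.
move=> hH hK hz; have [hl hn] := hH z hz.
have main d nd : N + N - nd <= d -> 0 < nd < N + N ->
   (forall i v, v < N -> (N + v) %/ 2 ^ i = nd -> enc c (K z v) v <= H (z * (N + N) + nd)) /\
   (H (z * (N + N) + nd) = 0 \/ exists2 v, v < N & H (z * (N + N) + nd) = enc c (K z v) v).
  elim: d nd => [|d ih] nd hd hnd; first by lia.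
  case: (ltnP nd N) => hndN; last first.
    have -> : nd = N + (nd - N) by lia.
    have hv : nd - N < N by lia.
    rewrite hl //; split; last by right; exists (nd - N).
    move=> [|i] v hv'; first by rewrite expn0 divn1 => /addnI ->.
    move=> e; have : (N + v) %/ 2 ^ i.+1 <= (N + v) %/ 2 by rewrite leq_div2l // -{1}(expn1 2) leq_exp2l.
    lia.
  rewrite hn; last by lia.
  have [a1 a2] := ih (2 * nd) ltac:(lia) ltac:(lia); have [b1 b2] := ih (2 * nd + 1) ltac:(lia) ltac:(lia).
  split; last first.
    by case: (leqP (H (z * (N + N) + 2 * nd)) (H (z * (N + N) + (2 * nd + 1)))) => _; [exact: b2|exact: a2].
  move=> [|i] v hv; first by rewrite expn0 divn1; lia.
  rewrite expnS mulnC divnMA => e.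
  have /orP[/eqP e'|/eqP e'] : ((N + v) %/ 2 ^ i == 2 * nd) || ((N + v) %/ 2 ^ i == 2 * nd + 1) by lia.
    by rewrite leq_max (a1 i).
  by rewrite leq_max (b1 i) ?orbT.
have [m1 m2] := main _ 1 (leqnn _) ltac:(lia).
have hmax v : v < N -> enc c (K z v) v <= H (z * (N + N) + 1).
  move=> hv; apply: (m1 L) => //; rewrite -hN divnD // divnn N0 divn_small // modnn modn_small //.
  by rewrite (_ : N <= 0 + v = false) //; lia.
move: (H _) m2 hmax => r m2 hmax.
have hz0 v : v < N -> r = 0 -> K z v = 0.
  by move=> hv e; have := hmax v hv; rewrite e /enc; case: eqP => // _; nia.
case: m2 => [e|[v hv e]].
  rewrite e mod0n div0n; split=> //; split=> //; [by rewrite hz0|by right|].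
  by move=> v hv; rewrite hz0.
case: (K z v =P 0) => [h0|/eqP h0].
  have er : r = 0 by rewrite e /enc h0.
  rewrite er mod0n div0n; split=> //; split=> //; [by rewrite hz0|by right|].
  by move=> b hb; rewrite hz0.
have er : r = K z v * N + v by rewrite e /enc (negbTE h0).
have e1 : r %% N = v by rewrite er modnMDl modn_small.
have e2 : r %/ N = K z v by rewrite er divnMDl // divn_small // addn0.
rewrite e1 e2; split; last by rewrite er; have := hK v hv; nia.
split=> //; first by left.
move=> b hb; have := hmax b hb; rewrite /enc er; case: eqP => [->//|_] h.
by have := leq_div2r N h; rewrite !divnMDl // !divn_small // !addn0.
Qed.

Section Run.
Variables (kH kD : nat) (cnd add : expr) (wl : bool) (A : nat -> rel nat) (addv : nat -> nat -> nat)
  (X : nat -> (nat -> nat) -> (nat -> nat) -> (nat -> nat) -> Prop) (M0 : nat -> nat -> nat).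
Hypothesis hkH : [&& kH != 7, kH != 3, kH != 2 & kH != kD].
Hypothesis hkD : [&& kD != 7, kD != 3 & kD != 2].
Hypothesis hadd : forall M k t x u s z j, z \in Z -> t z = j -> eval OFF M (lenv c u s k t x z) add = addv j z.
Hypothesis hadd0 : forall j z, 0 < j -> addv j z = 0.
Hypothesis hcnd : forall M k t x u s z v old, z \in Z -> v < N -> u z < N ->
  (forall k, k <> kH -> k <> kD -> k <> 7 -> M k = M0 k) -> (~~ wl -> M 7 = M0 7) ->
  eval OFF M (wenv c u s k t x L L (N + v) v old 0 0 0 z) cnd = A z (u z) v && (M kD (z * N + v) == 0).
Hypothesis hA : forall z u v, z \in Z -> A z u v -> g u v != 0.
Hypothesis hX : forall z D K lab u s, z \in Z -> dinv N BIG g (A z) D K -> extracted N K u s -> s <= BIG -> X z D K lab ->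
  X z (settle u s D) (requeue g (A z) u s (settle u s D) K)
    (fun v => if [&& wl, A z u v && (settle u s D v == 0) & K v < s - g u v] then (if u == z then v else lab u) else lab v).
Hypothesis M02 : forall u v, u < N -> v < N -> M0 2 (u * N + v) = g u v.
Hypothesis M03 : forall u nd, u < N -> nd < N + N -> M0 3 (u * (N + N) + nd) = tr u nd.

(** [Kc] is what the tree holds and [K] the queue in the abstract algorithm. They may differ at the
    vertex about to be extracted: in phase 0 of the first run the tree is empty but the queue holds
    the source. [X] is the invariant specific to a run. *)
Definition phase_state j (M : nat -> nat -> nat) (D K lab : nat -> nat -> nat) :=
  [/\ forall k, k <> kH -> k <> kD -> k <> 7 -> M k = M0 k, (~~ wl -> M 7 = M0 7),
      (forall a, a %/ N \notin Z -> M 7 a = M0 7 a /\ M kD a = M0 kD a) /\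
      (forall a, M 7 a <= N) /\ (forall a, M kH a <= KB),
      (forall z v, z \in Z -> v < N -> M kD (z * N + v) = D z v /\ M 7 (z * N + v) = lab z v) /\
      (forall z, z \in Z -> dinv N BIG g (A z) (D z) (K z) /\ X z (D z) (K z) (lab z)) &
      (forall z, z \in Z -> j <= \sum_(v < N) (D z v != 0) \/ forall v, v < N -> K z v = 0) /\
      exists Kc, [/\ heap c Z (M kH) Kc,
        forall z v, z \in Z -> v < N -> v <> (M kH (z * (N + N) + 1) + addv j z) %% N -> Kc z v = K z v,
        forall z v, z \in Z -> v < N -> Kc z v <= BIG &
        forall z, z \in Z -> extracted N (K z) ((M kH (z * (N + N) + 1) + addv j z) %% N)
          ((M kH (z * (N + N) + 1) + addv j z) %/ N) /\ M kH (z * (N + N) + 1) + addv j z <= KB]].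

Definition tphase := 200 + cost add + trelax c cnd.

(** Relaxing the edges of a settled vertex is paid by its out-degree, an idle phase by the summand
    [j]. So the work of a phase is its time bound times the increase, up to a constant. *)
Definition potential (D : nat -> nat -> nat) j := \sum_(z <- Z) (\sum_(v < N) (D z v != 0) * outdeg v + j).

Lemma wp_phase j M D K lab k0 u0 s0 t w (Q : state -> Prop) :
  phase_state j M D K lab ->
  (forall M' D' K' lab' k1 u1 s1 t' w', phase_state j.+1 M' D' K' lab' -> t' <= t + tphase ->
     w' <= w + 2 * tphase * (potential D' j.+1 - potential D j) -> potential D j + size Z <= potential D' j.+1 ->
     Q (St M' (map (lenv c u1 s1 k1 (fun=> j) (fun=> N)) Z) t' w')) ->
  wp OFF coins (PHASE kH kD cnd wl add) Q (St M (map (lenv c u0 s0 k0 (fun=> j) (fun=> N)) Z) t w).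
Proof.
move=> [p1 p2 [p3 [p3' p3'']] [p4 p5] [p6 [Kc [q1 q2 q3 q4]]]] hQ.
pose r z := M kH (z * (N + N) + 1) + addv j z.
pose u z := r z %% N; pose s z := r z %/ N.
have hu z : u z < N by rewrite ltn_mod.
have hext z : z \in Z -> extracted N (K z) (u z) (s z) by move=> hz; case: (q4 z hz).
have hrK z : z \in Z -> r z <= KB by move=> hz; case: (q4 z hz).
have sB z : z \in Z -> s z <= BIG.
  by move=> hz; have [hu' -> _ _] := hext z hz; have [_ h _ _ _] := (p5 z hz).1; apply: h.
have srN z : z \in Z -> (s z == 0) = (r z == 0).
  move=> hz; case: (posnP (r z)) => [h|h]; first by rewrite /s h div0n.
  apply/eqP => es; have [_ _ [hh|eu] _] := hext z hz; first by rewrite es in hh.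
  by move: h; rewrite (divn_eq (r z) N) -/(s z) -/(u z) es eu.
pose D' z := settle (u z) (s z) (D z).
pose K' z := requeue g (A z) (u z) (s z) (D' z) (K z).
pose lab' z v := if [&& wl, A z (u z) v && (D' z v == 0) & K z v < s z - g (u z) v] then (if u z == z then v else lab z (u z)) else lab z v.
have ep : potential D' j.+1 = potential D j + \sum_(z <- Z) ((s z != 0) * outdeg (u z) + 1).
  rewrite /potential -big_split /= big_seq [RHS]big_seq; apply: eq_bigr => z hz.
  have := @settle_count N BIG g hg (A z) (D z) (K z) (u z) (s z) (fun a b => @hA z a b hz) (p5 z hz).1 (hext z hz) outdeg.
  by rewrite /D' => ->; rewrite addnS addnA addn1 [in RHS]addnAC.
pose cap := 2 * size (IL tr Z u L).
have hcapE : cap <= 2 * (potential D' j.+1 - potential D j).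
  rewrite ep addKn /cap leq_mul2l size_ILE big_seq [X in _ <= X]big_seq /=; apply: leq_sum => z hz.
  case: (boolP (s z != 0)) => hs; first by rewrite mul1n leq_addr.
  have [_ _ [hh|->] _] := hext z hz; first by rewrite hh in hs.
  by rewrite outdeg0.
have hZc : size Z <= cap.
  rewrite /cap size_ILE -sum1_size; apply: leq_trans (leq_pmull _ _) => //.
  rewrite big_seq [X in _ <= X]big_seq; apply: leq_sum => z hz; rewrite /outdeg.
  have : N + u z \in nodes (tr (u z)) L by rewrite mem_filter hleaf ?hu // eqxx orbT mem_iota -hN leq_addr ltn_add2l hu.
  by case: (nodes _ _).
suff H : wpc OFF coins cap (PHASE kH kD cnd wl add) (fun M' E' t' => [/\ phase_state j.+1 M' D' K' lab', t' <= t + tphase &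
    E' = map (lenv c u s r (fun=> j) (fun=> N)) Z]) M (map (lenv c u0 s0 k0 (fun=> j) (fun=> N)) Z) t.
  apply: wp_mono (wpc_wp w H _) => [[M' E' t' w'] /= [[h1 h2 ->] h3 _ h4]|]; last by rewrite size_map.
  apply: (hQ M' D' K' lab') => //; last first.
    by rewrite ep leq_add2l -sum1_size; apply: leq_sum => z _; apply: leq_addl.
  apply: leq_trans h4 _; rewrite leq_add2l mulnAC; apply: leq_mul => //; lia.
rewrite /PHASE; apply: wpc_seq; apply: (@wpc_asg_in _ _ _ _ _ _ (lenv c u0 s0 r (fun=> j) (fun=> N))).
  move=> z hz; rewrite evalMin /= (@hadd M k0 (fun=> j) (fun=> N) u0 s0 z j hz erefl) -/(r z).
  by rewrite (minn_idPl (hrK z hz)).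
apply: wpc_seq; apply: (@wpc_asg_in _ _ _ _ _ _ (lenv c u s0 r (fun=> j) (fun=> N))).
  by move=> z hz; rewrite evalMod /=.
apply: wpc_seq; apply: (@wpc_asg_in _ _ _ _ _ _ (lenv c u s r (fun=> j) (fun=> N))).
  by move=> z hz.
have inj : inj_fam Z (fun z => s z != 0) (fun z => z * N + u z).
  by move=> z z' _ _ _ _ /(row_inj (hu z) (hu z')) [].
apply: wpc_seq; apply: (@wpc_wr _ _ _ _ _ _ (fun z => s z != 0) (fun z => z * N + u z) s).
- exact: Zu.
- exact: inj.
- by move=> z hz; rewrite /= srN.
- by [].
- by move=> z hz _; rewrite evalMin /=; apply/minn_idPl/sB.
set M1 := wfam _ _ _ _ _ _.
have [/eqP kH7 /eqP kH3 /eqP kH2 /eqP kHD] := and4P hkH; have [/eqP kD7 /eqP kD3 /eqP kD2] := and3P hkD.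
have M1k k : k <> kD -> M1 k = M k by move=> h; rewrite /M1 wfam_other.
have M1D z v : z \in Z -> v < N -> M1 kD (z * N + v) = D' z v.
  move=> hz hv; rewrite /D' /settle; case: ifP => [/andP[hs /eqP ->]|h].
    exact: (@wfam_in _ _ _ (fun z => z * N + u z) s kD M z Zu inj hz hs).
  rewrite /M1 wfam_out; first by case: (p4 z v hz hv).
  move=> _ z' hz' hs' /(row_inj (hu z') hv) [ez ev]; by move: h; rewrite -ev -ez hs' eqxx.
have hcc z v : z \in Z -> A z (u z) v && (D' z v == 0) -> g (u z) v != 0 by move=> hz /andP[/(hA hz)].
have hgu a : g a a = 0.
  by apply/eqP/negPn/negP => /hg; rewrite eqxx !andbF.
have MH1 : M1 kH = M kH by apply: M1k.
have M71 : M1 7 = M 7 by apply: M1k => /esym.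
have hext' z : z \in Z -> dinv N BIG g (A z) (D' z) (K' z).
  by move=> hz; exact: (@dijkstra_inv N BIG g hg (A z) (D z) (K z) (u z) (s z) (fun a b => @hA z a b hz) (p5 z hz).1 (hext z hz)).
apply: (@wpc_relax OFF coins cap c hN hKB g tr htr htr1 _ Z u s Zu _ _ r (fun=> j) (fun=> N) kH cnd true wl
   (fun z v => A z (u z) v && (D' z v == 0)) Kc M1).
- by move=> a b ha hb hab; rewrite hleaf // hab.
- by [].
- exact: leqnn.
- exact: kH7.
- exact: sB.
- exact: q3.
- by move=> a b ha hb; rewrite M1k ?p1 ?M02 //; [move/esym|move/esym|move/esym].
- by move=> a b ha hb; rewrite M1k ?p1 ?M03 //; [move/esym|move/esym|move/esym].
- by move=> a; rewrite M71.
- by move=> a; rewrite MH1.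
- by rewrite MH1.
- move=> z v old hz hv; rewrite (@hcnd M1) ?M1D //.
    by move=> k h1 h2 h3; rewrite M1k // p1.
  by move=> h; rewrite M71 p2.
- exact: hcc.
- exact: kH3.
- by move=> a ha; rewrite hleaf // eqxx orbT.
move=> M' t' ht' r1 r2 r3 r4 r5 r6; split=> //; last first.
  by move: ht'; rewrite /tphase /wr_cost /=; lia.
have newKE z v : z \in Z -> v < N -> newK g u s true (fun z v => A z (u z) v && (D' z v == 0)) Kc z v = K' z v.
  move=> hz hv; rewrite /newK /K' /requeue /=; case: (v =P u z) => // hne.
  by rewrite (q2 z v hz hv hne).
split.
- by move=> k h1 h2 h3; rewrite r1 // M1k // p1.
- move=> h; apply: funext => a; case: (boolP (a %/ N \in Z)) => ha; last by rewrite r2 // M71 p2.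
  rewrite (divn_eq a N) r5 ?ltn_mod //; first by rewrite (negbTE h) /= M71 p2.
- split; last by split.
  move=> a ha; rewrite r2 // M71; split; first by case: (p3 a ha).
  rewrite r1 //; last by move/esym.
  rewrite /M1 wfam_out; first by case: (p3 a ha).
  by move=> _ z hz _ e; move: ha; rewrite -e divnMDl // divn_small // addn0 hz.
- split=> [z v hz hv|z hz].
    rewrite r1 //; last by move/esym.
    rewrite M1D //; split=> //; rewrite r5 // M71 /lab' /newL M71.
    case: (p4 z v hz hv) => _ ->; case: (p4 z (u z) hz (hu z)) => _ ->.
    case: (v =P u z) => [e|hne]; last by rewrite (q2 z v hz hv hne).
    rewrite (_ : A z (u z) v = false) ?andbF //=.
    by apply/negP => /(hA hz); rewrite e hgu.
  split; first exact: hext'.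
  by apply: hX => //; [case: (p5 z hz)|exact: hext|exact: sB|case: (p5 z hz)].
- split=> [z hz|].
    have := @settle_count N BIG g hg (A z) (D z) (K z) (u z) (s z) (fun a b => @hA z a b hz) (p5 z hz).1 (hext z hz) (fun=> 1).
    rewrite !(eq_bigr (fun i : 'I_N => nat_of_bool (_ != 0)) (fun i _ => muln1 _)) => hcount.
    case: (posnP (s z)) => hs.
      right=> v hv; have [_ _ _ hm] := hext z hz.
      have [_ hi] := @dijkstra_idle N g hg (A z) (D z) (K z) (u z) (s z) (fun a b => @hA z a b hz) (hext z hz) hs.
      rewrite [K' z v]hi //.
      by have := hm v hv; rewrite hs leqn0 => /eqP.
    case: (p6 z hz) => [h|h]; last first.
      by have [hu' e _ _] := hext z hz; move: hs; rewrite e h.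
    by left; rewrite /D' hcount -lt0n hs muln1 addn1 ltnS.
  exists K'; have hK'B z v : z \in Z -> v < N -> K' z v <= BIG by move=> hz hv; have [_ h _ _ _] := hext' z hz; apply: h.
  have hp : heap c Z (M' kH) K'.
    by move=> z hz; have [a1 a2] := r6 z hz; split=> // v hv; rewrite a1 // newKE.
  split=> // z hz; rewrite hadd0 // addn0.
  by have [h1 h2] := heap_extract hp (fun v hv => hK'B z v hz hv) hz; split=> //; rewrite hKB.
Qed.

Lemma potential_le D : potential D N <= size Z * (\sum_(v < N) outdeg v + N).
Proof.
rewrite /potential -sum1_size big_distrl /=; apply: leq_sum => z _; rewrite mul1n leq_add2r.
by apply: leq_sum => v _; case: (_ != _); rewrite ?mul1n.
Qed.

Lemma wp_run M D K lab k0 u0 s0 t0 t w (Q : state -> Prop) :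
  phase_state 0 M D K lab ->
  (forall M' D' K' lab' k1 u1 s1 t' w', phase_state N M' D' K' lab' -> t' <= t + 4 + N * (tphase + 8) ->
     w' <= w + 2 * (tphase + 8) * (size Z * (\sum_(v < N) outdeg v + N)) + 4 * size Z ->
     Q (St M' (map (lenv c u1 s1 k1 (fun=> N) (fun=> N)) Z) t' w')) ->
  wp OFF coins (For 23 24 (PHASE kH kD cnd wl add)) Q (St M (map (lenv c u0 s0 k0 t0 (fun=> N)) Z) t w).
Proof.
move=> hst hQ; apply: (wp_for (I := fun j st => exists D' K' lab' u1 s1 k1, [/\ phase_state j (smem st) D' K' lab',
   env st = map (lenv c u1 s1 k1 (fun=> j) (fun=> N)) Z, tm st <= t + 2 + j * (tphase + 8),
   wk st <= w + 2 * size Z + 2 * (tphase + 8) * (potential D' j - potential D 0) & potential D 0 <= potential D' j]) (k := N)).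
- exists D, K, lab, u0, s0, k0; split=> //=; first by rewrite -map_comp.
  + by rewrite addn0.
  + by rewrite size_map subnn muln0 addn0.
- by move=> j st hj [D' [K' [lab' [u1 [s1 [k1 [_ -> _ _ _]]]]]]]; rewrite all_map; apply/allP => z _ /=; rewrite !eqxx.
- move=> j M1 E1 t1 w1 hj [D1 [K1 [lab1 [u1 [s1 [k1 [/= h1 -> h2 h3 h4]]]]]]]; rewrite size_map.
  apply: wp_phase h1 _ => M2 D2 K2 lab2 k2 u2 s2 t2 w2 h5 h6 h7 h8 /=; split.
    by rewrite all_map; apply/allP => z _ /=; rewrite !eqxx.
  exists D2, K2, lab2, u2, s2, k2; split=> //=; rewrite ?size_map -?map_comp //.
  + by rewrite mulSn; lia.
  + set p0 := potential D 0 in h3 h4 *; set p1 := potential D1 j in h3 h4 h7 h8 *; set p2 := potential D2 j.+1 in h7 h8 *.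
    have -> : p2 - p0 = (p2 - p1) + (p1 - p0) by lia.
    have hab : size Z <= p2 - p1 by lia.
    by move: (p2 - p1) (p1 - p0) (size Z) tphase h3 h7 hab; clear => a b z T h3 h7 hab; lia.
  + by lia.
move=> M1 E1 t1 w1 [D1 [K1 [lab1 [u1 [s1 [k1 [/= h1 -> h2 h3 h4]]]]]]]; apply: (hQ M1 D1 K1 lab1) => //; first by lia.
rewrite size_map; have h5 := potential_le D1.
have h6 : 2 * (tphase + 8) * (potential D1 N - potential D 0) <= 2 * (tphase + 8) * (size Z * (\sum_(v < N) outdeg v + N)).
  by rewrite leq_mul2l; apply/orP; right; apply: leq_trans (leq_subr _ _) h5.
move: h3 h6; clear; lia.
Qed.

End Run.

(** * Seeding the queues of the second run with crossing edges *)

Definition gpos : expr := (1 - (1 - ERd 2 (V 14 * vN + V 17)))%X.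
Definition cndS : expr :=
  (gpos * (1 - EEq (V 17) (V 13)) *
   (1 - EEq (EEq (V 14) (V 13) * V 17 + (1 - EEq (V 14) (V 13)) * ERd 7 (V 13 * vN + V 14)) (ERd 7 (V 13 * vN + V 17))))%X.

Definition SEEDS : stmt :=
  For 23 24 (Asg 14 (V 23) ;; Asg 15 (ERd 6 (V 13 * vN + V 14)) ;; RELAX 8 cndS 0 0).

Section Seeds.
Variables (M0 : nat -> nat -> nat) (D lab : nat -> nat -> nat).
Hypothesis M02 : forall u v, u < N -> v < N -> M0 2 (u * N + v) = g u v.
Hypothesis M03 : forall u nd, u < N -> nd < N + N -> M0 3 (u * (N + N) + nd) = tr u nd.
Hypothesis M06 : forall z v, z \in Z -> v < N -> M0 6 (z * N + v) = D z v.
Hypothesis M07 : forall z v, z \in Z -> v < N -> M0 7 (z * N + v) = lab z v.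
Hypothesis M07N : forall a, M0 7 a <= N.
Hypothesis M08 : forall a, M0 8 a = 0.
Hypothesis hDB : forall z v, z \in Z -> v < N -> D z v <= BIG.
Hypothesis hDz : forall z, z \in Z -> D z z = BIG.
Hypothesis hwit : forall z, z \in Z -> dwit N BIG g z (D z) (fun=> 0) (lab z).

(** For u = z the walk consists of the edge itself, so its first vertex is v. *)
Definition crossing z u v := [&& g u v != 0, v != z & (if u == z then v else lab z u) != lab z v].

Definition seeds_state j (M : nat -> nat -> nat) (K : nat -> nat -> nat) :=
  [/\ forall k, k <> 8 -> M k = M0 k, forall a, M 8 a <= KB, heap c Z (M 8) K,
      forall z v, z \in Z -> v < N -> K z v <= BIG &
      forall z, z \in Z -> ewit N BIG g z (lab z) (fun=> 0) (K z) /\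
        forall u v, u < j -> v < N -> crossing z u v -> D z u - g u v <= K z v].

Definition tseed := 50 + trelax c cndS.

Lemma wp_seeds k0 u0 s0 t0 t w (Q : state -> Prop) :
  (forall M' K' k1 u1 s1 t' w', seeds_state N M' K' -> t' <= t + 4 + N * (tseed + 8) ->
     w' <= w + 2 * (tseed + 8) * (size Z * (\sum_(v < N) outdeg v)) + 4 * size Z ->
     Q (St M' (map (lenv c u1 s1 k1 (fun=> N) (fun=> N)) Z) t' w')) ->
  wp OFF coins SEEDS Q (St M0 (map (lenv c u0 s0 k0 t0 (fun=> N)) Z) t w).
Proof.
have hod v : v < N -> 0 < outdeg v.
  move=> hv; rewrite /outdeg.
  have : N + v \in nodes (tr v) L by rewrite mem_filter hleaf // eqxx orbT mem_iota -hN leq_addr ltn_add2l hv.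
  by case: (nodes _ _).
move=> hQ; apply: (wp_for (I := fun j st => exists K' u1 s1 k1, [/\ seeds_state j (smem st) K',
   env st = map (lenv c u1 s1 k1 (fun=> j) (fun=> N)) Z, tm st <= t + 2 + j * (tseed + 8) &
   wk st <= w + 2 * size Z + 2 * (tseed + 8) * (size Z * (\sum_(0 <= v < j) outdeg v))]) (k := N)).
- exists (fun _ _ => 0), u0, s0, k0; split=> //=; rewrite -?map_comp //.
  + split=> //; first by move=> a; rewrite M08.
      by move=> z hz; split=> [v hv|nd hnd]; rewrite !M08.
  + by rewrite addn0.
  + by rewrite size_map big_geq // !muln0 addn0.
- by move=> j st hj [K' [u1 [s1 [k1 [_ -> _ _]]]]]; rewrite all_map; apply/allP => z _ /=; rewrite !eqxx.
- move=> j M1 E1 t1 w1 hj [K1 [u1 [s1 [k1 [/= [i1 i2 i3 i4 i5] -> h2 h3]]]]]; rewrite size_map.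
  pose cap := 2 * (size Z * outdeg j).
  pose u (_ : nat) := j; pose s z := D z j.
  have hIL : size (IL tr Z u L) = size Z * outdeg j by (rewrite size_ILE /u; elim: (Z) => [|z Z' ih]; rewrite ?big_nil // big_cons ih mulSn).
  have hgu a : g a a = 0 by apply/eqP/negPn/negP => /hg; rewrite eqxx !andbF.
  pose K2 z v := if crossing z j v then maxn (K1 z v) (D z j - g j v) else K1 z v.
  suff H : wpc OFF coins cap (Asg 14 (V 23) ;; Asg 15 (ERd 6 (V 13 * vN + V 14)) ;; RELAX 8 cndS 0 0)
    (fun M' E' t' => [/\ seeds_state j.+1 M' K2, t' <= t1 + 2 + tseed &
    E' = map (lenv c u s k1 (fun=> j) (fun=> N)) Z]) M1 (map (lenv c u1 s1 k1 (fun=> j) (fun=> N)) Z) (t1 + 2).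
    apply: wp_mono (wpc_wp (w1 + 2 * size Z) H _) => [[M' E' t' w'] /= [[e1 e2 ->] e3 _ e4]|]; last first.
      by rewrite size_map /cap; have := hod j hj; nia.
    split; first by rewrite all_map; apply/allP => z _ /=; rewrite !eqxx.
    exists K2, u, s, k1; split=> //; rewrite ?size_map -?map_comp //; first by rewrite mulSn; lia.
    rewrite big_nat_recr //=.
    have e5 : cap * (t' - (t1 + 2)) <= cap * tseed by rewrite leq_mul2l; apply/orP; right; lia.
    have ho := hod j hj; have e6 : size Z <= size Z * outdeg j by rewrite leq_pmulr.
    rewrite /cap in e4 e5; rewrite [size Z * (_ + _)]mulnDr; move: (size Z * outdeg j) e4 e5 e6 => zo e4 e5 e6.
    move: (2 * zo * (t' - (t1 + 2))) e4 e5 => d e4 e5.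
    move: h3 e4 e5 e6; move: (size Z * _) => zs; move: (size Z) tseed => z T; clear; lia.
  apply: wpc_seq; apply: (@wpc_asg_in _ _ _ _ _ _ (lenv c u s1 k1 (fun=> j) (fun=> N))); first by [].
  apply: wpc_seq; apply: (@wpc_asg_in _ _ _ _ _ _ (lenv c u s k1 (fun=> j) (fun=> N))).
    by move=> z hz; rewrite /= i1 // M06.
  apply: (@wpc_relax OFF coins cap c hN hKB g tr htr htr1 _ Z u s Zu _ _ k1 (fun=> j) (fun=> N) 8 cndS false false
     (fun z v => crossing z j v) K1 M1).
  + by move=> a b ha hb hab; rewrite hleaf // hab.
  + by [].
  + by rewrite hIL.
  + by [].
  + by move=> z hz; apply: hDB.
  + exact: i4.
  + by move=> a b ha hb; rewrite i1 ?M02.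
  + by move=> a b ha hb; rewrite i1 ?M03.
  + by move=> a; rewrite i1.
  + exact: i2.
  + exact: i3.
  + move=> z v old hz hv; rewrite /cndS /gpos /crossing /= !i1 // /u M02 // !M07 //.
    rewrite (_ : 1 - (j - z + (z - j)) = (j == z)); last by lia.
    rewrite (_ : 1 - (v - z + (z - v)) = (v == z)); last by lia.
    rewrite (_ : (j == z) * v + (1 - (j == z)) * lab z j = if j == z then v else lab z j); last by case: (j == z); lia.
    move: (if j == z then v else lab z j) (lab z v) (g j v) => a b e.
    rewrite (_ : 1 - (a - b + (b - a)) = (a == b)); last by lia.
    by case: (v == z); case: (a == b); case: e => // e; rewrite ?muln0 ?mul0n ?muln1.
  + by move=> z v hz /and3P[].
  + by [].
  + by move=> a ha; rewrite hleaf // eqxx orbT.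
  move=> M' t' ht' r1 r2 r3 r4 r5 r6; split=> //; last by move: ht'; rewrite /tseed /=; lia.
  have newKE z v : newK g u s false (fun z v => crossing z j v) K1 z v = K2 z v by [].
  split.
  + move=> k hk; case: (k =P 7) => [->|h7]; last by rewrite r1 // i1.
    apply: funext => a; rewrite -(i1 7) //; case: (boolP (a %/ N \in Z)) => ha; last by rewrite r2.
    by rewrite (divn_eq a N) r5 ?ltn_mod.
  + exact: r4.
  + by move=> z hz; have [a1 a2] := r6 z hz; split.
  + move=> z v hz hv; rewrite /K2; case: ifP => _; last exact: i4.
    by rewrite geq_max i4 // (leq_trans (leq_subr _ _)) // hDB.
  + move=> z hz; have [j1 j2] := i5 z hz; split.
      by apply: (@seed_ewit N BIG g z (lab z) (D z) (K1 z) _ j) => //; [exact: Zlt|exact: hDz|move=> v hv; exact: hDB|exact: hwit].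
    move=> a v; rewrite ltnS leq_eqVlt => /orP[/eqP->|ha] hv hc; rewrite /K2; first by rewrite hc leq_maxr.
    by case: ifP => _; rewrite ?leq_max j2.
move=> M1 E1 t1 w1 [K1 [u1 [s1 [k1 [/= h1 -> h2 h3]]]]]; apply: (hQ M1 K1) => //; first by lia.
rewrite size_map; rewrite big_mkord in h3; lia.
Qed.

End Seeds.

End Phases.

(** * Search trees of the out-neighbours *)

Definition cndT : expr := ((vm - vpid) * (1 - EEq (V 14) (V 15)) * EEq (V 15) (EMod (V 23) vN))%X.

(** Different edges may share tree nodes, so marking all paths at once would violate exclusive
    writing. In round i N + h only edges with head h write, each to the ancestor of that leaf i
    levels up in the tree of its tail; distinct edges with the same head have distinct tails. The N
    (L + 1) rounds fit into the time bound. Region 4 flags the tails. *)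
Definition TRIE : stmt :=
  FORK vLM ;; RdIn 14 (idx 2) ;; RdIn 15 (idx 3) ;;
  Asg 14 (EMin (V 14 + 1) vN) ;; Asg 15 (EMin (V 15 + 1) vN) ;; Asg 16 (EMin (vN + V 15) (vN + vN)) ;;
  Asg 24 (vN * (vL + 1)) ;;
  For 23 24 (Wr 3 cndT (V 14 * (vN + vN) + V 16) 1 ;; Wr 4 cndT (V 14) 1 ;;
             Asg 16 (V 16 / (1 + EEq (EMod (V 23 + 1) vN) 0))) ;;
  JOIN.

Definition LEADERS : stmt :=
  FORK vL ;; Asg 16 (EMin (vN + vpid) (vN + vN)) ;; Asg 24 (vL + 1) ;;
  For 23 24 (Wr 3 1 (vpid * (vN + vN) + V 16) 1 ;; Asg 16 (V 16 / 2)) ;;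
  Kill (EEq vpid 0 + ERd 4 vpid) ;; Asg 16 0 ;; Asg 23 0 ;; Asg 24 vN.

Lemma wfam_one (T : eqType) (I : seq T) (c : T -> bool) (ad : T -> nat) k M a : uniq I -> inj_fam I c ad ->
  wfam I c ad (fun=> 1) k M k a = if `[< exists2 x, x \in I & c x /\ ad x = a >] then 1 else M k a.
Proof.
move=> hu hi; case: asboolP => [[x hx [hc <-]]|h]; first exact: (@wfam_in _ I c ad (fun=> 1) k M x).
by apply: wfam_out => _ x hx hc e; apply: h; exists x.
Qed.

Section Tries.
Variables (n : nat) (G : wdigraph n) (es : seq ('I_n * 'I_n)).
Hypothesis hes : lists_edges G es.
Notation m := (size es).
Notation inp := (input G es).
Notation OFF := (3 * m + n * n + 2).
Notation L := (logN n).
Notation N := (2 ^ L).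
Notation LM := (logM m).
Notation g := (gG G).

Let N0 : 0 < N. Proof. by rewrite expn_gt0. Qed.

Definition tl p := (nth 0 inp (3 * p + 2)).+1.
Definition hd p := (nth 0 inp (3 * p + 3)).+1.

Lemma tl_lt p : p < m -> tl p <= n /\ hd p <= n.
Proof.
move=> hp; have d : 'I_n * 'I_n by case: (es) hp => // e.
by rewrite /tl /hd (input_tail G d hp) (input_head G d hp); split; exact: ltn_ord.
Qed.

Lemma tl_N p : p < m -> tl p < N /\ hd p < N.
Proof. by move=> /tl_lt [h1 h2]; have := ltn_logN n; split; apply: leq_ltn_trans (ltn_logN n). Qed.

Lemma edge_inj p p' : p < m -> p' < m -> tl p = tl p' -> hd p = hd p' -> p = p'.
Proof.
move=> hp hp'; have d : 'I_n * 'I_n by case: (es) hp => // e.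
rewrite /tl /hd !(input_tail G d) // !(input_head G d) // => -[e1] -[e2].
have hu : uniq es by rewrite (perm_uniq hes) enum_uniq.
apply/eqP; rewrite -(nth_uniq d hp hp' hu); apply/eqP.
by case: (nth d es p) (nth d es p') e1 e2 => a b [a' b'] /= /val_inj -> /val_inj ->.
Qed.

Lemma edgeP u v : g u v != 0 <-> exists p, [/\ p < m, u = tl p, v = hd p & tl p <> hd p].
Proof.
split=> [h|[p [hp -> ->]]].
  have [x [y [-> -> hE hxy]]] := gG_inv h.
  have /(nthP (x, y)) [i hi ei] : (x, y) \in es by rewrite (perm_mem hes) mem_enum.
  exists i; rewrite /tl /hd (input_tail G (x, y) hi) (input_head G (x, y) hi) ei /=; split=> //.
  by case=> /val_inj e; rewrite e eqxx in hxy.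
have d : 'I_n * 'I_n by case: (es) hp => // e.
rewrite /tl /hd (input_tail G d hp) (input_head G d hp) gGE => hne.
have -> : (nth d es p).1 != (nth d es p).2 by apply/eqP => e; case: hne; rewrite e.
by rewrite -surjective_pairing -(mem_enum (edges G)) -(perm_mem hes) mem_nth // addn1.
Qed.

(** Marks the leaves of the out-neighbours of u and of u itself, with all their ancestors. *)
Definition tr u nd : bool :=
  `[< exists v i, [/\ v < N, (g u v != 0) || (v == u), i <= L & nd = (N + v) %/ 2 ^ i] >].

Lemma anc_top v : v < N -> (N + v) %/ 2 ^ L = 1.
Proof. by move=> hv; rewrite divnD // divnn N0 divn_small // modnn modn_small //; have := N0; lia. Qed.

Lemma trS u nd : u < N -> 0 < nd < N -> tr u nd = tr u (2 * nd) || tr u (2 * nd + 1).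
Proof.
move=> hu /andP[h0 h1]; apply/asboolP/orP => [[v [[|i] [hv hc hi e]]]|h].
- by move: e; rewrite expn0 divn1; lia.
- move: e; rewrite expnS mulnC divnMA => e.
  have /orP[/eqP e'|/eqP e'] : ((N + v) %/ 2 ^ i == 2 * nd) || ((N + v) %/ 2 ^ i == 2 * nd + 1) by lia.
    by left; apply/asboolP; exists v, i; split=> //; exact: ltnW.
  by right; apply/asboolP; exists v, i; split=> //; exact: ltnW.
- have [v [i [hv hc hi e]]] : exists v i, [/\ v < N, (g u v != 0) || (v == u), i <= L & nd = (N + v) %/ 2 ^ i %/ 2 /\ 1 < (N + v) %/ 2 ^ i].
    case: h => /asboolP[v [i [hv hc hi e]]]; exists v, i; split=> //; rewrite -e; split; lia.
  exists v, i.+1; split=> //; last by rewrite expnS mulnC divnMA; case: e.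
  by rewrite ltn_neqAle hi andbT; apply/eqP => ei; move: e; rewrite ei anc_top // => -[].
Qed.

Lemma tr1 u : u < N -> tr u 1.
Proof. by move=> hu; apply/asboolP; exists u, L; split; rewrite ?eqxx ?orbT ?anc_top. Qed.

Lemma tr_leaf u v : u < N -> v < N -> tr u (N + v) = (g u v != 0) || (v == u).
Proof.
move=> hu hv; apply/asboolP/idP => [[v' [[|i] [hv' hc _ e]]]|h]; last by exists v, 0; rewrite expn0 divn1.
  by move: e; rewrite expn0 divn1 => /addnI ->.
have : (N + v') %/ 2 ^ i.+1 <= (N + v') %/ 2 by rewrite leq_div2l // -{1}(expn1 2) leq_exp2l.
lia.
Qed.

Definition srcs := [seq z <- iota 0 N | (z == 0) || `[< exists v, g z v != 0 >]].

Lemma srcs_uniq : uniq srcs. Proof. by rewrite filter_uniq ?iota_uniq. Qed.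

Lemma srcs_lt z : z \in srcs -> z < N.
Proof. by rewrite mem_filter mem_iota => /andP[_]. Qed.

(** The bound by the number of edges is essential for sparse graphs: a run from every vertex would
    cost at least n^2, even when m is much smaller than n. *)
Lemma size_srcs : size srcs <= m.+1 /\ size srcs <= N.
Proof.
split; last by rewrite size_filter (leq_trans (count_size _ _)) // size_iota.
rewrite -(size_iota 0 m) -(size_map tl) -[X in _ <= X]/(size (0 :: map tl (iota 0 m))).
apply: uniq_leq_size; first exact: srcs_uniq.
move=> z; rewrite mem_filter inE => /andP[/orP[->//|/asboolP[v /edgeP[p [hp -> _ _]]]] _].
by apply/orP; right; apply: map_f; rewrite mem_iota.
Qed.

Lemma srcsP z v : g z v != 0 -> z \in srcs.
Proof.
move=> h; rewrite mem_filter mem_iota; have /and5P[_ _ hz _ _] := gG_ge h.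
by apply/andP; split=> //; apply/orP; right; apply/asboolP; exists v.
Qed.

(** Each marked leaf is charged either to an edge or to the vertex whose tree it belongs to. *)
Lemma sum_outdeg W lev rep : \sum_(u < N) outdeg (ctlW es W lev rep) tr u <= m + N.
Proof.
rewrite -(big_mkord xpredT (fun u => outdeg (ctlW es W lev rep) tr u)) /index_iota subn0.
have -> : \sum_(u <- iota 0 N) outdeg (ctlW es W lev rep) tr u = size [seq (u, nd) | u <- iota 0 N, nd <- nodes (tr u) L].
  by rewrite size_allpairs_dep sumnE big_map.
rewrite -[m](size_iota 0) -{2}[N](size_iota 0) -(size_map (fun p => (tl p, N + hd p))) -(size_map (fun u => (u, N + u)) (iota 0 N)) -size_cat.
apply: uniq_leq_size.
  apply: allpairs_uniq_dep; [exact: iota_uniq|by move=> u _; rewrite filter_uniq ?iota_uniq|].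
  by move=> [a b] [a' b'] _ _ /= [-> ->].
move=> [u nd] /allpairsPdep[u' [nd' [hu hnd [-> ->]]]].
move: hu hnd; rewrite mem_filter !mem_iota => /andP[_ hu] /andP[ht hnd].
rewrite (_ : nd' = N + (nd' - N)) in ht *; last by lia.
move: ht; rewrite tr_leaf; [|lia|lia]; rewrite mem_cat => /orP[/edgeP[p [hp -> -> _]]|/eqP ->].
  by apply/orP; left; apply/mapP; exists p; rewrite ?mem_iota.
by apply/orP; right; apply/mapP; exists u'; rewrite ?mem_iota.
Qed.

Variables (coins : nat -> nat -> bool) (cap : nat).
Hypothesis hcap : 2 ^ LM <= cap.

(** The cells marked before round [j] in the schedule of [TRIE]; [od] is the same for the flags of
    the tails. *)
Definition mk j a : Prop := exists p i, [/\ p < m, tl p <> hd p, i * N + hd p < j & a = tl p * (N + N) + (N + hd p) %/ 2 ^ i].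
Definition od j a : Prop := exists p i, [/\ p < m, tl p <> hd p, i * N + hd p < j & a = tl p].

Definition ttrie := tfork vLM LM + 150 + N * (L + 1) * 150.

Lemma wpc_trie W lev rep (Q : assertion) (M : nat -> nat -> nat) t :
  M raw = nth 0 inp -> (forall a, M 3 a = 0) -> (forall a, M 4 a = 0) ->
  (forall (M' : nat -> nat -> nat) t', t' <= t + ttrie -> (forall k, k <> 3 -> k <> 4 -> M' k = M k) ->
     (forall a, M' 3 a = `[< mk (N * (L + 1)) a >]) -> (forall a, M' 4 a = `[< od (N * (L + 1)) a >]) ->
     Q M' [:: en0 (ctlW es W lev rep)] t') ->
  wpc OFF coins cap TRIE Q M [:: en0 (ctlW es W lev rep)] t.
Proof.
move=> hraw h3 h4 hQ; rewrite /TRIE; set c := ctlW es W lev rep.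
apply: wpc_seq; apply: (@wpc_fork _ _ _ c _ LM) => //; first exact: (LM_CP hes).
do 2 (apply: wpc_seq; apply: wpc_rdin => [p _|]; first by rewrite /idx /=; nia).
do 4 (apply: wpc_seq; apply: wpc_asg).
pose A p := N - (N - (M raw (3 * m + 1 - (3 * m + 1 - (3 * p + 2))) + 1)).
pose B p := N - (N - (M raw (3 * m + 1 - (3 * m + 1 - (3 * p + 3))) + 1)).
have hA p : p < m -> A p = tl p.
  move=> hp; have [h _] := tl_N hp; rewrite /A hraw (_ : 3 * m + 1 - _ = 3 * p + 2); last by lia.
  by rewrite addn1 subKn //; exact: ltnW.
have hB p : p < m -> B p = hd p.
  move=> hp; have [_ h] := tl_N hp; rewrite /B hraw (_ : 3 * m + 1 - _ = 3 * p + 3); last by lia.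
  by rewrite addn1 subKn //; exact: ltnW.
pose E0 j := [seq en c 0 0 0 p (A p) (B p) ((N + N - (N + N - (N + B p))) %/ 2 ^ (j %/ N)) 0 0 0 0 0 0 j (N * (L + 1)) 0 | p <- iota 0 (2 ^ LM)].
apply: wpc_seq; apply: (wpc_for (I := fun j M' E t' => [/\ t' <= t + tfork vLM LM + 90 + j * 150, E = E0 j,
   forall k, k <> 3 -> k <> 4 -> M' k = M k, forall a, M' 3 a = `[< mk j a >] & forall a, M' 4 a = `[< od j a >]]) (k := N * (L + 1))).
- split=> //.
  + by rewrite /=; lia.
  + by rewrite /E0 -map_comp; apply: eq_map => p /=; rewrite div0n expn0 divn1.
  + by move=> a; rewrite h3; case: asboolP => // -[p [i [_ _]]].
  + by move=> a; rewrite h4; case: asboolP => // -[p [i [_ _]]].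
- by move=> j M' E t' _ [_ -> _ _ _]; rewrite all_map; apply/allP=> p _ /=; rewrite !eqxx.
- move=> j M' E t' hj [ht -> hk hm3 hm4].
  pose cc p := [&& p < m, A p != B p & B p == j %% N].
  have hcc p M2 : (eval OFF M2 (en c 0 0 0 p (A p) (B p) ((N + N - (N + N - (N + B p))) %/ 2 ^ (j %/ N)) 0 0 0 0 0 0 j (N * (L + 1)) 0) cndT != 0) = cc p.
    rewrite /cndT /= -/(EMod _ _) (_ : j - j %/ N * N = j %% N); last by rewrite {1}(divn_eq j N) addKn.
    rewrite /cc !muln_eq0 !negb_or; have -> : (m - p != 0) = (p < m) by lia.
    have -> : (1 - (1 - (A p - B p + (B p - A p))) != 0) = (A p != B p) by lia.
    rewrite -andbA; congr (_ && (_ && _)); lia.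
  have injA : inj_fam (iota 0 (2 ^ LM)) cc A.
    move=> p p' _ _ /and3P[h1 _ /eqP e1] /and3P[h2 _ /eqP e2] e; apply: edge_inj => //; first by rewrite -!hA.
    by rewrite -!hB // e1 e2.
  pose S p := (N + N - (N + N - (N + B p))) %/ 2 ^ (j %/ N).
  have hS p : p < m -> S p = (N + hd p) %/ 2 ^ (j %/ N).
    by move=> hp; have [_ h] := tl_N hp; rewrite /S hB // subKn // leq_add2l ltnW.
  have hS2 p : p < m -> S p < N + N.
    by move=> hp; rewrite hS //; have [_ h] := tl_N hp; apply: leq_ltn_trans (leq_div _ _) _; rewrite ltn_add2l.
  have inj3 : inj_fam (iota 0 (2 ^ LM)) cc (fun p => A p * (N + N) + S p).
    move=> p p' i1 i2 h1 h2 e; apply: injA => //; have [hp _ _] := and3P h1; have [hp' _ _] := and3P h2.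
    by have [] := row_inj (hS2 p hp) (hS2 p' hp') e.
  apply: wpc_seq; apply: (@wpc_wr _ _ _ _ _ _ cc (fun p => A p * (N + N) + S p) (fun=> 1)) => //.
  + exact: iota_uniq.
  set M1 := wfam _ _ _ _ _ _.
  apply: wpc_seq; apply: (@wpc_wr _ _ _ _ _ _ cc A (fun=> 1)) => //.
  + exact: iota_uniq.
  set M2 := wfam _ _ _ _ _ _.
  apply: wpc_asg; split; first by rewrite all_map; apply/allP=> p _ /=; rewrite !eqxx.
  have split_lt p i : p < m -> (i * N + hd p < j.+1) = (i * N + hd p < j) || (hd p == j %% N) && (i == j %/ N).
    move=> hp; have [_ h] := tl_N hp; rewrite ltnS leq_eqVlt orbC; congr orb.
    apply/eqP/andP => [<-|[/eqP -> /eqP ->]]; last by rewrite -divn_eq.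
    by rewrite modnMDl modn_small // divnMDl // divn_small // addn0 !eqxx.
  have inI p : p < m -> p \in iota 0 (2 ^ LM) by move=> hp; rewrite mem_iota; apply: leq_trans hp (leq_logM m).
  split.
  + by rewrite /wr_cost /=; lia.
  + rewrite /E0 -map_comp; apply: eq_map => p /=; rewrite /en; do 16 (congr cons); congr cons.
    rewrite (_ : _ + 1 - _ = (j + 1) %% N); last by rewrite {1}(divn_eq (j + 1) N) addKn.
    rewrite addn1 divnS //; have -> : (1 - (j.+1 %% N - 0 + (0 - j.+1 %% N))) = (N %| j.+1) by rewrite /dvdn; lia.
    by case: (N %| j.+1); rewrite ?addn0 ?divn1 // add1n expnSr divnMA.
  + by move=> k hk3 hk4; rewrite /M2 wfam_other // /M1 wfam_other // hk.
  + move=> a; rewrite /M2 wfam_other // /M1 wfam_one ?iota_uniq // hm3.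
    case: asboolP => [[p hp [/and3P[p1 /eqP p2 /eqP p3] <-]]|hno].
      rewrite asboolT //; exists p, (j %/ N); rewrite -hA // -hB //; split=> //; last by rewrite hS // hB.
      by rewrite p3 -divn_eq.
    congr nat_of_bool; apply/asboolP/asboolP => -[p [i [p1 p2 p3 p4]]]; exists p, i; split=> //; first exact: ltnW.
    move: p3; rewrite split_lt // => /orP[//|/andP[/eqP e1 /eqP e2]].
    by case: hno; exists p; rewrite ?inI // /cc p1 hA // hB // e1 eqxx andbT hS // -e2 -e1; split=> //; apply/eqP.
  + move=> a; rewrite /M2 wfam_one ?iota_uniq // /M1 wfam_other // hm4.
    case: asboolP => [[p hp [/and3P[p1 /eqP p2 /eqP p3] <-]]|hno].
      rewrite asboolT //; exists p, (j %/ N); rewrite -hA // -hB //; split=> //.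
      by rewrite p3 -divn_eq.
    congr nat_of_bool; apply/asboolP/asboolP => -[p [i [p1 p2 p3 p4]]]; exists p, i; split=> //; first exact: ltnW.
    move: p3; rewrite split_lt // => /orP[//|/andP[/eqP e1 /eqP e2]].
    by case: hno; exists p; rewrite ?inI // /cc p1 hA // hB // e1 eqxx andbT -e1; split=> //; apply/eqP.
- move=> M' E t' [ht -> hk hm3 hm4].
  apply: wpc_join; [exact: iota_uniq|by rewrite mem_iota expn_gt0|by []|].
  by apply: (@wpc_reset _ _ _ c); apply: hQ => //; rewrite /ttrie /treset; lia.
Qed.

Hypothesis hcapN : N <= cap.

Definition tlead := tfork vL L + 100 + (L + 1) * 100.

Lemma wpc_leaders W lev rep (Q : assertion) (M : nat -> nat -> nat) t :
  (forall a, M 3 a = `[< mk (N * (L + 1)) a >]) -> (forall a, M 4 a = `[< od (N * (L + 1)) a >]) ->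
  (forall (M' : nat -> nat -> nat) t', t' <= t + tlead -> (forall k, k <> 3 -> M' k = M k) ->
     (forall u nd, u < N -> nd < N + N -> M' 3 (u * (N + N) + nd) = tr u nd) ->
     Q M' (map (lenv (ctlW es W lev rep) (fun=> 0) (fun=> 0) (fun=> 0) (fun=> 0) (fun=> N)) srcs) t') ->
  wpc OFF coins cap LEADERS Q M [:: en0 (ctlW es W lev rep)] t.
Proof.
clear hcap; move=> h3 h4 hQ; rewrite /LEADERS; set c := ctlW es W lev rep.
have hCP : N <= 4 * N * N * N by nia.
apply: wpc_seq; apply: (@wpc_fork _ _ _ c _ L) => //.
do 2 (apply: wpc_seq; apply: wpc_asg).
pose E0 j := [seq en c 0 0 0 p 0 0 ((N + N - (N + N - (N + p))) %/ 2 ^ j) 0 0 0 0 0 0 j (L + 1) 0 | p <- iota 0 N].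
apply: wpc_seq; apply: (wpc_for (I := fun j M' E t' => [/\ t' <= t + tfork vL L + 20 + j * 100, E = E0 j,
   forall k, k <> 3 -> M' k = M k &
   forall a, M' 3 a = `[< mk (N * (L + 1)) a \/ exists q i, [/\ q < N, i < j & a = q * (N + N) + (N + q) %/ 2 ^ i] >]]) (k := L + 1)).
- split=> //.
  + by rewrite /=; lia.
  + by rewrite /E0 -map_comp; apply: eq_map => p /=; rewrite expn0 divn1.
  + move=> a; rewrite h3; congr nat_of_bool; apply/asboolP/asboolP => [|[//|[q [i []]]] //].
    by left.
- by move=> j M' E t' _ [_ -> _ _]; rewrite all_map; apply/allP=> p _ /=; rewrite !eqxx.
- move=> j M' E t' hj [ht -> hk hm3].
  pose S p := (N + N - (N + N - (N + p))) %/ 2 ^ j.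
  have hS p : p \in iota 0 N -> S p = (N + p) %/ 2 ^ j.
    by rewrite mem_iota => /= hp; rewrite /S subKn // leq_add2l ltnW.
  have inj3 : inj_fam (iota 0 N) xpredT (fun p => p * (N + N) + S p).
    move=> p p' hp hp' _ _; rewrite !hS // => e.
    have lt q : q \in iota 0 N -> (N + q) %/ 2 ^ j < N + N.
      by rewrite mem_iota => /= hq; apply: leq_ltn_trans (leq_div _ _) _; rewrite ltn_add2l.
    by have [] := row_inj (lt p hp) (lt p' hp') e.
  apply: wpc_seq; apply: (@wpc_wr _ _ _ _ _ _ xpredT (fun p => p * (N + N) + S p) (fun=> 1)) => //.
  + exact: iota_uniq.
  set M1 := wfam _ _ _ _ _ _.
  apply: wpc_asg; split; first by rewrite all_map; apply/allP=> p _ /=; rewrite !eqxx.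
  split.
  + by rewrite /wr_cost /=; lia.
  + by rewrite /E0 -map_comp; apply: eq_map => p /=; rewrite expnSr divnMA.
  + by move=> k hk3; rewrite /M1 wfam_other // hk.
  + move=> a; rewrite /M1 wfam_one ?iota_uniq // hm3.
    case: asboolP => [[p hp [_ <-]]|hno].
      by rewrite asboolT //; right; exists p, j; rewrite hS //; split=> //; move: hp; rewrite mem_iota.
    congr nat_of_bool; apply/asboolP/asboolP => -[h|[q [i [q1 q2 q3]]]]; try (by left); right; exists q, i; split=> //; first exact: ltnW.
    move: q2; rewrite ltnS leq_eqVlt => /orP[/eqP e|//]; case: hno.
    have hq : q \in iota 0 N by rewrite mem_iota.
    by exists q => //; split=> //; rewrite hS // q3 e.
- move=> M' E t' [ht -> hk hm3].
  apply: wpc_seq; apply: wpc_kill; do 2 (apply: wpc_seq; apply: wpc_asg); apply: wpc_asg.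
  rewrite [X in Q M' X _](_ : _ = map (lenv c (fun=> 0) (fun=> 0) (fun=> 0) (fun=> 0) (fun=> N)) srcs); last first.
    rewrite /srcs; congr map; apply: eq_in_filter => z; rewrite mem_iota /= => hz; rewrite hk // h4.
    have -> : `[< od (N * (L + 1)) z >] = `[< exists v, g z v != 0 >].
      apply/asboolP/asboolP => [[p [i [p1 p2 _ ->]]]|[v /edgeP[p [p1 -> _ p2]]]].
        by exists (hd p); apply/edgeP; exists p.
      exists p, 0; split=> //; rewrite mul0n add0n; have [_ h] := tl_N p1; apply: leq_trans h _; nia.
    by case: (`[< _ >]); lia.
  apply: hQ => //; first by rewrite /tlead /=; lia.
  move=> u nd hu hnd; rewrite hm3 /tr; congr nat_of_bool.
  apply/asboolP/asboolP => [[[p [i [p1 p2 p3 p4]]]|[q [i [q1 q2 q3]]]]|[v [i [v1 v2 v3 v4]]]].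
  + have [p5 p6] := tl_N p1.
    have p7 : (N + hd p) %/ 2 ^ i < N + N by apply: leq_ltn_trans (leq_div _ _) _; rewrite ltn_add2l.
    have [e1 e2] := row_inj hnd p7 p4; exists (hd p), i; split=> //.
      by apply/orP; left; apply/edgeP; exists p.
    by rewrite leqNgt; apply/negP => h; nia.
  + have p7 : (N + q) %/ 2 ^ i < N + N by apply: leq_ltn_trans (leq_div _ _) _; rewrite ltn_add2l.
    have [e1 e2] := row_inj hnd p7 q3; exists q, i; split=> //; first by rewrite e1 eqxx orbT.
    by move: q2; rewrite addn1 ltnS.
  + case/orP: v2 => [/edgeP[p [p1 p2 p3 p4]]|/eqP ev]; last first.
      by right; exists u, i; rewrite -ev; split=> //; [lia | rewrite -v4].
    left; exists p, i; rewrite -p2 -p3; split=> //; [by rewrite p2 p3| |by rewrite -v4].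
    nia.
Qed.

End Tries.

(** * Pointer jumping *)

Section JumpMath.
Variables (g lab E : nat -> nat -> nat).

Fixpoint jump k x y := if k is k'.+1 then jump k' (lab x y) y else x.
Fixpoint dsum k x y := if k is k'.+1 then g x (lab x y) + dsum k' (lab x y) y else 0.

Lemma jump_add a b x y : jump (a + b) x y = jump b (jump a x y) y.
Proof. by elim: a x => //= a ih x; rewrite ih. Qed.

Lemma dsum_add a b x y : dsum (a + b) x y = dsum a x y + dsum b (jump a x y) y.
Proof. by elim: a x => //= a ih x; rewrite ih addnA. Qed.

(** The value is a maximum of detours shifted by prefix lengths, and truncated subtraction
    distributes over maxima; so two consecutive stretches of a chain compose. *)
Lemma Vn_add a b x y : Vn g lab E (a + b) x y = maxn (Vn g lab E a x y) (Vn g lab E b (jump a x y) y - dsum a x y).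
Proof. by elim: a x => [|a ih] x /=; [rewrite max0n subn0 | rewrite ih; lia]. Qed.

End JumpMath.

Definition SPREAD : stmt :=
  Asg 14 0 ;; Asg 15 0 ;; Asg 22 0 ;; Asg 23 0 ;; Asg 24 0 ;; Asg 10 vL ;;
  For 11 10 (Dup 12 ;; Asg 13 (EMin (2 * vpid + V 12) vCP) ;; Asg 12 0) ;;
  Asg 14 (vpid / vN) ;; Asg 15 (EMod vpid vN).

(** Regions 10, 11 and 12 hold the value, the end and the length of the stretch covered so far.
    Capping the length at [BIG] changes nothing, because no value exceeds [BIG] and the subtraction
    is truncated. *)
Definition JUMP : stmt :=
  Wr 10 1 vpid (ERd 9 vpid) ;; Wr 11 1 vpid (ERd 7 vpid) ;; Wr 12 1 vpid (ERd 2 (V 14 * vN + ERd 7 vpid)) ;;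
  For 11 10 (
    Asg 16 (ERd 11 vpid) ;; Asg 17 (ERd 10 (V 16 * vN + V 15)) ;; Asg 18 (ERd 12 vpid) ;;
    Asg 19 (ERd 12 (V 16 * vN + V 15)) ;; Asg 20 (ERd 11 (V 16 * vN + V 15)) ;;
    Wr 10 1 vpid (EMin (ERd 10 vpid + ((V 17 - V 18) - ERd 10 vpid)) vBIG) ;;
    Wr 11 1 vpid (EMin (V 20) vN) ;; Wr 12 1 vpid (EMin (V 18 + V 19) vBIG)).

Definition cndO : expr := ((1 - (1 - V 14)) * (1 - (1 - V 15)) * (1 - (V 14 - vn)) * (1 - (V 15 - vn)))%X.

(** The address is multiplied by the guard because [WrOut] requires a legal address even of
    processors that do not write. The value is one more than the weight, or 0 for infinity, as
    [decode] expects. *)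
Definition OUTPUT (k : nat) : stmt :=
  Asg 21 (ERd k vpid) ;;
  WrOut cndO (cndO * (2 + 3 * vm + (V 14 - 1) * vn + (V 15 - 1))) ((1 - (1 - V 21)) * ((vBIG - V 21) / vN + 1)).

Section Output.
Variables (OFF : nat) (coins : nat -> nat -> bool) (cap : nat) (n m N BIG : nat).
Hypothesis hOFF : OFF = 3 * m + n * n + 2.
Hypothesis hnN : n < N.

Lemma evalMul M v a b : eval OFF M v (EMul a b) = eval OFF M v a * eval OFF M v b.
Proof. by []. Qed.

Definition unscore s := if s == 0 then 0 else ((BIG - s) %/ N).+1.

Definition toutput := 200.

Lemma wpc_output (I : seq nat) (f : nat -> seq nat) k (Q : assertion) M t : uniq I ->
  (forall p, [/\ nth 0 (f p) 0 = n, nth 0 (f p) 1 = m, nth 0 (f p) 2 = N & nth 0 (f p) 6 = BIG]) ->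
  (forall p, [/\ nth 0 (f p) 13 = p, nth 0 (f p) 14 = p %/ N & nth 0 (f p) 15 = p %% N]) ->
  (forall M' E' t', t' <= t + toutput -> size E' = size I ->
     (forall x y, x < n -> y < n -> M' raw (3 * m + 2 + (x * n + y)) =
        if x.+1 * N + y.+1 \in I then unscore (M k (x.+1 * N + y.+1)) else M raw (3 * m + 2 + (x * n + y))) ->
     Q M' E' t') ->
  wpc OFF coins cap (OUTPUT k) Q M (map f I) t.
Proof.
move=> hu hf hf' hQ; have N0 : 0 < N by lia.
rewrite /OUTPUT; apply: wpc_seq; apply: wpc_asg.
pose c p := [&& 0 < p %/ N, 0 < p %% N, p %/ N <= n & p %% N <= n].
pose ad p := 2 + 3 * m + ((p %/ N).-1 * n + (p %% N).-1).
have hc M1 p z : eval OFF M1 (set_nth 0 (f p) 21 z) cndO = c p.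
  have [f0 f1 f2 f6] := hf p; have [f13 f14 f15] := hf' p.
  rewrite /cndO /= !nth_set_nth /= f0 f14 f15 /c.
  by case: (p %/ N) (p %% N) => [|a] [|b]; rewrite ?muln0 ?mul0n //=; case: (ltnP a n); case: (ltnP b n) => *; lia.
have hlt p : c p -> ad p < OFF /\ p = (p %/ N).-1.+1 * N + (p %% N).-1.+1.
  case/and4P=> h1 h2 h3 h4; split; last by rewrite !prednK // -divn_eq.
  by rewrite /ad hOFF; nia.
have inj : inj_fam I c ad.
  move=> p q _ _ hp hq e; have [h1 ->] := hlt p hp; have [h2 ->] := hlt q hq.
  move: hp hq => /and4P[p1 p2 p3 p4] /and4P[q1 q2 q3 q4].
  have hb1 : (p %% N).-1 < n by lia.
  have hb2 : (q %% N).-1 < n by lia.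
  by have [-> ->] := row_inj hb1 hb2 (addnI e).
apply: (@wpc_wrout _ _ _ _ _ _ c ad (fun p => unscore (M k p))).
- exact: hu.
- exact: inj.
- by move=> p _; rewrite hc; case: (c p).
- move=> p _; rewrite evalMul hc.
  have [f0 f1 f2 f6] := hf p; have [f13 f14 f15] := hf' p.
  case hcp: (c p); last by rewrite mul0n hOFF; lia.
  by rewrite mul1n /= !nth_set_nth /= f0 f1 f14 f15 !subn1; have [+ _] := hlt p hcp; rewrite /ad; lia.
- move=> p _ hcp; rewrite evalMul hc hcp mul1n.
  have [f0 f1 f2 f6] := hf p; have [f13 f14 f15] := hf' p.
  by rewrite /= !nth_set_nth /= f0 f1 f14 f15 !subn1 /ad; lia.
- move=> p _ _; have [f0 f1 f2 f6] := hf p; have [f13 f14 f15] := hf' p.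
  rewrite /= !nth_set_nth /= f13 f2 f6 /unscore; move: (M k p) => s.
  by case: eqP => [->|/eqP h]; [rewrite subn0 subnn mul0n | rewrite (_ : 1 - (1 - s) = 1) ?mul1n ?addn1 //; lia].
set M' := wfam _ _ _ _ _ _.
apply: hQ; [by rewrite /toutput /wr_cost /=; lia|by rewrite size_map|].
move=> x y hx hy.
have hd : (x.+1 * N + y.+1) %/ N = x.+1 by rewrite divnMDl // divn_small ?addn0 //; lia.
have hm : (x.+1 * N + y.+1) %% N = y.+1 by rewrite modnMDl modn_small //; lia.
have hcp : c (x.+1 * N + y.+1) by rewrite /c hd hm !ltnS hx hy.
have ea : ad (x.+1 * N + y.+1) = 3 * m + 2 + (x * n + y) by rewrite /ad hd hm /=; lia.
case: ifP => hI; first by rewrite -ea /M' (@wfam_in _ I c ad (fun p => unscore (M k p)) raw M _ hu inj hI hcp).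
rewrite /M' wfam_out // => _ p hp hcp' e.
have [_ ep] := hlt p hcp'; move: hcp' => /and4P[p1 p2 p3 p4].
have hb : (p %% N).-1 < n by lia.
have [e1 e2] : (p %/ N).-1 = x /\ (p %% N).-1 = y by apply: (row_inj hb hy); move: e; rewrite /ad; lia.
by move: hI; rewrite -e1 -e2 -ep hp.
Qed.

End Output.

Section Jumping.
Variables (OFF : nat) (coins : nat -> nat -> bool) (cap : nat) (c : ctl).
Notation N := (cN c).
Notation L := (cL c).
Notation BIG := (cBIG c).
Hypothesis hN : N = 2 ^ L.
Hypothesis hCP : N * N <= cCP c.
Variables (Z : seq nat).
Hypothesis Zu : uniq Z.
Hypothesis Zlt : forall z, z \in Z -> z < N.
Hypothesis hcap : size Z * N <= cap.

Let N0 : 0 < N. Proof. by rewrite hN expn_gt0. Qed.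

Definition cells j := [seq z * 2 ^ j + y | z <- Z, y <- iota 0 (2 ^ j)].

Lemma cellsE j : cells j = flatten [seq iota (z * 2 ^ j) (2 ^ j) | z <- Z].
Proof. by congr flatten; apply: eq_map => z; rewrite -iotaDl addn0. Qed.

Lemma mem_cells p : (p \in cells L) = (p %/ N \in Z).
Proof.
rewrite /cells -hN; apply/allpairsP/idP => [[[z y] /= [hz hy ->]]|h].
  by move: hy; rewrite mem_iota => /= hy; rewrite divnMDl // divn_small // addn0.
by exists (p %/ N, p %% N); rewrite /= h mem_iota ltn_mod N0 -divn_eq.
Qed.

Lemma uniq_cells j : uniq (cells j).
Proof.
apply: allpairs_uniq_dep => //; first by move=> z _; exact: iota_uniq.
move=> [z y] [z' y'] /allpairsPdep[a [b [_ hb [-> ->]]]] /allpairsPdep[a' [b' [_ hb' [-> ->]]]] /=.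
move: hb hb'; rewrite !mem_iota /= => hb hb' e.
by have [-> ->] := row_inj hb hb' e.
Qed.

Definition cenv x p := en c L L 0 p (p %/ N) (p %% N) (x p 0) (x p 1) (x p 2) (x p 3) (x p 4) 0 0 0 0 0.

Definition tspread := 60 + L * 60.

Lemma wpc_spread u s k t0 x0 (Q : assertion) M t :
  (forall t', t' <= t + tspread -> Q M (map (cenv (fun _ _ => 0)) (cells L)) t') ->
  wpc OFF coins cap SPREAD Q M (map (lenv c u s k t0 x0) Z) t.
Proof.
move=> hQ; rewrite /SPREAD; do 6 (apply: wpc_seq; apply: wpc_asg).
apply: wpc_seq; apply: (wpc_for (I := fun j M' E t' => [/\ M' = M, t' <= t + 30 + j * 60 &
   E = [seq en c L j 0 p 0 0 0 0 0 0 0 0 0 0 0 0 | p <- cells j]]) (k := L)).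
- split=> //; first by rewrite /=; lia.
  rewrite -map_comp /cells /=; elim: (Z) => //= z Z' ->.
  by rewrite expn0 muln1 addn0.
- by move=> j M' E t' _ [_ _ ->]; rewrite all_map; apply/allP=> p _ /=; rewrite !eqxx.
- move=> j M' E t' hj [-> ht ->]; apply: wpc_seq; split.
    rewrite size_map size_allpairs size_iota; apply: leq_trans hcap; rewrite mulnCA -expnS hN leq_mul2l leq_exp2l // hj orbT //.
  have -> : flatten [seq [:: set_nth 0 v 12 0; set_nth 0 v 12 1] | v <- [seq en c L j 0 p 0 0 0 0 0 0 0 0 0 0 0 0 | p <- cells j]]
     = [seq en c L j (odd p) (p %/ 2) 0 0 0 0 0 0 0 0 0 0 0 0 | p <- cells j.+1].
    have -> : cells j.+1 = flatten [seq [:: 2 * p; 2 * p + 1] | p <- cells j].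
      rewrite !cellsE; elim: (Z) => //= z Z' ih; rewrite map_cat flatten_cat flatten_iota2 ih expnS.
      by rewrite mulnCA.
    elim: (cells j) => //= p I' ->.
    have e1 : odd (2 * p) = false by rewrite mul2n odd_double.
    have e2 : odd (2 * p + 1) by rewrite addn1 /= mul2n odd_double.
    have e4 : (2 * p) %/ 2 = p by rewrite mulKn.
    have e5 : (2 * p + 1) %/ 2 = p by rewrite mulnC divnMDl // addn0.
    by rewrite e1 e2 e4 e5.
  apply: wpc_seq; apply: (@wpc_asg_in _ _ _ _ _ _ (fun p => en c L j (odd p) p 0 0 0 0 0 0 0 0 0 0 0 0)).
    move=> p hp; rewrite /= (_ : 2 * (p %/ 2) + odd p = p); last by rewrite [RHS](divn_eq _ 2) modn2 mulnC.
    rewrite subKn //; apply: leq_trans hCP.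
    move: hp => /allpairsP[[z y] /= [hz]]; rewrite mem_iota => /= hy ->.
    have h1 := Zlt hz; have : 2 ^ j.+1 <= N by rewrite hN leq_exp2l.
    by move: (2 ^ j.+1) hy => q hy hq; nia.
  apply: wpc_asg; split; first by rewrite all_map; apply/allP=> p _ /=; rewrite !eqxx.
  by split=> //; [rewrite /=; lia | rewrite -map_comp].
- move=> M' E t' [-> ht ->]; apply: wpc_seq; apply: wpc_asg.
  apply: (@wpc_asg_in _ _ _ _ _ _ (cenv (fun _ _ => 0))).
    by move=> p _; rewrite evalMod.
  by apply: hQ; rewrite /tspread /=; lia.
Qed.

Variables (g lab E : nat -> nat -> nat).
Hypothesis hEB : forall x y, E x y <= BIG.
Hypothesis hlab : forall x y, lab x y < N.
Hypothesis hZ0 : forall x y, x < N -> x \notin Z -> lab x y = 0 /\ E x y = 0.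
Hypothesis hlab0 : forall y, lab 0 y = 0.
Hypothesis hE0 : forall y, E 0 y = 0.
Hypothesis hg0 : forall x, g x 0 = 0.
Hypothesis hgB : forall x y, g x y <= BIG.

Notation Vk := (Vn g lab E).

Lemma Vk0 k y : Vk k 0 y = 0.
Proof. by elim: k => //= k ih; rewrite hlab0 hE0 ih. Qed.

Lemma jump0 k y : jump lab k 0 y = 0.
Proof. by elim: k => //= k ih; rewrite hlab0 ih. Qed.

Lemma dsum0 k y : dsum g lab k 0 y = 0.
Proof. by elim: k => //= k ih; rewrite hlab0 hg0 ih. Qed.

Lemma jump_lt k x y : x < N -> jump lab k x y < N.
Proof. by elim: k x => //= k ih x hx; apply: ih. Qed.

(** The rows of a vertex outside [Z] are 0, which is what untouched memory holds, so these rows need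
    no processors. *)
Lemma outside k x y : 0 < k -> x < N -> x \notin Z -> [/\ Vk k x y = 0, jump lab k x y = 0 & dsum g lab k x y = 0].
Proof.
by case: k => // k _ hx hz; have [h1 h2] := hZ0 y hx hz; rewrite /= h1 h2 Vk0 jump0 dsum0 hg0.
Qed.

Lemma Vk_le k x y : Vk k x y <= BIG.
Proof. by elim: k x => //= k ih x; rewrite geq_max hEB (leq_trans (leq_subr _ _) (ih _)). Qed.

Definition tjump := 100 + L * 200.

Lemma wpc_jump (Q : assertion) (M : nat -> nat -> nat) t :
  (forall x y, x < N -> y < N -> [/\ M 2 (x * N + y) = g x y, M 7 (x * N + y) = lab x y & M 9 (x * N + y) = E x y]) ->
  (forall a, [/\ M 10 a = 0, M 11 a = 0 & M 12 a = 0]) ->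
  (forall M' x t', t' <= t + tjump -> (forall k, k <> 10 -> k <> 11 -> k <> 12 -> M' k = M k) ->
     (forall x y, x < N -> y < N -> M' 10 (x * N + y) = Vk N x y) ->
     Q M' (map (cenv x) (cells L)) t') ->
  wpc OFF coins cap JUMP Q M (map (cenv (fun _ _ => 0)) (cells L)) t.
Proof.
move=> hM hM0 hQ; rewrite /JUMP.
have hcell p : p \in cells L -> p %/ N < N /\ p %% N < N.
  by rewrite mem_cells => /Zlt h; rewrite ltn_mod.
have idE k M1 (va : nat -> nat) x y : x < N -> y < N ->
    wfam (cells L) xpredT id va k M1 k (x * N + y) = if x \in Z then va (x * N + y) else M1 k (x * N + y).
  move=> hx hy; rewrite wfam_id ?uniq_cells // andbT mem_cells divnMDl // divn_small // addn0.
  by [].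
have hd x y : y < N -> (x * N + y) %/ N = x by move=> hy; rewrite divnMDl // divn_small // addn0.
have hm x y : y < N -> (x * N + y) %% N = y by move=> hy; rewrite modnMDl modn_small.
apply: wpc_seq; apply: (@wpc_wr _ _ _ _ _ _ xpredT id (M 9)) => //; first exact: uniq_cells.
apply: wpc_seq; apply: (@wpc_wr _ _ _ _ _ _ xpredT id (M 7)) => //; [exact: uniq_cells|by move=> p _ _; rewrite /= wfam_other|].
set M1 := wfam _ _ _ _ _ _.
apply: wpc_seq; apply: (@wpc_wr _ _ _ _ _ _ xpredT id (fun p => M 2 (p %/ N * N + M 7 p))) => //.
- exact: uniq_cells.
- by move=> p _ _; rewrite /= /M1 !wfam_other.
set M2 := wfam _ _ _ _ _ _.
apply: (wpc_for (I := fun j M' E' t' => [/\ t' <= t + 90 + j * 200,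
   forall k, k <> 10 -> k <> 11 -> k <> 12 -> M' k = M k,
   forall x y, x < N -> y < N -> [/\ M' 10 (x * N + y) = Vk (2 ^ j) x y, M' 11 (x * N + y) = jump lab (2 ^ j) x y &
      M' 12 (x * N + y) = minn (dsum g lab (2 ^ j) x y) BIG] &
   exists x, E' = [seq en c L j 0 p (p %/ N) (p %% N) (x p 0) (x p 1) (x p 2) (x p 3) (x p 4) 0 0 0 0 0 | p <- cells L]]) (k := L)).
- split.
  + by rewrite /wr_cost /=; lia.
  + by move=> k h1 h2 h3; rewrite /M2 wfam_other // /M1 wfam_other // wfam_other.
  + move=> x y hx hy; have [m1 m2 m3] := hM x y hx hy.
    have [z10 z11 z12] := hM0 (x * N + y).
    have -> : M2 10 (x * N + y) = if x \in Z then E x y else 0.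
      by rewrite /M2 wfam_other // /M1 wfam_other // idE // z10 m3.
    have -> : M2 11 (x * N + y) = if x \in Z then lab x y else 0.
      by rewrite /M2 wfam_other // /M1 idE // wfam_other // z11 m2.
    have -> : M2 12 (x * N + y) = if x \in Z then g x (lab x y) else 0.
      by rewrite /M2 idE // hd // m2 /M1 !wfam_other // z12; have [-> _ _] := hM x (lab x y) hx (hlab x y).
    case: ifP => hz; last first.
      by have [h1 h2] := hZ0 y hx (negbT hz); rewrite /= h1 h2 hg0 ?addn0 min0n.
    by rewrite /= addn0 sub0n maxn0 (minn_idPl (hgB _ _)).
  + by exists (fun _ _ => 0); rewrite -map_comp.
- by move=> j M' E' t' _ [_ _ _ [x ->]]; rewrite all_map; apply/allP=> p _ /=; rewrite !eqxx.
- move=> j M' E' t' hj [ht hk hI [x0 ->]].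
  do 5 (apply: wpc_seq; apply: wpc_asg).
  pose J p := M' 11 p.
  pose x1 p i := nth 0 [:: J p; M' 10 (J p * N + p %% N); M' 12 p; M' 12 (J p * N + p %% N); M' 11 (J p * N + p %% N)] i.
  rewrite [X in wpc _ _ _ _ _ _ X _](_ : _ = [seq en c L j 0 p (p %/ N) (p %% N) (x1 p 0) (x1 p 1) (x1 p 2) (x1 p 3) (x1 p 4) 0 0 0 0 0 | p <- cells L]); last by [].
  have hMB p : p \in cells L -> M' 10 p <= BIG /\ M' 10 (J p * N + p %% N) <= BIG.
    move=> /hcell[h1 h2]; have [e1 e2 _] := hI _ _ h1 h2; rewrite -divn_eq in e1 e2.
    have hJ : J p < N by rewrite /J e2 jump_lt.
    by have [e3 _ _] := hI _ _ hJ h2; rewrite e1 e3 !Vk_le.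
  have hJN p : p \in cells L -> M' 11 (J p * N + p %% N) <= N.
    move=> /hcell[h1 h2]; have [_ e2 _] := hI _ _ h1 h2; rewrite -divn_eq in e2.
    have hJ : J p < N by rewrite /J e2 jump_lt.
    by have [_ -> _] := hI _ _ hJ h2; rewrite ltnW // jump_lt.
  apply: wpc_seq; apply: (@wpc_wr _ _ _ _ _ _ xpredT id (fun p => maxn (M' 10 p) (M' 10 (J p * N + p %% N) - M' 12 p))) => //.
  + exact: uniq_cells.
  + move=> p hp _; rewrite evalMin; have [h1 h2] := hMB p hp.
    change (minn (M' 10 p + (M' 10 (J p * N + p %% N) - M' 12 p - M' 10 p)) BIG = maxn (M' 10 p) (M' 10 (J p * N + p %% N) - M' 12 p)).
    by move: (M' 10 (J p * N + p %% N)) (M' 10 p) (M' 12 p) h1 h2; clear; lia.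
  set M3 := wfam _ _ _ _ _ _.
  apply: wpc_seq; apply: (@wpc_wr _ _ _ _ _ _ xpredT id (fun p => M' 11 (J p * N + p %% N))) => //.
  + exact: uniq_cells.
  + by move=> p hp _; rewrite evalMin /=; apply/minn_idPl/hJN.
  set M4 := wfam _ _ _ _ _ _.
  apply: (@wpc_wr _ _ _ _ _ _ xpredT id (fun p => minn (M' 12 p + M' 12 (J p * N + p %% N)) BIG)) => //.
  + exact: uniq_cells.
  + by move=> p hp _; rewrite evalMin /=.
  set M5 := wfam _ _ _ _ _ _.
  split; first by rewrite all_map; apply/allP=> p _ /=; rewrite !eqxx.
  split.
  + by rewrite /wr_cost /=; lia.
  + by move=> k h1 h2 h3; rewrite /M5 wfam_other // /M4 wfam_other // /M3 wfam_other // hk.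
  + move=> x y hx hy; have [e1 e2 e3] := hI x y hx hy.
    have e10 : M5 10 (x * N + y) = if x \in Z then maxn (M' 10 (x * N + y)) (M' 10 (J (x * N + y) * N + y) - M' 12 (x * N + y)) else M' 10 (x * N + y).
      by rewrite /M5 wfam_other // /M4 wfam_other // /M3 idE // hm.
    have e11 : M5 11 (x * N + y) = if x \in Z then M' 11 (J (x * N + y) * N + y) else M' 11 (x * N + y).
      by rewrite /M5 wfam_other // /M4 idE // hm // /M3 wfam_other.
    have e12 : M5 12 (x * N + y) = if x \in Z then minn (M' 12 (x * N + y) + M' 12 (J (x * N + y) * N + y)) BIG else M' 12 (x * N + y).
      by rewrite /M5 idE // hm // /M4 wfam_other // /M3 wfam_other.
    have eJ : J (x * N + y) = jump lab (2 ^ j) x y by rewrite /J e2.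
    have hJ := jump_lt (2 ^ j) y hx.
    have [f1 f2 f3] := hI _ y hJ hy.
    rewrite e10 e11 e12 eJ expnS mul2n -addnn; case: ifP => hz; last first.
      have h0 : 0 < 2 ^ j by rewrite expn_gt0.
      have h0' : 0 < 2 ^ j + 2 ^ j by lia.
      have [g1 g2 g3] := outside y h0 hx (negbT hz); have [-> -> ->] := outside y h0' hx (negbT hz).
      by rewrite e1 e2 e3 g1 g2 g3.
    rewrite e1 e3 f1 f2 f3 Vn_add jump_add dsum_add; have := Vk_le (2 ^ j) (jump lab (2 ^ j) x y) y.
    by move: (Vk _ _ _) (Vk _ (jump _ _ _ _) _) (dsum _ _ _ x _) (dsum _ _ _ (jump _ _ _ _) _); clear => a b d e h; split=> //; lia.
  + by exists x1; rewrite -map_comp.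
- move=> M' E' t' [ht hk hI [x ->]]; apply: (hQ M' x) => //; first by rewrite /tjump; lia.
  by move=> a b ha hb; rewrite [in RHS]hN; case: (hI a b ha hb).
Qed.

End Jumping.

(** * The deterministic algorithm *)

Definition cnd1 : expr := (gpos * (1 - ERd 6 (V 13 * vN + V 17)))%X.
Definition cnd2 : expr :=
  (gpos * (1 - EEq (V 17) (V 13)) * EEq (ERd 7 (V 13 * vN + V 14)) (ERd 7 (V 13 * vN + V 17)) *
   (1 - ERd 9 (V 13 * vN + V 17)))%X.
Definition add1 : expr := (EEq (V 23) 0 * (vBIG * vN + V 13))%X.

Definition RUN1 := For 23 24 (PHASE 5 6 cnd1 1 add1).
Definition RUN2 := For 23 24 (PHASE 8 9 cnd2 0 0).

(** If there are no edges, the work bound allows only polylogarithmically many operations. So the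
    single processor is killed at once, and the untouched output reads as infinity everywhere. *)
Definition ALGA : stmt :=
  (Kill vm ;; ADJ ;; TRIE) ;; LEADERS ;; RUN1 ;; SEEDS ;; RUN2 ;; (SPREAD ;; JUMP ;; OUTPUT 10).

Lemma wp_seq OFF coins a b Q st : wp OFF coins a (wp OFF coins b Q) st -> wp OFF coins (a ;; b) Q st.
Proof. by case: st. Qed.

Lemma wpc_kill1 OFF coins cap e v (Q : assertion) M t : eval OFF M v e != 0 -> Q M [:: v] (t + (cost e + 2)) ->
  wpc OFF coins cap (Kill e) Q M [:: v] t.
Proof. by move=> h hQ; rewrite /wpc /= h. Qed.

Lemma wp_capped OFF coins cap s (P : assertion) (Q : state -> Prop) M E t w : wpc OFF coins cap s P M E t -> size E <= cap ->
  (forall M' E' t' w', P M' E' t' -> t <= t' -> size E' <= cap -> w' <= w + cap * (t' - t) -> Q (St M' E' t' w')) ->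
  wp OFF coins s Q (St M E t w).
Proof. by move=> h hE hQ; apply: wp_mono (wpc_wp w h hE) => -[M' E' t' w'] /= [*]; apply: hQ. Qed.

Lemma wp_kill OFF coins e (Q : state -> Prop) M E t w :
  Q (St M [seq v <- E | eval OFF M v e != 0] (t + (cost e + 2)) (w + (cost e + 2) * size E)) ->
  wp OFF coins (Kill e) Q (St M E t w).
Proof. by []. Qed.

(* A loop entered by no processor may be left at once. *)
Fixpoint idle_time (s : stmt) : nat :=
  match s with
  | Asg _ e | RdIn _ e | While e _ => (cost e).+1
  | Wr k c a v => wr_cost c (addr k a) v
  | WrOut c a v => wr_cost c a v
  | Dup _ => 3
  | Kill e => cost e + 2
  | Flip _ => 1
  | Seq a b => idle_time a + idle_time b
  end.

Lemma wp_idle OFF coins s (Q : state -> Prop) M t w :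
  Q (St M [::] (t + idle_time s) w) -> wp OFF coins s Q (St M [::] t w).
Proof.
elim: s Q t => [r e|r e|k c a v|c a v|r|e|r|a iha b ihb|e s ih] Q t; rewrite /wp -/wp /= ?muln0 ?addn0 //.
- by rewrite addnA => h; apply: iha; apply: ihb.
- by move=> h; exists 0; split=> //=; rewrite /tick /= muln0 addn0.
Qed.

Lemma first_edge g z a p : path (ge g) z (a :: p) -> ge g z a.
Proof. by move=> /= /andP[]. Qed.

(** * Correctness and cost of the deterministic algorithm *)

Section AlgorithmA.
Variables (n : nat) (G : wdigraph n) (es : seq ('I_n * 'I_n)).
Hypothesis hes : lists_edges G es.
Variables (coins : nat -> nat -> bool) (W : nat).
Notation m := (size es).
Notation inp := (input G es).
Notation OFF := (3 * m + n * n + 2).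
Notation L := (logN n).
Notation N := (2 ^ L).
Notation LM := (logM m).
Notation g := (gG G).
Notation c := (ctlW es W 0 0).
Notation BIG := (N * (N * W + 1) + 1).
Notation Z := (srcs G).
Hypothesis hW : forall i, i < m -> nth 0 inp (3 * i + 4) <= W.
Hypothesis hm : 0 < m.

Let N0 : 0 < N. Proof. by rewrite expn_gt0. Qed.

Lemma weight_le x y : (x, y) \in edges G -> weight G x y <= W.
Proof.
move=> h; have /(nthP (x, y)) [i hi ei] : (x, y) \in es by rewrite (perm_mem hes) mem_enum.
by have := hW hi; rewrite (input_weight G (x, y) hi) ei.
Qed.

Lemma gB x y : g x y <= BIG.
Proof. by have := @gG_small n G W weight_le x y; move: (g x y) N0 => a; nia. Qed.

Section Correctness.
Variables (D lab E : nat -> nat -> nat).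
Hypothesis hD : forall z, z \in Z -> dinv N BIG g (fun u v => g u v != 0) (D z) (fun=> 0).
Hypothesis hwit : forall z, z \in Z -> dwit N BIG g z (D z) (fun=> 0) (lab z).
Hypothesis hE : forall z, z \in Z ->
  dinv N BIG g (fun u v => [&& g u v != 0, v != z & lab z u == lab z v]) (E z) (fun=> 0).
Hypothesis hew : forall z, z \in Z -> ewit N BIG g z (lab z) (E z) (fun=> 0).
Hypothesis hseed : forall z u v, z \in Z -> u < N -> v < N -> crossing g lab z u v -> D z u - g u v <= E z v.

Definition restrict (F : nat -> nat -> nat) z y := if (z \in Z) && (y < N) then F z y else 0.
(** A vertex outside the sources has no outgoing edge and reaches only itself, with score [BIG]. No
    memory cell holds this value, but [labels_second] needs distances from all vertices. *)
Definition Dhat z y := if z \in Z then restrict D z y else if z == y then BIG else 0.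

Lemma lab_zero z y : z \in Z -> y < N -> D z y = 0 -> lab z y = 0.
Proof. by move=> hz hy h; have [_ _ h3 _] := hwit hz; apply: h3; rewrite // h. Qed.

Lemma src0 : 0 \in Z. Proof. by rewrite mem_filter mem_iota /= expn_gt0. Qed.

Lemma restrict_lab0 y : restrict lab 0 y = 0.
Proof.
rewrite /restrict src0 /=; case: ifP => // hy; case: (y =P 0) => [->|hne]; first by have [_ h _ _] := hwit src0.
apply: lab_zero => //; first exact: src0.
have [_ _ _ h4] := hwit src0; case: (posnP (D 0 y)) => // h0.
have [|p [p1 _ _ _]] := h4 y hy hne; first by rewrite maxn0.
by have := gG_ge (first_edge p1).
Qed.

Lemma restrict_labN z y : restrict lab z y < N.
Proof.
rewrite /restrict; case: ifP => [/andP[hz hy]|_]; last exact: N0.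
case: (y =P z) => [->|hne]; first by have [_ -> _ _] := hwit hz; exact: N0.
case: (posnP (D z y)) => h0; first by rewrite lab_zero // N0.
have [_ _ _ h4] := hwit hz; have [|p [p1 _ _ _]] := h4 y hy hne; first by rewrite maxn0.
by have /and5P[_ _ _ h _] := gG_ge (first_edge p1).
Qed.

Lemma second_Vn x y : x < N -> is_second BIG g x y (Vn g (restrict lab) (restrict E) N x y).
Proof.
have hDz z : z \in Z -> D z z = BIG by move=> hz; have [h _ _ _] := hwit hz; rewrite maxn0 in h.
have ge_src z v : ge g z v -> z \in Z by move=> h; exact: (srcsP h).
have ge_N u v : ge g u v -> u < N /\ v < N by move=> /gG_ge/and5P[].
have rin F z v : z \in Z -> v < N -> restrict F z v = F z v by move=> h1 h2; rewrite /restrict h1 h2.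
have rout F z v : z \notin Z -> restrict F z v = 0 by move=> h1; rewrite /restrict (negbTE h1).
have routN F z v : N <= v -> restrict F z v = 0 by move=> h1; rewrite /restrict ltnNge h1 andbF.
have Din z v : z \in Z -> v < N -> Dhat z v = D z v by move=> h1 h2; rewrite /Dhat h1 rin.
have DinN z v : z \in Z -> N <= v -> Dhat z v = 0 by move=> h1 h2; rewrite /Dhat h1 routN.
have Dout z v : z \notin Z -> Dhat z v = if z == v then BIG else 0 by move=> h1; rewrite /Dhat (negbTE h1).
apply: (@labels_second N BIG g (@gG_ge n G) (@gG_small n G W weight_le) Dhat).
- by rewrite addn1.
- exact: N0.
- move=> z v; case: (boolP (z \in Z)) => hz; last by rewrite Dout //; case: ifP.
  by case: (ltnP v N) => hv; [rewrite Din //; have [h _ _ _ _] := hD hz; apply: h | rewrite DinN].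
- by move=> z hz; case: (boolP (z \in Z)) => hzZ; [rewrite Din // hDz | rewrite Dout // eqxx].
- move=> z u v hz huv; have [hu hv] := ge_N _ _ huv; case: (boolP (z \in Z)) => hzZ.
    rewrite !Din //; case: (posnP (D z u)) => [->//|h0]; have [_ _ _ _ h] := hD hzZ.
    by have := h u v hu hv h0 huv; rewrite maxn0.
  rewrite Dout //; case: (z =P u) => [e|_] //.
  by move: hzZ; rewrite e (ge_src u v huv).
- move=> z v hz hvz; case: (boolP (z \in Z)) => hzZ; last by rewrite Dout //; case: eqP => // e; case: hvz.
  case: (ltnP v N) => hv; last by rewrite DinN.
  rewrite Din // rin // => h0; have [_ _ _ h4] := hwit hzZ; have [|p [p1 p2 p3 p4]] := h4 v hv hvz; first by rewrite maxn0.
  by exists p; rewrite maxn0 in p4.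
- move=> z; case: (boolP (z \in Z)) => hz; last by rewrite rout.
  by rewrite rin ?(srcs_lt hz) //; have [_ -> _ _] := hwit hz.
- move=> z v; case: (boolP (z \in Z)) => hz; last by rewrite rout.
  by case: (ltnP v N) => hv; [rewrite rin //; have [h _ _ _ _] := hE hz; apply: h | rewrite routN].
- move=> z v; case: (boolP (z \in Z)) => hz; last by rewrite rout.
  by case: (ltnP v N) => hv; [rewrite Din // rin //; apply: lab_zero | rewrite routN].
- exact: restrict_lab0.
- move=> z u v hz hvz huv; have [hu hv] := ge_N _ _ huv; case: (boolP (z \in Z)) => hzZ.
    rewrite Din // !rin // => hl; apply: hseed => //; rewrite /crossing [g u v != 0]huv /=; apply/andP; split; exact/eqP.
  move=> hl; rewrite Dout //; case: (z =P u) => [e|_] //.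
  by move: hzZ; rewrite e (ge_src u v huv).
- move=> z u v hz hvz huz huv; have [hu hv] := ge_N _ _ huv; case: (boolP (z \in Z)) => hzZ; last by rewrite !rout.
  rewrite !rin // => hl; case: (posnP (E z u)) => [->//|h0]; have [_ _ _ _ h] := hE hzZ.
  have := h u v hu hv h0; rewrite maxn0; apply; rewrite [g u v != 0]huv (introF eqP hvz) /=; exact/eqP.
- move=> z v hz; case: (boolP (z \in Z)) => hzZ; last by rewrite rout.
  case: (ltnP v N) => hv; last by rewrite routN.
  rewrite !rin // => h0; have [|h1 [b [p [p1 p2 p3 p4 p5]]]] := hew hzZ hv; first by rewrite maxn0.
  by split=> //; exists b, p; rewrite maxn0 in p5.
Qed.

End Correctness.

Definition tA := tfork vLM LM + 250 + ttrie es + tlead n + (4 + N * (tphase c cnd1 add1 + 8)) + (4 + N * (tseed c + 8)) +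
  (4 + N * (tphase c cnd2 0 + 8)) + (tspread c + tjump c + toutput).

(** Each stage has its own processor bound: 2m for reading the edges and building the trees, N for
    the leaders, amortized bounds for the two runs and the seeds, and N per source for the
    jumping. *)
Definition wA := (2 * m) * (tfork vLM LM + 250 + ttrie es) + N * tlead n +
  (2 * (tphase c cnd1 add1 + 8) + 2 * (tseed c + 8) + 2 * (tphase c cnd2 0 + 8)) * (size Z * (m + N + N)) +
  12 * size Z + size Z * N * (tspread c + tjump c + toutput + 1).

Lemma wp_algA (M : nat -> nat -> nat) t w (Q : state -> Prop) :
  (forall k, k <> 1 -> M k = mem0 inp k) ->
  (forall st, tm st <= t + tA -> wk st + size (env st) <= w + wA ->
     (forall x y : 'I_n, second_distance G x y (decode (smem st raw (3 * m + 2 + (x * n + y))))) -> Q st) ->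
  wp OFF coins ALGA Q (St M [:: en0 c] t w).
Proof.
move=> hM hQ.
have hg := @gG_ge n G; have hN : cN c = 2 ^ cL c by [].
have hKB : cKB c = cBIG c * cN c + cN c by [].
have hZu := srcs_uniq G; have hZlt := @srcs_lt n G.
have hmem0 k : k <> raw -> mem0 inp k = fun=> 0 by move=> hk; apply: funext => a; rewrite /mem0 (introF eqP hk).
have hLM : 2 ^ LM <= 2 * m := logM_leq hm.
have c1 : wpc OFF coins (2 * m) (Kill vm ;; ADJ ;; TRIE) (fun M' E' t' => [/\ t' <= t + (tfork vLM LM + 250 + ttrie es),
    E' = [:: en0 c], forall u v, u < N -> v < N -> M' 2 (u * N + v) = g u v, forall k, 4 < k -> M' k = mem0 inp k &
    (forall a, M' 3 a = `[< mk G es (N * (L + 1)) a >]) /\ (forall a, M' 4 a = `[< od G es (N * (L + 1)) a >])]) M [:: en0 c] t.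
  apply: wpc_seq; apply: wpc_kill1; first by rewrite -lt0n.
  apply: wpc_seq; apply: (@wpc_adj n G es hes coins (2 * m) hLM) => //; [by rewrite hM; [apply: funext => a; rewrite /mem0 eqxx|]| by move=> a; rewrite hM // hmem0|].
  move=> M1 t1 h1 h2 h3; apply: (@wpc_trie n G es hes coins (2 * m) hLM).
  + by rewrite h2 // hM //; apply: funext => a; rewrite /mem0 eqxx.
  + by move=> a; rewrite h2 // hM // hmem0.
  + by move=> a; rewrite h2 // hM // hmem0.
  move=> M2 t2 h4 h5 h6 h7; split=> //; first by move: h1 h4; rewrite /=; lia.
    by move=> u v hu hv; rewrite h5 // h3.
  by move=> k hk; rewrite h5 ?h2 ?hM //; lia.
rewrite /ALGA; apply: wp_seq; apply: (wp_capped c1); first by rewrite /=; lia.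
move=> M1 E1 t1 w1 [ht1 -> M1g M1k [M13 M14]] _ _ hw1.
have c2 : wpc OFF coins N LEADERS (fun M' E' t' => [/\ t' <= t1 + tlead n, forall k, k <> 3 -> M' k = M1 k,
     forall u nd, u < N -> nd < N + N -> M' 3 (u * (N + N) + nd) = tr G u nd &
     E' = map (lenv c (fun=> 0) (fun=> 0) (fun=> 0) (fun=> 0) (fun=> N)) Z]) M1 [:: en0 c] t1.
  refine (@wpc_leaders n G es hes coins N (leqnn N) W 0 0 _ M1 t1 M13 M14 _).
  by move=> M' t' h1 h2 h3; split.
apply: wp_seq; apply: (wp_capped c2); first by rewrite /= expn_gt0.
move=> M2 E2 t2 w2 [ht2 M2k M23 ->] _ _ hw2.
have M22 u v : u < N -> v < N -> M2 2 (u * N + v) = g u v by move=> hu hv; rewrite M2k // M1g.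
have M2z k : 4 < k -> k <> raw -> forall a, M2 k a = 0.
  by move=> hk hkr a; rewrite M2k ?M1k ?hmem0 //; move: hk; clear; lia.
have htr := @trS n G; have htr1 := @tr1 n G; have hlf := @tr_leaf n G.
have bool3 a b : (1 - (1 - a)) * (1 - b) = (a != 0) && (b == 0) by clear; case: a; case: b => *; lia.
apply: wp_seq; rewrite /RUN1.
pose X1 z := fun D K lab => dwit N BIG g z D K lab.
pose addv1 (j z : nat) := if j == 0 then BIG * N + z else 0.
pose A1 (z : nat) := fun u v => g u v != 0.
pose K0 (z v : nat) := if v == z then BIG else 0.
apply: (@wp_run OFF coins c hN hKB g (tr G) hg htr htr1 hlf Z hZu 5 6 cnd1 add1 true A1 addv1 X1 M2 isT isT
   _ _ _ _ _ M22 M23 M2 (fun _ _ => 0) K0 (fun _ _ => 0)).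
- move=> M' k t' x u s z j hz hj; rewrite /add1 /addv1 /= hj; case: j hj => [|j] _ /=; last by rewrite addn0 mul0n.
  by rewrite mul1n.
- by move=> [|j] z.
- move=> M' k t' x u s z v old hz hv hu h1 h2; by rewrite /cnd1 /gpos /= /A1 h1 // M22 // ?bool3.
- by [].
- move=> z D K lab u s hz hd he hs hx; apply: (@dijkstra_wit N BIG g hg (A1 z) D K u s _ hd he z lab) => //.
  exact: hZlt.
- split=> //.
  + by split=> [//|]; split=> a; rewrite M2z.
  + split=> [z v hz hv|z hz]; first by rewrite !M2z.
    split; first split=> //.
    * by move=> v hv; rewrite /K0; case: ifP.
    split=> //; first by rewrite max0n /K0 eqxx.
    by move=> v hv hne; rewrite max0n /K0 (introF eqP hne).
  + split=> [z hz|]; first by left.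
    exists (fun _ _ => 0); split=> //.
    * by move=> z hz; split=> [v hv|nd hnd]; rewrite !M2z.
    * move=> z v hz hv; rewrite M2z // add0n /addv1 eqxx modnMDl modn_small ?hZlt //.
      by rewrite /K0 => /eqP/negbTE ->.
    * move=> z hz; have hzN := hZlt z hz; rewrite M2z // add0n /addv1 eqxx modnMDl modn_small // divnMDl // divn_small // addn0.
      split; last by rewrite hKB leq_add2l ltnW.
      by split=> //; [rewrite /K0 eqxx|left; rewrite addn1|move=> v hv; rewrite /K0; case: ifP].
move=> M3 D K lab k3 u3 s3 t3 w3 [p1 _ [p3 [p3' _]] [p4 p5] [p6 _]] ht3 hw3.
have hK0 z v : z \in Z -> v < N -> K z v = 0.
  by move=> hz hv; have [hd _] := p5 z hz; apply: (queue_empty hd (leqnn _) (p6 z hz)).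
have hD z : z \in Z -> dinv N BIG g (A1 z) (D z) (fun=> 0).
  move=> hz; have [[i1 i2 i3 i4 i5] _] := p5 z hz; split=> //.
  by move=> u v hu hv h0 huv; have := i5 u v hu hv h0 huv; rewrite hK0.
have hwit z : z \in Z -> dwit N BIG g z (D z) (fun=> 0) (lab z).
  move=> hz; have [_ [w1' w2' w3' w4']] := p5 z hz; split=> //.
  + by rewrite -w1' hK0 ?hZlt.
  + by move=> v hv h; apply: w3'; rewrite ?hK0.
  + by move=> v hv hne h; have := w4' v hv hne; rewrite hK0 //; apply.
have M32 u v : u < N -> v < N -> M3 2 (u * N + v) = g u v by move=> hu hv; rewrite p1 ?M22.
have M33 u nd : u < N -> nd < N + N -> M3 3 (u * (N + N) + nd) = tr G u nd by move=> hu hv; rewrite p1 ?M23.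
have M3z k : 7 < k -> k <> raw -> forall a, M3 k a = 0.
  by move=> hk hkr a; rewrite p1 ?M2z //; move: hk; clear; lia.
apply: wp_seq.
apply: (@wp_seeds OFF coins c hN hKB g (tr G) hg htr htr1 hlf Z hZu hZlt M3 D lab M32 M33 _ _ p3' _ _ _ hwit).
- by move=> z v hz hv; case: (p4 z v hz hv).
- by move=> z v hz hv; case: (p4 z v hz hv).
- exact: M3z.
- by move=> z v hz hv; have [h _ _ _ _] := hD z hz; apply: h.
- by move=> z hz; have [h _ _ _] := hwit z hz; rewrite maxn0 in h.
move=> M4 K4 k4 u4 s4 t4 w4 [q1 q2 q3 q4 q5] ht4 hw4.
have M42 u v : u < N -> v < N -> M4 2 (u * N + v) = g u v by move=> hu hv; rewrite q1 ?M32.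
have M43 u nd : u < N -> nd < N + N -> M4 3 (u * (N + N) + nd) = tr G u nd by move=> hu hv; rewrite q1 ?M33.
apply: wp_seq; rewrite /RUN2.
pose A2 z := fun u v => [&& g u v != 0, v != z & lab z u == lab z v].
(* Scores never decrease, so the lower bounds given by the crossing edges persist through the second
   run. *)
pose X2 z (E K : nat -> nat) (_ : nat -> nat) := ewit N BIG g z (lab z) E K /\
  forall u v, u < N -> v < N -> crossing g lab z u v -> D z u - g u v <= maxn (E v) (K v).
apply: (@wp_run OFF coins c hN hKB g (tr G) hg htr htr1 hlf Z hZu 8 9 cnd2 0 false A2 (fun _ _ => 0) X2 M4 isT isT
   _ _ _ _ _ M42 M43 M4 (fun _ _ => 0) K4 lab).
- by [].
- by [].
- move=> M' k t' x u s z v old hz hv hu h1 h2; rewrite /cnd2 /gpos /= /A2 h1 // M42 // h2 // q1 //.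
  have [_ ->] := p4 z v hz hv; have [_ ->] := p4 z (u z) hz hu.
  move: (lab z (u z)) (lab z v) (M' 9 _) (g (u z) v); clear => a b d e.
  rewrite (_ : 1 - (v - z + (z - v)) = (v == z)); last by lia.
  rewrite (_ : 1 - (a - b + (b - a)) = (a == b)); last by lia.
  by case: (v == z); case: (a == b); case: d => [|d]; case: e => [|e].
- by move=> z u v hz /and3P[].
- move=> z E Ke lb u s hz hd he hs [hx1 hx2]; have hA : forall u v, A2 z u v -> g u v != 0 by move=> ? ? /and3P[].
  split.
    apply: (@dijkstra_ewit N BIG g hg (A2 z) E Ke u s hA hd he z (lab z) hs) => //.
    by move=> v /and3P[_ /eqP h1 /eqP h2].
  move=> a v ha hv hc; apply: leq_trans (hx2 a v ha hv hc) _.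
  exact: (@dijkstra_ge N BIG g hg (A2 z) E Ke u s hA hd he v hv).
- split=> //.
  + by split=> //; split=> // a; rewrite q1.
  + split=> [z v hz hv|z hz].
      by rewrite !q1 // M3z //; case: (p4 z v hz hv).
    have [e1 e2] := q5 z hz; split; first by split=> // v hv; apply: q4.
    split=> // u v hu hv hc; rewrite max0n; exact: e2.
  + split=> [z hz|]; first by left.
    exists K4; split=> //.
    by move=> z hz; rewrite !addn0; have [h1 h2] := heap_extract hN hKB hZu q3 (fun v hv => q4 z v hz hv) hz.
move=> M5 E K5 lab5 k5 u5 s5 t5 w5 [r1 r2 [r3 [r3' _]] [r4 r5] [r6 _]] ht5 hw5.
have hK50 z v : z \in Z -> v < N -> K5 z v = 0.
  by move=> hz hv; have [hd _] := r5 z hz; apply: (queue_empty hd (leqnn _) (r6 z hz)).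
have hE z : z \in Z -> dinv N BIG g (A2 z) (E z) (fun=> 0).
  move=> hz; have [[i1 i2 i3 i4 i5] _] := r5 z hz; split=> //.
  by move=> u v hu hv h0 huv; have := i5 u v hu hv h0 huv; rewrite hK50.
have hew z : z \in Z -> ewit N BIG g z (lab z) (E z) (fun=> 0).
  by move=> hz v hv; have [_ [h _]] := r5 z hz; have := h v hv; rewrite hK50.
have hseed z u v : z \in Z -> u < N -> v < N -> crossing g lab z u v -> D z u - g u v <= E z v.
  by move=> hz hu hv hc; have [_ [_ h]] := r5 z hz; have := h u v hu hv hc; rewrite hK50 // maxn0.
have hV := second_Vn hD hwit hE hew hseed.
set labh := restrict lab in hV; set Eh := restrict E in hV.
have e7 : M5 7 = M3 7 by rewrite r2 // q1.
have e9 z v : z \notin Z -> v < N -> M5 9 (z * N + v) = 0.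
  by move=> hz hv; have [|_ ->] := r3 (z * N + v); rewrite ?q1 ?M3z // divnMDl // divn_small // addn0.
have e7' z v : z \notin Z -> v < N -> M5 7 (z * N + v) = 0.
  by move=> hz hv; rewrite e7; have [|-> _] := p3 (z * N + v); rewrite ?M2z // divnMDl // divn_small // addn0.
have hJ : wpc OFF coins (size Z * N) (SPREAD ;; JUMP ;; OUTPUT 10)
   (fun M' E' t' => t' <= t5 + (tspread c + tjump c + toutput) /\
      forall x y : 'I_n, second_distance G x y (decode (M' raw (3 * m + 2 + (x * n + y)))))
   M5 (map (lenv c u5 s5 k5 (fun=> N) (fun=> N)) Z) t5.
  have hCP : cN c * cN c <= cCP c by rewrite /=; move: N N0; clear; nia.
  have hE0 y : Eh 0 y = 0.
    case: (posnP (Eh 0 y)) => //; rewrite /Eh /restrict src0 /=; case: ifP => // hy h0.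
    have [|_ [b [p [pp1 _ _ _ _]]]] := hew 0 src0 y hy; first by rewrite maxn0.
    by have := hg _ _ (first_edge pp1).
  have hlab0 : forall y, labh 0 y = 0 := restrict_lab0 hwit.
  have hg0 x : g x 0 = 0 by apply/eqP/negPn/negP => /hg; rewrite andbF.
  have hZ0 x y : x < N -> x \notin Z -> labh x y = 0 /\ Eh x y = 0.
    by move=> hx hz; rewrite /labh /Eh /restrict (negbTE hz).
  apply: wpc_seq; apply: (@wpc_spread OFF coins (size Z * N) c hN hCP Z hZu hZlt (leqnn _)) => t6 ht6.
  apply: wpc_seq; apply: (@wpc_jump OFF coins (size Z * N) c hN hCP Z hZu hZlt (leqnn _) g labh Eh) => //.
  + move=> x y; rewrite /Eh /restrict; case: ifP => // /andP[hz hv]; have [h _ _ _ _] := hE x hz; exact: h.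
  + exact: (restrict_labN hwit).
  + exact: gB.
  + move=> x y hx hy; rewrite r1 // M42 //; split=> //; rewrite /labh /Eh /restrict hy andbT; case: ifP => hz.
    * by rewrite e7; case: (p4 x y hz hy).
    * by rewrite e7' // hz.
    * by case: (r4 x y hz hy).
    * by rewrite e9 // hz.
  + by move=> a; rewrite !r1 // !q1 // !M3z.
  move=> M6 x6 t7 ht7 h6k h6.
  have hnN := ltn_logN n.
  apply: (@wpc_output OFF coins (size Z * N) n m N BIG erefl hnN (cells Z L)) => //.
    exact: uniq_cells.
  move=> M7 E7 t8 ht8 _ hout; split; first by lia.
  move=> x y; rewrite hout //; have hx : x.+1 < N by apply: leq_ltn_trans hnN.
  have hy : y.+1 < N by apply: leq_ltn_trans hnN.
  have -> : (if x.+1 * N + y.+1 \in cells Z L then unscore N BIG (M6 10 (x.+1 * N + y.+1)) else M6 raw (3 * m + 2 + (x * n + y))) =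
     unscore N BIG (Vn g labh Eh N x.+1 y.+1).
    case: ifP => [_|]; first by rewrite h6.
    rewrite (mem_cells hN) divnMDl // divn_small // addn0 => /negbT hz.
    rewrite h6k // r1 // q1 // p1 // M2k // M1k // /mem0 eqxx nth_default; last by rewrite size_input; lia.
    by have [-> _ _] := @outside c Z g labh Eh hZ0 hlab0 hE0 hg0 N x.+1 y.+1 N0 hx hz.
  exact: (second_link weight_le (hV x.+1 y.+1 hx)).
have hZN : size Z <= size Z * N by rewrite leq_pmulr.
apply: (wp_capped hJ); first by rewrite size_map.
move=> M8 E8 t9 w9 [ht9 hfin] _ hE8 hw9; apply: hQ => //=.
  have {}ht3 : t3 <= t2 + 4 + N * (tphase c cnd1 add1 + 8) := ht3.
  have {}ht4 : t4 <= t3 + 4 + N * (tseed c + 8) := ht4.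
  have {}ht5 : t5 <= t4 + 4 + N * (tphase c cnd2 0 + 8) := ht5.
  rewrite /tA; move: ht1 ht2 ht3 ht4 ht5 ht9.
  move: (N * (tphase c cnd1 add1 + 8)) (N * (tseed c + 8)) (N * (tphase c cnd2 0 + 8)).
  by clear; lia.
have hsum : \sum_(v < N) outdeg c (tr G) v <= m + N := sum_outdeg hes W 0 0.
have b1 : w1 <= w + 2 * m * (tfork vLM LM + 250 + ttrie es) by apply: leq_trans hw1 _; rewrite leq_add2l leq_mul2l; apply/orP; right; lia.
have b2 : w2 <= w1 + N * tlead n by apply: leq_trans hw2 _; rewrite leq_add2l leq_mul2l; apply/orP; right; lia.
have b9 : w9 <= w5 + size Z * N * (tspread c + tjump c + toutput) by apply: leq_trans hw9 _; rewrite leq_add2l leq_mul2l; apply/orP; right; lia.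
have s1 : size Z * (\sum_(v < N) outdeg c (tr G) v + N) <= size Z * (m + N + N) by rewrite leq_mul2l leq_add2r hsum orbT.
have s2 : size Z * (\sum_(v < N) outdeg c (tr G) v) <= size Z * (m + N + N).
  by rewrite leq_mul2l; apply/orP; right; apply: leq_trans hsum (leq_addr _ _).
have b3 := leq_trans hw3 (leq_add (leq_add (leqnn w2) (leq_mul (leqnn (2 * (tphase c cnd1 add1 + 8))) s1)) (leqnn (4 * size Z))).
have b4 := leq_trans hw4 (leq_add (leq_add (leqnn w3) (leq_mul (leqnn (2 * (tseed c + 8))) s2)) (leqnn (4 * size Z))).
have b5 := leq_trans hw5 (leq_add (leq_add (leqnn w4) (leq_mul (leqnn (2 * (tphase c cnd2 0 + 8))) s1)) (leqnn (4 * size Z))).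
have eA : (2 * (tphase c cnd1 add1 + 8) + 2 * (tseed c + 8) + 2 * (tphase c cnd2 0 + 8)) * (size Z * (m + N + N)) =
   2 * (tphase c cnd1 add1 + 8) * (size Z * (m + N + N)) + 2 * (tseed c + 8) * (size Z * (m + N + N)) +
   2 * (tphase c cnd2 0 + 8) * (size Z * (m + N + N)) by rewrite !mulnDl.
rewrite /wA eA [size Z * N * (_ + 1)]mulnDr muln1.
move: b1 b2 b3 b4 b5 b9 hE8.
move: (2 * m * _) (N * tlead n) (2 * (tphase c cnd1 add1 + 8) * _) (2 * (tseed c + 8) * _) (2 * (tphase c cnd2 0 + 8) * _) (size Z * N * _) (size E8).
by clear; lia.
Qed.

End AlgorithmA.

(** Degrees are inferred and checked by evaluation: 20 is the memory degree of the main program, and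
    200 bounds all degrees. *)
Lemma well_sizedA : well_sized PHASE1 ALGA 20 200.
Proof. by vm_cast_no_check (erefl true). Qed.

Lemma coin_freeA : coin_free (compile PHASE1 ALGA).
Proof. by vm_cast_no_check (erefl true). Qed.

(** * Numerical bounds for the deterministic algorithm *)

Section Logs.
Variables (n m : nat).
Notation l := (trunc_log 2 n).+1.

Lemma logN_le : logN n <= l.
Proof. by case: n. Qed.

Lemma powN_le : 2 ^ logN n <= 2 * n + 1.
Proof. by case: n => // k; apply: leq_trans (logN_leq (ltn0Sn k)) _; rewrite leq_addr. Qed.

Lemma logM_le : m <= n * n -> logM m <= 2 * l.
Proof.
move=> hm; rewrite /logM /logN; case e: m.-1 => [|k] //.
have h1 : 2 ^ trunc_log 2 k.+1 <= k.+1 by apply: trunc_logP.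
have h2 : n < 2 ^ l by apply: trunc_log_ltn.
have h3 : k.+1 < 2 ^ (2 * l).
  by rewrite mulnC expnM -mulnn; move: (2 ^ l) h2 => q h2; nia.
by have := leq_ltn_trans h1 h3; rewrite ltn_exp2l.
Qed.

End Logs.

Lemma no_edges_second n (G : wdigraph n) (x y : 'I_n) : edges G = set0 -> second_distance G x y None.
Proof.
move=> hE; have hnil p : simple_path G x y p -> p = [::].
  by case: p => // a p /and3P[/= /andP[+ _]]; rewrite hE inE.
rewrite /second_distance; split; last by [].
by move=> P [hP _]; rewrite /second_distance_wrt => q [hq]; rewrite (hnil _ hP) (hnil _ hq).
Qed.

Lemma idleA : idle_time (ADJ ;; TRIE) + idle_time (LEADERS ;; RUN1 ;; SEEDS ;; RUN2 ;; (SPREAD ;; JUMP ;; OUTPUT 10)) <= 500.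
Proof. by vm_cast_no_check (erefl true). Qed.

Section BoundsA.
Variables (n : nat) (G : wdigraph n) (es : seq ('I_n * 'I_n)).
Hypothesis hes : lists_edges G es.
Notation m := (size es).
Notation l := (trunc_log 2 n).+1.
Notation N := (2 ^ logN n).

Lemma time1_le : time1 es <= 1000 * l.
Proof.
have hL := logN_le n; have hLM := logM_le (m_le hes).
by rewrite /time1 /twin /tfork /treset /=; move: (logN n) (logM m) l hL hLM (ltn0Sn (trunc_log 2 n)); clear => *; lia.
Qed.

Lemma times_le W : [/\ tfork vLM (logM m) <= 60 * l, tlead n <= 500 * l,
  tphase (ctlW es W 0 0) cnd1 add1 + 8 <= 900 * l /\ tphase (ctlW es W 0 0) cnd2 0 + 8 <= 900 * l,
  tseed (ctlW es W 0 0) + 8 <= 900 * l & tspread (ctlW es W 0 0) + tjump (ctlW es W 0 0) + toutput + 1 <= 900 * l].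
Proof.
have hL := logN_le n; have hLM := logM_le (m_le hes).
rewrite /tfork /tlead /tphase /tseed /trelax /tforkout /tleaf /tup /tspread /tjump /toutput /tfork /=.
by move: (logN n) (logM m) l hL hLM (ltn0Sn (trunc_log 2 n)); clear => *; split; try split; lia.
Qed.

Lemma ttrie_le : ttrie es <= 300 * l + 300 * (N * l).
Proof.
have [h1 _ _ _ _] := times_le 0; have hL := logN_le n; rewrite /ttrie.
have : N * (logN n + 1) <= N * (2 * l) by rewrite leq_mul2l; apply/orP; right; lia.
by move: (N * (logN n + 1)) (tfork _ _) h1 => a b h1; lia.
Qed.

Lemma tA_le W : tA es W <= 10 * 1000 * (n.+1 * l).
Proof.
have [h1 h2 [h3 h4] h5 h6] := times_le W; have h7 := ttrie_le; have hN := powN_le n.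
have hP : N * l <= (2 * n + 1) * l by rewrite leq_mul2r hN orbT.
have b3 : N * (tphase (ctlW es W 0 0) cnd1 add1 + 8) <= N * (900 * l) by rewrite leq_mul2l h3 orbT.
have b4 : N * (tphase (ctlW es W 0 0) cnd2 0 + 8) <= N * (900 * l) by rewrite leq_mul2l h4 orbT.
have b5 : N * (tseed (ctlW es W 0 0) + 8) <= N * (900 * l) by rewrite leq_mul2l h5 orbT.
rewrite /tA; move: (N * (tphase _ cnd1 _ + 8)) (N * (tphase _ cnd2 _ + 8)) (N * (tseed _ + 8)) b3 b4 b5 => x3 x4 x5 b3 b4 b5.
have e : N * (900 * l) = 900 * (N * l) by rewrite mulnCA.
rewrite e in b3 b4 b5; move: (N * l) hP h7 b3 b4 b5 => P hP h7 b3 b4 b5.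
have e2 : (2 * n + 1) * l = 2 * (n * l) + l by rewrite mulnDl mul1n mulnA.
have e3 : n.+1 * l = n * l + l by rewrite mulSn addnC.
rewrite e2 in hP; rewrite e3; move: (n * l) l hP h7 b3 b4 b5 h1 h2 h6 (ltn0Sn (trunc_log 2 n)); clear => *; lia.
Qed.

Lemma wA_le W : 0 < m -> 2 * m * (1000 * l) + wA G es W <= 200 * 1000 * (m * n * l).
Proof.
move=> hm; have [h1 h2 [h3 h4] h5 h6] := times_le W; have h7 := ttrie_le; have hN := powN_le n.
have [z1 z2] := size_srcs hes; have N0 : 0 < N by rewrite expn_gt0.
have n0 : 0 < n.
  rewrite lt0n; apply/eqP => e0; have := m_le hes; rewrite [X in _ <= X](_ : _ = 0); [lia | by rewrite e0].
set Zs := size (srcs G) in z1 z2 *.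
have q1 : m * l <= m * (N * l) by rewrite leq_mul2l leq_pmull ?orbT.
have q2 : N * l <= m * (N * l) by rewrite leq_pmull.
(* Both bounds on the number of sources are needed: N against the summand m, and m + 1 against the
   summands N. *)
have q3 : Zs * (m + N + N) <= 5 * (m * N).
  have a1 : Zs * m <= m * N by rewrite mulnC leq_mul2l z2 orbT.
  have a2 : Zs * N <= m.+1 * N by rewrite leq_mul2r z1 orbT.
  have a3 : N <= m * N by rewrite leq_pmull.
  rewrite !mulnDr; rewrite mulSn in a2; move: (Zs * m) (Zs * N) (m * N) a1 a2 a3; clear => *; lia.
have q4 : Zs * N <= 2 * (m * N).
  have a2 : Zs * N <= m.+1 * N by rewrite leq_mul2r z1 orbT.
  have a3 : N <= m * N by rewrite leq_pmull.
  rewrite mulSn in a2; move: (Zs * N) (m * N) a2 a3; clear => *; lia.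
have q5 : Zs <= 2 * (m * (N * l)).
  apply: leq_trans (_ : Zs * N <= _); first by rewrite leq_pmulr.
  by apply: leq_trans q4 _; rewrite leq_mul2l /= mulnA leq_pmulr.
have t1 : 2 * m * (tfork vLM (logM m) + 250 + ttrie es) <= 2000 * (m * (N * l)).
  apply: leq_trans (_ : 2 * m * (650 * l + 300 * (N * l)) <= _).
    by rewrite leq_mul2l; apply/orP; right; move: (N * l) l h1 h7 (ltn0Sn (trunc_log 2 n)); clear => *; lia.
  have -> : 2 * m * (650 * l + 300 * (N * l)) = 1300 * (m * l) + 600 * (m * (N * l)) by move: (N * l); clear => *; lia.
  by move: (m * (N * l)) (m * l) q1; clear => *; lia.
have t2 : N * tlead n <= 500 * (m * (N * l)).
  apply: leq_trans (_ : N * (500 * l) <= _); first by rewrite leq_mul2l h2 orbT.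
  by rewrite mulnCA leq_mul2l q2 orbT.
have t3 : (2 * (tphase (ctlW es W 0 0) cnd1 add1 + 8) + 2 * (tseed (ctlW es W 0 0) + 8) + 2 * (tphase (ctlW es W 0 0) cnd2 0 + 8)) * (Zs * (m + N + N))
    <= 27 * 1000 * (m * (N * l)).
  apply: leq_trans (_ : 54 * 100 * l * (5 * (m * N)) <= _).
    by apply: leq_mul => //; move: (tphase _ cnd1 _) (tphase _ cnd2 _) (tseed _) h3 h4 h5; clear => *; lia.
  by rewrite leq_eqVlt; apply/orP; left; apply/eqP; clear; lia.
have t4 : Zs * N * (tspread (ctlW es W 0 0) + tjump (ctlW es W 0 0) + toutput + 1) <= 1800 * (m * (N * l)).
  apply: leq_trans (_ : 2 * (m * N) * (900 * l) <= _); first by apply: leq_mul.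
  by rewrite leq_eqVlt; apply/orP; left; apply/eqP; clear; lia.
have t5 : m * (N * l) <= 3 * (m * n * l).
  have -> : 3 * (m * n * l) = m * (3 * n * l) by clear; lia.
  by rewrite leq_mul2l leq_mul2r; apply/orP; right; apply/orP; right; lia.
rewrite /wA -/Zs; move: (2 * m * (tfork _ _ + _ + _)) (N * tlead n) (_ * (Zs * (m + N + N))) (Zs * N * _) t1 t2 t3 t4 => x1 x2 x3 x4 t1 t2 t3 t4.
have e1 : 2 * m * (1000 * l) = 2000 * (m * l) by clear; lia.
rewrite e1; move: (m * (N * l)) (m * l) (m * n * l) q1 q5 t1 t2 t3 t4 t5; clear => *; lia.
Qed.

End BoundsA.

Theorem deterministic_part : exists (P : program) (C k K : nat), coin_free P /\
  forall (n : nat) (G : wdigraph n) (es : seq ('I_n * 'I_n)), lists_edges G es ->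
  forall coins : nat -> nat -> bool,
  within_budget P coins (initial G es) (soft_bound C k n n) (soft_bound C k n (#|edges G| * n)) (word_bound G K) /\
  computes_APSSSP G P coins es (soft_bound C k n n).
Proof.
(* [C] is kept abstract so that no tactic unfolds the large unary number. *)
have [C hC] : exists C, 1000 * 1000 <= C by (exists (1000 * 1000); exact: leqnn).
exists (compile PHASE1 ALGA), C, 1, (7 * 200); split; first exact: coin_freeA.
move=> n G es hes coins.
have em : #|edges G| = size es by rewrite cardE (perm_size hes).
rewrite em; move eT : (soft_bound C 1 n n) => T; move eW : (soft_bound C 1 n _) => W.
have l0 := ltn0Sn (trunc_log 2 n); have ht1 := time1_le hes.
move: eT eW; rewrite /soft_bound expn1 => eT eW.
pose R (st : state) := forall x y : 'I_n, second_distance G x y (decode (smem st raw (3 * size es + 2 + (x * n + y)))).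
have main : wp (3 * size es + n * n + 2) coins PHASE1 (wp (3 * size es + n * n + 2) coins ALGA (fun st =>
     [/\ tm st < T, wk st + size (env st) <= W & R st])) (St (mem0 (input G es)) [:: [:: n; size es]] 9 9).
  have hcap : 2 ^ logM (size es) <= maxn 1 (2 * size es).
    case: (posnP (size es)) => [->|h]; first by [].
    exact: leq_trans (logM_leq h) (leq_maxr _ _).
  have h1 := @wpc_phase1 n G es hes coins _ hcap (fun M' E' t' => exists W', [/\ forall k, k <> 1 -> M' k = mem0 (input G es) k,
     forall i, i < size es -> nth 0 (input G es) (3 * i + 4) <= W', t' = time1 es & E' = [:: en0 (ctlW es W' 0 0)]]).
  apply: (wp_capped (h1 _)).
  - by move=> M' W' t' a1 a2 a3; exists W'.
  - exact: leq_maxl.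
  move=> M1 E1 t1 w1 [W' [a1 a2 a3 ->]] _ _ hw1.
  have hw1' : w1 <= 9 + maxn 1 (2 * size es) * (1000 * (trunc_log 2 n).+1).
    by apply: leq_trans hw1 _; rewrite leq_add2l leq_mul2l; apply/orP; right; lia.
  case: (posnP (size es)) => hm.
    rewrite /ALGA; apply: wp_seq; apply: wp_seq; apply: wp_kill.
    have -> : [seq v <- [:: en0 (ctlW es W' 0 0)] | eval (3 * size es + n * n + 2) M1 v vm != 0] = [::].
      by rewrite /= hm.
    do 2 apply: wp_idle; have := idleA; move: (idle_time _) (idle_time _) => i1 i2 hi.
    rewrite hm muln0 in hw1'; rewrite hm mul0n in eW.
    have b1 : 1000 * 1000 * (trunc_log 2 n).+1 <= C * (trunc_log 2 n).+1 by rewrite leq_mul2r hC orbT.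
    split.
    + rewrite -eT a3 [tm _]/=; have : C * (trunc_log 2 n).+1 <= C * n.+1 * (trunc_log 2 n).+1 by rewrite leq_mul2r leq_pmulr ?orbT.
      move: b1 ht1 l0 hi; move: (C * n.+1 * _) => x1; move: (C * _) => x2; move: (trunc_log 2 n).+1 (time1 es) => x3 x4.
      by clear; lia.
    + rewrite -eW muln1 [wk _]/= [size _]/= addn0; rewrite (maxn_idPl (leq0n 1)) mul1n in hw1'.
      move: b1 l0 hw1'; move: (C * _) => x2; move: (trunc_log 2 n).+1 => x3.
      by clear; lia.
    + move=> x y; rewrite [smem _]/= a1 // /mem0 eqxx nth_default; last by rewrite size_input; lia.
      by apply: no_edges_second; apply/eqP; rewrite -cards_eq0 em hm.
  apply: (@wp_algA n G es hes coins W' a2 hm) => [//|st hst1 hst2 hst3]; split; last exact: hst3.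
  - apply: leq_ltn_trans hst1 _; rewrite a3 -eT -mulnA.
    have b1 := tA_le hes W'; have b2 : 1000 * 1000 * (n.+1 * (trunc_log 2 n).+1) <= C * (n.+1 * (trunc_log 2 n).+1) by rewrite leq_mul2r hC orbT.
    have b3 : (trunc_log 2 n).+1 <= n.+1 * (trunc_log 2 n).+1 by rewrite leq_pmull.
    move: b1 b2 b3 ht1 l0; move: (C * _) => x1; move: (n.+1 * _) => x2; move: (trunc_log 2 n).+1 (time1 es) (tA _ _) => x3 x4 x5.
    by clear; lia.
  - apply: leq_trans hst2 _; rewrite (maxn_idPr _) in hw1'; last by lia.
    have b1 := wA_le hes W' hm.
    have b2 : 1000 * 1000 * ((size es * n).+1 * (trunc_log 2 n).+1) <= C * (size es * n).+1 * (trunc_log 2 n).+1.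
      by rewrite -[C * _ * _]mulnA leq_mul2r hC orbT.
    rewrite -eW; apply: leq_trans b2; rewrite [(_ * _).+1 * _]mulSn.
    move: b1 hw1' l0; move: (2 * size es * _) (wA _ _ _) => x1 x2; move: (size es * n * _) => x3; move: (trunc_log 2 n).+1 => x4.
    by clear; lia.
have hsub : (code2 PHASE1 ALGA).1 = map (subst_const 61) (code2 PHASE1 ALGA).1.
  by rewrite -[LHS]map_id; apply: eq_map => i; rewrite subst_const61.
(* 61 is below 2^6, which gives the exponent 7 * 200 of the word bound. Substituting 61 for itself
   changes nothing. *)
have [hb [c hc [st hst hmem]]] := program_correct (r := 6) hes well_sizedA (erefl : wfs ALGA) hsub isT main.
split; first exact: hb.
exists c; first exact: hc.
move=> x y; rewrite hmem /conc size_input ifT; first exact: hst.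
by have := ltn_ord x; have := ltn_ord y; move: (nat_of_ord x) (nat_of_ord y) => a b; nia.
Qed.

(** * Distances avoiding a vertex *)

(* For a number of hops 2 ^ k: [tW u v] is BIG minus the length of a walk from u to v, [tV u v] lists the vertices of
   that walk, [tP u v f] is one more than a position of f in this list (0 if there is none), and [tR u v i] is BIG minus
   the length of a walk that avoids the i-th vertex of the list. *)
Record tab := Tab { tW : nat -> nat -> nat; tV : nat -> nat -> nat -> nat; tP : nat -> nat -> nat -> nat;
  tR : nat -> nat -> nat -> nat }.

Definition qry t u v f := if tP t u v f is p.+1 then tR t u v p else tW t u v.

Section Avoid.
Variables (L BIG Q : nat) (g : nat -> nat -> nat) (U : nat -> nat).
Notation N := (2 ^ L).
Hypothesis hg : forall u v, g u v != 0 -> [&& 0 < u, 0 < v, u < N, v < N & u != v].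
Hypothesis hU : forall s, U s < N.

Let N0 : 0 < N. Proof. by rewrite expn_gt0. Qed.

Definition tab0 := Tab (fun u v => if u == v then BIG else if g u v == 0 then 0 else BIG - g u v)
  (fun u v i => v) (fun u v f => ((u != v) && (f == v) : nat)) (fun _ _ _ => 0).

(** Packing the score with the vertex lets a single maximum deliver the optimum and a midpoint that
    attains it. *)
Definition key (W : nat -> nat -> nat) u v := \max_(c < N) ((W u c + W c v - BIG) * N + c).
Definition mid W u v := key W u v %% N.

(** [a] numbers a group of [Q] samples that one processor tries in turn. Level k uses 2^(L-k)
    groups: the fewer hops a walk has, the fewer centres there are, and the more samples are
    needed. *)
Fixpoint acc (q : nat -> nat -> nat -> nat) u v f a j :=
  if j is j'.+1 then maxn (acc q u v f a j') (q u (U (a * Q + j')) f + q (U (a * Q + j')) v f - BIG) else q u v f.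

Definition comb k q u v f := \max_(a < 2 ^ (L - k)) acc q u v f a Q.

Definition nW t u v := key (tW t) u v %/ N.
Definition nV k t u v i := let c := mid (tW t) u v in if i < 2 ^ k then tV t u c i else tV t c v (i - 2 ^ k).
Definition nP k t u v f := let c := mid (tW t) u v in
  if tP t u c f != 0 then tP t u c f else if tP t c v f != 0 then 2 ^ k + tP t c v f else 0.

(** Walks and lists already have the form of level k + 1; only the lengths that avoid a vertex are
    computed in two rounds, up to 3/2 and then 2 times 2^k hops. *)
Definition halfstep k t := Tab (nW t) (nV k t) (nP k t) (fun u v i => comb k (qry t) u v (nV k t u v i)).
Definition fullstep k t := Tab (nW t) (nV k t) (nP k t) (fun u v i => comb k (qry (halfstep k t)) u v (nV k t u v i)).

Fixpoint tabs k := if k is k'.+1 then fullstep k' (tabs k') else tab0.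

Definition walk u v p := path (ge g) u p && (last u p == v).

Lemma walk_cat u v w p q : walk u v p -> walk v w q -> walk u w (p ++ q).
Proof. by move=> /andP[h1 /eqP h2] /andP[h3 h4]; rewrite /walk cat_path last_cat h1 h2 h3. Qed.

Lemma glen_walk_cat u v p q : walk u v p -> glen g u (p ++ q) = glen g u p + glen g v q.
Proof. by move=> /andP[_ /eqP <-]; rewrite glen_cat. Qed.

Lemma walk_mem u v p x : walk u v p -> x \in p -> x < N.
Proof. by move=> /andP[h _] hx; have /allP/(_ x hx)/andP[] := path_lt hg h. Qed.

Lemma walk_last u v p : u < N -> walk u v p -> v < N.
Proof.
move=> hu hw; move: (hw) => /andP[_ /eqP <-]; have := mem_last u p; rewrite inE => /orP[/eqP-> //|].
exact: walk_mem hw.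
Qed.

Lemma walk_split u v p j : walk u v p -> walk u (last u (take j p)) (take j p) /\ walk (last u (take j p)) v (drop j p).
Proof. by rewrite -{1}(cat_take_drop j p) /walk cat_path last_cat => /andP[/andP[-> ->] ->]; rewrite eqxx. Qed.

Lemma keyP W u v : exists2 c, c < N & [/\ nat_of_ord (inord c : 'I_N.-1.+1) = c, key W u v = (W u c + W c v - BIG) * N + c,
  mid W u v = c & key W u v %/ N = W u c + W c v - BIG].
Proof.
have hc : 0 < #|'I_N| by rewrite card_ord.
have [c hc2] := eq_bigmax (fun c : 'I_N => (W u c + W c v - BIG) * N + c) hc.
exists c; first exact: ltn_ord.
have e : key W u v = (W u c + W c v - BIG) * N + c by rewrite /key hc2.
split=> //; first by rewrite inordK // prednK.
- by rewrite /mid e modnMDl modn_small.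
- by rewrite e divnMDl // divn_small // addn0.
Qed.

Lemma mid_lt W u v : mid W u v < N.
Proof. by rewrite /mid ltn_mod. Qed.

Lemma key_ge W u v c : c < N -> W u c + W c v - BIG <= key W u v %/ N.
Proof.
move=> hc; rewrite leq_divRL //; apply: leq_trans (leq_addr c _) _.
exact: (leq_bigmax (Ordinal hc)).
Qed.

Section Queries.
Variable (q : nat -> nat -> nat -> nat).

Definition qsound := forall u v f, u < N -> v < N -> f < N -> q u v f <= BIG /\
  (0 < q u v f -> exists p, [/\ walk u v p, f \notin p & glen g u p <= BIG - q u v f]).

Definition qcomplete r := forall u v f p, u < N -> v < N -> f < N -> walk u v p -> f \notin p -> size p <= r ->
  BIG - glen g u p <= q u v f.

Lemma join_sound u x v f : qsound -> u < N -> x < N -> v < N -> f < N -> q u x f + q x v f - BIG <= BIG /\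
  (0 < q u x f + q x v f - BIG -> exists p, [/\ walk u v p, f \notin p & glen g u p <= BIG - (q u x f + q x v f - BIG)]).
Proof.
move=> hq hu hx hv hf; have [a1 a2] := hq u x f hu hx hf; have [b1 b2] := hq x v f hx hv hf.
split; first lia; move=> h.
have [|p [p1 p2 p3]] := a2; first lia.
have [|p' [p1' p2' p3']] := b2; first lia.
exists (p ++ p'); split; first exact: walk_cat p1 p1'.
  by rewrite mem_cat negb_or p2.
by rewrite (glen_walk_cat p' p1); lia.
Qed.

End Queries.

Lemma comb_sound k q : qsound q -> qsound (comb k q).
Proof.
move=> hq u v f hu hv hf; have hacc a j : acc q u v f a j <= BIG /\
  (0 < acc q u v f a j -> exists p, [/\ walk u v p, f \notin p & glen g u p <= BIG - acc q u v f a j]).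
  elim: j => [|j [ih1 ih2]] /=; first exact: hq.
  have [h1 h2] := join_sound hq hu (hU (a * Q + j)) hv hf.
  by rewrite maxnE; case: (leqP (q u (U (a * Q + j)) f + q (U (a * Q + j)) v f - BIG) (acc q u v f a j)) => h;
    rewrite -maxnE; [rewrite (maxn_idPl h) | rewrite (maxn_idPr (ltnW h))].
have hc : 0 < #|'I_(2 ^ (L - k))| by rewrite card_ord expn_gt0.
by rewrite /comb; have [a ->] := eq_bigmax (fun a : 'I_(2 ^ (L - k)) => acc q u v f a Q) hc.
Qed.

(** Nothing here depends on tables or samples, so the set of centres is fixed before any coin is
    flipped. *)
Definition centre r1 r2 u v f x := exists p1 p2, [/\ walk u x p1, walk x v p2, f \notin p1 ++ p2,
  (size p1 <= r1) && (size p2 <= r1) &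
  forall p, walk u v p -> f \notin p -> size p <= r2 -> glen g u p1 + glen g x p2 <= glen g u p].

Definition centres r1 r2 u v f : {set 'I_N} := [set x : 'I_N | `[< centre r1 r2 u v f x >]].

(** The premise makes this vacuous for small sets, which random samples may well miss. *)
Definition hits k (X : {set 'I_N}) := 2 ^ k <= 2 * #|X| -> exists2 x : 'I_N, x \in X &
  exists a j, [/\ a < 2 ^ (L - k), j < Q & U (a * Q + j) = x].

Lemma optimal_walk r u v f p : walk u v p -> f \notin p -> size p <= r ->
  exists p0, [/\ walk u v p0, f \notin p0, size p0 <= r, uniq (u :: p0) &
    forall p', walk u v p' -> f \notin p' -> size p' <= r -> glen g u p0 <= glen g u p'].
Proof.
move=> h1 h2 h3; pose S m := `[< exists p, [/\ walk u v p, f \notin p, size p <= r & glen g u p = m] >].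
have hex : exists m, S m by exists (glen g u p); apply/asboolP; exists p.
case: (ex_minnP hex) => m /asboolP[p0 [a1 a2 a3 a4]] hmin.
have [q [/= q1 q2 q3 q4 q5]] := walk_simple g (proj1 (andP a1)).
have hw : walk u v q by rewrite /walk q1 q2; case/andP: a1.
exists q; split=> //.
- by apply: contra a2 => /q5.
- apply: leq_trans a3; apply: uniq_leq_size => //; by case/andP: q3.
move=> p' b1 b2 b3; apply: leq_trans q4 _; rewrite a4; apply: hmin; apply/asboolP; by exists p'.
Qed.

Lemma comb_complete k q r1 r2 u v f : qcomplete q r1 -> r2 <= 2 * r1 -> 2 ^ k <= 2 * (2 * r1 - r2 + 1) ->
  hits k (centres r1 r2 u v f) -> u < N -> v < N -> f < N ->
  forall p, walk u v p -> f \notin p -> size p <= r2 -> BIG - glen g u p <= comb k q u v f.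
Proof.
move=> hq hr hk hh hu hv hf p h1 h2 h3.
have [p0 [a1 a2 a3 a4 a5]] := optimal_walk h1 h2 h3.
apply: leq_trans (leq_sub2l BIG (a5 p h1 h2 h3)) _.
have hacc0 a j : q u v f <= acc q u v f a j by elim: j => //= j ih; rewrite leq_max ih.
(* A walk of at most r1 hops is covered by the old query, with which every [acc] starts. *)
case: (leqP (size p0) r1) => hs.
  apply: leq_trans (hq u v f p0 hu hv hf a1 a2 hs) _; apply: leq_trans (hacc0 0 Q) _.
  have h0 : 0 < 2 ^ (L - k) by rewrite expn_gt0.
  exact: (leq_bigmax (Ordinal h0)).
(* A cut at any position from |p0| - r1 to r1 leaves at most r1 hops on either side, which gives 2
   r1 - |p0| + 1 distinct centres. *)
have hlow : 2 * r1 - r2 + 1 <= #|centres r1 r2 u v f|.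
  pose s := [seq nth u (u :: p0) j | j <- iota (size p0 - r1) (2 * r1 - size p0 + 1)].
  have us : uniq s.
    rewrite map_inj_in_uniq ?iota_uniq // => i j; rewrite !mem_iota => /andP[_ hi] /andP[_ hj] e.
    by apply/eqP; rewrite -(nth_uniq u _ _ a4) /= ?ltnS ?e //; lia.
  have hsz : size s = 2 * r1 - size p0 + 1 by rewrite size_map size_iota.
  apply: leq_trans (_ : size s <= _); first by rewrite hsz; lia.
  have hsN x : x \in s -> x < N.
    case/mapP=> j; rewrite mem_iota => hj ->.
    have : nth u (u :: p0) j \in u :: p0 by apply: mem_nth => /=; lia.
    by rewrite inE => /orP[/eqP->|/(walk_mem a1)].
  have hN : N = N.-1.+1 by rewrite prednK.
  pose s' := pmap (insub : nat -> option 'I_N) s.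
  have hs' : map val s' = s.
    by rewrite /s' pmap_filter; [apply/all_filterP/allP => x /hsN hx; rewrite /= insubT | exact: insubK].
  have -> : size s = size s' by rewrite -hs' size_map.
  have us' : uniq s' by rewrite -(map_inj_uniq val_inj) hs'.
  rewrite -(card_uniqP us'); apply: subset_leq_card; apply/subsetP => x hx; rewrite inE; apply/asboolP.
  have : val x \in s by rewrite -hs' map_f.
  case/mapP=> j; rewrite mem_iota => hj ex.
  have el : last u (take j p0) = x.
    rewrite (ex : nat_of_ord x = _); have hj2 : j <= size p0 by lia.
    by rewrite -nth_last size_takel //; case: j hj2 {ex hj} => [|j] hj2 //=; rewrite ?take0 // nth_take //; apply: set_nth_default.
  have [w1 w2] := walk_split j a1; rewrite el in w1 w2.
  exists (take j p0), (drop j p0); split=> //.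
  - by rewrite cat_take_drop.
  - by clear -hj hs a3 hr; rewrite size_takel ?size_drop; lia.
  - by move=> p' b1 b2 b3; rewrite -(glen_walk_cat _ w1) cat_take_drop; apply: a5.
have [|x hx [a [j [ha hj ej]]]] := hh; first lia.
move: hx; rewrite inE => /asboolP[p1 [p2 [w1 w2 hf12 /andP[s1 s2] hopt]]].
have hx : x < N by exact: ltn_ord.
move: hf12; rewrite mem_cat negb_or => /andP[f1 f2].
have b1 := hq u x f p1 hu hx hf w1 f1 s1; have b2 := hq x v f p2 hx hv hf w2 f2 s2.
have b3 := hopt p0 a1 a2 a3.
have hacc i : j < i -> q u x f + q x v f - BIG <= acc q u v f a i.
  elim: i => // i ih; rewrite ltnS leq_eqVlt /= leq_max => /orP[/eqP<-|/ih->//].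
  by rewrite ej leqnn orbT.
apply: leq_trans (_ : q u x f + q x v f - BIG <= _); first by clear -b1 b2 b3; lia.
apply: leq_trans (hacc Q hj) _.
exact: (leq_bigmax (Ordinal ha)).
Qed.

(** Listed vertices need not lie on the walk. It suffices that all vertices of the walk have a
    position, and that a position given by [tP] really holds the vertex. *)
Definition tsound k t := [/\ qsound (qry t),
  forall u v, u < N -> v < N -> tW t u v <= BIG /\ (0 < tW t u v -> exists p, [/\ walk u v p, glen g u p <= BIG - tW t u v &
     forall f, f \in p -> tP t u v f != 0]),
  forall u v f, u < N -> v < N -> tP t u v f <= 2 ^ k /\ (0 < tP t u v f -> tV t u v (tP t u v f).-1 = f),
  forall u v p, u < N -> v < N -> walk u v p -> size p <= 2 ^ k -> BIG - glen g u p <= tW t u v &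
  forall u v i, u < N -> v < N -> i < 2 ^ k -> tV t u v i < N].

Lemma tab0_sound : tsound 0 tab0.
Proof.
split.
- move=> u v f hu hv hf; rewrite /qry /=.
  case: (u =P v) => [<-|huv] /=.
    by split=> // _; exists [::]; rewrite /walk /= eqxx subnn.
  case: (f =P v) => [->|hfv] /=; first by [].
  case: eqP => h0 //; split; first exact: leq_subr.
  move=> h; exists [:: v]; rewrite /walk /= !andbT eqxx /ge inE; split; [by rewrite (introN eqP h0) | exact/eqP|].
  by rewrite /glen /= addn0; lia.
- move=> u v hu hv /=; case: (u =P v) => [<-|huv].
    by split=> // _; exists [::]; rewrite /walk /= eqxx subnn.
  case: eqP => h0 //; split; first exact: leq_subr.
  move=> h; exists [:: v]; rewrite /walk /= !andbT eqxx /ge; split; [by rewrite (introN eqP h0) | |].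
    by rewrite /glen /= addn0; lia.
  by move=> f; rewrite inE => ->.
- move=> u v f hu hv /=; split; first by case: (_ && _).
  by case: (u =P v) => //= _; case: eqP.
- move=> u v [|a [|b p]] hu hv //= /andP[/= h1 /eqP h2] _.
    by rewrite -h2 eqxx /glen /= subn0.
  move: h1; rewrite andbT h2 /ge => h1; have /and5P[_ _ _ _ /negbTE ->] := hg h1.
  by rewrite (negbTE h1) /glen /= addn0.
- by move=> u v i hu hv hi.
Qed.

Lemma tab0_complete : qcomplete (qry tab0) 1.
Proof.
move=> u v f [|a [|b p]] hu hv hf //= /andP[/= h1 /eqP h2] hfp _; rewrite /qry /=.
  by rewrite -h2 eqxx /= /glen /= subn0.
move: h1; rewrite andbT h2 /ge => h1; have /and5P[_ _ _ _ /negbTE ->] := hg h1.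
have -> : (f == v) = false by move: hfp; rewrite inE h2 => /negbTE.
by rewrite (negbTE h1) /glen /= addn0.
Qed.

Section Step.
Variables (k : nat) (t : tab).
Hypothesis ht : tsound k t.

Lemma nW_sound u v : u < N -> v < N -> nW t u v <= BIG /\ (0 < nW t u v -> exists p,
   [/\ walk u v p, glen g u p <= BIG - nW t u v & forall f, f \in p -> nP k t u v f != 0]).
Proof.
move=> hu hv; case: ht => _ hW _ _ _; have [c hc [_ _ e1 e2]] := keyP (tW t) u v.
have [a1 a2] := hW u c hu hc; have [b1 b2] := hW c v hc hv.
rewrite /nW e2; split; first lia; move=> h.
have [|p [p1 p2 p3]] := a2; first lia.
have [|p' [p1' p2' p3']] := b2; first lia.
exists (p ++ p'); split; first exact: walk_cat p1 p1'.
  by rewrite (glen_walk_cat p' p1); lia.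
move=> f; rewrite mem_cat /nP e1 => /orP[/p3 h1|/p3' h1]; first by rewrite h1.
by case: ifP => // _; rewrite h1; lia.
Qed.

Lemma nP_sound u v f : u < N -> v < N -> nP k t u v f <= 2 ^ k.+1 /\ (0 < nP k t u v f -> nV k t u v (nP k t u v f).-1 = f).
Proof.
move=> hu hv; case: ht => _ _ hP _ _; have hc := mid_lt (tW t) u v; rewrite /nP /nV expnS.
move: (mid _ _ _) hc => c hc; have [a1 a2] := hP u c f hu hc; have [b1 b2] := hP c v f hc hv.
case: (posnP (tP t u c f)) => h1 /=.
  case: (posnP (tP t c v f)) => h2 /=; split=> //; first lia.
  move=> _; rewrite ifF; last by lia.
  by rewrite (_ : (2 ^ k + tP t c v f).-1 - 2 ^ k = (tP t c v f).-1) ?b2 //; lia.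
by split=> [|_]; [lia | rewrite ifT ?a2 //; lia].
Qed.

Lemma nW_complete u v p : u < N -> v < N -> walk u v p -> size p <= 2 ^ k.+1 -> BIG - glen g u p <= nW t u v.
Proof.
move=> hu hv hw hs; case: ht => _ _ _ hC _; have [w1 w2] := walk_split (2 ^ k) hw.
have hc := walk_last hu w1; apply: leq_trans (key_ge (tW t) u v hc).
have := hC _ _ _ hu hc w1; rewrite size_take_min geq_minl => /(_ isT) h1.
have := hC _ _ _ hc hv w2; rewrite size_drop => h2.
have := glen_walk_cat (drop (2 ^ k) p) w1; rewrite cat_take_drop => ->.
by rewrite expnS in hs; lia.
Qed.

Lemma nV_lt u v i : u < N -> v < N -> i < 2 ^ k.+1 -> nV k t u v i < N.
Proof.
rewrite expnS => hu hv hi; case: ht => _ _ _ _ hV; have hc := mid_lt (tW t) u v; rewrite /nV.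
by case: (ltnP i (2 ^ k)) => h; apply: hV => //; lia.
Qed.

(* A vertex outside the list of the new walk is avoided by that walk. *)
Lemma query_sound R : (forall u v f, u < N -> v < N -> f < N -> R u v f <= BIG /\
    (0 < R u v f -> exists p, [/\ walk u v p, f \notin p & glen g u p <= BIG - R u v f])) ->
  qsound (qry (Tab (nW t) (nV k t) (nP k t) (fun u v i => R u v (nV k t u v i)))).
Proof.
move=> hR u v f hu hv hf; rewrite /qry /=; have [_ h2] := nP_sound f hu hv.
case e: (nP k t u v f) h2 => [|p] h2; last by rewrite h2 //; apply: hR.
have [h3 h4] := nW_sound hu hv; split=> // /h4[p [p1 p2 p3]]; exists p; split=> //.
by apply/negP => /p3; rewrite e.
Qed.

Lemma query_complete R r : r <= 2 ^ k.+1 -> (forall u v f p, u < N -> v < N -> f < N -> walk u v p -> f \notin p -> size p <= r ->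
    BIG - glen g u p <= R u v f) ->
  qcomplete (qry (Tab (nW t) (nV k t) (nP k t) (fun u v i => R u v (nV k t u v i)))) r.
Proof.
move=> hr hR u v f p hu hv hf hw hfp hs; rewrite /qry /=; have [_ h2] := nP_sound f hu hv.
case e: (nP k t u v f) h2 => [|i] h2; last by rewrite h2 //; apply: hR.
by apply: nW_complete => //; apply: leq_trans hr.
Qed.

Lemma halfstep_sound : tsound k.+1 (halfstep k t).
Proof.
split; [|exact: nW_sound|by move=> u v f hu hv; apply: nP_sound|exact: nW_complete|exact: nV_lt].
by apply: (@query_sound (comb k (qry t))); apply: comb_sound; case: ht.
Qed.

Lemma fullstep_sound : tsound k.+1 (fullstep k t).
Proof.
split; [|exact: nW_sound|by move=> u v f hu hv; apply: nP_sound|exact: nW_complete|exact: nV_lt].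
by apply: (@query_sound (comb k (qry (halfstep k t)))); apply: comb_sound; case: halfstep_sound.
Qed.

(** With r = 2^k, the rounds go from r to 3r/2 and from there to 2r hops. Each guarantees at least
    r/2 centres, as the premise of [hits] demands; r = 1 also works, the first round then being
    void. *)
Lemma fullstep_complete : qcomplete (qry t) (2 ^ k) ->
  (forall u v f, u < N -> v < N -> f < N -> hits k (centres (2 ^ k) (2 ^ k + 2 ^ k %/ 2) u v f) /\
     hits k (centres (2 ^ k + 2 ^ k %/ 2) (2 ^ k.+1) u v f)) ->
  qcomplete (qry (fullstep k t)) (2 ^ k.+1).
Proof.
move=> hq hh; have e : 2 ^ k.+1 = 2 * 2 ^ k by rewrite expnS.
have h1 : qcomplete (qry (halfstep k t)) (2 ^ k + 2 ^ k %/ 2).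
  apply: (@query_complete (comb k (qry t))); first by rewrite e; lia.
  move=> u v f p hu hv hf; apply: (comb_complete hq) => //; [lia|lia|].
  by case: (hh u v f hu hv hf).
apply: (@query_complete (comb k (qry (halfstep k t)))) => //.
move=> u v f p hu hv hf; apply: (comb_complete h1) => //; [by rewrite e; lia|by rewrite e; lia|].
by case: (hh u v f hu hv hf).
Qed.

End Step.

Lemma tabs_sound k : tsound k (tabs k).
Proof. by elim: k => [|k ih] /=; [exact: tab0_sound | exact: fullstep_sound]. Qed.

(** This is all that correctness asks of the random samples. *)
Definition good := forall k, k < L -> forall u v f, u < N -> v < N -> f < N ->
  hits k (centres (2 ^ k) (2 ^ k + 2 ^ k %/ 2) u v f) /\ hits k (centres (2 ^ k + 2 ^ k %/ 2) (2 ^ k.+1) u v f).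

Lemma tabs_complete k : good -> k <= L -> qcomplete (qry (tabs k)) (2 ^ k).
Proof.
move=> hgood; elim: k => [|k ih] hk /=; first exact: tab0_complete.
by apply: fullstep_complete; [exact: tabs_sound | apply: ih; exact: ltnW | exact: hgood].
Qed.

End Avoid.

(** * Computing the tables *)

(* Regions: 2 = edge lengths, 7 = labels, 9 = detours, 20 = samples, 21 to 24 = [tW], [tV], [tP] and [tR] by level,
   25 = [tR] after the first round of a level, 26 = scratch, cell 0 of 27 = number of samples per processor. *)
Definition B3 (l : expr) : expr := (l * (vN * vN * vN))%X.
Definition rd2 (k : nat) (l a b : expr) : expr := ERd k (B3 l + (a * vN + b)).
Definition rd3 (k : nat) (l a b f : expr) : expr := ERd k (B3 l + ((a * vN + b) * vN + f)).
Definition nz (e : expr) : expr := (1 - (1 - e))%X.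

Definition DEC : stmt :=
  Asg 14 (vpid / vN) ;; Asg 15 (EMod vpid vN) ;; Asg 16 (V 14 / vN) ;; Asg 17 (EMod (V 14) vN).

Definition TAB0 : stmt :=
  FORK (3 * vL) ;; DEC ;; Asg 18 (EEq (V 16) (V 17)) ;; Asg 19 (ERd 2 (V 14)) ;;
  Wr 21 (1 - V 15) (V 14) (EMin (V 18 * vBIG + (1 - V 18) * (nz (V 19) * (vBIG - V 19))) vBIG) ;;
  Wr 22 (1 - V 15) (V 14 * vN) (V 17) ;;
  Wr 23 1 vpid ((1 - V 18) * EEq (V 15) (V 17)) ;; JOIN.

Definition KEYS : stmt :=
  FORK (3 * vL) ;; DEC ;;
  Wr 26 1 vpid (EMin ((rd2 21 vlev (V 16) (V 15) + rd2 21 vlev (V 15) (V 17) - vBIG) * vN + V 15) vKB) ;; JOIN ;;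
  WINMAX 26 (3 * vL) vL.

Definition LISTS : stmt :=
  FORK (3 * vL) ;; DEC ;; Asg 18 (ERd 26 (V 14 * vN)) ;; Asg 19 (EMod (V 18) vN) ;;
  Asg 20 (rd3 23 vlev (V 16) (V 19) (V 15)) ;; Asg 21 (rd3 23 vlev (V 19) (V 17) (V 15)) ;;
  Asg 22 (nz (vrep - V 15)) ;;
  Wr 21 (1 - V 15) (B3 (vlev + 1) + V 14) (EMin (V 18 / vN) vBIG) ;;
  Wr 22 1 (B3 (vlev + 1) + vpid)
    (EMin (V 22 * rd3 22 vlev (V 16) (V 19) (V 15) + (1 - V 22) * rd3 22 vlev (V 19) (V 17) (V 15 - vrep)) vN) ;;
  Wr 23 1 (B3 (vlev + 1) + vpid) (EMin (V 20 + (1 - V 20) * (V 21 + nz (V 21) * vrep)) vN) ;; JOIN.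

Definition QRY (l : expr) (k r : nat) (a b : expr) : stmt :=
  Asg 22 (rd3 23 l a b (V 15)) ;;
  Asg r (EMin ((1 - V 22) * rd2 21 l a b + nz (V 22) * rd3 k l a b (V 22 - 1)) vBIG).

(** With S = 2^k there are 2 N^3 processors: N^2 pairs, 2S list positions and N / S groups of
    samples. The groups of an entry have consecutive numbers, so a window maximum of length N / S
    combines them. The last fork copies one result per entry into the table. *)
Definition COMBINE (l : expr) (ro rn : nat) : stmt :=
  FORK (3 * vL + 1) ;; Asg 14 (vN / vrep) ;; Asg 15 (vpid / V 14) ;; Asg 14 (EMod vpid (V 14)) ;;
  Asg 16 (V 15 / (vrep + vrep)) ;; Asg 17 (EMod (V 15) (vrep + vrep)) ;;
  Asg 15 (ERd 22 (B3 (vlev + 1) + (V 16 * vN + V 17))) ;;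
  Asg 17 (EMod (V 16) vN) ;; Asg 16 (V 16 / vN) ;; Asg 10 (ERd 27 0) ;; Asg 23 (V 14 * V 10) ;;
  QRY l ro 21 (V 16) (V 17) ;;
  For 11 10 (Asg 18 (ERd 20 (V 23 + V 11)) ;; QRY l ro 19 (V 16) (V 18) ;; QRY l ro 20 (V 18) (V 17) ;;
    Asg 21 (EMin (V 21 + (V 19 + V 20 - vBIG - V 21)) vBIG)) ;;
  Wr 26 1 vpid (V 21) ;; JOIN ;;
  WINMAX 26 (3 * vL + 1) (vL - vlev) ;;
  FORK (vL + vL + vlev + 1) ;; Asg 14 (vpid / (vrep + vrep)) ;; Asg 15 (EMod vpid (vrep + vrep)) ;;
  Wr rn 1 (B3 (vlev + 1) + (V 14 * vN + V 15)) (EMin (ERd 26 (vpid * (vN / vrep))) vBIG) ;; JOIN.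

(** The first round leaves its lengths in region 25, from where the second one reads them as a table
    of level k + 1; region 24 is final. *)
Definition LEVEL : stmt :=
  (KEYS ;; LISTS) ;; COMBINE vlev 24 25 ;; COMBINE (vlev + 1) 25 24.

Lemma modE a b : a - a %/ b * b = a %% b.
Proof. by rewrite {1}(divn_eq a b) addKn. Qed.

Lemma nzE a : 1 - (1 - a) = (a != 0).
Proof. by case: a. Qed.

Lemma capE a b : a <= b -> b - (b - a) = a.
Proof. exact: subKn. Qed.

Section Flat.
Variable N : nat.
Hypothesis N0 : 0 < N.

Definition flat u v f := (u * N + v) * N + f.

Lemma flat_div u v f : f < N -> flat u v f %/ N = u * N + v.
Proof. by move=> h; rewrite divnMDl // divn_small // addn0. Qed.

Lemma flat_mod u v f : f < N -> flat u v f %% N = f.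
Proof. by move=> h; rewrite modnMDl modn_small. Qed.

Lemma row_div u v : v < N -> (u * N + v) %/ N = u.
Proof. by move=> h; rewrite divnMDl // divn_small // addn0. Qed.

Lemma row_mod u v : v < N -> (u * N + v) %% N = v.
Proof. by move=> h; rewrite modnMDl modn_small. Qed.

Lemma row_lt u v k : u < k -> v < N -> u * N + v < k * N.
Proof. by move=> hu hv; apply: leq_trans (_ : u.+1 * N <= _); rewrite ?leq_mul2r ?hu ?orbT // mulSn addnC ltn_add2r. Qed.

Lemma flat_lt u v f : u < N -> v < N -> f < N -> flat u v f < N * N * N.
Proof. by move=> hu hv hf; apply: row_lt => //; apply: row_lt. Qed.

Lemma flat_bounds p : p < N * N * N -> [/\ p %/ N %/ N < N, p %/ N %% N < N & p %% N < N].
Proof. by move=> h; rewrite !ltn_mod N0 !ltn_divLR. Qed.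

End Flat.

Lemma wfam_flat m (c : nat -> bool) va k M b p :
  wfam (iota 0 m) c (fun p => b + p) va k M k (b + p) = if (p < m) && c p then va p else M k (b + p).
Proof.
case: ifP => [/andP[hp hc]|h].
  apply: (@wfam_in _ (iota 0 m) c (fun p => b + p) va k M p) => //; [exact: iota_uniq | by move=> x y _ _ _ _ /addnI | by rewrite mem_iota].
by apply: wfam_out => _ x; rewrite mem_iota /= => hx hc /addnI e; rewrite -e hx hc in h.
Qed.

Lemma wfam_low (T : eqType) (I : seq T) (c : T -> bool) ad va k M a :
  (forall x, x \in I -> a < ad x) -> wfam I c ad va k M k a = M k a.
Proof. by move=> h; apply: wfam_out => _ x /h hx _ e; rewrite e ltnn in hx. Qed.

Section Level.
Variables (OFF : nat) (coins : nat -> nat -> bool) (c : ctl).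
Notation N := (cN c).
Notation L := (cL c).
Notation BIG := (cBIG c).
Notation k := (clev c).
Notation S := (crep c).
Notation N3 := (N * N * N).
Notation cap := (4 * N3).
Notation wpk := (wpc OFF coins cap).
Hypothesis hN : N = 2 ^ L.
Hypothesis hCP : cCP c = 4 * N3.
Hypothesis hKB : cKB c = BIG * N + N.

Let N0 : 0 < N. Proof. by rewrite hN expn_gt0. Qed.

Lemma pow3L : 2 ^ (3 * L) = N3.
Proof. by rewrite mulnC expnM -hN !expnS expn0 muln1 mulnA. Qed.

Definition en3 p x18 x19 x20 x21 x22 := en c 0 0 0 p (p %/ N) (p %% N) (p %/ N %/ N) (p %/ N %% N) x18 x19 x20 x21 x22 0 0 0.

Lemma wpc_dec m (Q : assertion) M t : Q M [seq en3 p 0 0 0 0 0 | p <- iota 0 m] (t + 12) ->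
  wpk DEC Q M (map (enp c) (iota 0 m)) t.
Proof.
move=> hQ; rewrite /DEC; do 3 (apply: wpc_seq; apply: wpc_asg => /=); apply: wpc_asg => /=.
move: hQ; rewrite -!addnA /=; congr Q; apply: eq_map => p; by rewrite /en3 /en !modE.
Qed.

Lemma wpc_end (f : nat -> seq nat) m (Q : assertion) M t : 0 < m -> (forall p, nth 0 (f p) 13 = p) ->
  (exists a10 a11 a12 a14 a15 a16 a17 a18 a19 a20 a21 a22 a23 a24 a25,
     f 0 = en c a10 a11 a12 0 a14 a15 a16 a17 a18 a19 a20 a21 a22 a23 a24 a25) ->
  Q M [:: en0 c] (t + 36) -> wpk JOIN Q M (map f (iota 0 m)) t.
Proof.
move=> hm hf [a10 [a11 [a12 [a14 [a15 [a16 [a17 [a18 [a19 [a20 [a21 [a22 [a23 [a24 [a25 e]]]]]]]]]]]]]]] hQ.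
apply: wpc_join => //; [exact: iota_uniq | by rewrite mem_iota |rewrite e; apply: wpc_reset].
by rewrite -addnA.
Qed.

Variables (Q : nat) (g : nat -> nat -> nat) (U : nat -> nat).
Hypothesis hgB : forall u v, g u v <= BIG.

Definition holds l (t : tab) (r : nat) (M : nat -> nat -> nat) := forall u v, u < N -> v < N ->
  [/\ M 21 (l * N3 + (u * N + v)) = tW t u v,
      forall i, i < 2 ^ l -> M 22 (l * N3 + flat N u v i) = tV t u v i,
      forall f, f < N -> M 23 (l * N3 + flat N u v f) = tP t u v f &
      forall i, i < 2 ^ l -> M r (l * N3 + flat N u v i) = tR t u v i].

Lemma wpc_tab0 (R : assertion) M t : k = 0 ->
  (forall u v, u < N -> v < N -> M 2 (u * N + v) = g u v) -> (forall a, M 24 a = 0) ->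
  (forall M' t', t' <= t + (500 + L * 60) -> (forall j, j <> 21 -> j <> 22 -> j <> 23 -> M' j = M j) ->
     holds 0 (tab0 BIG g) 24 M' -> R M' [:: en0 c] t') ->
  wpk TAB0 R M [:: en0 c] t.
Proof.
move=> hk hg h24 hR; rewrite /TAB0.
apply: wpc_seq; apply: (@wpc_fork _ _ _ c _ (3 * L)) => //; rewrite ?pow3L ?hCP; [lia|lia|].
apply: wpc_seq; apply: wpc_dec; do 2 (apply: wpc_seq; apply: wpc_asg).
pose u p := p %/ N %/ N; pose v p := p %/ N %% N.
apply: wpc_seq; apply: (@wpc_wr _ _ _ _ _ _ (fun p => p %% N == 0) (fun p => p %/ N) (fun p => tW (tab0 BIG g) (u p) (v p))).
- exact: iota_uniq.
- by move=> p q _ _ /eqP h1 /eqP h2 e; rewrite (divn_eq p N) (divn_eq q N) h1 h2 e.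
- by move=> p _ /=; case: (p %% N).
- by [].
- move=> p; rewrite mem_iota => /= hp _; have [h1 h2 h3] := flat_bounds N0 hp.
  have e : p %/ N = u p * N + v p by rewrite -divn_eq.
  have eM : M 2 (p %/ N) = g (u p) (v p) by rewrite e hg.
  rewrite eM nzE -/(u p) -/(v p); case: (u p =P v p) => [->|hne]; first by rewrite !subnn mul1n mul0n addn0 capE.
  have -> : 1 - (u p - v p + (v p - u p)) = 0 by lia.
  rewrite mul0n add0n nzE (_ : (u p - v p + (v p - u p) != 0) = true) ?mul1n; last by lia.
  by case: (g _ _ =P 0) => /= _; rewrite ?mul0n ?mul1n capE ?leq_subr.
set M1 := wfam _ _ _ _ _ _.
apply: wpc_seq; apply: (@wpc_wr _ _ _ _ _ _ (fun p => p %% N == 0) (fun p => p %/ N * N) (fun p => v p)).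
- exact: iota_uniq.
- move=> p q _ _ /eqP h1 /eqP h2 e; rewrite (divn_eq p N) (divn_eq q N) h1 h2 e //.
- by move=> p _ /=; case: (p %% N).
- by [].
- by [].
set M2 := wfam _ _ _ _ _ _.
apply: wpc_seq; apply: (@wpc_wr _ _ _ _ _ _ xpredT (fun p => 0 + p) (fun p => tP (tab0 BIG g) (u p) (v p) (p %% N))).
- exact: iota_uniq.
- by [].
- by [].
- by [].
- move=> p _ _ /=; rewrite -/(u p) -/(v p); move: (p %% N) (u p) (v p) => a b d.
  by case: (b =P d) => [->|hbd]; case: (a =P d) => [->|had]; rewrite ?subnn /=; lia.
set M3 := wfam _ _ _ _ _ _.
apply: wpc_end; rewrite ?muln_gt0 ?N0 //; first by do 15 eexists.
apply: hR; first by rewrite /tfork /wr_cost /=; lia.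
  by move=> j h1 h2 h3; rewrite /M3 wfam_other // /M2 wfam_other // /M1 wfam_other.
move=> a b ha hb; rewrite !mul0n !add0n.
have hab : a * N + b < N * N by apply: row_lt.
have e0 : flat N a b 0 %/ N = a * N + b by rewrite flat_div.
have em : flat N a b 0 %% N == 0 by rewrite flat_mod.
have hin : flat N a b 0 \in iota 0 N3 by rewrite mem_iota; apply: flat_lt.
have inj1 : inj_fam (iota 0 N3) (fun p => p %% N == 0) (fun p => p %/ N).
  by move=> p q _ _ /eqP h1 /eqP h2 e; rewrite (divn_eq p N) (divn_eq q N) h1 h2 e.
have inj2 : inj_fam (iota 0 N3) (fun p => p %% N == 0) (fun p => p %/ N * N).
  by move=> p q _ _ /eqP h1 /eqP h2 e; rewrite (divn_eq p N) (divn_eq q N) h1 h2 e.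
split.
- rewrite /M3 wfam_other // /M2 wfam_other //.
  have := wfam_in (fun p => tW (tab0 BIG g) (u p) (v p)) 21 M (iota_uniq _ _) inj1 hin em.
  by rewrite -/M1 /u /v e0 row_div // row_mod.
- move=> [|i] // _; rewrite /M3 wfam_other //.
  have := wfam_in (fun p => v p) 22 M1 (iota_uniq _ _) inj2 hin em.
  by rewrite -/M2 /v e0 row_mod // /flat addn0.
- move=> f hf; have := @wfam_flat N3 xpredT (fun p => tP (tab0 BIG g) (u p) (v p) (p %% N)) 23 M2 0 (flat N a b f).
  rewrite -/M3 flat_lt //= add0n => ->.
  by rewrite /u /v flat_div // flat_mod // row_div // row_mod.
- by move=> i _; rewrite /M3 wfam_other // /M2 wfam_other // /M1 wfam_other.
Qed.

Lemma wpc_keys (W : nat -> nat -> nat) (R : assertion) M t :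
  (forall u v, u < N -> v < N -> M 21 (k * N3 + (u * N + v)) = W u v /\ W u v <= BIG) ->
  (forall M' t', t' <= t + (500 + L * 200) -> (forall j, j <> 26 -> M' j = M j) ->
     (forall u v, u < N -> v < N -> M' 26 ((u * N + v) * N) = key L BIG W u v) -> R M' [:: en0 c] t') ->
  wpk KEYS R M [:: en0 c] t.
Proof.
move=> hW hR; rewrite /KEYS.
apply: wpc_seq; apply: (@wpc_fork _ _ _ c _ (3 * L)) => //; rewrite ?pow3L ?hCP; [lia|lia|].
apply: wpc_seq; apply: wpc_dec.
pose u p := p %/ N %/ N; pose v p := p %/ N %% N.
apply: wpc_seq; apply: (@wpc_wr _ _ _ _ _ _ xpredT (fun p => 0 + p) (fun p => (W (u p) (p %% N) + W (p %% N) (v p) - BIG) * N + p %% N)).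
- exact: iota_uniq.
- by [].
- by [].
- by [].
- move=> p; rewrite mem_iota => hp _; have [h1 h2 h3] := flat_bounds N0 hp.
  rewrite /= -/(u p) -/(v p); have [-> b1] := hW (u p) (p %% N) h1 h3; have [-> b2] := hW (p %% N) (v p) h3 h2.
  rewrite capE // hKB leq_add ?(ltnW h3) // leq_mul2r; apply/orP; right; lia.
set M1 := wfam _ _ _ _ _ _.
apply: wpc_seq; apply: wpc_end; rewrite ?muln_gt0 ?N0 //; first by do 15 eexists.
apply: (@wpc_winmax _ _ _ c _ _ _ (3 * L) L) => //.
- by move=> v' /(_ 3 isT).
- by rewrite pow3L; lia.
- by rewrite pow3L hCP; lia.
- by lia.
move=> M2 h2 h3; apply: hR.
- by rewrite /twin /tfork /treset /wr_cost /=; lia.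
- by move=> j hj; rewrite h2 // /M1 wfam_other.
move=> a b ha hb; rewrite h3; last first.
  rewrite pow3L -hN; have hab : (a * N + b).+1 <= N * N by apply: row_lt.
  by rewrite -mulSnr leq_mul2r hab orbT.
rewrite /winmax /key; apply: eq_bigr => d _; move: (ltn_ord d); move: (nat_of_ord d) => {}d; rewrite -hN => hd.
have := @wfam_flat N3 xpredT (fun p => (W (u p) (p %% N) + W (p %% N) (v p) - BIG) * N + p %% N) 26 M 0 (flat N a b d).
rewrite -/M1 flat_lt //= add0n => ->.
by rewrite /u /v flat_div // flat_mod // row_div // row_mod.
Qed.

Variable tb : tab.
Hypothesis hWB : forall u v, u < N -> v < N -> tW tb u v <= BIG.
Hypothesis hVN : forall u v i, u < N -> v < N -> i < 2 ^ k -> tV tb u v i < N.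
Hypothesis hPk : forall u v f, u < N -> v < N -> tP tb u v f <= 2 ^ k.
Hypothesis hS : S = 2 ^ k.
Hypothesis hkL : k < L.

Lemma S2N : 2 * S <= N.
Proof. by rewrite hS hN -expnS leq_exp2l. Qed.

Lemma level_lt u v f : u < N -> v < N -> f < N -> k * N3 + flat N u v f < k.+1 * N3.
Proof. by move=> hu hv hf; rewrite mulSn addnC ltn_add2r flat_lt. Qed.

Lemma wpc_lists (R : assertion) M t : holds k tb 24 M ->
  (forall u v, u < N -> v < N -> M 26 ((u * N + v) * N) = key L BIG (tW tb) u v) ->
  (forall M' t', t' <= t + (1000 + L * 60) -> (forall j, j <> 21 -> j <> 22 -> j <> 23 -> M' j = M j) ->
     (forall j a, a < k.+1 * N3 -> M' j a = M j a) ->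
     (forall u v, u < N -> v < N -> [/\ M' 21 (k.+1 * N3 + (u * N + v)) = nW L BIG tb u v,
        forall i, i < 2 ^ k.+1 -> M' 22 (k.+1 * N3 + flat N u v i) = nV L BIG k tb u v i &
        forall f, f < N -> M' 23 (k.+1 * N3 + flat N u v f) = nP L BIG k tb u v f]) -> R M' [:: en0 c] t') ->
  wpk LISTS R M [:: en0 c] t.
Proof.
move=> hM hK hR; rewrite /LISTS.
apply: wpc_seq; apply: (@wpc_fork _ _ _ c _ (3 * L)) => //; rewrite ?pow3L ?hCP; [lia|lia|].
apply: wpc_seq; apply: wpc_dec.
do 5 (apply: wpc_seq; apply: wpc_asg => /=).
pose K p := M 26 (p %/ N * N); pose C p := K p %% N.
pose u p := p %/ N %/ N; pose v p := p %/ N %% N; pose f p := p %% N.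
pose x20 p := M 23 (k * N3 + ((u p * N + C p) * N + f p)).
pose x21 p := M 23 (k * N3 + ((C p * N + v p) * N + f p)).
rewrite [X in wpc _ _ _ _ _ _ X _](_ : _ = [seq en3 p (K p) (C p) (x20 p) (x21 p) (S - f p != 0) | p <- iota 0 N3]); last first.
  by apply: eq_map => p; rewrite /en3 /en !nzE !modE.
have inj1 : inj_fam (iota 0 N3) (fun p => p %% N == 0) (fun p => k.+1 * N3 + p %/ N).
  by move=> p q _ _ /eqP h1 /eqP h2 /addnI e; rewrite (divn_eq p N) (divn_eq q N) h1 h2 e.
have hKp p : p < N3 -> K p = key L BIG (tW tb) (u p) (v p).
  by move=> hp; have [h1 h2 h3] := flat_bounds N0 hp; rewrite -hK // -divn_eq.
have hCp p : p < N3 -> C p = mid L BIG (tW tb) (u p) (v p) by move=> hp; rewrite /C hKp // /mid hN.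
have hKN p : p < N3 -> K p %/ N = nW L BIG tb (u p) (v p) by move=> hp; rewrite hKp // /nW hN.
have hnW p : p < N3 -> nW L BIG tb (u p) (v p) <= BIG.
  move=> hp; have [h1 h2 h3] := flat_bounds N0 hp; rewrite /nW.
  have [d hd [_ _ _ ->]] := keyP L BIG (tW tb) (u p) (v p); rewrite -hN in hd.
  by have := hWB h1 hd; have := hWB hd h2; rewrite -/(u p) -/(v p); lia.
apply: wpc_seq; apply: (@wpc_wr _ _ _ _ _ _ (fun p => p %% N == 0) (fun p => k.+1 * N3 + p %/ N) (fun p => nW L BIG tb (u p) (v p))).
- exact: iota_uniq.
- exact: inj1.
- by move=> p _ /=; case: (p %% N).
- by move=> p _ _ /=; rewrite addn1.
- move=> p; rewrite mem_iota => hp _; rewrite evalMin.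
  change (minn (K p %/ N) BIG = nW L BIG tb (u p) (v p)).
  by rewrite hKN //; apply/minn_idPl/hnW.
set M1 := wfam _ _ _ _ _ _.
pose va p := minn ((S - f p != 0) * M 22 (k * N3 + ((u p * N + C p) * N + f p)) +
   (1 - (S - f p != 0)) * M 22 (k * N3 + ((C p * N + v p) * N + (f p - S)))) N.
apply: wpc_seq; apply: (@wpc_wr _ _ _ _ _ _ xpredT (fun p => k.+1 * N3 + p) va).
- exact: iota_uniq.
- by move=> p q _ _ _ _ /addnI.
- by [].
- by move=> p _ _ /=; rewrite addn1.
- move=> p _ _; rewrite evalMin /va /M1; congr minn.
  by rewrite -[M 22]/(M 22) /= wfam_other.
set M2 := wfam _ _ _ _ _ _.
apply: wpc_seq; apply: (@wpc_wr _ _ _ _ _ _ xpredT (fun p => k.+1 * N3 + p) (fun p => minn (x20 p + (1 - x20 p) * (x21 p + (x21 p != 0) * S)) N)).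
- exact: iota_uniq.
- by move=> p q _ _ _ _ /addnI.
- by [].
- by move=> p _ _ /=; rewrite addn1.
- by move=> p _ _; rewrite evalMin /= nzE.
set M3 := wfam _ _ _ _ _ _.
apply: wpc_end; rewrite ?muln_gt0 ?N0 //; first by do 15 eexists.
apply: hR.
- by rewrite /tfork /wr_cost /=; lia.
- by move=> j h1 h2 h3; rewrite /M3 wfam_other // /M2 wfam_other // /M1 wfam_other.
- move=> j a ha; have hlow z : a < k.+1 * N3 + z by apply: leq_trans ha (leq_addr _ _).
  have e1 : M1 j a = M j a by case: (j =P 21) => [->|h]; rewrite /M1 ?wfam_low // wfam_other.
  have e2 : M2 j a = M1 j a by case: (j =P 22) => [->|h]; rewrite /M2 ?wfam_low // wfam_other.
  have e3 : M3 j a = M2 j a by case: (j =P 23) => [->|h]; rewrite /M3 ?wfam_low // wfam_other.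
  by rewrite e3 e2 e1.
move=> a b ha hb.
have hp f0 : f0 < N -> [/\ flat N a b f0 < N3, u (flat N a b f0) = a, v (flat N a b f0) = b & f (flat N a b f0) = f0].
  by move=> hf; rewrite /u /v /f flat_div // flat_mod // row_div // row_mod // flat_lt.
have hc : mid L BIG (tW tb) a b < N by rewrite hN mid_lt.
have [_ hMV1 hMP1 _] := hM a _ ha hc; have [_ hMV2 hMP2 _] := hM _ b hc hb.
split.
- have [h1 h2 h3 h4] := hp 0 N0.
  rewrite /M3 wfam_other // /M2 wfam_other //.
  have := wfam_in (fun p => nW L BIG tb (u p) (v p)) 21 M (iota_uniq _ _) inj1 (_ : flat N a b 0 \in _).
  rewrite mem_iota flat_mod // => /(_ h1 (eqxx _)).
  by rewrite -/M1 flat_div // h2 h3.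
- move=> i hi; have hi' : i < N by apply: leq_trans hi _; rewrite expnS -hS S2N.
  have [h1 h2 h3 h4] := hp i hi'.
  rewrite /M3 wfam_other // /M2 wfam_flat h1 /= /va h2 h3 h4 hCp // h2 h3 /nV -hS.
  case: (ltnP i S) => his.
    rewrite (_ : (S - i != 0) = true) ?mul1n ?subnn ?mul0n ?addn0; last by lia.
    have {}his : i < 2 ^ k by rewrite -hS.
    by rewrite hMV1 //; apply/minn_idPl/ltnW/hVN.
  rewrite (_ : (S - i != 0) = false) ?mul0n ?subn0 ?mul1n ?add0n; last by lia.
  have {}his : i - S < 2 ^ k by rewrite expnS in hi; rewrite hS in his *; lia.
  by rewrite hMV2 //; apply/minn_idPl/ltnW/hVN.
move=> f0 hf; have [h1 h2 h3 h4] := hp f0 hf.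
rewrite /M3 wfam_flat h1 /= /x20 /x21 h2 h3 h4 hCp // h2 h3 hMP1 // hMP2 // /nP -hS.
have b1 := hPk f0 ha hc; have b2 := hPk f0 hc hb; rewrite -hS in b1 b2; have hSN := S2N.
move: (tP _ _ _ _) (tP _ _ _ _) b1 b2 => x y b1 b2.
by case: y b1 => [|y] b1; case: x b2 => [|x] b2 /=; lia.
Qed.

Section Combine.
Variables (t0 : tab) (le : expr) (l ro : nat).
Hypothesis hle : forall M v, nth 0 v 8 = k -> eval OFF M v le = l.
Hypothesis hcle : cost le <= 2.
Hypothesis hlN : 2 ^ l <= N.
Hypothesis hPl : forall u v f, u < N -> v < N -> tP t0 u v f <= 2 ^ l.
Hypothesis hqB : forall u v f, u < N -> v < N -> f < N -> qry t0 u v f <= BIG.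
Hypothesis hUN : forall s, U s < N.

Definition reads (M : nat -> nat -> nat) := forall u v, u < N -> v < N ->
  [/\ M 21 (l * N3 + (u * N + v)) = tW t0 u v,
      forall f, f < N -> M 23 (l * N3 + flat N u v f) = tP t0 u v f &
      forall i, i < 2 ^ l -> M ro (l * N3 + flat N u v i) = tR t0 u v i].

Lemma wpc_qry (I : seq nat) (f : nat -> seq nat) r ia ib (A B F : nat -> nat) (R : assertion) M t : reads M ->
  (forall p, p \in I -> [/\ nth 0 (f p) 2 = N, nth 0 (f p) 6 = BIG & nth 0 (f p) 8 = k]) ->
  (forall p, p \in I -> [/\ nth 0 (f p) 15 = F p, nth 0 (f p) ia = A p & nth 0 (f p) ib = B p]) ->
  (forall p, p \in I -> [/\ A p < N, B p < N & F p < N]) -> ia != 22 -> ib != 22 ->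
  (forall t', t' <= t + 100 -> R M [seq set_nth 0 (set_nth 0 (f p) 22 (tP t0 (A p) (B p) (F p))) r (qry t0 (A p) (B p) (F p)) | p <- I] t') ->
  wpk (QRY le ro r (V ia) (V ib)) R M (map f I) t.
Proof.
move=> hM hf1 hf2 hf3 hia hib hR; rewrite /QRY.
apply: wpc_seq; apply: (@wpc_asg_in _ _ _ _ _ _ (fun p => set_nth 0 (f p) 22 (tP t0 (A p) (B p) (F p)))).
  move=> p hp; have [f2 f6 f8] := hf1 p hp; have [f15 fa fb] := hf2 p hp; have [hA hB hF] := hf3 p hp.
  by have [_ h _] := hM _ _ hA hB; rewrite /= hle // f2 f15 fa fb -/(flat N (A p) (B p) (F p)) h.
apply: (@wpc_asg_in _ _ _ _ _ _ (fun p => set_nth 0 (set_nth 0 (f p) 22 (tP t0 (A p) (B p) (F p))) r (qry t0 (A p) (B p) (F p)))); last first.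
  by apply: hR; rewrite /=; move: (cost le) hcle; clear; lia.
move=> p hp; have [f2 f6 f8] := hf1 p hp; have [f15 fa fb] := hf2 p hp; have [hA hB hF] := hf3 p hp.
congr set_nth; rewrite evalMin /= !nth_set_nth /= (negbTE hia) (negbTE hib) hle ?nth_set_nth //= f2 f6 fa fb.
have [e1 e2 e3] := hM _ _ hA hB; have := hqB hA hB hF; have := hPl (F p) hA hB; rewrite e1 /qry.
case: (tP _ _ _ _) => [|q] hq hb; first by rewrite subn0 subnn mul1n mul0n addn0; apply/minn_idPl.
by rewrite nzE /= mul1n subn1 /= -/(flat N (A p) (B p) q) e3 //; apply/minn_idPl.
Qed.

Lemma acc_le u v f a j : u < N -> v < N -> f < N -> acc BIG Q U (qry t0) u v f a j <= BIG.
Proof.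
move=> hu hv hf; elim: j => [|j ih] /=; first exact: hqB.
have := hqB hu (hUN (a * Q + j)) hf; have := hqB (hUN (a * Q + j)) hv hf.
by rewrite geq_max ih /=; lia.
Qed.

Definition tcomb := 2000 + L * 200 + Q * 500.

Lemma wpc_combine rn (V' : nat -> nat -> nat -> nat) (R : assertion) M t : rn <> 26 -> reads M -> ro <> 26 ->
  (forall u v i, u < N -> v < N -> i < 2 ^ k.+1 -> M 22 (k.+1 * N3 + flat N u v i) = V' u v i /\ V' u v i < N) ->
  M 27 0 = Q -> (forall s, s < N * Q -> M 20 s = U s) ->
  (forall M' t', t' <= t + tcomb -> (forall j, j <> 26 -> j <> rn -> M' j = M j) ->
     (forall u v i, u < N -> v < N -> i < 2 ^ k.+1 ->
        M' rn (k.+1 * N3 + flat N u v i) = comb L BIG Q U k (qry t0) u v (V' u v i)) -> R M' [:: en0 c] t') ->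
  wpk (COMBINE le ro rn) R M [:: en0 c] t.
Proof.
move=> hrn hM hro hV h27 h20 hR; rewrite /COMBINE.
have S0 : 0 < S by rewrite hS expn_gt0.
have eN : N = 2 ^ (L - k) * S by rewrite hS hN -expnD subnK // ltnW.
have eD : N %/ S = 2 ^ (L - k) by rewrite eN mulnK.
have D0 : 0 < 2 ^ (L - k) by rewrite expn_gt0.
have eS : 2 ^ k.+1 = S + S by rewrite hS expnS mul2n addnn.
have S2 : S + S <= N by rewrite addnn -mul2n S2N.
have e2N : 2 ^ (3 * L + 1) = N * N * (S + S) * 2 ^ (L - k).
  rewrite expnD pow3L expn1 addnn -mul2n; rewrite {3}eN; move: (2 ^ (L - k)) => D; lia.
have hcap2 : 2 ^ (3 * L + 1) <= 4 * N3 by rewrite expnD pow3L expn1; lia.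
set D := 2 ^ (L - k) in eN eD D0 e2N *.
pose r1 p := p %/ D; pose a p := p %% D; pose uv p := r1 p %/ (S + S); pose i p := r1 p %% (S + S).
pose u p := uv p %/ N; pose v p := uv p %% N.
pose F p := M 22 (k.+1 * N3 + (uv p * N + i p)).
pose I := iota 0 (2 ^ (3 * L + 1)).
have hI p : p \in I -> [/\ a p < D, u p < N, v p < N, i p < S + S & F p = V' (u p) (v p) (i p) /\ F p < N].
  rewrite mem_iota e2N => hp; have h1 : r1 p < N * N * (S + S) by rewrite ltn_divLR.
  have h2 : uv p < N * N by rewrite ltn_divLR //; lia.
  have h3 : u p < N by rewrite ltn_divLR.
  have h4 : v p < N by rewrite ltn_mod.
  have h5 : i p < S + S by rewrite ltn_mod; lia.
  have [|e h] := hV (u p) (v p) (i p) h3 h4; first by rewrite eS.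
  have eF : F p = V' (u p) (v p) (i p) by rewrite -e /F /flat -divn_eq.
  by rewrite ltn_mod eF.
apply: wpc_seq; apply: (@wpc_fork _ _ _ c _ (3 * L + 1)) => //; first by rewrite hCP.
rewrite -/I; do 9 (apply: wpc_seq; apply: wpc_asg => /=).
rewrite h27; apply: wpc_seq; apply: wpc_asg => /=.
rewrite [X in wpc _ _ _ _ _ _ X _](_ : _ = [seq en c Q 0 0 p (a p) (F p) (u p) (v p) 0 0 0 0 0 (a p * Q) 0 0 | p <- I]); last first.
  by apply: eq_map => p; rewrite /en !modE eD addn1.
pose C p := acc BIG Q U (qry t0) (u p) (v p) (F p) (a p).
apply: wpc_seq; apply: (@wpc_qry I _ 21 16 17 u v F) => //; first by move=> p /hI[_ ? ? _ []].
move=> t1 ht1 /=.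
apply: wpc_seq; apply: (wpc_for (I := fun j M' E t' => [/\ M' = M, t' <= t1 + 10 + j * 450 & exists x : nat -> nat -> nat,
   E = [seq en c Q j 0 p (a p) (F p) (u p) (v p) (x p 0) (x p 1) (x p 2) (C p j) (x p 3) (a p * Q) 0 0 | p <- I]]) (k := Q)).
- split=> //; first by lia.
  by exists (fun p j => nth 0 [:: 0; 0; 0; tP t0 (u p) (v p) (F p)] j); rewrite -map_comp.
- by move=> j M' E t' _ [_ _ [x ->]]; rewrite all_map; apply/allP=> p _ /=; rewrite !eqxx.
- move=> j M' E t' hj [-> ht' [x ->]].
  pose X p := U (a p * Q + j).
  have hX p : p \in I -> M 20 (a p * Q + j) = X p.
    move=> /hI[h _ _ _ _]; apply: h20; apply: leq_trans (_ : D * Q <= _); first exact: row_lt.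
    by rewrite leq_mul2r eN leq_pmulr ?orbT.
  apply: wpc_seq; apply: (@wpc_asg_in _ _ _ _ _ _ (fun p => en c Q j 0 p (a p) (F p) (u p) (v p) (X p) (x p 1) (x p 2) (C p j) (x p 3) (a p * Q) 0 0)).
    by move=> p hp; rewrite /= hX.
  apply: wpc_seq; apply: (@wpc_qry I _ 19 16 18 u X F) => //; first by move=> p /hI[_ ? ? _ []]; rewrite hUN.
  move=> t2 ht2 /=.
  apply: wpc_seq; apply: (@wpc_qry I _ 20 18 17 X v F) => //; first by move=> p /hI[_ ? ? _ []]; rewrite hUN.
  move=> t3 ht3 /=.
  apply: (@wpc_asg_in _ _ _ _ _ _ (fun p => en c Q j 0 p (a p) (F p) (u p) (v p) (X p) (qry t0 (u p) (X p) (F p)) (qry t0 (X p) (v p) (F p))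
     (C p j.+1) (tP t0 (X p) (v p) (F p)) (a p * Q) 0 0)).
    move=> p /hI[h1 h2 h3 h4 [h5 h6]]; rewrite [set_nth _ _ _ _]/= /en; congr [:: _, _, _, _, _, _, _, _, _, _, _, _, _, _, _, _, _, _, _, _, _, _ & _].
    have b1 := acc_le (a p) j h2 h3 h6; have b2 := acc_le (a p) j.+1 h2 h3 h6.
    rewrite /C /= -/(X p) in b1 b2 *; move: (acc _ _ _ _ _ _ _ _ _) (qry _ _ _ _) (qry _ _ _ _) b1 b2; clear; lia.
  split; first by rewrite all_map; apply/allP=> p _ /=; rewrite !eqxx.
  split=> //; first by move: ht' ht2 ht3; clear; rewrite /=; lia.
  by exists (fun p j => nth 0 [:: X p; qry t0 (u p) (X p) (F p); qry t0 (X p) (v p) (F p); tP t0 (X p) (v p) (F p)] j); rewrite -map_comp.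
move=> M' E t4 [-> ht4 [x ->]].
apply: wpc_seq; apply: (@wpc_wr _ _ _ _ _ _ xpredT (fun p => 0 + p) (fun p => C p Q)) => //; first exact: iota_uniq.
set M1 := wfam _ _ _ _ _ _.
apply: wpc_seq; apply: wpc_end; rewrite ?expn_gt0 //; first by do 15 eexists.
apply: wpc_seq; apply: (@wpc_winmax _ _ _ c _ _ _ (3 * L + 1) (L - k)) => //.
- by move=> w hw; rewrite /= (hw 3) // (hw 8).
- by rewrite hCP.
- by lia.
move=> M2 h2 h3.
have e2k : 2 ^ (L + L + k + 1) = N * N * (S + S) by rewrite addn1 expnS !expnD -hN -hS addnn -mul2n mulnCA.
have hcap3 : 2 ^ (L + L + k + 1) <= 4 * N3.
  by rewrite e2k [4 * _]mulnC -!mulnA !leq_mul2l; do 2 (apply/orP; right); lia.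
apply: wpc_seq; apply: (@wpc_fork _ _ _ c _ (L + L + k + 1)) => //; first by rewrite hCP.
rewrite e2k; do 2 (apply: wpc_seq; apply: wpc_asg => /=).
pose ad p := k.+1 * N3 + (p %/ (S + S) * N + p %% (S + S)).
have hm2 p : p %% (S + S) < N by apply: leq_trans S2; rewrite ltn_mod; lia.
have hinj : inj_fam (iota 0 (N * N * (S + S))) xpredT ad.
  move=> p q _ _ _ _ /addnI e; have [e1 e2] := row_inj (hm2 p) (hm2 q) e.
  by rewrite (divn_eq p (S + S)) (divn_eq q (S + S)) e1 e2.
apply: wpc_seq; apply: (@wpc_wr _ _ _ _ _ _ xpredT ad (fun p => minn (M2 26 (p * D)) BIG)).
- exact: iota_uniq.
- exact: hinj.
- by [].
- by move=> p _ _; rewrite /= modE addn1.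
- by move=> p _ _; rewrite evalMin /= eD.
set M3 := wfam _ _ _ _ _ _.
apply: wpc_end; rewrite ?muln_gt0 ?N0 ?addn_gt0 ?S0 //; first by do 15 eexists.
apply: hR.
- rewrite /tcomb; move: ht4 ht1; rewrite /twin /tfork /wr_cost /treset /=; clear -hkL; move: (L) (k) (Q) hkL => a1 a2 a3; lia.
- by move=> j h1 h4; rewrite /M3 wfam_other // h2 // /M1 wfam_other.
move=> x1 y1 i1 hx hy hi; rewrite eS in hi; have hi2 : i1 < N by apply: leq_trans hi S2.
pose p := (x1 * N + y1) * (S + S) + i1.
have S20 : 0 < S + S by lia.
have hp : p < N * N * (S + S) by apply: row_lt => //; apply: row_lt.
have ead : ad p = k.+1 * N3 + flat N x1 y1 i1 by rewrite /ad /p row_div // row_mod.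
have := wfam_in (fun p => minn (M2 26 (p * D)) BIG) rn M2 (iota_uniq _ _) hinj (_ : p \in _) isT.
rewrite mem_iota => /(_ hp); rewrite -/M3 ead => ->.
rewrite h3; last by rewrite e2N -/D -mulSnr leq_mul2r hp orbT.
have -> : winmax (M1 26) (L - k) (p * D) = comb L BIG Q U k (qry t0) x1 y1 (V' x1 y1 i1).
  rewrite /winmax /comb; apply: eq_bigr => d _; move: (ltn_ord d); rewrite -/D; move: (nat_of_ord d) => {}d hd.
  have := @wfam_flat (2 ^ (3 * L + 1)) xpredT (fun p => C p Q) 26 M 0 (p * D + d).
  have hpd : p * D + d < 2 ^ (3 * L + 1) by rewrite e2N; apply: row_lt.
  rewrite -/M1 hpd add0n /= => ->; rewrite /C.
  have hin : p * D + d \in I by rewrite mem_iota.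
  have [_ _ _ _ [-> _]] := hI _ hin.
  by rewrite /u /v /i /uv /r1 /a row_div // row_mod // /p row_div // row_mod // row_div // row_mod.
apply/minn_idPl; rewrite /comb; apply/bigmax_leqP => d _; apply: acc_le => //.
by case: (hV x1 y1 i1 hx hy) => [|_ ->]; rewrite ?eS.
Qed.

End Combine.

Hypothesis hg : forall u v, g u v != 0 -> [&& 0 < u, 0 < v, u < 2 ^ L, v < 2 ^ L & u != v].
Hypothesis hUN : forall s, U s < N.
Hypothesis hts : tsound L BIG g k tb.

Definition tlevel := 6 * 1000 + L * 1000 + Q * 1000.

Lemma wpc_level (R : assertion) M t : holds k tb 24 M -> M 27 0 = Q -> (forall s, s < N * Q -> M 20 s = U s) ->
  (forall M' t', t' <= t + tlevel -> (forall j, j \notin [:: 21; 22; 23; 24; 25; 26] -> M' j = M j) ->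
     holds k.+1 (fullstep L BIG Q U k tb) 24 M' -> R M' [:: en0 c] t') ->
  wpk LEVEL R M [:: en0 c] t.
Proof.
move=> hM h27 h20 hR; rewrite /LEVEL.
have hU2 s : U s < 2 ^ L by rewrite -hN.
have hsnd : tsound L BIG g k.+1 (halfstep L BIG Q U k tb) by apply: halfstep_sound.
apply: wpc_seq; apply: wpc_seq; apply: (@wpc_keys (tW tb)).
  by move=> u v hu hv; have [-> _ _ _] := hM u v hu hv; split=> //; apply: hWB.
move=> M1 t1 ht1 h1 hK.
have hM1 : holds k tb 24 M1 by move=> u v hu hv; rewrite !h1 //; apply: hM.
apply: (wpc_lists hM1 hK) => M2 t2 ht2 h2 hlow hnew.
have hl u v : u < N -> v < N -> k * N3 + (u * N + v) < k.+1 * N3.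
  move=> hu hv; rewrite mulSn addnC ltn_add2r; apply: leq_trans (row_lt hu hv) _.
  by rewrite leq_pmulr.
have hlf u v f : u < N -> v < N -> f < N -> k * N3 + flat N u v f < k.+1 * N3 by apply: level_lt.
have hkN : 2 ^ k <= N by rewrite hN leq_exp2l // ltnW.
have hk1N : 2 ^ k.+1 <= N by rewrite hN leq_exp2l.
have hVlt u v i : u < N -> v < N -> i < 2 ^ k.+1 -> nV L BIG k tb u v i < N.
  by rewrite !hN => hu hv hi; exact: (nV_lt hts hu hv hi).
apply: wpc_seq; apply: (@wpc_combine tb vlev k 24 _ _ hkN _ _ hUN 25 (nV L BIG k tb)) => //.
- by move=> u v f hu hv hf; case: hts => hq _ _ _ _; rewrite !hN in hu hv hf; case: (hq u v f hu hv hf).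
- move=> u v hu hv; have [e1 e2 e3 e4] := hM1 u v hu hv; split.
  + by rewrite hlow ?e1 // hl.
  + by move=> f hf; rewrite hlow ?e3 // hlf.
  + by move=> i hi; rewrite hlow ?e4 // hlf // (leq_trans hi).
- by move=> u v i hu hv hi; have [_ e2 _] := hnew u v hu hv; rewrite e2 // hVlt.
- by rewrite h2 // h1.
- by move=> s hs; rewrite h2 // h1 // h20.
move=> M3 t3 ht3 h3 hR3.
apply: (@wpc_combine (halfstep L BIG Q U k tb) (vlev + 1)%X k.+1 25 _ _ hk1N _ _ hUN 24 (nV L BIG k tb)) => //.
- by move=> M' v' h; rewrite /= h addn1.
- move=> u v f hu hv; case: hsnd => _ _ hP _ _; rewrite !hN in hu hv; by case: (hP u v f hu hv).
- by move=> u v f hu hv hf; case: hsnd => hq _ _ _ _; rewrite !hN in hu hv hf; case: (hq u v f hu hv hf).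
- move=> u v hu hv; have [e1 e2 e3] := hnew u v hu hv; rewrite (h3 21) // (h3 23) //; split=> //.
  by move=> i hi; rewrite hR3.
- by move=> u v i hu hv hi; have [_ e2 _] := hnew u v hu hv; rewrite h3 // e2 // hVlt.
- by rewrite h3 // h2 // h1.
- by move=> s hs; rewrite h3 // h2 // h1 // h20.
move=> M4 t4 ht4 h4 hR4; apply: hR.
- by move: ht1 ht2 ht3 ht4; rewrite /tcomb /tlevel; clear; lia.
- move=> j; rewrite !inE !negb_or => /and5P[/eqP j1 /eqP j2 /eqP j3 /eqP j4 /andP[/eqP j5 /eqP j6]].
  by rewrite h4 // h3 // h2 // h1.
move=> u v hu hv; have [e1 e2 e3] := hnew u v hu hv; rewrite (h4 21) // (h4 22) // (h4 23) // (h3 21) // (h3 22) // (h3 23) //; split=> // i hi.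
by rewrite hR4.
Qed.

End Level.

(** * Labels and detours *)

(** The label is the end of a best first edge, found as a maximum over b of the remaining score
    packed with b; it is 0 if the score is 0 or the two vertices coincide. *)
Definition LABELS : stmt :=
  FORK (3 * vL) ;; DEC ;; Asg 18 (ERd 2 (V 16 * vN + V 15)) ;;
  Wr 26 1 vpid (EMin (nz (V 18) * ((rd2 21 vlev (V 15) (V 17) - V 18) * vN + V 15)) vKB) ;; JOIN ;;
  WINMAX 26 (3 * vL) vL ;;
  FORK (vL + vL) ;; Asg 14 (vpid / vN) ;; Asg 15 (EMod vpid vN) ;; Asg 16 (ERd 26 (vpid * vN)) ;;
  Wr 7 1 vpid (EMin ((1 - EEq (V 14) (V 15)) * (nz (V 16 / vN) * EMod (V 16) vN)) vN) ;; JOIN.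

(** [QRY] takes the avoided vertex from variable 15, so the first vertex b moves to variable 20 and
    the source takes its place. The final assignments set up the environment in which [JUMP]
    starts. *)
Definition DETOURS : stmt :=
  FORK (3 * vL) ;; DEC ;; Asg 18 (ERd 2 (V 16 * vN + V 15)) ;; Asg 19 (ERd 7 (V 14)) ;;
  Asg 20 (V 15) ;; Asg 15 (V 16) ;; QRY vlev 24 21 (V 20) (V 17) ;;
  Wr 26 1 vpid (EMin (nz (V 18) * ((1 - EEq (V 20) (V 19)) * (V 21 - V 18))) vBIG) ;; JOIN ;;
  WINMAX 26 (3 * vL) vL ;;
  FORK (vL + vL) ;; Wr 9 1 vpid (EMin (ERd 26 (vpid * vN)) vBIG) ;;
  Asg 10 vL ;; Asg 11 vL ;; Asg 14 (vpid / vN) ;; Asg 15 (EMod vpid vN).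

(** * Labels and detours as maxima over the first edge *)

Section LabelMath.
Variables (L BIG : nat) (g D : nat -> nat -> nat) (q : nat -> nat -> nat -> nat).
Notation N := (2 ^ L).

Definition lkey z y := \max_(b < N) (if g z b != 0 then (D b y - g z b) * N + b else 0).
Definition labf z y := if (z == y) || (lkey z y %/ N == 0) then 0 else lkey z y %% N.
Definition detf z y := \max_(b < N) (if (g z b != 0) && (nat_of_ord b != labf z y) then q b y z - g z b else 0).

Let N0 : 0 < N. Proof. by rewrite expn_gt0. Qed.

Lemma labf_lt z y : labf z y < N.
Proof. by rewrite /labf; case: ifP => _; rewrite ?ltn_mod. Qed.

Lemma lkeyP z y : 0 < lkey z y %/ N -> exists b, [/\ b < N, g z b != 0, lkey z y %% N = b & lkey z y %/ N = D b y - g z b].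
Proof.
have hc : 0 < #|'I_N| by rewrite card_ord.
have [b hb] := eq_bigmax (fun b : 'I_N => if g z b != 0 then (D b y - g z b) * N + b else 0) hc.
rewrite /lkey hb; case: ifP => hg; last by rewrite div0n.
by move=> _; exists b; rewrite divnMDl // divn_small // addn0 modnMDl modn_small.
Qed.

Lemma lkey_ge z y b : b < N -> g z b != 0 -> D b y - g z b <= lkey z y %/ N.
Proof.
move=> hb hg; rewrite leq_divRL //; apply: leq_trans (leq_addr b _) _.
have := @leq_bigmax _ (fun b : 'I_N => if g z b != 0 then (D b y - g z b) * N + b else 0) (Ordinal hb).
by rewrite /= hg.
Qed.

Lemma detf_ge z y b : b < N -> g z b != 0 -> b != labf z y -> q b y z - g z b <= detf z y.
Proof.
move=> hb hg hl; have := @leq_bigmax _ (fun b : 'I_N => if (g z b != 0) && (nat_of_ord b != labf z y) then q b y z - g z b else 0) (Ordinal hb).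
by rewrite /= hg hl.
Qed.

Lemma detfP z y : 0 < detf z y -> exists b, [/\ b < N, g z b != 0, b != labf z y & detf z y = q b y z - g z b].
Proof.
have hc : 0 < #|'I_N| by rewrite card_ord.
have [b hb] := eq_bigmax (fun b : 'I_N => if (g z b != 0) && (nat_of_ord b != labf z y) then q b y z - g z b else 0) hc.
by rewrite /detf hb; case: ifP => // /andP[h1 h2] _; exists b.
Qed.

Lemma detf_le z y : (forall b, b < N -> q b y z <= BIG) -> detf z y <= BIG.
Proof.
by move=> h; apply/bigmax_leqP => b _; case: ifP => // _; apply: leq_trans (leq_subr _ _) (h b (ltn_ord b)).
Qed.

End LabelMath.

Section Labels.
Variables (OFF : nat) (coins : nat -> nat -> bool) (c : ctl).
Notation N := (cN c).
Notation L := (cL c).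
Notation BIG := (cBIG c).
Notation k := (clev c).
Notation N3 := (N * N * N).
Notation cap := (4 * N3).
Notation wpk := (wpc OFF coins cap).
Hypothesis hN : N = 2 ^ L.
Hypothesis hCP : cCP c = 4 * N3.
Hypothesis hKB : cKB c = BIG * N + N.
Variables (g : nat -> nat -> nat) (tb : tab).
Hypothesis hk : k = L.
Hypothesis hWB : forall u v, u < N -> v < N -> tW tb u v <= BIG.
Hypothesis hPk : forall u v f, u < N -> v < N -> tP tb u v f <= 2 ^ k.
Hypothesis hqB : forall u v f, u < N -> v < N -> f < N -> qry tb u v f <= BIG.

Let N0 : 0 < N. Proof. by rewrite hN expn_gt0. Qed.
Let pow3 : 2 ^ (3 * L) = N3. Proof. exact: (pow3L hN). Qed.
Let pow2 : 2 ^ (L + L) = N * N. Proof. by rewrite expnD -hN. Qed.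
Let N2_le : N * N <= 4 * N3. Proof. by move: N0; case: (N) => // x _; nia. Qed.

Notation lab := (labf L g (tW tb)).
Notation det := (detf L g (tW tb) (qry tb)).

Lemma wpc_labels (R : assertion) M t : holds c k tb 24 M ->
  (forall u v, u < N -> v < N -> M 2 (u * N + v) = g u v) ->
  (forall M' t', t' <= t + (1000 + L * 300) -> (forall j, j <> 26 -> j <> 7 -> M' j = M j) ->
     (forall u v, u < N -> v < N -> M' 7 (u * N + v) = lab u v) -> R M' [:: en0 c] t') ->
  wpk LABELS R M [:: en0 c] t.
Proof.
move=> hM hg hR; rewrite /LABELS.
apply: wpc_seq; apply: (@wpc_fork _ _ _ c _ (3 * L)) => //; rewrite ?pow3 ?hCP; [lia|lia|].
apply: wpc_seq; apply: wpc_dec; apply: wpc_seq; apply: wpc_asg.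
pose u p := p %/ N %/ N; pose v p := p %/ N %% N; pose b p := p %% N.
pose X z y d := if g z d != 0 then (tW tb d y - g z d) * N + d else 0.
apply: wpc_seq; apply: (@wpc_wr _ _ _ _ _ _ xpredT (fun p => 0 + p) (fun p => X (u p) (v p) (b p))).
- exact: iota_uniq.
- by [].
- by [].
- by [].
- move=> p; rewrite mem_iota => hp _; have [h1 h2 h3] := flat_bounds N0 hp.
  have [e1 _ _ _] := hM (b p) (v p) h3 h2; have e2 := hg (u p) (b p) h1 h3.
  rewrite evalMin /= -/(u p) -/(v p) -/(b p) e1 e2 nzE /X; case: (g _ _ != 0); rewrite ?mul0n ?min0n // mul1n.
  apply/minn_idPl; rewrite hKB leq_add ?(ltnW h3) // leq_mul2r; apply/orP; right.
  by apply: leq_trans (leq_subr _ _) (hWB h3 h2).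
set M1 := wfam _ _ _ _ _ _.
apply: wpc_seq; apply: wpc_end; rewrite ?muln_gt0 ?N0 //; first by do 15 eexists.
apply: wpc_seq; apply: (@wpc_winmax _ _ _ c _ _ _ (3 * L) L) => //.
- by move=> v' /(_ 3 isT).
- by rewrite pow3; lia.
- by rewrite pow3 hCP; lia.
- by lia.
move=> M2 h2 h3.
have hkey z y : z < N -> y < N -> M2 26 ((z * N + y) * N) = lkey L g (tW tb) z y.
  move=> hz hy; rewrite h3; last first.
    by rewrite pow3 -hN -mulSnr leq_mul2r row_lt // orbT.
  rewrite /winmax /lkey; apply: eq_bigr => d _; move: (ltn_ord d); move: (nat_of_ord d) => {}d; rewrite -hN => hd.
  have := @wfam_flat N3 xpredT (fun p => X (u p) (v p) (b p)) 26 M 0 (flat N z y d).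
  rewrite -/M1 flat_lt //= add0n => ->.
  by rewrite /u /v /b flat_div // flat_mod // row_div // row_mod // /X.
apply: wpc_seq; apply: (@wpc_fork _ _ _ c _ (L + L)) => //; rewrite ?pow2 ?hCP //.
do 3 (apply: wpc_seq; apply: wpc_asg).
apply: wpc_seq; apply: (@wpc_wr _ _ _ _ _ _ xpredT (fun p => 0 + p) (fun p => lab (p %/ N) (p %% N))).
- exact: iota_uniq.
- by [].
- by [].
- by [].
- move=> p; rewrite mem_iota => hp _.
  have h4 : p %/ N < N by rewrite ltn_divLR.
  have h5 : p %% N < N by rewrite ltn_mod.
  have e : M2 26 (p * N) = lkey L g (tW tb) (p %/ N) (p %% N) by rewrite -hkey // -divn_eq.
  have hl := labf_lt L g (tW tb) (p %/ N) (p %% N); rewrite -hN in hl.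
  rewrite evalMin /= !modE e !nzE.
  have -> : (p %/ N - p %% N + (p %% N - p %/ N) != 0) * ((lkey L g (tW tb) (p %/ N) (p %% N) %/ N != 0) * (lkey L g (tW tb) (p %/ N) (p %% N) %% N))
     = lab (p %/ N) (p %% N); last by apply/minn_idPl/ltnW.
  rewrite /labf -hN; case: (p %/ N =P p %% N) => [->|hne]; first by rewrite subnn.
  by rewrite (_ : (_ - _ + _ != 0) = true); [case: eqP => _; rewrite ?mul0n ?mul1n|lia].
set M3 := wfam _ _ _ _ _ _.
apply: wpc_end; rewrite ?muln_gt0 ?N0 //; first by do 15 eexists.
apply: hR.
- by rewrite /twin /tfork /treset /wr_cost /=; lia.
- by move=> j h4 h5; rewrite /M3 wfam_other // h2 // /M1 wfam_other.
move=> z y hz hy; have := @wfam_flat (N * N) xpredT (fun p => lab (p %/ N) (p %% N)) 7 M2 0 (z * N + y).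
by rewrite -/M3 row_lt //= add0n => ->; rewrite row_div // row_mod.
Qed.

Lemma wpc_detours (R : assertion) M t : holds c k tb 24 M ->
  (forall u v, u < N -> v < N -> M 2 (u * N + v) = g u v) ->
  (forall u v, u < N -> v < N -> M 7 (u * N + v) = lab u v) ->
  (forall M' t', t' <= t + (1000 + L * 300) -> (forall j, j <> 26 -> j <> 9 -> M' j = M j) ->
     (forall u v, u < N -> v < N -> M' 9 (u * N + v) = det u v) ->
     R M' [seq cenv c (fun _ _ => 0) p | p <- iota 0 (N * N)] t') ->
  wpk DETOURS R M [:: en0 c] t.
Proof.
move=> hM hg hlab hR; rewrite /DETOURS.
apply: wpc_seq; apply: (@wpc_fork _ _ _ c _ (3 * L)) => //; rewrite ?pow3 ?hCP; [lia|lia|].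
apply: wpc_seq; apply: wpc_dec; do 4 (apply: wpc_seq; apply: wpc_asg => /=).
pose u p := p %/ N %/ N; pose v p := p %/ N %% N; pose b p := p %% N.
have hB p : p \in iota 0 N3 -> [/\ b p < N, v p < N & u p < N].
  by rewrite mem_iota => hp; have [h1 h2 h3] := flat_bounds N0 hp.
pose X z y d := if (g z d != 0) && (d != lab z y) then qry tb d y z - g z d else 0.
have hkN : 2 ^ k <= N by rewrite hN hk.
apply: wpc_seq; apply: (@wpc_qry OFF coins c tb vlev k 24 _ _ hPk hqB (iota 0 N3) _ 21 20 17 b v u) => //.
  by move=> z y hz hy; case: (hM z y hz hy).
move=> t1 ht1 /=.
apply: wpc_seq; apply: (@wpc_wr _ _ _ _ _ _ xpredT (fun p => 0 + p) (fun p => X (u p) (v p) (b p))).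
- exact: iota_uniq.
- by [].
- by [].
- by [].
- move=> p hp _; have [h3 h2 h1] := hB p hp; have e2 := hg (u p) (b p) h1 h3.
  have e3 : M 7 (p %/ N) = lab (u p) (v p) by rewrite -hlab // -divn_eq.
  rewrite evalMin /= -/(u p) -/(v p) -/(b p) e2 e3 !nzE /X.
  have hq := hqB h3 h2 h1; case: (g _ _ != 0); rewrite ?mul0n ?min0n // mul1n /=.
  case: (b p =P lab (u p) (v p)) => [->|hne]; first by rewrite !subnn mul0n min0n.
  rewrite (_ : (_ - _ + _ != 0) = true) ?mul1n; last by lia.
  by apply/minn_idPl; apply: leq_trans (leq_subr _ _) hq.
set M1 := wfam _ _ _ _ _ _.
apply: wpc_seq; apply: wpc_end; rewrite ?muln_gt0 ?N0 //; first by do 15 eexists.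
apply: wpc_seq; apply: (@wpc_winmax _ _ _ c _ _ _ (3 * L) L) => //.
- by move=> v' /(_ 3 isT).
- by rewrite pow3; lia.
- by rewrite pow3 hCP; lia.
- by lia.
move=> M2 h2 h3.
have hkey z y : z < N -> y < N -> M2 26 ((z * N + y) * N) = det z y.
  move=> hz hy; rewrite h3; last first.
    by rewrite pow3 -hN -mulSnr leq_mul2r row_lt // orbT.
  rewrite /winmax /detf; apply: eq_bigr => d _; move: (ltn_ord d); move: (nat_of_ord d) => {}d; rewrite -hN => hd.
  have := @wfam_flat N3 xpredT (fun p => X (u p) (v p) (b p)) 26 M 0 (flat N z y d).
  rewrite -/M1 flat_lt //= add0n => ->.
  by rewrite /u /v /b flat_div // flat_mod // row_div // row_mod // /X.
apply: wpc_seq; apply: (@wpc_fork _ _ _ c _ (L + L)) => //; rewrite ?pow2 ?hCP //.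
apply: wpc_seq; apply: (@wpc_wr _ _ _ _ _ _ xpredT (fun p => 0 + p) (fun p => det (p %/ N) (p %% N))).
- exact: iota_uniq.
- by [].
- by [].
- by [].
- move=> p; rewrite mem_iota => hp _.
  have h4 : p %/ N < N by rewrite ltn_divLR.
  have h5 : p %% N < N by rewrite ltn_mod.
  have e : M2 26 (p * N) = det (p %/ N) (p %% N) by rewrite -hkey // -divn_eq.
  rewrite evalMin /= e; apply/minn_idPl; apply: detf_le => d hd; rewrite -hN in hd; exact: hqB.
set M3 := wfam _ _ _ _ _ _.
do 3 (apply: wpc_seq; apply: wpc_asg => /=); apply: wpc_asg => /=.
rewrite [X in R _ X _](_ : _ = [seq cenv c (fun _ _ => 0) p | p <- iota 0 (N * N)]); last first.
  by apply: eq_map => p; rewrite /cenv /en modE.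
apply: hR.
- by move: ht1; rewrite /twin /tfork /treset /wr_cost /=; lia.
- by move=> j h4 h5; rewrite /M3 wfam_other // h2 // /M1 wfam_other.
move=> z y hz hy; have := @wfam_flat (N * N) xpredT (fun p => det (p %/ N) (p %% N)) 9 M2 0 (z * N + y).
by rewrite -/M3 row_lt //= add0n => ->; rewrite row_div // row_mod.
Qed.

End Labels.

Lemma cells_iota j : cells (iota 0 (2 ^ j)) j = iota 0 (2 ^ j * 2 ^ j).
Proof.
rewrite cellsE; move: (2 ^ j) => m; have : forall k, flatten [seq iota (z * m) m | z <- iota 0 k] = iota 0 (k * m); last by apply.
elim=> // k ih; rewrite -addn1 iotaD map_cat flatten_cat ih /= cats0 add0n mulnDl mul1n iotaD.
by rewrite add0n.
Qed.

(** * Random samples *)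

Definition bitstep : expr := EMin (2 * V 16 + V 18) vN.

(** N is a power of two, so L coins make a uniform vertex number without rejection. Each of the N
    processors draws kap * L samples. *)
Definition COINS (kap : nat) : stmt :=
  Wr 27 1 0 (kap * vL) ;; FORK vL ;; Asg 15 (ERd 27 0) ;;
  For 14 15 (Asg 16 0 ;; For 17 3 (Flip 18 ;; Asg 16 bitstep) ;; Wr 20 1 (vpid * V 15 + V 14) (V 16)) ;; JOIN.

Fixpoint bsum (f : nat -> bool) b := if b is b'.+1 then 2 * bsum f b' + f b' else 0.

Lemma bsum_lt f b : bsum f b < 2 ^ b.
Proof. by elim: b => //= b ih; rewrite expnS; case: (f b); lia. Qed.

Lemma eq_bsum f f' b : (forall i, i < b -> f i = f' i) -> bsum f b = bsum f' b.
Proof. by elim: b => //= b ih h; rewrite ih ?h // => i hi; apply: h; apply: ltnW. Qed.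

(** Processors are listed by number, so processor p gets coin p. *)
Lemma wpc_flip OFF (coins : nat -> nat -> bool) cap m (f : nat -> seq nat) r (Q : assertion) M t :
  Q M [seq set_nth 0 (f p) r (coins t p : nat) | p <- iota 0 m] (t + 1) ->
  wpc OFF coins cap (Flip r) Q M (map f (iota 0 m)) t.
Proof.
rewrite /wpc size_map size_iota; congr Q; rewrite /mkseq; elim: (iota 0 m) => //= p s ih; by rewrite ih.
Qed.

(* The flip number [b] for sample [q] takes place at time [flip_time t L q b], where [t] is the time at which the
   loop over the samples starts. *)
Definition tbit := 9 + (cost bitstep).+1.
Definition tsample L := 14 + L * tbit + wr_cost 1 (addr 20 (vpid * V 15 + V 14)) (V 16).
Definition flip_time t L q b := t + 10 + q * tsample L + b * tbit.
Definition tcoins0 (kap L : nat) := wr_cost 1 (addr 27 0) (kap * vL) + tfork vL L + (cost (ERd 27 0)).+1.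

Definition sample (coins : nat -> nat -> bool) t L Q s :=
  bsum (fun b => coins (flip_time t L (s %% Q) b) (s %/ Q)) L.

Section Coins.
Variables (OFF : nat) (coins : nat -> nat -> bool) (cap : nat) (c : ctl) (kap : nat).
Notation N := (cN c).
Notation L := (cL c).
Notation Q := (kap * L).
Hypothesis hN : N = 2 ^ L.
Hypothesis hcap : N <= cap.
Hypothesis hCP : N <= cCP c.

Lemma wpc_coins (R : assertion) M t :
  (forall M' t', t' <= t + tcoins0 kap L + 50 + Q * tsample L -> (forall j, j <> 20 -> j <> 27 -> M' j = M j) ->
     M' 27 0 = Q -> (forall s, s < N * Q -> M' 20 s = sample coins (t + tcoins0 kap L) L Q s) -> R M' [:: en0 c] t') ->
  wpc OFF coins cap (COINS kap) R M [:: en0 c] t.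
Proof.
move=> hR; rewrite /COINS.
apply: wpc_seq; rewrite -[[:: en0 c]]/(map (fun _ => en0 c) [:: tt]).
apply: (@wpc_wr _ _ _ _ _ _ xpredT (fun=> 0) (fun=> Q)); [by [] | by move=> [] [] | by [] | by [] | by [] |].
set M1 := wfam _ _ _ _ _ _.
have e27 : M1 27 0 = Q.
  by apply: (@wfam_in _ [:: tt] xpredT (fun=> 0) (fun=> Q) 27 M tt) => // -[] [].
rewrite /=.
apply: wpc_seq; apply: (@wpc_fork _ _ _ c _ L) => //; rewrite -?hN //.
apply: wpc_seq; apply: wpc_asg; rewrite /= e27.
have -> : t + wr_cost 1 (addr 27 0) (kap * vL) + tfork vL L + (cost (ERd 27 0)).+1 = t + tcoins0 kap L by rewrite /tcoins0; lia.
set t0 := t + tcoins0 kap L.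
pose v q p b := bsum (fun b => coins (flip_time t0 L q b) p) b.
have hv q p b : b <= L -> v q p b <= N by move=> hb; apply: ltnW; apply: leq_trans (bsum_lt _ _) _; rewrite hN leq_exp2l.
apply: wpc_seq; apply: (wpc_for (I := fun j M' E t' => [/\ t' = t0 + 2 + j * tsample L, forall j, j <> 20 -> M' j = M1 j,
   forall p q, p < N -> q < j -> M' 20 (p * Q + q) = v q p L &
   exists x, E = [seq en c 0 0 0 p j Q (x p 0) (x p 1) (x p 2) 0 0 0 0 0 0 0 | p <- iota 0 N]]) (k := Q)).
- split=> //; first by lia.
  by exists (fun _ _ => 0); rewrite -map_comp.
- by move=> j M' E t' _ [_ _ _ [x ->]]; rewrite all_map; apply/allP=> p _ /=; rewrite !eqxx.
- move=> j M' E t' hj [ht' hM' hI [x ->]].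
  apply: wpc_seq; apply: wpc_asg => /=.
  apply: wpc_seq; apply: (wpc_for (I := fun b M2 E2 t2 => [/\ t2 = t0 + 8 + j * tsample L + b * tbit, M2 = M' &
     exists x, E2 = [seq en c 0 0 0 p j Q (v j p b) b (x p) 0 0 0 0 0 0 0 | p <- iota 0 N]]) (k := L)).
  + split=> //; first by rewrite ht'; lia.
    by exists (fun p => x p 2); rewrite -map_comp.
  + by move=> b M2 E2 t2 _ [_ _ [y ->]]; rewrite all_map; apply/allP=> p _ /=; rewrite !eqxx.
  + move=> b M2 E2 t2 hb [ht2 -> [y ->]]; apply: wpc_seq; apply: wpc_flip.
    apply: (@wpc_asg_in _ _ _ _ _ _ (fun p => en c 0 0 0 p j Q (v j p b.+1) b (coins (t2 + 2) p) 0 0 0 0 0 0 0)).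
      move=> p _; rewrite /= /en.
      have -> : t2 + 2 = flip_time t0 L j b by rewrite ht2 /flip_time; lia.
      have := hv j p b.+1 hb; rewrite /v /= => h; rewrite capE //.
    split; first by rewrite all_map; apply/allP=> p _ /=; rewrite !eqxx.
    split=> //; first by rewrite ht2 mulSn; have : tbit = 9 + (cost bitstep).+1 by []; lia.
    by exists (fun p => coins (t2 + 2) p : nat); rewrite -map_comp.
  move=> M2 E2 t2 [ht2 -> [y ->]].
  have hinj : inj_fam (iota 0 N) xpredT (fun p => p * Q + j).
    by move=> p q _ _ _ _ e; have [] := row_inj hj hj e.
  apply: (@wpc_wr _ _ _ _ _ _ xpredT (fun p => p * Q + j) (fun p => v j p L)) => //; first exact: iota_uniq.
  set M3 := wfam _ _ _ _ _ _.
  split; first by rewrite all_map; apply/allP=> p _ /=; rewrite !eqxx.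
  split.
  + by rewrite ht2 mulSn; have : tsample L = 14 + L * tbit + wr_cost 1 (addr 20 (vpid * V 15 + V 14)) (V 16) by []; lia.
  + by move=> i hi; rewrite /M3 wfam_other // hM'.
  + move=> p q hp; rewrite ltnS leq_eqVlt => /orP[/eqP ->|hq].
      by apply: (wfam_in (fun p => v j p L) 20 M' (iota_uniq _ _) hinj); rewrite ?mem_iota.
    rewrite /M3 wfam_out ?hI // => _ p' _ _ e; have hq' : q < Q by apply: ltn_trans hj.
    by have [_ e2] := row_inj hj hq' e; rewrite e2 ltnn in hq.
  + by exists (fun p i => nth 0 [:: v j p L; L; y p] i); rewrite -map_comp.
move=> M' E t' [ht' hM' hI [x ->]].
apply: wpc_join => //; [exact: iota_uniq | by rewrite mem_iota /= hN expn_gt0|].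
apply: wpc_reset; apply: hR.
- by rewrite ht' /treset /t0; lia.
- by move=> j h1 h2; rewrite hM' // /M1 wfam_other.
- by rewrite hM'.
move=> s hs; have Q0 : 0 < Q by case: (Q) hs => //; rewrite muln0.
have h1 : s %/ Q < N by rewrite ltn_divLR.
by rewrite {1}(divn_eq s Q) hI ?ltn_mod.
Qed.

End Coins.

(** * Second distances from the tables of avoiding walks *)

Definition inside (N : nat) (F : nat -> nat -> nat) z y := if (z < N) && (y < N) then F z y else 0.

Lemma insideE N F z y : z < N -> y < N -> inside N F z y = F z y.
Proof. by rewrite /inside => -> ->. Qed.

Section Detours.
Variables (L BIG : nat) (g : nat -> nat -> nat) (t : tab).
Notation N := (2 ^ L).
Hypothesis hg : forall u v, g u v != 0 -> [&& 0 < u, 0 < v, u < N, v < N & u != v].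
Hypothesis hB : forall u v, N * g u v < BIG.
Hypothesis hts : tsound L BIG g L t.

Notation D := (inside N (tW t)).
Notation lab := (inside N (labf L g (tW t))).
Notation E := (inside N (detf L g (tW t) (qry t))).

Let N0 : 0 < N. Proof. by rewrite expn_gt0. Qed.
Let B0 : 0 < BIG. Proof. exact: leq_ltn_trans (leq0n _) (hB 0 0). Qed.

Lemma g0 b : g 0 b = 0.
Proof. by apply/eqP/negPn/negP => /hg. Qed.

Lemma lab_zero_src y : lab 0 y = 0.
Proof.
rewrite /inside N0 /=; case: ifP => // _; rewrite /labf; case: eqP => //= _; case: eqP => //= /eqP; rewrite -lt0n => /lkeyP[b [_ + _ _]].
by rewrite g0.
Qed.

Lemma det_zero_src y : E 0 y = 0.
Proof.
rewrite /inside N0 /=; case: ifP => // _; case: (posnP (detf L g (tW t) (qry t) 0 y)) => // /detfP[b [_ + _ _]].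
by rewrite g0.
Qed.

Lemma lab_ltN z y : lab z y < N.
Proof. by rewrite /inside; case: ifP => // _; apply: labf_lt. Qed.

Lemma det_leB z y : E z y <= BIG.
Proof.
rewrite /inside; case: ifP => // /andP[hz hy]; apply: detf_le => b hb; case: hts => hq _ _ _ _.
by case: (hq b y z hb hy hz).
Qed.

Lemma simple_walk z y p : walk g z y p -> exists q, [/\ walk g z y q, size q <= N, glen g z q <= glen g z p & {subset q <= p}].
Proof.
move=> /andP[h1 h2]; have [q [q1 q2 q3 q4 q5]] := walk_simple g h1.
exists q; split=> //; first by rewrite /walk q1 q2.
case: (q =P [::]) => [-> //|hq]; exact: ltnW (simple_size hg q1 q3 hq).
Qed.

Lemma D_ge z y p : z < N -> walk g z y p -> BIG - glen g z p <= D z y.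
Proof.
move=> hz hw; have [q [q1 q2 q3 q4]] := simple_walk hw; have hy := walk_last hg hz hw.
rewrite insideE //; case: hts => _ _ _ hC _; apply: leq_trans (leq_sub2l _ q3) (hC _ _ _ hz hy q1 q2).
Qed.

Lemma D_walk z y : 0 < D z y -> [/\ z < N, y < N & exists p, walk g z y p /\ glen g z p <= BIG - D z y].
Proof.
rewrite /inside; case: ifP => // /andP[hz hy] h; split=> //; case: hts => _ hW _ _ _; have [_ /(_ h)[p [p1 p2 _]]] := hW z y hz hy.
by exists p.
Qed.

Lemma D_le z y : D z y <= BIG.
Proof. by rewrite /inside; case: ifP => // /andP[hz hy]; case: hts => _ hW _ _ _; case: (hW z y hz hy). Qed.

Lemma label_walk z y : z < N -> y <> z -> 0 < D z y ->
  exists p, [/\ path (ge g) z (lab z y :: p), last (lab z y) p = y & glen g z (lab z y :: p) <= BIG - D z y].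
Proof.
move=> hz hyz h; have [_ hy [[|b p] [/andP[p1 /eqP p2] p3]]] := D_walk h; first by case: hyz.
move: p1 => /= /andP[hb p1]; have /and5P[_ _ _ hbN _] := hg hb.
have h1 : BIG - glen g b p <= tW t b y by have := @D_ge b y p hbN; rewrite insideE // /walk p1 (p2 : last b p = y) eqxx; apply.
have h2 := lkey_ge (tW t) y hbN hb; rewrite glen_cons in p3.
have e : D z y = tW t z y by rewrite insideE.
have hD := D_le z y.
have hk : D z y <= lkey L g (tW t) z y %/ N by move: p3 h1 h2 hD h; rewrite e; clear; lia.
have [b0 [b1 b2 b3 b4]] := lkeyP (leq_trans h hk).
have el : lab z y = b0.
  rewrite insideE // /labf; case: eqP => [ezy|_]; first by case: hyz.
  by rewrite ifF ?b3 //=; apply/negbTE; rewrite -lt0n; exact: leq_trans h hk.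
have hD0 : 0 < D b0 y by rewrite insideE //; move: h hk; rewrite b4; clear; lia.
have [_ _ [q [/andP[q1 /eqP q2] q3]]] := D_walk hD0.
exists q; rewrite el /= q1 q2 glen_cons /ge b2; split=> //.
have e0 : D b0 y = tW t b0 y by rewrite insideE.
have hD2 := D_le b0 y; move: q3 hk hD hD2 h; rewrite b4 e0 e; clear; lia.
Qed.

Lemma lab_unreachable z y : D z y = 0 -> lab z y = 0.
Proof.
rewrite /inside; case: ifP => // /andP[hz hy] h; rewrite /labf; case: eqP => //= _; case: eqP => //= /eqP; rewrite -lt0n => hl.
have [b [b1 b2 b3 b4]] := lkeyP hl; have hD0 : 0 < D b y by rewrite insideE //; move: hl; rewrite b4; clear; lia.
have [_ _ [q [/andP[q1 /eqP q2] q3]]] := D_walk hD0.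
have hw : walk g z y (b :: q) by rewrite /walk /= q1 q2 eqxx /ge b2.
have := D_ge hz hw; rewrite insideE // h glen_cons.
have e0 : D b y = tW t b y by rewrite insideE.
have hD2 := D_le b y; move: hl q3 hD2; rewrite b4 e0; clear; lia.
Qed.

Section Complete.
Hypothesis hq : qcomplete L BIG g (qry t) N.

Lemma query_ge b y z p : b < N -> z < N -> walk g b y p -> z \notin p -> BIG - glen g b p <= qry t b y z.
Proof.
move=> hb hz hw hzp; have [q [q1 q2 q3 q4]] := simple_walk hw; have hy := walk_last hg hb hw.
apply: leq_trans (leq_sub2l _ q3) (hq hb hy hz q1 _ q2); apply: contra hzp; exact: q4.
Qed.

Lemma det_ge z y b p : z < N -> path (ge g) z (b :: p) -> last b p = y -> b <> lab z y -> z \notin p ->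
  BIG - glen g z (b :: p) <= E z y.
Proof.
move=> hz /= /andP[h1 h2] h3 h4 h5; have /and5P[_ _ _ hb _] := hg h1.
have hw : walk g b y p by rewrite /walk h2 h3 eqxx.
have hy := walk_last hg hb hw; rewrite insideE // in h4; rewrite insideE //.
have := detf_ge (qry t) hb h1 (introN eqP h4); have := query_ge hb hz hw h5.
by rewrite glen_cons; lia.
Qed.

(** The detour table is not built by relaxation but is an exact optimum over all detours, so each
    closure property demanded by [labels_second] follows by exhibiting a walk. *)
Lemma detours_second x y : x < N -> is_second BIG g x y (Vn g lab E N x y).
Proof.
apply: (@labels_second N BIG g hg hB D) => //.
- exact: D_le.
- move=> z hz; apply/eqP; rewrite eqn_leq D_le; have := @D_ge z z [::] hz.
  by rewrite /walk /= eqxx /glen /= subn0; apply.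
- move=> z u v hz huv; case: (posnP (D z u)) => h; first by rewrite h.
  have [_ _ [p [p1 p2]]] := D_walk h.
  have hw : walk g z v (p ++ [:: v]) by apply: walk_cat p1 _; rewrite /walk /= huv eqxx.
  have := D_ge hz hw; rewrite (glen_walk_cat _ p1) /glen [pairmap _ u _]/= [sumn [:: _]]/= addn0 -/(glen g z p).
  by move: p2 (D_le z u); move: (D z u) (D z v); clear; lia.
- by move=> z y'; apply: label_walk.
- by move=> z; rewrite /inside; case: ifP => // _; rewrite /labf eqxx.
- exact: det_leB.
- exact: lab_unreachable.
- exact: lab_zero_src.
- move=> z u y' hz hyz; case: (u =P z) => [->|huz] huy hl.
    have := @det_ge z y' y' [::] hz; rewrite /= huy /= => /(_ isT erefl hl isT).
    rewrite /glen /= addn0; have := D_le z z; move: (D z z) (E z y'); clear; lia.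
  case: (posnP (D z u)) => h; first by rewrite h.
  have [p [p1 p2 p3]] := label_walk hz huz h.
  (* A walk through the label does not return to z: the part after the return would beat the
     distance by at least the positive length of the first edge. *)
  have hzp : z \notin p.
    apply/negP => hin; case/splitPr: hin p1 p2 p3 => q1 q2 p1 p2 p3.
    have hw : walk g z u q2.
      by move: p1; rewrite /walk /= cat_path /= => /and4P[_ _ _ ->]; move: p2; rewrite last_cat /= => ->; rewrite eqxx.
    have := D_ge hz hw; move: p3; rewrite glen_cons glen_cat glen_cons.
    have : 0 < g z (lab z u) by rewrite lt0n; move: p1 => /= /andP[].
    by have := D_le z u; move: (D z u) (g z (lab z u)) h; clear; lia.
  have := @det_ge z y' (lab z u) (p ++ [:: y']) hz; rewrite -cat_cons cat_path p1 /= last_cat /= p2 huy => /(_ isT erefl hl).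
  rewrite mem_cat inE negb_or hzp /= => /(_ (introN eqP _)) h1.
  have := h1 (fun e => hyz (esym e)).
  rewrite -cat_cons glen_cat /= p2 {2}/glen /= addn0.
  by move: (D z u) (E z y') (glen g z (lab z u :: p)) p3 (D_le z u); clear; lia.
- move=> z u y' hz hyz huz huy hl; case: (posnP (E z u)) => h; first by rewrite h.
  have hu : u < N by case/and5P: (hg huy).
  have hy' : y' < N by case/and5P: (hg huy).
  move: h; rewrite insideE // => h; have [b [b1 b2 b3 b4]] := detfP h.
  have hqp : 0 < qry t b u z by move: h; rewrite b4; clear; lia.
  case: hts => hqs _ _ _ _; have [q1 /(_ hqp)[p [p1 p2 p3]]] := hqs b u z b1 hu hz.
  move: p1 => /andP[p1 /eqP p4].
  have hl' : b <> lab z y' by rewrite -hl insideE //; exact/eqP.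
  have := @det_ge z y' b (p ++ [:: y']) hz; rewrite /= cat_path p1 /= last_cat /= p4 huy /ge b2 => /(_ isT erefl hl').
  rewrite mem_cat inE negb_or p2 /= => /(_ (introN eqP (fun e => hyz (esym e)))).
  rewrite glen_cons glen_cat /= p4 {2}/glen /= addn0 !insideE // b4.
  by move: (detf _ _ _ _ z y') (qry t b u z) (glen g b p) q1 p3; clear; lia.
- move=> z y' hz; rewrite {1}/inside; case: ifP => // /andP[_ hy'] h; have [b [b1 b2 b3 b4]] := detfP h.
  have hqp : 0 < qry t b y' z by move: h; rewrite b4; clear; lia.
  case: hts => hqs _ _ _ _; have [q1 /(_ hqp)[p [p1 p2 p3]]] := hqs b y' z b1 hy' hz.
  move: p1 => /andP[p1 /eqP p4]; have /and5P[_ _ _ _ hzb] := hg b2; split.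
    move=> e; move: p4; rewrite e => p4; have := mem_last b p; rewrite p4 inE (negbTE p2) orbF => /eqP ezb.
    by rewrite ezb eqxx in hzb.
  exists b, p; rewrite !insideE //= p1 /ge b2 inE negb_or p2 andbT glen_cons b4; split=> //.
  - exact/eqP.
  - by rewrite hzb.
  - by move: h; rewrite b4; move: p3 q1; clear; lia.
Qed.

End Complete.
End Detours.

(** * The randomized algorithm *)

(** Kept apart from [COINS] because no constant in it depends on [kap]. *)
Definition TABLES : stmt :=
  ADJ ;; Asg 9 1 ;; TAB0 ;; For 8 3 (LEVEL ;; Asg 9 (EMin (vrep + vrep) vN)) ;;
  LABELS ;; DETOURS ;; JUMP ;; OUTPUT 10.

Definition ALGB (kap : nat) : stmt := COINS kap ;; TABLES.

Section AlgorithmB.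
Variables (n : nat) (G : wdigraph n) (es : seq ('I_n * 'I_n)).
Hypothesis hes : lists_edges G es.
Variables (coins : nat -> nat -> bool) (W kap : nat).
Notation m := (size es).
Notation inp := (input G es).
Notation OFF := (3 * m + n * n + 2).
Notation L := (logN n).
Notation N := (2 ^ L).
Notation LM := (logM m).
Notation g := (gG G).
Notation c := (ctlW es W).
Notation BIG := (N * (N * W + 1) + 1).
Notation Q := (kap * L).
Notation cap := (4 * (N * N * N)).
Notation U := (sample coins (time1 es + tcoins0 kap L) L Q).
Hypothesis hW : forall i, i < m -> nth 0 inp (3 * i + 4) <= W.

Let N0 : 0 < N. Proof. by rewrite expn_gt0. Qed.

Definition tB := time1 es + tcoins0 kap L + 50 + Q * tsample L + (tfork vLM LM + 200) + (600 + L * 60) +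
  L * (tlevel (c 0 0) Q + 30) + (2100 + L * 600) + tjump (c 0 0) + toutput.

Lemma sample_lt s : U s < N.
Proof. exact: bsum_lt. Qed.

(** The time bound holds for all coins; only the correctness of the output is conditional on
    [good]. *)
Lemma wpc_algB (R : assertion) M : (forall k, k <> 1 -> M k = mem0 inp k) ->
  (forall M' E' t', t' <= tB ->
     (good L Q g U -> forall x y : 'I_n, second_distance G x y (decode (M' raw (3 * m + 2 + (x * n + y))))) -> R M' E' t') ->
  wpc OFF coins cap (ALGB kap) R M [:: en0 (c 0 0)] (time1 es).
Proof.
move=> hM hR; rewrite /ALGB /TABLES.
have hN l r : cN (c l r) = 2 ^ cL (c l r) by [].
have hCP l r : cCP (c l r) = 4 * (cN (c l r) * cN (c l r) * cN (c l r)) by rewrite /= !mulnA.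
have hKB l r : cKB (c l r) = cBIG (c l r) * cN (c l r) + cN (c l r) by [].
have hg := @gG_ge n G; have hgs := @gG_small n G W (weight_le hes hW).
have hsnd k := @tabs_sound L BIG Q g U hg sample_lt k.
pose tb k := tabs L BIG Q g U k.
have hWB k u v : u < N -> v < N -> tW (tb k) u v <= BIG by case: (hsnd k) => _ h _ _ _ hu hv; case: (h u v hu hv).
have hVN k u v i : u < N -> v < N -> i < 2 ^ k -> tV (tb k) u v i < N by case: (hsnd k) => _ _ _ _; apply.
have hPk k u v f : u < N -> v < N -> tP (tb k) u v f <= 2 ^ k by case: (hsnd k) => _ _ h _ _ hu hv; case: (h u v f hu hv).
have hqB k u v f : u < N -> v < N -> f < N -> qry (tb k) u v f <= BIG.
  by case: (hsnd k) => h _ _ _ _ hu hv hf; case: (h u v f hu hv hf).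
have N_cap : N <= cap by move: N0; move: N => x x0; nia.
apply: wpc_seq; apply: (@wpc_coins _ _ _ (c 0 0) kap) => //; first by rewrite hCP.
move=> M1 t1 ht1 h1 h27 h20.
have hLM : 2 ^ LM <= cap by rewrite !mulnA; exact: (LM_CP hes).
have M1z k a : k \notin [:: 1; 20; 27; raw] -> M1 k a = 0.
  rewrite !inE !negb_or => /and4P[/eqP k1 /eqP k2 /eqP k3 /negbTE k4].
  by rewrite h1 // hM // /mem0 k4.
apply: wpc_seq; apply: (@wpc_adj n G es hes coins cap hLM W 0 0) => //.
- by rewrite h1 // hM // /mem0 eqxx.
- by move=> a; rewrite M1z.
move=> M2 t2 ht2 h2 hM2.
apply: wpc_seq; apply: wpc_asg1; rewrite [set_nth _ _ _ _]/= -/(en0 (c 0 1)).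
apply: wpc_seq; apply: (@wpc_tab0 _ _ (c 0 1) (hN 0 1) (hCP 0 1) (hKB 0 1) g) => //.
  by move=> a; rewrite h2 // M1z.
move=> M3 t3 ht3 h3 hT0.
apply: wpc_seq; apply: (wpc_for (I := fun j M' E t' => [/\ t' <= t3 + 2 + j * (tlevel (c 0 0) Q + 30), E = [:: en0 (c j (2 ^ j))],
   forall k, k \notin [:: 21; 22; 23; 24; 25; 26] -> M' k = M3 k & holds (c 0 0) j (tb j) 24 M']) (k := L)).
- by split=> //; lia.
- by move=> j M' E t' _ [_ -> _ _] /=; rewrite !eqxx.
- move=> j M' E t' hj [ht' -> hk hT].
  apply: wpc_seq; apply: (@wpc_level _ _ (c j (2 ^ j)) (hN _ _) (hCP _ _) (hKB _ _) Q g U (tb j) (hWB j) (hVN j) (hPk j) erefl hj hg sample_lt (hsnd j)).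
  + exact: hT.
  + by rewrite hk // h3 // h2.
  + by move=> s hs; rewrite hk // h3 // h2 // h20.
  move=> M4 t4 ht4 h4 hT4; apply: wpc_asg1; split; first by rewrite /= !eqxx.
  have e2 : N - (N - (2 ^ j + 2 ^ j)) = 2 ^ j.+1.
    by rewrite capE; [rewrite expnS mul2n addnn | rewrite addnn -mul2n -expnS leq_exp2l].
  split.
  + by move: ht4 ht'; rewrite /tlevel mulSn /=; clear; lia.
  + by rewrite /= e2.
  + by move=> k' hk'; rewrite h4 // hk.
  + exact: hT4.
move=> M4 E4 t4 [ht4 -> h4 hT4].
have g4 u v : u < N -> v < N -> M4 2 (u * N + v) = g u v by move=> hu hv; rewrite h4 // h3 // hM2.
apply: wpc_seq; apply: (@wpc_labels _ _ (c L N) (hN _ _) (hCP _ _) (hKB _ _) g (tb L) erefl (hWB L)) => //.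
move=> M5 t5 ht5 h5 hL5.
apply: wpc_seq; apply: (@wpc_detours _ _ (c L N) (hN _ _) (hCP _ _) (hKB _ _) g (tb L) erefl (hPk L) (hqB L)) => //.
- by move=> u v hu hv; rewrite !h5 //; apply: hT4.
- by move=> u v hu hv; rewrite h5 // g4.
move=> M6 t6 ht6 h6 hE6.
have hZ0 : 2 ^ L * 2 ^ L = cN (c L N) * cN (c L N) by [].
have N2cap : N * N <= cap by move: N0; move: N => x x0; nia.
rewrite -hZ0 -cells_iota.
pose lab := inside N (labf L g (tW (tb L))); pose E := inside N (detf L g (tW (tb L)) (qry (tb L))).
have hZlt z : z \in iota 0 N -> z < N by rewrite mem_iota.
apply: wpc_seq; apply: (@wpc_jump OFF coins cap (c L N) (hN _ _) _ (iota 0 N) (iota_uniq _ _) hZlt _ g lab E).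
- by rewrite hCP.
- by rewrite size_iota.
- exact: (det_leB (hsnd L)).
- by move=> x y; apply: lab_ltN.
- by move=> x y hx; rewrite mem_iota hx.
- by move=> y; apply: lab_zero_src.
- by move=> y; apply: det_zero_src.
- by move=> x; apply/eqP/negPn/negP => /hg; rewrite andbF.
- by move=> x y; have := hgs x y; rewrite [cBIG _]/=; move: (g x y) (N) N0 => a z; clear; nia.
- by move=> x y hx hy; rewrite h6 // h5 // g4 // (h6 7) // hL5 // hE6 // /lab /E !insideE.
- by move=> a; rewrite !h6 // !h5 // !h4 // !h3 // !h2 // !M1z.
move=> M7 x7 t7 ht7 h7 hV7.
have hnN := ltn_logN n.
apply: (@wpc_output OFF coins cap n m N BIG erefl hnN (cells (iota 0 N) L)) => //.
  by apply: uniq_cells; exact: iota_uniq.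
move=> M8 E8 t8 ht8 _ hout; apply: hR.
  move: ht1 ht2 ht3 ht4 ht5 ht6 ht7 ht8; rewrite /tB /tjump /=; move: (L * (tlevel _ _ + 30)) (Q * _) (tfork _ _) (tcoins0 _ _) toutput (time1 es).
  by clear; lia.
move=> hgood x y; rewrite hout //; have hx : x.+1 < N by apply: leq_ltn_trans hnN.
have hy : y.+1 < N by apply: leq_ltn_trans hnN.
rewrite (mem_cells (hN L N)) divnMDl // divn_small // addn0 mem_iota hx /= hV7 //.
apply: (second_link (weight_le hes hW)); apply: detours_second => //.
exact: (tabs_complete BIG hg sample_lt hgood (leqnn L)).
Qed.

End AlgorithmB.

(** * Probability of a miss *)

(** The most significant bit comes first, which is the order in which [bsum] consumes bits. *)
Definition bitn L v b := odd (v %/ 2 ^ (L - b.+1)).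

Lemma bsum_bitn L v : v < 2 ^ L -> bsum (bitn L v) L = v.
Proof.
move=> hv; have : forall j, j <= L -> bsum (bitn L v) j = v %/ 2 ^ (L - j); last by move/(_ L (leqnn L)); rewrite subnn divn1.
elim=> [|j ih] hj; first by rewrite /= subn0 divn_small.
rewrite /= ih ?(ltnW hj) // /bitn (_ : L - j = (L - j.+1).+1); last by lia.
rewrite expnSr divnMA; move: (v %/ 2 ^ (L - j.+1)) => x.
by rewrite [RHS](divn_eq x 2) modn2 mulnC.
Qed.

Lemma bsum_inj f f' b : bsum f b = bsum f' b -> forall i, i < b -> f i = f' i.
Proof.
elim: b => //= b ih e i; have [e1 e2] : bsum f b = bsum f' b /\ f b = f' b by case: (f b) (f' b) e => -[] /=; lia.
by rewrite ltnS leq_eqVlt => /orP[/eqP->//|]; apply: ih.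
Qed.

(** * Counting the coin tables whose samples miss a set *)

Section Blocks.
Variables (Co : finType) (L : nat) (kappa : nat -> nat -> Co) (NS : nat).
Notation Om := {ffun Co -> bool}.
Notation N := (2 ^ L).
Hypothesis kinj : forall s b s' b', s < NS -> s' < NS -> b < L -> b' < L -> kappa s b = kappa s' b' -> s = s' /\ b = b'.

Definition value (om : Om) s := bsum (fun b => om (kappa s b)) L.

(** Overwriting the coins of one sample maps the tables with one sample value injectively to those
    with any other value; so all values are equally frequent. *)
Definition set_block s v (om : Om) : Om :=
  [ffun co => if [pick b : 'I_L | kappa s b == co] is Some b then bitn L v b else om co].

Lemma set_block_in s v om b : s < NS -> b < L -> set_block s v om (kappa s b) = bitn L v b.
Proof.
move=> hs hb; rewrite ffunE; case: pickP => [b' /eqP e|/(_ (Ordinal hb))]; last by rewrite eqxx.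
by have [_ ->] := kinj hs hs (ltn_ord b') hb e.
Qed.

Lemma set_block_out s v om co : (forall b, b < L -> kappa s b <> co) -> set_block s v om co = om co.
Proof. by move=> h; rewrite ffunE; case: pickP => // b /eqP e; case: (h b (ltn_ord b)). Qed.

Lemma value_set_block s v om : s < NS -> v < N -> value (set_block s v om) s = v.
Proof. by move=> hs hv; rewrite -[RHS](bsum_bitn hv); apply: eq_bsum => b hb; rewrite set_block_in. Qed.

Lemma value_other s s' v om : s < NS -> s' < NS -> s <> s' -> value (set_block s v om) s' = value om s'.
Proof.
move=> hs hs' hne; apply: eq_bsum => b hb; apply: set_block_out => b' hb' e.
by have [] := kinj hs hs' hb' hb e.
Qed.

(** Independence takes the form that [B] is closed under changing the coins of sample [s]. *)
Lemma card_block s (B : {set Om}) (X : {set 'I_N}) : s < NS ->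
  (forall om v, om \in B -> set_block s v om \in B) ->
  #|[set om in B | [forall x in X, value om s != x]]| * N = (N - #|X|) * #|B|.
Proof.
move=> hs hB; pose F v := [set om in B | value om s == v].
have hle v v' : v < N -> v' < N -> #|F v| <= #|F v'|.
  move=> hv hv'; have inj : {in F v &, injective (set_block s v')}.
    move=> om om'; rewrite !inE => /andP[_ /eqP e] /andP[_ /eqP e'] es; apply/ffunP => co.
    case: (pickP (fun b : 'I_L => kappa s b == co)) => [b /eqP <-|h].
      by apply: (bsum_inj (f := fun b => om (kappa s b)) (f' := fun b => om' (kappa s b)) (b := L)); rewrite -?/(value _ _) ?e.
    have hn b : b < L -> kappa s b <> co by move=> hb ek; have := h (Ordinal hb); rewrite /= ek eqxx.
    by have := congr1 (fun f : Om => f co) es; rewrite !set_block_out.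
  rewrite -(card_in_imset inj); apply: subset_leq_card; apply/subsetP => _ /imsetP[om + ->].
  by rewrite !inE => /andP[h _]; rewrite hB // value_set_block // eqxx.
have heq v : v < N -> #|F v| = #|F 0|.
  by move=> hv; apply/eqP; rewrite eqn_leq !hle // expn_gt0.
have hlt om : value om s < N by exact: bsum_lt.
have hsum (A : {set 'I_N}) : #|[set om in B | [exists x in A, value om s == x]]| = #|A| * #|F 0|.
  pose p om := Ordinal (hlt om); set C := [set om in B | _].
  have hC om : om \in C -> p om \in A.
    rewrite inE => /andP[_ /exists_inP[x hx /eqP e]].
    by have -> : p om = x by exact: val_inj.
  rewrite -sum1_card (partition_big p (mem A)) //= -sum_nat_const; apply: eq_bigr => x hx.
  rewrite -(heq x (ltn_ord x)) -sum1_card; apply: eq_bigl => om; rewrite !inE.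
  apply/andP/andP => [[/andP[h1 _] /eqP <-]|[h1 /eqP e]]; first by rewrite h1 eqxx.
  have ex : p om = x by exact: val_inj.
  by rewrite h1 ex eqxx; split=> //; apply/exists_inP; exists x; rewrite // e.
have hT : #|B| = N * #|F 0|.
  have := hsum setT; rewrite cardsT card_ord => <-; apply: eq_card => om; rewrite inE.
  by case: (om \in B) => //=; symmetry; apply/exists_inP; exists (Ordinal (hlt om)); rewrite ?inE.
have -> : [set om in B | [forall x in X, value om s != x]] = [set om in B | [exists x in ~: X, value om s == x]].
  apply/setP => om; rewrite !inE; case: (om \in B) => //=; apply/forall_inP/exists_inP => [h|[x]].
    exists (Ordinal (hlt om)) => //; rewrite inE; apply/negP => /h; by rewrite eqxx.
  by rewrite inE => hx /eqP e y hy; rewrite e; apply: contra hx => /eqP /val_inj ->.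
have := cardsC X; rewrite card_ord => hC.
rewrite hsum hT (_ : #|~: X| = N - #|X|); last by clear -hC; lia.
by rewrite [RHS]mulnCA mulnC.
Qed.

(** Induction on the samples: the condition on the others is insensitive to the coins of the next
    one, since blocks are disjoint. *)
Lemma card_miss (ss : seq nat) (X : {set 'I_N}) : uniq ss -> all (fun s => s < NS) ss ->
  #|[set om : Om | all (fun s => [forall x in X, value om s != x]) ss]| * N ^ size ss = (N - #|X|) ^ size ss * #|{: Om}|.
Proof.
elim: ss => [_ _|s ss ih] /=; first by rewrite muln1 mul1n -cardsT; congr (card (mem _)); apply/setP => om; rewrite !inE.
move=> /andP[hn hu] /andP[hs ha]; set B := [set om : Om | all (fun s => [forall x in X, value om s != x]) ss] in ih.
have hB om v : om \in B -> set_block s v om \in B.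
  rewrite !inE => /allP h; apply/allP => s' hs'; have := h s' hs'.
  rewrite value_other // ?(allP ha _ hs') // => e; by rewrite e hs' in hn.
have := card_block X hs hB; rewrite !expnS.
have -> : [set om in B | [forall x in X, value om s != x]] = [set om | [forall x in X, value om s != x] && all (fun s => [forall x in X, value om s != x]) ss].
  by apply/setP => om; rewrite !inE andbC.
by move=> e; rewrite mulnA e -mulnA ih // mulnA.
Qed.

End Blocks.

(** This is (1 - 1/t)^t <= 1/2, and the inner claim is Bernoulli's inequality. *)
Lemma bernoulli t : 0 < t -> 2 * t.-1 ^ t <= t ^ t.
Proof.
case: t => // t _; rewrite [t.+1.-1]/=; have h : forall j, t ^ j + j * t ^ j.-1 <= t.+1 ^ j.
  elim=> // j ih; rewrite [t.+1 ^ _]expnS; apply: leq_trans (leq_mul (leqnn t.+1) ih).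
  rewrite expnS /=; case: j {ih} => [|j]; first by rewrite !expn0; lia.
  by rewrite /= expnS; move: (t ^ j) => x; nia.
by apply: leq_trans (h t.+1); rewrite /= expnS; lia.
Qed.

Lemma miss_bound L k Q' (x A O : nat) : k <= L -> 2 ^ k <= 2 * x -> x <= 2 ^ L ->
  A * (2 ^ L) ^ (2 ^ (L - k) * (2 * Q')) <= (2 ^ L - x) ^ (2 ^ (L - k) * (2 * Q')) * O -> A * 2 ^ Q' <= O.
Proof.
move=> hk hx hxN; pose t := 2 * 2 ^ (L - k); have t0 : 0 < t by rewrite muln_gt0 expn_gt0.
have -> : 2 ^ (L - k) * (2 * Q') = t * Q' by rewrite /t mulnA [_ * 2]mulnC.
set Sz := t * Q'; have N0 : 0 < 2 ^ L by rewrite expn_gt0.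
have h1 : t * (2 ^ L - x) <= t.-1 * 2 ^ L.
  have eN : 2 ^ L = 2 ^ k * 2 ^ (L - k) by rewrite -expnD subnKC.
  have h : 2 ^ L <= t * x.
    rewrite /t eN; move: (2 ^ (L - k)) (2 ^ k) hx => a b; clear; nia.
  by rewrite mulnBr -subn1 mulnBl mul1n leq_sub2l.
have h2 : t ^ Sz * (2 ^ L - x) ^ Sz <= t.-1 ^ Sz * (2 ^ L) ^ Sz.
  by rewrite -!expnMn; case: (Sz) => // q; rewrite leq_exp2r.
have h3 : 2 ^ Q' * t.-1 ^ Sz <= t ^ Sz.
  have hb := bernoulli t0; rewrite /Sz ![_ ^ (t * Q')]expnM -expnMn.
  by case: (Q') => // q; rewrite leq_exp2r.
move=> h.
have P0 : 0 < t ^ Sz * (2 ^ L) ^ Sz by rewrite muln_gt0 !expn_gt0 t0.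
rewrite -(leq_pmul2r P0); move: h h2 h3 P0.
move: (t ^ Sz) (t.-1 ^ Sz) ((2 ^ L) ^ Sz) ((2 ^ L - x) ^ Sz) (2 ^ Q') => a b d e f h h2 h3 P0.
have c1 : A * f * (a * d) <= f * a * (e * O) by rewrite (_ : A * f * (a * d) = f * a * (A * d)) ?leq_mul2l ?h ?orbT //; lia.
have c2 : f * (a * e) * O <= f * (b * d) * O by rewrite leq_mul2r leq_mul2l h2 !orbT.
have c3 : f * b * (d * O) <= a * (d * O) by rewrite leq_mul2r h3 orbT.
apply: leq_trans c1 _; apply: leq_trans (_ : f * (a * e) * O <= _); first by rewrite !mulnA.
apply: leq_trans c2 _; apply: leq_trans (_ : f * b * (d * O) <= _); first by rewrite !mulnA.
by apply: leq_trans c3 _; rewrite mulnA mulnC.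
Qed.

Lemma card_bigcup_le (I T : finType) (F : I -> {set T}) b : (forall i, #|F i| <= b) -> #|\bigcup_i F i| <= #|I| * b.
Proof.
move=> h; apply: leq_trans (_ : \sum_i #|F i| <= _); last by rewrite -sum_nat_const; apply: leq_sum.
elim/big_rec2: _ => [|i x A _ ih]; first by rewrite cards0.
by apply: leq_trans (leq_card_setU _ _) _; rewrite leq_add2l.
Qed.

Section GoodSamples.
Variables (T W t0 L kap : nat) (g : nat -> nat -> nat).
Notation N := (2 ^ L).
Notation Q := (2 * kap * L).
Hypothesis hT : forall q b, q < Q -> b < L -> flip_time t0 L q b < T.
Hypothesis hW : N <= W.
Hypothesis L0 : 0 < L.

Notation samples om := (sample (coins_of om) t0 L Q).

Lemma flip_time_inj q b q' b' : b < L -> b' < L -> flip_time t0 L q b = flip_time t0 L q' b' -> q = q' /\ b = b'.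
Proof.
move=> hb hb' e; have h : tsample L = 14 + L * tbit + wr_cost 1 (addr 20 (vpid * V 15 + V 14)) (V 16) by [].
have tb0 : 0 < tbit by [].
have ht : L * tbit < tsample L by rewrite h; lia.
have h1 : b * tbit < tsample L by apply: leq_ltn_trans ht; rewrite leq_mul2r ltnW ?orbT.
have h2 : b' * tbit < tsample L by apply: leq_ltn_trans ht; rewrite leq_mul2r ltnW ?orbT.
have e' : q * tsample L + b * tbit = q' * tsample L + b' * tbit by move: e; rewrite /flip_time; lia.
have [-> e2] := row_inj h1 h2 e'; split=> //; apply/eqP; rewrite -(eqn_pmul2r tb0); exact/eqP.
Qed.

(** Union bound over the level, the pair, the avoided vertex and the two rounds: 2 L N^3 events,
    each of probability at most 2^(-kap L), that is N^(-kap). *)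
Lemma bad_samples : #|[set om : coin_table T W | `[< ~ good L Q g (samples om) >]]| * 2 ^ (kap * L) <=
   2 * L * (N * N * N) * #|coin_table T W|.
Proof.
case: (posnP kap) => [->|kap0].
  rewrite mul0n muln1; apply: leq_trans (max_card _) _; rewrite leq_pmull // !muln_gt0 L0 !expn_gt0 //.
have Q0 : 0 < Q by rewrite !muln_gt0 kap0 L0.
have N0 : 0 < N by rewrite expn_gt0.
have [o1 o2] : 0 < T /\ 0 < W by split; [exact: leq_ltn_trans (leq0n _) (hT Q0 L0) | exact: leq_trans N0 hW].
pose kappa s b : 'I_T * 'I_W := (insubd (Ordinal o1) (flip_time t0 L (s %% Q) b), insubd (Ordinal o2) (s %/ Q)).
have kE s b : s < N * Q -> b < L -> [/\ val (kappa s b).1 = flip_time t0 L (s %% Q) b & val (kappa s b).2 = s %/ Q].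
  move=> hs hb; rewrite !val_insubd hT ?ltn_mod // ifT //; apply: leq_trans hW; by rewrite ltn_divLR.
have kinj s b s' b' : s < N * Q -> s' < N * Q -> b < L -> b' < L -> kappa s b = kappa s' b' -> s = s' /\ b = b'.
  move=> hs hs' hb hb' e; have [e1 e2] := kE s b hs hb; have [e3 e4] := kE s' b' hs' hb'.
  rewrite e in e1 e2; rewrite e1 in e3; rewrite e2 in e4.
  have [e5 e6] := flip_time_inj hb hb' e3; split=> //.
  by rewrite (divn_eq s Q) (divn_eq s' Q) e4 e5.
have hval (om : coin_table T W) s : s < N * Q -> samples om s = value L kappa om s.
  move=> hs; apply: eq_bsum => b hb; rewrite /coins_of.
  have h1 := hT (_ : s %% Q < Q) hb; rewrite ltn_mod in h1.
  have h2 : s %/ Q < W by apply: leq_trans hW; rewrite ltn_divLR.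
  rewrite (insubT (fun i => i < T) (h1 Q0)) (insubT (fun i => i < W) h2); congr (om (_, _)); apply: val_inj.
    by have [-> _] := kE s b hs hb.
  by have [_ ->] := kE s b hs hb.
pose X (i : 'I_L * 'I_N * 'I_N * 'I_N * bool) : {set 'I_N} :=
  let: (k, u, v, f, st) := i in
  if st then centres L g (2 ^ k) (2 ^ k + 2 ^ k %/ 2) u v f else centres L g (2 ^ k + 2 ^ k %/ 2) (2 ^ k.+1) u v f.
pose ss k := iota 0 (2 ^ (L - k) * Q).
pose kk (i : 'I_L * 'I_N * 'I_N * 'I_N * bool) : nat := i.1.1.1.1.
(* If there are few centres, [hits] asks for nothing, and the event is taken to be empty. *)
pose F i := if 2 ^ kk i <= 2 * #|X i| then
   [set om : coin_table T W | all (fun s => [forall x in X i, value L kappa om s != x]) (ss (kk i))] else set0.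
have hF i : #|F i| * 2 ^ (kap * L) <= #|coin_table T W|.
  rewrite /F; case: ifP => [hX|_]; last by rewrite cards0.
  have hk : kk i <= L by rewrite ltnW // /kk ltn_ord.
  have hk2 : 2 ^ (L - kk i) * Q <= N * Q by rewrite leq_mul2r leq_exp2l // leq_subr orbT.
  apply: (miss_bound hk hX); first by have := max_card (mem (X i)); rewrite card_ord.
  have e : 2 ^ (L - kk i) * (2 * (kap * L)) = size (ss (kk i)) by rewrite size_iota (mulnA 2).
  rewrite e (card_miss kinj) ?iota_uniq //; apply/allP => s; rewrite mem_iota => hs; exact: leq_trans hs hk2.
have hsub : [set om : coin_table T W | `[< ~ good L Q g (samples om) >]] \subset \bigcup_i F i.
  apply/subsetP => om; rewrite inE => /asboolP hbad; apply/negPn/negP => hno; apply: hbad.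
  have hit (i : 'I_L * 'I_N * 'I_N * 'I_N * bool) : hits Q (samples om) (kk i) (X i).
    move=> hX; have : om \notin F i by apply: contra hno => h; apply/bigcupP; exists i.
    rewrite /F hX inE => /allPn[s hs /forall_inPn[x hx]]; rewrite negbK => /eqP e.
    exists x => //; exists (s %/ Q), (s %% Q); rewrite -divn_eq ltn_mod Q0; move: hs; rewrite mem_iota => hs; split=> //.
      by rewrite ltn_divLR.
    rewrite hval //; apply: leq_trans hs _; by rewrite leq_mul2r leq_exp2l // leq_subr orbT.
  move=> k hk u v f hu hv hf.
  pose o := (Ordinal hk, Ordinal hu, Ordinal hv, Ordinal hf).
  by split; [exact: (hit (o, true)) | exact: (hit (o, false))].
have := subset_leq_card hsub; set bad := [set om | _] => h.
have hc : #|\bigcup_i F i| * 2 ^ (kap * L) <= #|{: 'I_L * 'I_N * 'I_N * 'I_N * bool}| * #|coin_table T W|.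
  have P0 : 0 < 2 ^ (kap * L) by rewrite expn_gt0.
  apply: leq_trans (_ : #|{: 'I_L * 'I_N * 'I_N * 'I_N * bool}| * (#|coin_table T W| %/ 2 ^ (kap * L)) * 2 ^ (kap * L) <= _).
    by rewrite leq_mul2r card_bigcup_le ?orbT // => i; rewrite leq_divRL.
  by rewrite -mulnA leq_mul2l leq_trunc_div orbT.
apply: leq_trans (_ : #|\bigcup_i F i| * 2 ^ (kap * L) <= _); first by rewrite leq_mul2r h orbT.
apply: leq_trans hc _; rewrite !card_prod !card_ord card_bool leq_mul2r; apply/orP; right.
by rewrite leq_eqVlt; apply/orP; left; apply/eqP; move: N => x; clear; lia.
Qed.

End GoodSamples.

(** * Word sizes for code with a parameter *)

Lemma well_sizedB : well_sized PHASE1 (ALGB 61) 25 100.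
Proof. by vm_cast_no_check (erefl true). Qed.

Lemma wfsB kap : wfs (ALGB kap).
Proof. by vm_cast_no_check (erefl true). Qed.

Definition free61 (i : instr) : bool := if i is Const _ k then k != 61 else true.

Lemma subst_free61 kap p : all free61 p -> map (subst_const kap) p = p.
Proof. by elim: p => //= i p ih /andP[h /ih ->]; case: i h => //= r k /negbTE ->. Qed.

Lemma tables_free61 l n : all free61 (cs TABLES l n).1.
Proof. by vm_cast_no_check (erefl true). Qed.

Lemma cs_seq a b l n : (cs (a ;; b) l n).1 = (cs a l n).1 ++ (cs b (l + size (cs a l n).1) (cs a l n).2).1.
Proof. by rewrite /=; case: (cs a l n) => p n1 /=; case: (cs b _ _). Qed.

Lemma code_seq_subst kap a a' b l n : (cs a l n).1 = map (subst_const kap) (cs a' l n).1 ->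
  (cs a l n).2 = (cs a' l n).2 -> (forall l n, all free61 (cs b l n).1) ->
  (cs (a ;; b) l n).1 = map (subst_const kap) (cs (a' ;; b) l n).1.
Proof. by move=> e1 e2 h; rewrite !cs_seq map_cat e1 e2 size_map (subst_free61 kap (h _ _)). Qed.

Lemma coins_subst kap l n : (cs (COINS kap) l n).1 = map (subst_const kap) (cs (COINS 61) l n).1.
Proof. by vm_cast_no_check (erefl (cs (COINS kap) l n).1). Qed.

(** With a variable [kap] the size check cannot be evaluated. It is evaluated for 61 and transferred
    by substitution, which leaves [TABLES] alone because 61 does not occur in its code. *)
Lemma codeB kap : (code2 PHASE1 (ALGB kap)).1 = map (subst_const kap) (code2 PHASE1 (ALGB 61)).1.
Proof.
apply: code_seq_subst; [exact: coins_subst | | exact: tables_free61].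
by vm_cast_no_check (erefl (code2 PHASE1 (COINS kap)).2).
Qed.

(** * Numerical bounds for the randomized algorithm *)

Section BoundsB.
Variables (n : nat) (G : wdigraph n) (es : seq ('I_n * 'I_n)) (kap : nat).
Hypothesis hes : lists_edges G es.
Notation m := (size es).
Notation l := (trunc_log 2 n).+1.
Notation L := (logN n).
Notation N := (2 ^ logN n).

Lemma tB_le W : tB es W kap <= 20 * 1000 * (kap.+1 * (l * l)).
Proof.
have hL := logN_le n; have hLM := logM_le (m_le hes); have ht1 := time1_le hes.
have l0 := ltn0Sn (trunc_log 2 n).
have hs : tsample L <= 100 * l by rewrite /tsample /tbit /wr_cost /=; move: (L) (l) hL l0; clear; lia.
have hc : tcoins0 kap L <= 100 * l by rewrite /tcoins0 /tfork /wr_cost /=; move: (L) (l) hL l0; clear; lia.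
have hf : tfork vLM (logM m) <= 60 * l by rewrite /tfork /=; move: (logM m) (l) hLM l0; clear; lia.
have a1 : kap * L * tsample L <= kap * l * (100 * l) by apply: leq_mul => //; rewrite leq_mul2l hL orbT.
have a2 : L * (tlevel (ctlW es W 0 0) (kap * L) + 30) <= l * (8 * 1000 * (kap.+1 * l)).
  apply: leq_mul => //; rewrite /tlevel /= mulSn.
  have : kap * L <= kap * l by rewrite leq_mul2l hL orbT.
  by move: (kap * L) (kap * l) (L) (l) hL l0; clear; lia.
have a3 : l <= l * l by rewrite leq_pmull.
have e1 : kap * l * (100 * l) = 100 * (kap * (l * l)) by clear; lia.
have e2 : l * (8 * 1000 * (kap.+1 * l)) = 8 * 1000 * (l * l) + 8 * 1000 * (kap * (l * l)) by clear; lia.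
rewrite e1 in a1; rewrite e2 in a2; rewrite /tB /tjump /toutput [kap.+1 * _]mulSn /=.
move: (kap * L * tsample L) (L * (tlevel _ _ + 30)) a1 a2 => x1 x2 a1 a2.
move: (kap * (l * l)) a1 a2 => y1 a1 a2; move: (l * l) a1 a2 a3 => y2 a1 a2 a3.
move: (tcoins0 _ _) hc => z1 hc; move: (tfork _ _) hf => z2 hf; move: (time1 es) ht1 => z3 ht1.
by clear -a1 a2 a3 hc hf ht1 hL; lia.
Qed.

Lemma cap_le : 4 * (N * N * N) <= 108 * (n ^ 3).+1.
Proof.
have := powN_le n; rewrite !expnS expn0 muln1; case: (posnP n) => [-> //|n0] h.
have h3 : N <= 3 * n by lia.
have : N * N * N <= 3 * n * (3 * n) * (3 * n) by rewrite !leq_mul.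
by move: (N * N * N) => x; rewrite (_ : 3 * n * (3 * n) * (3 * n) = 27 * (n * (n * n))); [lia | clear; lia].
Qed.

End BoundsB.

Section RandomizedPart.
Variables (n : nat) (G : wdigraph n) (es : seq ('I_n * 'I_n)) (kap C : nat).
Hypothesis hes : lists_edges G es.
Hypothesis hC : 200 * 20 * 1000 * kap.+1 <= C.
Notation m := (size es).
Notation l := (trunc_log 2 n).+1.
Notation L := (logN n).
Notation N := (2 ^ logN n).
Notation T := (soft_bound C 2 n 1).
Notation W := (soft_bound C 2 n (n ^ 3)).
Notation samples coins := (sample coins (time1 es + tcoins0 kap L) L (kap * L)).

Lemma tB_lt w : tB es w kap < T.
Proof.
apply: leq_ltn_trans (tB_le kap hes w) _; rewrite /soft_bound -mulnn.
have q0 : 0 < l * l by [].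
have : 200 * 20 * 1000 * kap.+1 * (l * l) <= C * (l * l) by rewrite leq_mul2r hC orbT.
rewrite -[200 * 20 * 1000 * _ * _]mulnA -[C * 2 * _]mulnAC.
have : 0 < kap.+1 * (l * l) by [].
by move: (C * (l * l)) (kap.+1 * (l * l)); clear; lia.
Qed.

Lemma work_lt w : 4 * (N * N * N) * (tB es w kap + 10) <= W.
Proof.
have h1 := tB_le kap hes w; have h2 := cap_le n.
have : tB es w kap + 10 <= 21 * 1000 * (kap.+1 * (l * l)).
  by have : 0 < kap.+1 * (l * l) by []; move: (kap.+1 * (l * l)) h1; clear; lia.
move=> h3; apply: leq_trans (leq_mul h2 h3) _.
rewrite /soft_bound -mulnn; apply: leq_trans (_ : 200 * 20 * 1000 * kap.+1 * (n ^ 3).+1 * (l * l) <= _); last first.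
  by rewrite leq_mul2r leq_mul2r hC !orbT.
rewrite (_ : 108 * (n ^ 3).+1 * (21 * 1000 * (kap.+1 * (l * l))) = 108 * 21 * 1000 * (kap.+1 * (n ^ 3).+1 * (l * l))); last by clear; lia.
rewrite (_ : 200 * 20 * 1000 * kap.+1 * (n ^ 3).+1 * (l * l) = 200 * 20 * 1000 * (kap.+1 * (n ^ 3).+1 * (l * l))); last by clear; lia.
by rewrite leq_mul2r; apply/orP; right; clear; lia.
Qed.

(** If n = 0 there is no pair to answer for, and the output is correct whatever the coins are. *)
Lemma randomized_run r coins : kap < 2 ^ r ->
  within_budget (compile PHASE1 (ALGB kap)) coins (initial G es) T W (word_bound G (r.+1 * 100)) /\
  (good L (kap * L) (gG G) (samples coins) \/ n = 0 ->
   computes_APSSSP G (compile PHASE1 (ALGB kap)) coins es T).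
Proof.
move=> hr; pose R (st : state) := good L (kap * L) (gG G) (samples coins) ->
  forall x y : 'I_n, second_distance G x y (decode (smem st raw (3 * m + 2 + (x * n + y)))).
pose cap := 4 * (N * N * N).
have cap0 : 0 < cap by rewrite !muln_gt0 expn_gt0.
have hLM : 2 ^ logM m <= cap by rewrite /cap !mulnA; exact: (LM_CP hes).
have main : wp (3 * m + n * n + 2) coins PHASE1 (wp (3 * m + n * n + 2) coins (ALGB kap) (fun st =>
     [/\ tm st < T, wk st + size (env st) <= W & R st])) (St (mem0 (input G es)) [:: [:: n; m]] 9 9).
  apply: wp_seq.
  have h := @wpc_phase1 n G es hes coins cap hLM (wpc (3 * m + n * n + 2) coins cap (ALGB kap) (fun M' E' t' =>
     (exists w, t' <= tB es w kap) /\ (good L (kap * L) (gG G) (samples coins) ->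
      forall x y : 'I_n, second_distance G x y (decode (M' raw (3 * m + 2 + (x * n + y))))))).
  have h2 : wpc (3 * m + n * n + 2) coins cap (PHASE1 ;; ALGB kap) (fun M' E' t' =>
     (exists w, t' <= tB es w kap) /\ (good L (kap * L) (gG G) (samples coins) ->
      forall x y : 'I_n, second_distance G x y (decode (M' raw (3 * m + 2 + (x * n + y))))))
     (mem0 (input G es)) [:: [:: n; m]] 9.
    apply: wpc_seq; apply: h => M w t hM hw ->; apply: (wpc_algB hes hw hM) => M' E' t' ht' hsec.
    by split; [exists w | exact: hsec].
  apply: (wp_capped h2) => // M' E' t' w' [[w ht'] hsec] _ hE hw'; split=> //=.
    exact: leq_ltn_trans ht' (tB_lt w).
  apply: leq_trans (work_lt w); rewrite mulnDr -/cap.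
  have : cap * (t' - 9) <= cap * tB es w kap by rewrite leq_mul2l (leq_trans (leq_subr _ _) ht') orbT.
  by move: (cap * (t' - 9)) (cap * tB es w kap) hw' hE cap0; clear; lia.
have [hb [c hc [st hst hmem]]] := program_correct hes well_sizedB (wfsB kap) (codeB kap) hr main.
split=> // hgood; exists c; first exact: hc.
case: hgood => [hgood|h0]; last by move=> x; have := ltn_ord x; rewrite {2}h0.
move=> x y; rewrite hmem /conc size_input ifT; first exact: hst.
by have := ltn_ord x; have := ltn_ord y; move: (nat_of_ord x) (nat_of_ord y) => a b; nia.
Qed.

End RandomizedPart.

Lemma prob_complement (Om : finType) (A : {set Om}) (x : nat) : 0 < x -> 0 < #|Om| -> #|~: A| * x <= #|Om| ->
  (1 - (x%:R)^-1 <= uniform_prob A)%R.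
Proof.
move=> x0 O0 h; rewrite /uniform_prob.
have O0' : (0 < (#|Om|%:R : rat))%R by rewrite Num.Theory.ltr0n.
have x0' : (0 < (x%:R : rat))%R by rewrite Num.Theory.ltr0n.
rewrite Num.Theory.ler_pdivlMr // GRing.mulrBl GRing.mul1r -(cardsC A) GRing.natrD.
rewrite Num.Theory.lerBlDr Num.Theory.lerD2l GRing.mulrC Num.Theory.ler_pdivlMr //.
by rewrite -GRing.natrM -GRing.natrD Num.Theory.ler_nat cardsC.
Qed.

Theorem randomized_part (c : nat) : exists (P : program) (C k K : nat),
  forall (n : nat) (G : wdigraph n) (es : seq ('I_n * 'I_n)), lists_edges G es ->
  let T := soft_bound C k n 1 in let W := soft_bound C k n (n ^ 3) in
  (forall coins : nat -> nat -> bool, within_budget P coins (initial G es) T W (word_bound G K)) /\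
  (1 - (n%:R ^+ c)^-1 <= uniform_prob [set om : coin_table T W | `[< computes_APSSSP G P (coins_of om) es T >]])%R.
Proof.
(* The failure probability is at most 2 L N^3 / N^h, and 2 L <= N^2, so h = c + 5 leaves N^(-c). The
   factor 2 in [kap] is the number of samples per group that [bad_samples] requires. *)
pose h := c + 5; pose kap := 2 * h.
have [C hC] : exists C, 200 * 20 * 1000 * kap.+1 <= C by (exists (200 * 20 * 1000 * kap.+1); exact: leqnn).
exists (compile PHASE1 (ALGB kap)), C, 2, (kap.+1 * 100) => n G es hes T W.
have hr : kap < 2 ^ kap by exact: ltn_expl.
have hrun coins := @randomized_run n G es kap C hes hC kap coins hr.
split; first by move=> coins; case: (hrun coins).
set A := [set om | _].
have O0 : 0 < #|coin_table T W| by apply/card_gt0P; exists [ffun=> false].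
(* For n = 0 and positive c the required probability is 1, because the inverse of 0 is 0; so every
   coin table has to succeed. *)
case: (posnP n) => [n0|n0].
  have -> : A = setT by apply/setP => om; rewrite !inE; apply/asboolP; case: (hrun (coins_of om)) => _; apply; right.
  rewrite /uniform_prob cardsT GRing.mulfV; last by rewrite Num.Theory.pnatr_eq0 -lt0n.
  by rewrite Num.Theory.gerBl Num.Theory.invr_ge0 Num.Theory.exprn_ge0 // Num.Theory.ler0n.
have hsub : ~: A \subset [set om : coin_table T W | `[< ~ good (logN n) (kap * logN n) (gG G)
    (sample (coins_of om) (time1 es + tcoins0 kap (logN n)) (logN n) (kap * logN n)) >]].
  apply/subsetP => om; rewrite !inE => hno; apply/asboolP => hgood; case/negP: hno; apply/asboolP.
  by case: (hrun (coins_of om)) => _; apply; left.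
have L0 : 0 < logN n by case: (n) n0.
have hT q b : q < kap * logN n -> b < logN n -> flip_time (time1 es + tcoins0 kap (logN n)) (logN n) q b < T.
  move=> hq hb; apply: leq_ltn_trans (tB_lt hes hC 0); rewrite /flip_time.
  have h1 : q.+1 * tsample (logN n) <= kap * logN n * tsample (logN n) by rewrite leq_mul2r hq orbT.
  have h2 : b * tbit <= tsample (logN n).
    by apply: leq_trans (_ : logN n * tbit <= _); [rewrite leq_mul2r ltnW ?orbT | rewrite /tsample; lia].
  rewrite /tB; rewrite mulSn in h1; move: (kap * logN n * tsample _) h1 => x4 h1; move: (b * tbit) h2 => x1 h2.
  move: (q * tsample _) h1 => x2 h1; move: (tsample _) h1 h2 => x3 h1 h2; clear -h1 h2; lia.
have hW : 2 ^ logN n <= W.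
  apply: leq_trans (work_lt hes hC 0); have N0 : 0 < 2 ^ logN n by rewrite expn_gt0.
  move: (2 ^ logN n) (tB _ _ _) N0; clear => x y x0.
  by apply: leq_trans (_ : 4 * (x * x * x) * 1 <= _); [nia | rewrite leq_mul2l; apply/orP; right; lia].
have hbad := @bad_samples T W (time1 es + tcoins0 kap (logN n)) (logN n) h (gG G) hT hW L0.
have hcard := subset_leq_card hsub.
rewrite -GRing.natrX; apply: prob_complement; [by rewrite expn_gt0 n0 | exact: O0 |].
have hnN := ltn_logN n.
have hLN : 2 * logN n <= 2 ^ logN n * 2 ^ logN n.
  by have := ltn_expl (logN n) (isT : 1 < 2); move: (2 ^ logN n) => x; move: (logN n) L0; clear; nia.
set bad := #|[set om | _]| in hbad hcard.
have eh : 2 ^ (h * logN n) = (2 ^ logN n) ^ c * (2 ^ logN n) ^ 5 by rewrite mulnC expnM expnD.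
have hc : n ^ c <= (2 ^ logN n) ^ c by case: (c) => // d; rewrite leq_exp2r // ltnW.
have P0 : 0 < (2 ^ logN n) ^ 5 by rewrite !expn_gt0.
apply: leq_trans (_ : bad * (2 ^ logN n) ^ c <= _); first exact: leq_mul.
rewrite -(leq_pmul2r P0) -mulnA -eh; apply: leq_trans hbad _; rewrite [X in _ <= X]mulnC leq_mul2r; apply/orP; right.
apply: leq_trans (leq_mul hLN (leqnn _)) _; rewrite !expnS expn0 muln1 !mulnA; exact: leqnn.
Qed.

Theorem theorem6 :
  (exists (P : program) (C k K : nat),
     coin_free P /\
     forall (n : nat) (G : wdigraph n) (es : seq ('I_n * 'I_n)),
       lists_edges G es ->
       let m := #|edges G| in
       let T := soft_bound C k n n in
       let W := soft_bound C k n (m * n) in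
       forall coins : nat -> nat -> bool,
         within_budget P coins (initial G es) T W (word_bound G K) /\
         computes_APSSSP G P coins es T)
  /\
  (forall c : nat,
     exists (P : program) (C k K : nat),
     forall (n : nat) (G : wdigraph n) (es : seq ('I_n * 'I_n)),
       lists_edges G es ->
       let T := soft_bound C k n 1 in
       let W := soft_bound C k n (n ^ 3) in
       (forall coins : nat -> nat -> bool,
          within_budget P coins (initial G es) T W (word_bound G K)) /\
       (1 - (n%:R ^+ c)^-1 <=
          uniform_prob [set om : coin_table T W |
            `[< computes_APSSSP G P (coins_of om) es T >]])%R).
Proof. by split; [exact: deterministic_part | exact: randomized_part]. Qed.
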